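(* Let $a_1,a_2,a_3\in\mathbb N$ be fixed and let $w=a_1+a_2+a_3$. The constant Fourier mode of $C_{a_1,a_2,a_3}$ is given by $$C^{(0)}_{a_1,a_2,a_3}(\tau_2)=\mathcal L(\tau_2)+\mathcal E(\tau_2),$$ where $\mathcal L(\tau_2)$ is a Laurent polynomial in $\tau_2$ of degree $(w,1-w)$ and $\mathcal E(\tau_2)$ is exponentially decaying as $\tau_2\to\infty$. The Laurent polynomial is given by $$\mathcal L(\tau_2)=c_w(-4\pi\tau_2)^w+\sum_{k=1}^{w-1}c_{w-2k-1}\,\frac{\zeta(2k+1)}{(4\pi\tau_2)^{2k+1-w}}+\frac{c_{2-w}}{(4\pi\tau_2)^{w-2}},$$ with coefficients as follows. (a) The coefficient $c_w$ is a rational number given by $$c_w=\sum_{k=0}^{a_2}\frac{B_{2k}B_{2w-2k}}{(2k)!\,(2w-2k)!}\,\frac{\Gamma(2a_2+2a_3-2k)}{\Gamma(2a_3)\,\Gamma(2a_2-2k+1)}+(a_2\leftrightarrow a_3).$$ (b) The coefficients $c_{w-2k-1}$ for $1\le k\le w-1$ are rational numbers given by $$c_{w-2k-1}=\frac{2B_{2w-2k-2}}{(2w-2k-2)!}\sum_{\alpha=0}^{a_1-1}\sum_{\beta=0}^{a_1-1-\alpha}(-1)^{a_1+a_3+\beta+1}\,\theta\!\left(a_3+\left[\tfrac{a_2+\beta}{2}\right]-w+k+1\right)g_{a_1,a_2}(\alpha,\beta)\binom{2k-2a_1+\alpha+\beta+1}{a_2+\alpha-1}$$ $$+\ \text{5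 permutations of }a_1,a_2,a_3,$$ where $g_{a_1,a_2}(\alpha,\beta)$ is integer-valued and given by $$g_{a_1,a_2}(\alpha,\beta)=(-1)^{a_1}\binom{2a_1-2-\alpha-\beta}{a_1-1}\binom{a_2+\alpha-1}{a_2-1}\binom{a_2+\beta-1}{a_2-1}.$$ (c) The coefficient $c_{2-w}$ is given by $$c_{2-w}=c^0_{2-w}\,(-1)^w\,\zeta(2w-2)+2\sum_{\sigma\in\mathfrak S_3}Z(a_{\sigma(1)},a_{\sigma(2)},a_{\sigma(3)}),$$ where $c^0_{2-w}$ is an integer given by $$c^0_{2-w}=\sum_{\alpha=0}^{a_1-1}\sum_{\beta=0}^{a_1-1-\alpha}(-1)^{a_2+\beta}g_{a_1,a_2}(\alpha,\beta)\binom{2a_2+2a_3+\alpha+\beta-2}{a_2+\alpha-1}\ +\ \text{5 permutations of }a_1,a_2,a_3,$$ while $Z(a_1,a_2,a_3)$ is the linear combination with integer coefficients of depth-two multiple zeta values of total weight $2w-2$ given by $$Z(a_1,a_2,a_3)=\sum_{k=1}^{a_1}\sum_{\ell=1}^{a_1}\binom{a_1+a_2-k-1}{a_2-1}\binom{a_1+a_2-\ell-1}{a_2-1}\binom{k+\ell-2}{k-1}\binom{2w-k-\ell-2}{w-k-1}\,\zeta(2w-k-\ell-1,\,k+\ell-1).$$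
   Context: Here $\mathbb N$ is the set of positive integers and $\tau=\tau_1+i\tau_2$ with $\tau_1\in\mathbb R$, $\tau_2>0$. For $a_1,a_2,a_3\in\mathbb N$ the two-loop modular graph function is the absolutely convergent sum $$C_{a_1,a_2,a_3}(\tau)=\sum\ \prod_{r=1}^{3}\left(\frac{\tau_2}{\pi|m_r+n_r\tau|^2}\right)^{a_r},$$ over all $(m_r,n_r)\in\mathbb Z^2\setminus\{(0,0)\}$, $r=1,2,3$, satisfying $m_1+m_2+m_3=0$ and $n_1+n_2+n_3=0$. It is smooth and invariant under $\tau\mapsto\tau+1$, so $C_{a_1,a_2,a_3}(\tau)=\sum_{k\in\mathbb Z}C^{(k)}_{a_1,a_2,a_3}(\tau_2)e^{2\pi ik\tau_1}$, and the constant Fourier mode is $C^{(0)}_{a_1,a_2,a_3}(\tau_2)=\int_0^1C_{a_1,a_2,a_3}(\tau_1+i\tau_2)\,d\tau_1$. Conventions: a Laurent polynomial of degree $(w,1-w)$ has highest power $w$ and lowest power $1-w$; $B_n$ are the Bernoulli numbers; $\zeta(s)$ is the Riemann zeta function; the depth-two zeta values are $\zeta(a,b)=\sum_{m,n=1}^\infty\frac{1}{(m+n)^a\,n^b}$; $[x]$ is the integer part of $x$; $\theta(x)=1$ for $x\ge0$ and $\theta(x)=0$ otherwise (a summand in which $\theta$ vanishes is $0$); $\mathfrak S_3$ is the group of permutations of $\{1,2,3\}$. The notation ''$+(a_2\leftrightarrow a_3)$'' means adding the same expression with $a_2$ and $a_3$ interchanged. The notation ''$+$ 5 permutations of $a_1,a_2,a_3$''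 means that the displayed expression $F(a_1,a_2,a_3)$ is replaced by $\sum_{\sigma\in\mathfrak S_3}F(a_{\sigma(1)},a_{\sigma(2)},a_{\sigma(3)})$ (six terms, counted with repetition if some $a_i$ coincide). *)

(* Defs.v *)
From mathcomp Require Import all_boot all_order all_algebra all_fingroup.
From mathcomp Require Import all_classical all_reals all_analysis.
From mathcomp Require Import complex.

Set Implicit Arguments.
Unset Strict Implicit.
Unset Printing Implicit Defensive.

Import Order.TTheory GRing.Theory Num.Theory.
Import numFieldNormedType.Exports.

Local Open Scope classical_set_scope.
Local Open Scope ring_scope.

(** ** Modular graph functions *)

Definition triple (a1 a2 a3 : nat) : 'I_3 -> nat := tnth [tuple a1; a2; a3].

(* A lattice configuration [p] assigns to r the pair (m_r, n_r). *)
Definition lattice_configs : set {ffun 'I_3 -> int * int} :=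
  [set p | [/\ forall r, p r <> (0, 0),
               \sum_(r < 3) (p r).1 = 0 & \sum_(r < 3) (p r).2 = 0]].

(* All terms are nonnegative, so the absolutely convergent sum is the
   unordered sum in [\bar R]; equating it, or its integral, with a real number
   includes its finiteness. *)
Definition modular_graph_function (R : realType) (a1 a2 a3 : nat)
    (tau : R[i]) : \bar R :=
  \esum_(p in lattice_configs)
    (\prod_(r < 3)
       (complex.Im tau / (pi * Normc.normc ((p r).1%:~R + (p r).2%:~R * tau) ^+ 2))
         ^+ triple a1 a2 a3 r)%:E.

Definition constant_mode (R : realType) (a1 a2 a3 : nat) (t : R) : \bar R :=
  (\int[lebesgue_measure]_(x in `[0%R, 1%R])
      modular_graph_function a1 a2 a3 (Complex x t))%E.

(** ** Laurent polynomials and exponential decay *)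

(* [f t = sum_(lo <= j <= hi) c_j t ^ j] on t > 0, where the coefficients
   c_hi and c_lo are nonzero: p collects the c_j, shifted by lo, and its leading
   coefficient is nonzero because its size is exactly hi - lo + 1. *)
Definition laurent_polynomial_of_degree (R : realType) (hi lo : int)
    (f : R -> R) : Prop :=
  exists p : {poly R},
    [/\ (size p)%:Z = hi - lo + 1, p`_0 != 0
      & forall t : R, 0 < t -> f t = t ^ lo * p.[t]].

Definition exponentially_decaying (R : realType) (f : R -> R) : Prop :=
  exists c K : R, 0 < c /\ \forall t \near +oo, `|f t| <= K * expR (- (c * t)).

(** ** Special numbers *)

(* [bernoulli_seq n] lists B_0, ..., B_n, computed from
   sum_(k <= n) binom(n+1, k) B_k = 0 for n > 0 (so B_1 = -1/2). *)
Fixpoint bernoulli_seq (n : nat) : seq rat :=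
  if n is n'.+1 then
    let s := bernoulli_seq n' in
    rcons s (- (\sum_(k < n) 'C(n.+1, k)%:R * s`_k) / n.+1%:R)
  else [:: 1].

Definition bernoulli (n : nat) : rat := (bernoulli_seq n)`_n.

Lemma size_bernoulli_seq n : size (bernoulli_seq n) = n.+1.
Proof. by elim: n => //= n IH; rewrite size_rcons IH. Qed.

Lemma nth_bernoulli_seq n k : (k <= n)%N -> (bernoulli_seq n)`_k = bernoulli k.
Proof.
elim: n => [|n IH]; first by rewrite leqn0 => /eqP ->.
rewrite leq_eqVlt => /orP[/eqP -> //|]; rewrite ltnS => le /=.
by rewrite nth_rcons size_bernoulli_seq ltnS le IH.
Qed.

Lemma bernoulli_rec n :
  \sum_(k < n.+1) 'C(n.+1, k)%:R * bernoulli k = (n == 0)%:R :> rat.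
Proof.
case: n => [|n]; first by rewrite big_ord1 bin0 mul1r.
rewrite big_ord_recr /= {2}/bernoulli /= nth_rcons size_bernoulli_seq ltnn eqxx.
rewrite binSn [X in _ + X]mulrC divfK; last by rewrite pnatr_eq0.
apply/eqP; rewrite subr_eq0; apply/eqP; apply: eq_bigr => k _.
by rewrite nth_bernoulli_seq // -ltnS.
Qed.

(* Gamma(n) for n > 0; only positive integer arguments occur. *)
Definition Gamma (n : nat) : nat := (n.-1)`!.

(* The integer s must be at least 2 for the series to converge. *)
Definition zeta (R : realType) (s : nat) : R :=
  fine (\sum_(1 <= n <oo) ((n%:R ^+ s)^-1)%:E)%E.

(* Convergent for a >= 2 and b >= 1. *)
Definition zeta2 (R : realType) (a b : nat) : R :=
  fine (\esum_(p in [set p : nat * nat | (0 < p.1)%N /\ (0 < p.2)%N])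
          (((p.1 + p.2)%:R ^+ a * p.2%:R ^+ b)^-1)%:E).

Definition theta (x : int) : int := if 0 <= x then 1 else 0.

Definition sum_S3 (V : nmodType) (F : nat -> nat -> nat -> V)
    (a1 a2 a3 : nat) : V :=
  \sum_(s : 'S_3)
    F (triple a1 a2 a3 (s (inord 0))) (triple a1 a2 a3 (s (inord 1)))
      (triple a1 a2 a3 (s (inord 2))).

(** ** Coefficients of the Laurent polynomial *)

(* For positive a1, a2, a3 and for all indices in range, no natural-number
   subtraction below is truncated, except in the last binomial coefficient of
   [coef_mid_summand], where truncation only occurs if the factor theta is 0. *)

Definition coef_top_half (w a2 a3 : nat) : rat :=
  \sum_(0 <= k < a2.+1)
    bernoulli (2 * k) * bernoulli (2 * w - 2 * k)
      / ((2 * k)`!%:R * (2 * w - 2 * k)`!%:R)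
    * ((Gamma (2 * a2 + 2 * a3 - 2 * k))%:R
       / ((Gamma (2 * a3))%:R * (Gamma (2 * a2 - 2 * k + 1))%:R)).

(* c_w *)
Definition coef_top (a1 a2 a3 : nat) : rat :=
  let w := (a1 + a2 + a3)%N in coef_top_half w a2 a3 + coef_top_half w a3 a2.

(* In the double sums, alpha + beta <= a1 - 1 is alpha + beta < a1. *)
Definition g (a1 a2 alpha beta : nat) : int :=
  (-1) ^+ a1 * ('C(2 * a1 - 2 - alpha - beta, a1 - 1))%:R
    * ('C(a2 + alpha - 1, a2 - 1))%:R * ('C(a2 + beta - 1, a2 - 1))%:R.

Definition coef_mid_summand (k a1 a2 a3 : nat) : rat :=
  let w := (a1 + a2 + a3)%N in
  2 * bernoulli (2 * w - 2 * k - 2) / (2 * w - 2 * k - 2)`!%:R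
  * (\sum_(0 <= alpha < a1) \sum_(0 <= beta < a1 - alpha)
       (-1) ^+ (a1 + a3 + beta + 1)
       * theta (a3%:Z + ((a2 + beta) %/ 2)%:Z - w%:Z + k%:Z + 1)
       * g a1 a2 alpha beta
       * ('C(2 * k + alpha + beta + 1 - 2 * a1, a2 + alpha - 1))%:R)%:~R.

(* c_{w-2k-1} *)
Definition coef_mid (k a1 a2 a3 : nat) : rat :=
  sum_S3 (coef_mid_summand k) a1 a2 a3.

(* c^0_{2-w} *)
Definition coef_bot0 (a1 a2 a3 : nat) : int :=
  sum_S3 (fun a1 a2 a3 =>
    \sum_(0 <= alpha < a1) \sum_(0 <= beta < a1 - alpha)
      (-1) ^+ (a2 + beta) * g a1 a2 alpha beta
      * ('C(2 * a2 + 2 * a3 + alpha + beta - 2, a2 + alpha - 1))%:R) a1 a2 a3.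

Definition Zcomb (R : realType) (a1 a2 a3 : nat) : R :=
  let w := (a1 + a2 + a3)%N in
  \sum_(1 <= k < a1.+1) \sum_(1 <= l < a1.+1)
    ('C(a1 + a2 - k - 1, a2 - 1) * 'C(a1 + a2 - l - 1, a2 - 1)
     * 'C(k + l - 2, k - 1) * 'C(2 * w - k - l - 2, w - k - 1))%:R
    * zeta2 R (2 * w - k - l - 1) (k + l - 1).

(* c_{2-w} *)
Definition coef_bot (R : realType) (a1 a2 a3 : nat) : R :=
  let w := (a1 + a2 + a3)%N in
  (coef_bot0 a1 a2 a3)%:~R * (-1) ^+ w * zeta R (2 * w - 2)
  + 2 * sum_S3 (Zcomb R) a1 a2 a3.

(* Main.v *)
(* Proof idea.  In the integral over tau_1, group the lattice configurations by (n_1, n_2).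
   The class n_1 = n_2 = 0 is a Tornheim sum, which partial fractions reduce to products of even
   zeta values: it gives c_w.  For any other (n_1, n_2) a unimodular change of the m-variables
   unrolls the integral over [0, 1] to the real line, leaving one sum over M in Z of an integral
   over y of a product of powers of three kernels T / ((y - x_r)^2 + T^2).  Partial fractions and
   residues evaluate the integral, and the sum over M is a rational function of shifted cotangents,
   each constant up to an exponentially small error; only the pole at M = 0, present when some n_r
   vanishes, contributes Bernoulli numbers.  Summing over the n_r gives the odd zeta values, from
   the lines n_r = 0, and the double zeta values.
   That c_{1-w} does not vanish is seen from a closed form: the coefficient of M^{2c} in the
   integral of (y^2 + 1)^{-a} ((y + M)^2 + 1)^{-b} is a Dixon-type alternating sum of binomials,
   so c_{1-w} is, up to a nonzero factor, the sum of (-1)^a / (a (w + a - 1)! (w - a - 1)!) over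
   a = a_1, a_2, a_3, in which no cancellation is possible. *)

Require Import Defs.
From mathcomp Require Import all_boot all_order all_algebra all_fingroup.
From mathcomp Require Import all_classical all_reals all_analysis.
From mathcomp Require Import measurable_realfun complex ring lra zify.
Set Implicit Arguments.
Unset Strict Implicit.
Unset Printing Implicit Defensive.
Import Order.TTheory GRing.Theory Num.Theory.
Import numFieldNormedType.Exports.
Local Open Scope classical_set_scope.
Local Open Scope ring_scope.

(** * Partial fractions in a commutative ring *)

Section PartialFractions.
Variable K : comNzRingType.
Implicit Types X Y D : K.

(** After partial fractions a single term need be neither integrable nor summable, so integrals are
    symmetric principal values given by explicit antiderivatives, and sums over Z are symmetric
    limits. All exponential estimates rest on one function, the sum over m of 1 / (rho + i m):
    Eisenstein's quadratic relation yields its differential equation, and higher powers follow from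
    difference quotients. Infinitely many classes have to be added, so every estimate is uniform in
    a family: for (n_1, n_2) = g (k_1, k_2) with k_1, k_2 coprime the poles have height T = g tau_2,
    and errors are at most a power of X times exp(- c T X), with X = k_1 k_2, or X = 1 if some n_r
    vanishes. When n_1 and n_2 have the same sign, the slope of the third line of poles is the
    mediant of the other two; lying between them, it makes all mixed residues cancel. The convention
    1/0 = 0 deletes the excluded lattice points, and the value -1 for the sum of m^0 over nonzero m
    accounts for the deletion. The coefficient c_w is nonzero because it comes from a sum of
    nonnegative terms. Estimates hold for tau_2 >= 1; smaller tau_2 are compared with tau_2 = 1. *)

Definition pf X D p q : K :=
  \sum_(0 <= i < p) (-1) ^+ i * ('C(q + i - 1, i))%:R * D ^+ (q + i) * X ^+ (p - i).

Lemma pf0l X D q : pf X D 0 q = 0.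
Proof. by rewrite /pf big_nil. Qed.

Lemma pf0r X D p : (0 < p)%N -> pf X D p 0 = X ^+ p.
Proof.
case: p => // p _; rewrite /pf big_nat_recl // big1_seq ?addr0 => [|i _].
  by rewrite !expr0 bin0 !mul1r subn0.
by rewrite add0n subn1 /= bin_small // mulr0 !mul0r.
Qed.

Lemma pfSS X D p q : pf X D p.+1 q.+1 = D * (pf X D p.+1 q - pf X D p q.+1).
Proof.
rewrite /pf !big_nat_recl // mulrBr mulrDr -addrA; congr (_ + _).
  by rewrite !bin0 !addn0 !expr0 !mul1r exprS mulrA.
rewrite !big_distrr /= -sumrB; apply: eq_big_nat => i /andP[_ ip].
rewrite subSS !addSn !addnS !subn1 /= binS natrD !exprS; ring.
Qed.

(** [X] and [Y] play the inverses of two linear forms, and [D] the inverse of the second form minus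
    the first. With the hypothesis stated as a ring identity no nonvanishing condition appears:
    multiplying it by powers gives the recursion in [(p, q)] that [pfSS] derives from Pascal's
    rule. *)
Lemma partial_fractions X Y D p q : X * Y = D * (X - Y) -> (0 < p + q)%N ->
  X ^+ p * Y ^+ q = pf X D p q + pf Y (- D) q p.
Proof.
move=> XY; have [n] := ubnP (p + q); elim: n p q => // n IH [|p] [|q] //= pqn _.
- by rewrite pf0l add0r expr0 mul1r pf0r.
- by rewrite pf0l addr0 expr0 mulr1 pf0r.
rewrite !pfSS.
transitivity (D * (X ^+ p.+1 * Y ^+ q - X ^+ p * Y ^+ q.+1)).
  by rewrite !exprS mulrACA XY; ring.
by rewrite !IH //; [ring | lia | lia].
Qed.

End PartialFractions.

(** * Principal values of integrals over the real line *)

Section PrincipalValue.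
Variable R : realType.
Local Notation C := R[i].
Implicit Types (f : R -> R) (F : R -> C).

Lemma ReD (a b : C) : complex.Re (a + b) = complex.Re a + complex.Re b.
Proof. by case: a b => [? ?] [? ?]. Qed.

Lemma ImD (a b : C) : complex.Im (a + b) = complex.Im a + complex.Im b.
Proof. by case: a b => [? ?] [? ?]. Qed.

Lemma ReM (a b : C) : complex.Re (a * b) =
  complex.Re a * complex.Re b + (- complex.Im a) * complex.Im b.
Proof. by case: a b => [? ?] [? ?] /=; rewrite mulNr. Qed.

Lemma ImM (a b : C) : complex.Im (a * b) =
  complex.Re a * complex.Im b + complex.Im a * complex.Re b.
Proof. by case: a b => [? ?] [? ?]. Qed.

(** Only the increment of an antiderivative over [-x, x] has to converge. This gives a value to a
    simple pole 1 / (y - z), which is not absolutely integrable, so partial fractions can be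
    integrated term by term. *)
Definition rpv f (v : R) := exists A : R -> R,
  (forall x : R, is_derive x (1 : R) A (f x)) /\ (fun x => A x - A (- x)) @ +oo --> v.

Definition has_pv F (v : C) :=
  rpv (fun x => complex.Re (F x)) (complex.Re v) /\
  rpv (fun x => complex.Im (F x)) (complex.Im v).

Lemma cvg_eqf (T : Type) (G : set_system T) (FG : Filter G) (f h : T -> R) (a b : R) :
  f x @[x --> G] --> a -> f =1 h -> a = b -> h x @[x --> G] --> b.
Proof. by move=> fa /funext <- <-. Qed.

Lemma rpv_ext f h v : f =1 h -> rpv f v -> rpv h v.
Proof. by move=> fh [A [dA lA]]; exists A; split => // x; rewrite -fh. Qed.

Lemma rpv0 : rpv (fun=> 0) 0.
Proof.
exists (fun=> 0); split => [x|]; first exact: is_derive_cst.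
by under eq_fun do rewrite subr0; exact: cvg_cst.
Qed.

Lemma rpvD f h u v : rpv f u -> rpv h v -> rpv (fun x => f x + h x) (u + v).
Proof.
move=> [A [dA lA]] [B [dB lB]]; exists (A \+ B); split => [x|].
  exact: is_deriveD.
rewrite (_ : (fun x => _) = (fun x => A x - A (- x)) \+ (fun x => B x - B (- x))).
  exact: cvgD.
by apply/funext => x /=; ring.
Qed.

Lemma rpvZ k f u : rpv f u -> rpv (fun x => k * f x) (k * u).
Proof.
move=> [A [dA lA]]; exists (k \*: A); split => [x|].
  exact: is_deriveZ.
rewrite (_ : (fun x => _) = (fun x => k * (A x - A (- x)))); first exact: cvgMl_tmp.
by apply/funext => x /=; rewrite mulrBr.
Qed.

Lemma rpv_ge0 f u : (forall x, 0 <= f x) -> rpv f u -> 0 <= u.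
Proof.
move=> f0 [A [dA lA]].
have Ahomo : {homo A : x y / x <= y}.
  move=> x y; rewrite le_eqVlt => /predU1P[-> //|xy].
  have cA : {within `[x, y], continuous A}.
    by apply: derivable_within_continuous => t _; have [] := dA t.
  have [c _ AE] := MVT xy (fun z _ => dA z) cA.
  by rewrite -subr_ge0 AE mulr_ge0 // subr_ge0 ltW.
apply: (cvgr_to_ge lA); near=> x; rewrite subr_ge0; apply: Ahomo.
by rewrite ge0_cp.
Unshelve. all: by end_near. Qed.

Lemma rpv_le f h u v : (forall x, f x <= h x) -> rpv f u -> rpv h v -> u <= v.
Proof.
move=> fh fu hv; rewrite -subr_ge0; apply: (@rpv_ge0 (fun x => h x - f x)).
  by move=> x; rewrite subr_ge0.
by rewrite -mulN1r; apply: rpv_ext (rpvD hv (rpvZ (-1) fu)) => x; rewrite mulN1r.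
Qed.

Lemma has_pv_ext F G v : F =1 G -> has_pv F v -> has_pv G v.
Proof. by move=> FG [re im]; split; [move: re | move: im]; apply: rpv_ext => x; rewrite FG. Qed.

Lemma has_pv0 : has_pv (fun=> 0) 0.
Proof. by split; exact: rpv0. Qed.

Lemma has_pvD F G u v : has_pv F u -> has_pv G v -> has_pv (fun x => F x + G x) (u + v).
Proof.
move=> [reF imF] [reG imG]; split; [rewrite ReD; apply: rpv_ext (rpvD reF reG)
  | rewrite ImD; apply: rpv_ext (rpvD imF imG)] => x; by rewrite (ReD, ImD).
Qed.

Lemma has_pvZ k F u : has_pv F u -> has_pv (fun x => k * F x) (k * u).
Proof.
move=> [re im]; split.
  by rewrite ReM; apply: rpv_ext (rpvD (rpvZ _ re) (rpvZ _ im)) => x; rewrite ReM.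
by rewrite ImM; apply: rpv_ext (rpvD (rpvZ _ im) (rpvZ _ re)) => x; rewrite ImM.
Qed.

Lemma has_pv_sum (I : Type) (r : seq I) (P : pred I) (F : I -> R -> C) (v : I -> C) :
  (forall i, P i -> has_pv (F i) (v i)) ->
  has_pv (fun x => \sum_(i <- r | P i) F i x) (\sum_(i <- r | P i) v i).
Proof.
move=> Fv; elim: r => [|i r IH].
  by rewrite big_nil; apply: has_pv_ext has_pv0 => x; rewrite big_nil.
rewrite big_cons; case: ifPn => Pi.
  by apply: has_pv_ext (has_pvD (Fv i Pi) IH) => x; rewrite big_cons Pi.
by apply: has_pv_ext IH => x; rewrite big_cons (negbTE Pi).
Qed.

Definition resolvent (z : C) (x : R) : C := (x%:C%C - z)^-1.

Lemma resolventE a b x : resolvent (a +i* b)%C x =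
  ((x - a) / ((x - a) ^+ 2 + b ^+ 2) +i* (b / ((x - a) ^+ 2 + b ^+ 2)))%C.
Proof. by rewrite /resolvent /= /GRing.inv /= sub0r sqrrN mulNr opprK. Qed.

Definition cder (A F : R -> C) := forall x : R,
  is_derive x (1 : R) (fun x => complex.Re (A x)) (complex.Re (F x)) /\
  is_derive x (1 : R) (fun x => complex.Im (A x)) (complex.Im (F x)).

Lemma cder_ext A B F G : A =1 B -> F =1 G -> cder A F -> cder B G.
Proof. by move=> /funext -> /funext ->. Qed.

Lemma cderM A B F G : cder A F -> cder B G ->
  cder (fun x => A x * B x) (fun x => A x * G x + B x * F x).
Proof.
move=> dA dB x; have [rA iA] := dA x; have [rB iB] := dB x; split.
  rewrite (_ : (fun x => _) = ((fun x => complex.Re (A x)) * (fun x => complex.Re (B x))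
      - (fun x => complex.Im (A x)) * (fun x => complex.Im (B x)))).
    apply: (is_derive_eq (is_deriveB (is_deriveM rA rB) (is_deriveM iA iB))).
    by rewrite ReD !ReM /GRing.scale /=; ring.
  by apply/funext => y; rewrite !fctE ReM mulNr.
rewrite (_ : (fun x => _) = ((fun x => complex.Re (A x)) * (fun x => complex.Im (B x))
      + (fun x => complex.Im (A x)) * (fun x => complex.Re (B x)))).
  apply: (is_derive_eq (is_deriveD (is_deriveM rA iB) (is_deriveM iA rB))).
  by rewrite ImD !ImM /GRing.scale /=; ring.
by apply/funext => y; rewrite !fctE ImM.
Qed.

Lemma cder_resolvent z : complex.Im z != 0 ->
  cder (resolvent z) (fun x => - resolvent z x ^+ 2).
Proof.
case: z => a b /= b0 x.
have q0 (y : R) : (y - a) ^+ 2 + b ^+ 2 != 0.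
  by rewrite gt_eqF // ltr_wpDl ?sqr_ge0 // exprn_even_gt0.
have dq : is_derive x (1 : R) (fun y : R => (y - a) ^+ 2 + b ^+ 2) (2 * (x - a)).
  by apply: is_derive_eq; rewrite /GRing.scale /=; ring.
have dV := @is_deriveV _ (fun y : R => (y - a) ^+ 2 + b ^+ 2) _ _ _ (q0 x) dq.
split.
  rewrite (_ : (fun y => _) = (fun y => y - a) * (fun y => ((y - a) ^+ 2 + b ^+ 2)^-1)).
    apply: is_derive_eq; rewrite resolventE /GRing.scale /= -!exprVn; field.
    exact: q0.
  by apply/funext => y; rewrite resolventE.
rewrite (_ : (fun y => _) = b \*: (fun y => ((y - a) ^+ 2 + b ^+ 2)^-1)).
  apply: is_derive_eq; rewrite resolventE /GRing.scale /= -!exprVn; field.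
  exact: q0.
by apply/funext => y; rewrite resolventE.
Qed.

Lemma cder_resolvent_pow z n : complex.Im z != 0 ->
  cder (fun x => resolvent z x ^+ n.+1) (fun x => - n.+1%:R * resolvent z x ^+ n.+2).
Proof.
move=> z0; have dz := cder_resolvent z0; elim: n => [|n IH] x.
  by have := dz x; rewrite mulN1r.
move: x; apply: cder_ext (cderM dz IH) => x; first by rewrite -exprS.
by rewrite -[n.+2%:R]natr1 !exprS; ring.
Qed.

Lemma cvg_invB_pinfty (a : R) : (x - a)^-1 @[x --> +oo] --> (0 : R).
Proof.
apply/gtr0_cvgV0; last exact: cvg_addrr.
near=> x; rewrite subr_gt0; near: x; apply: nbhs_pinfty_gt; exact: num_real.
Unshelve. all: by end_near. Qed.

Lemma resolventN z x : resolvent z (- x) = - resolvent (- z) x.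
Proof. by rewrite /resolvent opprK rmorphN /= -opprD invrN. Qed.

Definition cvg0 F := complex.Re (F x) @[x --> +oo] --> (0 : R) /\
  complex.Im (F x) @[x --> +oo] --> (0 : R).

Lemma cvg0M F G : cvg0 F -> cvg0 G -> cvg0 (fun x => F x * G x).
Proof.
move=> [rF iF] [rG iG]; split.
  under eq_fun do rewrite ReM mulNr.
  have := cvgB (cvgM rF rG) (cvgM iF iG); rewrite !mulr0 subr0; exact.
under eq_fun do rewrite ImM.
have := cvgD (cvgM rF iG) (cvgM iF rG); rewrite !mulr0 addr0; exact.
Qed.

Lemma resolvent_cvg0 z : complex.Im z != 0 -> cvg0 (resolvent z).
Proof.
case: z => a b /= b0; split.
  apply: (@squeeze_cvgr _ _ _ _ (fun=> 0) (fun x => (x - a)^-1)); last 2 first.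
  - exact: cvg_cst.
  - exact: cvg_invB_pinfty.
  near=> x; have xa : 0 < x - a by rewrite subr_gt0; near: x; apply: nbhs_pinfty_gt; exact: num_real.
  have q0 : 0 < (x - a) ^+ 2 + b ^+ 2.
    by rewrite ltr_wpDr ?sqr_ge0 // exprn_gt0.
  rewrite resolventE /=; apply/andP; split; first by apply: divr_ge0; exact: ltW.
  by rewrite ler_pdivrMr // mulrC ler_pdivlMr // -expr2 lerDl sqr_ge0.
under eq_fun do rewrite resolventE /=.
suff : ((x - a) ^+ 2 + b ^+ 2)^-1 @[x --> +oo] --> (0 : R).
  move/(cvgMl_tmp (a := b)); rewrite mulr0; exact.
apply: (@squeeze_cvgr _ _ _ _ (fun=> 0) (fun x => (x - a)^-1)); last 2 first.
- exact: cvg_cst.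
- exact: cvg_invB_pinfty.
near=> x; have xa : 1 < x - a by rewrite ltrBrDr; near: x; apply: nbhs_pinfty_gt; exact: num_real.
have q0 : 0 < (x - a) ^+ 2 + b ^+ 2.
  by rewrite ltr_wpDr ?sqr_ge0 // exprn_gt0 // (lt_trans _ xa).
have xa0 : 0 < x - a by apply: lt_trans xa.
apply/andP; split; first by rewrite invr_ge0; exact: ltW.
rewrite lef_pV2 ?posrE // ler_wpDr ?sqr_ge0 // expr2 ler_peMr //; exact: ltW.
Unshelve. all: by end_near. Qed.

Lemma resolvent_pow_cvg0 z n : complex.Im z != 0 -> cvg0 (fun x => resolvent z x ^+ n.+1).
Proof.
move=> z0; elim: n => [|n IH]; first exact: resolvent_cvg0.
under [X in cvg0 X]eq_fun do rewrite exprS.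
by apply: cvg0M => //; exact: resolvent_cvg0.
Qed.

(** A pole of order at least two has a multiple of the next lower power as antiderivative, which
    tends to 0 at both ends. *)
Lemma has_pv_resolvent_pow z n : complex.Im z != 0 ->
  has_pv (fun x => resolvent z x ^+ n.+2) 0.
Proof.
move=> z0; have nz0 : complex.Im (- z) != 0 by case: z z0 => a b /=; rewrite oppr_eq0.
pose A x := - n.+1%:R^-1 * resolvent z x ^+ n.+1.
have dA : cder A (fun x => resolvent z x ^+ n.+2).
  have dc : cder (fun=> - n.+1%:R^-1) (fun=> 0) by move=> x; split; apply: is_derive_cst.
  apply: cder_ext (cderM dc (cder_resolvent_pow n z0)) => // x.
  by rewrite mulr0 addr0 mulrA mulrNN mulVf ?mul1r ?pnatr_eq0.
have lA : cvg0 (fun x => A x - A (- x)).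
  pose B x := resolvent z x ^+ n.+1 + (-1) ^+ n * resolvent (- z) x ^+ n.+1.
  rewrite (_ : (fun x => _) = (fun x => (- n.+1%:R^-1) * B x)); last first.
    apply/funext => x; rewrite /A /B resolventN (exprNn (resolvent _ _)) (exprS (-1)); ring.
  have [r1 i1] := resolvent_pow_cvg0 n z0.
  have [r2 i2] := resolvent_pow_cvg0 n nz0.
  have rs : (-1) ^+ n = ((-1) ^+ n)%:C%C :> C by rewrite rmorphXn rmorphN rmorph1.
  have rn : - n.+1%:R^-1 = (- n.+1%:R^-1)%:C%C :> C.
    by rewrite rmorphN fmorphV rmorph_nat.
  rewrite rn; split.
    under eq_fun do rewrite ReM /= oppr0 mul0r addr0 /B rs ReD ReM /= oppr0 mul0r addr0.
    have := cvgMl_tmp (a := - n.+1%:R^-1) (cvgD r1 (cvgMl_tmp (a := (-1) ^+ n) r2)).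
    rewrite mulr0 addr0 mulr0; exact.
  under eq_fun do rewrite ImM /= mul0r addr0 /B rs ImD ImM /= mul0r addr0.
  have := cvgMl_tmp (a := - n.+1%:R^-1) (cvgD i1 (cvgMl_tmp (a := (-1) ^+ n) i2)).
  rewrite mulr0 addr0 mulr0; exact.
have ReB (a b : C) : complex.Re (a - b) = complex.Re a - complex.Re b by case: a b => [? ?] [? ?].
have ImB (a b : C) : complex.Im (a - b) = complex.Im a - complex.Im b by case: a b => [? ?] [? ?].
case: lA => rl il; split; [exists (fun x => complex.Re (A x))|exists (fun x => complex.Im (A x))];
  split=> [x|]; try by have [] := dA x.
- by under eq_fun do rewrite -ReB.
- by under eq_fun do rewrite -ImB.
Qed.

Lemma rpv_poisson (a b : R) : b != 0 ->
  rpv (fun x => b / ((x - a) ^+ 2 + b ^+ 2)) (pi * Num.sg b).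
Proof.
move=> b0; exists (fun x => atan ((x - a) / b)); split => [x|].
  have dl : is_derive x (1 : R) (fun y : R => (y - a) / b) b^-1.
    by apply: is_derive_eq; rewrite /GRing.scale /=; ring.
  have := @is_derive1_comp _ atan (fun y => (y - a) / b) x _ _ (is_derive1_atan ((x - a) / b)) dl.
  move/is_derive_eq; apply; rewrite /GRing.scale /=.
  have q0 : (x - a) ^+ 2 + b ^+ 2 != 0.
    by rewrite gt_eqF // ltr_wpDl ?sqr_ge0 // exprn_even_gt0.
  rewrite (_ : 1 + _ = ((x - a) ^+ 2 + b ^+ 2) / b ^+ 2); last by field.
  by field; rewrite ?b0 ?q0.
have lin (c : R) : 0 < c -> atan ((x - a) * c) @[x --> +oo] --> pi / 2.
  move=> c0; apply: (cvg_comp _ _ _ (@cvgy_atan R)).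
  apply/cvgryPge => A; near=> x; rewrite -ler_pdivrMr // lerBrDr.
  by near: x; apply: nbhs_pinfty_ge; exact: num_real.
have linN (c : R) : 0 < c -> atan ((- x - a) * c) @[x --> +oo] --> - (pi / 2).
  move=> c0; have : atan ((x + a) * c) @[x --> +oo] --> pi / 2.
    apply: (cvg_comp _ _ _ (@cvgy_atan R)).
    apply/cvgryPge => A; near=> x; rewrite -ler_pdivrMr // -lerBlDr.
    by near: x; apply: nbhs_pinfty_ge; exact: num_real.
  rewrite (_ : (fun x => atan ((- x - a) * c)) = (fun x => - atan ((x + a) * c))).
    exact: cvgN.
  by apply/funext => x; rewrite -opprD mulNr atanN.
have [b_gt|b_lt|b_eq] := ltgtP b 0; last by rewrite b_eq eqxx in b0.
  have nb : 0 < - b^-1 by rewrite oppr_gt0 invr_lt0.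
  rewrite ltr0_sg // mulrN1.
  apply: cvg_eqf; first by apply: cvgN; apply: cvgB; [exact: lin nb|exact: linN nb].
    by move=> x; rewrite !fctE !mulrN !atanN; ring.
  by rewrite opprK -splitr.
have nb : 0 < b^-1 by rewrite invr_gt0.
rewrite gtr0_sg // mulr1.
apply: cvg_eqf; first by apply: cvgB; [exact: lin nb|exact: linN nb].
  by [].
by rewrite opprK -splitr.
Unshelve. all: by end_near. Qed.

(** The antiderivative is half the logarithm of a quadratic; its increment over [-x, x] is half the
    logarithm of a ratio tending to 1. *)
Lemma rpv_conj_poisson (a b : R) : b != 0 ->
  rpv (fun x => (x - a) / ((x - a) ^+ 2 + b ^+ 2)) 0.
Proof.
move=> b0; pose q a (x : R) := (x - a) ^+ 2 + b ^+ 2.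
have q0 c x : 0 < q c x by rewrite /q ltr_wpDl ?sqr_ge0 // exprn_even_gt0.
exists (fun x => 2^-1 * ln (q a x)); split => [x|].
  have dq : is_derive x (1 : R) (q a) (2 * (x - a)).
    by apply: is_derive_eq; rewrite /GRing.scale /=; ring.
  have := is_deriveZ 2^-1 (@is_derive1_comp _ (@ln R) (q a) x _ _ (is_derive1_ln (q0 a x)) dq).
  move/is_derive_eq; apply; rewrite /GRing.scale /= -/(q a x).
  by field; rewrite gt_eqF.
(* The ratio minus 1 is a combination of the real and imaginary parts of one resolvent, which vanish
   at infinity. *)
have ratio : q a x / q (- a) x @[x --> +oo] --> (1 : R).
  have [r i] : cvg0 (resolvent (- a +i* b)%C) by exact: resolvent_cvg0.
  apply: cvg_eqf; first by apply: cvgD; [exact: (cvg_cst (1 : R))|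
    apply: cvgD; [exact: (cvgMl_tmp (a := - 4 * a) r)|
                  exact: (cvgMl_tmp (a := 4 * a ^+ 2 / b) i)]].
    move=> x; rewrite !fctE !resolventE /= -/(q (- a) x) /q.
    have := q0 (- a) x; rewrite /q => /gt_eqF h.
    by field; rewrite b0 h.
  by rewrite !mulr0 !addr0.
apply: cvg_eqf; last 2 first.
- by move=> x; reflexivity.
- by [].
have l := cvg_comp _ _ ratio (continuous_ln ltr01).
apply: cvg_eqf; first exact: (cvgMl_tmp (a := 2^-1) l); last by rewrite ln1 mulr0.
move=> x; rewrite /= ln_div ?posrE // mulrBr; congr (_ - _ * ln _).
by rewrite /q; ring.
Unshelve. all: by end_near. Qed.

Lemma has_pv_resolvent z : complex.Im z != 0 ->
  has_pv (resolvent z) (Complex 0 (pi * Num.sg (complex.Im z))).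
Proof.
case: z => a b /= b0; split.
  by apply: rpv_ext (rpv_conj_poisson a b0) => x; rewrite resolventE.
by apply: rpv_ext (rpv_poisson a b0) => x; rewrite resolventE.
Qed.

End PrincipalValue.

(** * Integrals of products of two or three resolvent powers *)

Section ResidueFormulas.
Variable R : realType.
Local Notation C := R[i].

Definition pv1 (z : C) : C := Complex 0 (pi * Num.sg (complex.Im z)).

Lemma resolventM (a b : C) x : complex.Im a != 0 -> complex.Im b != 0 -> a != b ->
  resolvent a x * resolvent b x = (a - b)^-1 * (resolvent a x - resolvent b x).
Proof.
have nz (z : C) : complex.Im z != 0 -> x%:C%C - z != 0.
  by case: z => u v /= v0; rewrite eq_complex /= negb_and sub0r oppr_eq0 v0 orbT.
move=> /nz a0 /nz b0 ab; rewrite /resolvent; field.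
by rewrite a0 b0 subr_eq0 ab.
Qed.

Lemma has_pv_pow z n : complex.Im z != 0 ->
  has_pv (fun x => resolvent z x ^+ n.+1) (if n == 0%N then pv1 z else 0).
Proof.
by move=> z0; case: n => [|n]; [exact: has_pv_resolvent|exact: has_pv_resolvent_pow].
Qed.

(** Only the simple pole, at [i = p], contributes. *)
Lemma has_pv_pf z D p q : complex.Im z != 0 ->
  has_pv (fun x => pf (resolvent z x) D p.+1 q)
    ((-1) ^+ p * ('C(q + p - 1, p))%:R * D ^+ (q + p) * pv1 z).
Proof.
move=> z0; rewrite /pf.
have -> : (-1) ^+ p * ('C(q + p - 1, p))%:R * D ^+ (q + p) * pv1 z =
  \sum_(0 <= i < p.+1) (-1) ^+ i * ('C(q + i - 1, i))%:R * D ^+ (q + i) *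
     (if (p - i)%N == 0%N then pv1 z else 0).
  rewrite big_nat_recr //= subnn eqxx big1_seq ?add0r // => i; rewrite mem_index_iota /= => ip.
  by rewrite subn_eq0 leqNgt ip mulr0.
rewrite big_nat; under eq_fun do rewrite big_nat.
apply: has_pv_sum => i ip; apply: has_pvZ; rewrite subSn; first exact: has_pv_pow.
by rewrite -ltnS.
Qed.

Lemma has_pv2 (a b : C) p q : complex.Im a != 0 -> complex.Im b != 0 -> a != b ->
  has_pv (fun x => resolvent a x ^+ p.+1 * resolvent b x ^+ q.+1)
    ((-1) ^+ p * ('C(p + q, p))%:R * (a - b)^-1 ^+ (p + q).+1 * (pv1 a - pv1 b)).
Proof.
move=> a0 b0 ab; have aD := has_pv_pf (a - b)^-1 p q.+1 a0.
have bD := has_pv_pf (- (a - b)^-1) q p.+1 b0.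
have := has_pvD aD bD.
set v := (X in has_pv _ X); set w := (X in _ -> has_pv _ X); have -> : v = w.
  rewrite {}/v {}/w !addSn !subn1 /= [(q + p)%N]addnC mulrBr -(@bin_sub (p + q) q) ?leq_addl //.
  rewrite addnK; congr (_ + _); rewrite -mulNr; congr (_ * _).
  rewrite (exprNn (_^-1)) -addSn exprD [(-1) ^+ p.+1]exprS.
  have : (-1) ^+ q * (-1) ^+ q = 1 :> C by rewrite -exprMn mulN1r opprK expr1n.
  move: ((-1) ^+ q) ((-1) ^+ p) => s t ss; ring: ss.
by apply: has_pv_ext => x; rewrite -partial_fractions // resolventM.
Qed.

(** For distinct poles in one half-plane the two values [pv1] coincide and cancel. For equal poles,
    where partial fractions break down, the product is a single pole of order at least two. *)
Lemma has_pv2_same (a b : C) p q :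
  0 < complex.Im a * complex.Im b ->
  has_pv (fun x => resolvent a x ^+ p.+1 * resolvent b x ^+ q.+1) 0.
Proof.
move=> ab0.
have a0 : complex.Im a != 0 by apply: contraTneq ab0 => ->; rewrite mul0r ltxx.
have b0 : complex.Im b != 0 by apply: contraTneq ab0 => ->; rewrite mulr0 ltxx.
have [<-|ab] := eqVneq a b.
  apply: has_pv_ext (has_pv_pow (p + q).+1 a0) => x.
  by rewrite -exprD addSn addnS.
have := has_pv2 p q a0 b0 ab; rewrite /pv1.
suff -> : Num.sg (complex.Im a) = Num.sg (complex.Im b) by rewrite subrr mulr0.
by have [a1|a1|a1] := ltgtP (complex.Im a) 0; have [b1|b1|b1] := ltgtP (complex.Im b) 0;
  rewrite ?(ltr0_sg a1) ?(gtr0_sg a1) ?(ltr0_sg b1) ?(gtr0_sg b1) //; nra.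
Qed.

Definition pv2 (z : C) : C := Complex 0 (2 * pi * Num.sg (complex.Im z)).

Lemma has_pv2_opp (a b : C) p q :
  complex.Im a * complex.Im b < 0 ->
  has_pv (fun x => resolvent a x ^+ p.+1 * resolvent b x ^+ q.+1)
    ((-1) ^+ p * ('C(p + q, p))%:R * (a - b)^-1 ^+ (p + q).+1 * pv2 a).
Proof.
move=> ab0.
have a0 : complex.Im a != 0 by apply: contraTneq ab0 => ->; rewrite mul0r ltxx.
have b0 : complex.Im b != 0 by apply: contraTneq ab0 => ->; rewrite mulr0 ltxx.
have ab : a != b.
  by apply: contraTneq ab0 => ->; rewrite -leNgt -expr2 sqr_ge0.
rewrite (_ : pv2 a = pv1 a - pv1 b); first exact: has_pv2.
suff E : Num.sg (complex.Im b) = - Num.sg (complex.Im a).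
  rewrite /pv1 /pv2 E; apply/eqP; rewrite eq_complex /= subrr eqxx /=.
  by apply/eqP; ring.
by have [a1|a1|a1] := ltgtP (complex.Im a) 0; have [b1|b1|b1] := ltgtP (complex.Im b) 0;
  rewrite ?(ltr0_sg a1) ?(gtr0_sg a1) ?(ltr0_sg b1) ?(gtr0_sg b1) ?opprK //; nra.
Qed.

(** The residue at a of (y - a)^-(i+1) (y - b1)^-(p+1) (y - b2)^-(q+1), by the Leibniz rule, with D1
    = 1 / (a - b1) and D2 = 1 / (a - b2). *)
Definition residue3 (D1 D2 : C) i p q := (-1) ^+ i *
  \sum_(0 <= k < i.+1) ('C(p + k, k))%:R * ('C(q + (i - k), i - k))%:R
     * D1 ^+ (p + k).+1 * D2 ^+ (q + (i - k)).+1.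

(** Partial fractions between [a] and [b1] leave products of two kinds. Those with poles at [b1] and
    [b2] vanish, both poles being in the half-plane opposite to [a]; those with poles at [a] and
    [b2] are given by [has_pv2_opp] and add up to the Leibniz sum. *)
Lemma has_pv3 (a b1 b2 : C) i p q :
  complex.Im a * complex.Im b1 < 0 -> complex.Im a * complex.Im b2 < 0 ->
  has_pv (fun x => resolvent a x ^+ i.+1 * resolvent b1 x ^+ p.+1 * resolvent b2 x ^+ q.+1)
    (residue3 (a - b1)^-1 (a - b2)^-1 i p q * pv2 a).
Proof.
move=> ab1 ab2; rewrite /residue3 big_distrr big_distrl /=.
have a0 : complex.Im a != 0 by apply: contraTneq ab1 => ->; rewrite mul0r ltxx.
have b10 : complex.Im b1 != 0 by apply: contraTneq ab1 => ->; rewrite mulr0 ltxx.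
have ab : a != b1.
  by apply: contraTneq ab1 => ->; rewrite -leNgt -expr2 sqr_ge0.
have E1 x : resolvent a x ^+ i.+1 * resolvent b1 x ^+ p.+1 * resolvent b2 x ^+ q.+1 =
    pf (resolvent a x) (a - b1)^-1 i.+1 p.+1 * resolvent b2 x ^+ q.+1 +
    pf (resolvent b1 x) (- (a - b1)^-1) p.+1 i.+1 * resolvent b2 x ^+ q.+1.
  by rewrite (partial_fractions (D := (a - b1)^-1)) ?mulrDl // resolventM.
apply: (has_pv_ext (fun x => esym (E1 x))).
rewrite -[X in has_pv _ X]addr0; apply: has_pvD.
  under eq_fun do rewrite /pf big_nat big_distrl /=.
  rewrite big_nat; apply: has_pv_sum => k ki.
  rewrite ltnS in ki.
  under eq_fun do rewrite subSn //.
  apply: (has_pv_ext (fun x => mulrA _ _ _)).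
  rewrite addSn subn1 /=.
  set v := (X in has_pv _ X).
  have -> : v = (-1) ^+ k * ('C(p + k, k))%:R * (a - b1)^-1 ^+ (p + k).+1 *
     ((-1) ^+ (i - k) * ('C((i - k) + q, i - k))%:R * (a - b2)^-1 ^+ (i - k + q).+1 * pv2 a).
    rewrite {}/v -{1}(subnK ki) exprD [(q + _)%N]addnC; ring.
  by apply: has_pvZ; apply: has_pv2_opp.
have -> : 0 = \sum_(0 <= k < p.+1) (0 : C) by rewrite big1.
under eq_fun do rewrite /pf big_nat big_distrl /=.
rewrite big_nat; apply: has_pv_sum => k kp.
rewrite ltnS in kp.
under eq_fun do rewrite subSn //.
apply: (has_pv_ext (fun x => mulrA _ _ _)).
set cst := _ * _ ^+ (i.+1 + k); rewrite -[0](mulr0 cst); apply: has_pvZ; apply: has_pv2_same.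
by move: ab1 ab2; nra.
Qed.

End ResidueFormulas.

(** * Symmetric sums over the integers *)

Section SymmetricSums.
Variable R : realType.
Implicit Types f h : int -> R.

(** The partial sums are kept symmetric because the sum of (m + i rho)^-1 converges only in this
    sense. *)
Definition symsum f (N : nat) : R :=
  f 0 + \sum_(1 <= m < N.+1) (f m%:Z + f (- m%:Z)).

Definition ssum f (s : R) := symsum f N @[N --> \oo] --> s.

Lemma ssum_ext f h s : f =1 h -> ssum f s -> ssum h s.
Proof. by move=> /funext ->. Qed.

Lemma ssum0 : ssum (fun=> 0) 0.
Proof.
rewrite /ssum (_ : symsum _ = fun=> 0); first exact: cvg_cst.
by apply/funext => N; rewrite /symsum big1 ?addr0 // => i _; rewrite addr0.
Qed.

Lemma symsumD f h N : symsum (fun m => f m + h m) N = symsum f N + symsum h N.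
Proof. by rewrite /symsum addrACA -big_split; congr (_ + _); apply: eq_bigr => i _; rewrite addrACA. Qed.

Lemma symsumZ k f N : symsum (fun m => k * f m) N = k * symsum f N.
Proof. by rewrite /symsum mulrDr big_distrr; congr (_ + _); apply: eq_bigr => i _ /=; rewrite mulrDr. Qed.

Lemma ssumD f h s t : ssum f s -> ssum h t -> ssum (fun m => f m + h m) (s + t).
Proof.
move=> fs ht; rewrite /ssum (_ : symsum _ = fun N => symsum f N + symsum h N).
  exact: cvgD.
by apply/funext => N; rewrite symsumD.
Qed.

Lemma ssumZ k f s : ssum f s -> ssum (fun m => k * f m) (k * s).
Proof.
move=> fs; rewrite /ssum (_ : symsum _ = fun N => k * symsum f N).
  exact: cvgMl_tmp.
by apply/funext => N; rewrite symsumZ.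
Qed.

Lemma ssum_odd f : (forall m, f (- m) = - f m) -> ssum f 0.
Proof.
move=> fN; rewrite /ssum (_ : symsum _ = fun=> 0); first exact: cvg_cst.
have f0 : f 0 = 0 by have := fN 0; rewrite oppr0 => h; lra.
by apply/funext => N; rewrite /symsum big1 ?addr0 // => i _; rewrite fN subrr.
Qed.

Lemma sum_inv_sqr_le N : \sum_(1 <= m < N.+1) ((m%:R ^+ 2)^-1 : R) <= 2.
Proof.
case: N => [|N]; first by rewrite big_nil.
suff : \sum_(1 <= m < N.+2) ((m%:R ^+ 2)^-1 : R) <= 2 - N.+1%:R^-1.
  by move=> /le_trans; apply; rewrite gerBl invr_ge0.
elim: N => [|N IH]; first by rewrite big_nat1 expr1n invr1; lra.
rewrite big_nat_recr //=; apply: le_trans (lerD IH (lexx _)) _.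
have N0 : 0 < N.+1%:R :> R by [].
rewrite -[N.+2%:R]natr1; move: (N.+1%:R : R) N0 => x x0.
rewrite -subr_ge0 (_ : _ - _ = (x * (x + 1) ^+ 2)^-1).
  by rewrite invr_ge0 mulr_ge0 ?sqr_ge0 ?ltW.
by field; apply/andP; split; lra.
Qed.

(** Absolute convergence is required only after pairing m with -m; the factor 2 is the bound of
    [sum_inv_sqr_le]. *)
Lemma ssum_bound f K : 0 <= K ->
  (forall m : nat, (0 < m)%N -> `|f m%:Z + f (- m%:Z)| <= K / m%:R ^+ 2) ->
  exists2 s, ssum f s & `|s - f 0| <= 2 * K.
Proof.
move=> K0 fK.
pose g m := if m is 0%N then 0 else f m%:Z + f (- m%:Z).
have gE N : series g N.+1 = symsum f N - f 0.
  rewrite /symsum addrC addKr /series /= big_ltn // add0r.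
  by apply: eq_big_nat => -[].
have gb (m : nat) : `|g m| <= K * (m%:R ^+ 2)^-1.
  by case: m => [|m]; rewrite ?normr0 ?expr0n ?invr0 ?mulr0 //; exact: fK.
have pb N : \sum_(0 <= m < N) `|g m| <= 2 * K.
  apply: (le_trans (ler_sum _ (fun i _ => gb i))).
  rewrite -big_distrr /= mulrC ler_wpM2r //.
  case: N => [|N]; first by rewrite big_nil.
  by rewrite big_ltn // expr0n invr0 add0r sum_inv_sqr_le.
have cg : cvgn (series g).
  apply: normed_cvg; apply: nondecreasing_is_cvgn.
    by apply: nondecreasing_series => n _ _; exact: normr_ge0.
  by exists (2 * K) => _ [N _ <-]; exact: pb.
have cs : symsum f N @[N --> \oo] --> f 0 + lim (series g @ \oo).
  rewrite (_ : symsum f = fun N => f 0 + series g N.+1).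
    by apply: cvgD; [exact: cvg_cst|rewrite (cvg_shiftS (series g))].
  by apply/funext => N; rewrite gE addrC subrK.
exists (f 0 + lim (series g @ \oo)) => //.
rewrite addrC addKr; apply: (cvgr_to_le (cvg_norm cg)).
near=> N; apply: le_trans (pb N); exact: ler_norm_sum.
Unshelve. all: by end_near. Qed.

End SymmetricSums.

(** * Eisenstein's quadratic relation at finite level *)

Section Eisenstein.
Variable R : realType.
Implicit Types rho : R.

Definition lorentz rho (m : nat) : R := (m%:R ^+ 2 + rho ^+ 2)^-1.

(** What remains at the upper end when the sums of 1 / (n - m) and of 1 / (n + m) over n <= N are
    subtracted, the second one being the first shifted by 2 m. *)
Definition harm_window (N m : nat) : R := \sum_(N.+1 <= n < (N + 2 * m).+1) (n%:R - m%:R)^-1.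

(** The reflection of n into 2 m - n cancels every term except n = 2 m; the term n = m is 1/0 =
    0. *)
Lemma sum_inv_shift m : (0 < m)%N ->
  \sum_(1 <= n < (2 * m).+1) ((n%:R - m%:R)^-1 : R) = m%:R^-1.
Proof.
move=> m0; rewrite big_nat_recr /=; last by lia.
rewrite [X in _ + X](_ : _ = m%:R^-1); last by rewrite natrM; congr (_^-1); ring.
suff : \sum_(1 <= n < 2 * m) ((n%:R - m%:R)^-1 : R) = 0 by move->; rewrite add0r.
set S := \sum_(_ <= _ < _) _; suff : S = - S by move=> h; lra.
rewrite {1}/S big_nat_rev /= -sumrN; apply: eq_big_nat => i /andP[i1 i2].
rewrite -invrN; congr (_^-1).
rewrite (_ : (1 + 2 * m - i.+1 = 2 * m - i)%N) ?natrB ?natrM; [ring|lia|lia].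
Qed.

Lemma sum_inv_sqrB N m : (0 < m)%N -> (m <= N)%N ->
  \sum_(1 <= n < N.+1) ((n%:R ^+ 2 - m%:R ^+ 2)^-1 : R) =
  3 / (4 * m%:R ^+ 2) - harm_window N m / (2 * m%:R).
Proof.
move=> m0 mN; have mR : m%:R != 0 :> R by rewrite pnatr_eq0 -lt0n.
(* At n = m the left side is 1/0 = 0 while the bracket equals -1 / (2 m); the last summand repairs
   the difference. *)
have E (n : nat) : (0 < n)%N -> (n%:R ^+ 2 - m%:R ^+ 2)^-1 =
    (2 * m%:R)^-1 * ((n%:R - m%:R)^-1 - (n%:R + m%:R)^-1)
    + (n == m)%:R * (4 * m%:R ^+ 2)^-1 :> R.
  move=> n0; have [->|nm] := eqVneq n m.
    rewrite !subrr !invr0 mul1r (_ : m%:R + m%:R = 2 * m%:R); last by ring.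
    by field.
  rewrite mul0r addr0 subr_sqr; field.
  by rewrite mR subr_eq0 eqr_nat nm -natrD pnatr_eq0; case: n n0 {nm}.
under eq_big_nat => n /andP[n1 _] do rewrite E //.
rewrite big_split /= -big_distrr /= -big_distrl /= sumrB.
have -> : \sum_(1 <= n < N.+1) (n == m)%:R = 1 :> R.
  rewrite (bigD1_seq m) /= ?mem_index_iota ?iota_uniq ?m0 //.
  by rewrite eqxx big1 ?addr0 // => n /negbTE ->.
have -> : \sum_(1 <= n < N.+1) (n%:R + m%:R)^-1 =
    \sum_((2 * m).+1 <= n < (N + 2 * m).+1) (n%:R - m%:R)^-1 :> R.
  rewrite -[(2 * m).+1]add1n -[(N + 2 * m).+1]addSn big_addn addnK.
  apply: eq_big_nat => n _; rewrite natrD natrM; congr (_^-1); ring.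
have F (a b : nat) : (a <= b)%N -> \sum_(1 <= n < b.+1) (n%:R - m%:R)^-1 =
  \sum_(1 <= n < a.+1) (n%:R - m%:R)^-1 + \sum_(a.+1 <= n < b.+1) (n%:R - m%:R)^-1 :> R.
  by move=> ab; rewrite -big_cat_nat.
have h1 := F N (N + 2 * m)%N (leq_addr _ _); rewrite -/(harm_window N m) in h1.
have h2 := F (2 * m)%N (N + 2 * m)%N (leq_addl _ _).
rewrite sum_inv_shift // in h2.
have -> : \sum_(1 <= n < N.+1) (n%:R - m%:R)^-1 -
    \sum_((2 * m).+1 <= n < (N + 2 * m).+1) (n%:R - m%:R)^-1 = m%:R^-1 - harm_window N m :> R by lra.
by field.
Qed.

Lemma harm_window_bound N m : (m <= N)%N -> 0 <= harm_window N m <= 2 * m%:R / (N.+1%:R - m%:R).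
Proof.
move=> mN; have pos n : (N < n)%N -> 0 < n%:R - m%:R :> R.
  by move=> Nn; rewrite subr_gt0 ltr_nat (leq_ltn_trans mN).
apply/andP; split; rewrite /harm_window.
  by rewrite big_nat; apply: sumr_ge0 => n /andP[Nn _]; rewrite invr_ge0 ltW ?pos.
apply: le_trans (_ : \sum_(N.+1 <= n < (N + 2 * m).+1) (N.+1%:R - m%:R)^-1 <= _).
  rewrite big_nat [X in _ <= X]big_nat; apply: ler_sum => n /andP[Nn _].
  by rewrite lef_pV2 ?posrE ?pos // lerD2r ler_nat.
by rewrite sumr_const_nat subSS addKn -[X in X <= _]mulr_natl natrM.
Qed.

(** A truncation of Eisenstein's relation between the sum over m of (rho + i m)^-1, squared, and the
    sum of (rho + i m)^-2. Partial fractions in m^2 and n^2 turn the off-diagonal part of the square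
    into single sums. The main term on the right is free of rho; the other one is a truncation
    error. *)
Lemma eisenstein_finite rho N : 0 < rho ->
  (rho^-1 + 2 * rho * \sum_(1 <= m < N.+1) lorentz rho m) ^+ 2 -
  (rho^-1 ^+ 2 + 2 * \sum_(1 <= m < N.+1) (2 * rho ^+ 2 * lorentz rho m ^+ 2 - lorentz rho m)) =
  6 * \sum_(1 <= m < N.+1) (m%:R ^+ 2)^-1 -
  4 * rho ^+ 2 * \sum_(1 <= m < N.+1) lorentz rho m * harm_window N m / m%:R.
Proof.
move=> r0.
have q0 (m : nat) : m%:R ^+ 2 + rho ^+ 2 != 0.
  by rewrite gt_eqF // ltr_wpDl ?sqr_ge0 // exprn_gt0.
have pp (m n : nat) : lorentz rho m * lorentz rho n = (lorentz rho m - lorentz rho n) * (n%:R ^+ 2 - m%:R ^+ 2)^-1 +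
   (m == n)%:R * lorentz rho m ^+ 2.
  have [->|mn] := eqVneq m n; first by rewrite subrr mul0r add0r mul1r expr2.
  rewrite mul0r addr0 /lorentz; have d0 : n%:R ^+ 2 - m%:R ^+ 2 != 0 :> R.
    by rewrite subr_eq0 -!natrX eqr_nat eqn_exp2r // eq_sym.
  by field; rewrite !q0 d0.
have sq : (\sum_(1 <= m < N.+1) lorentz rho m) ^+ 2 = \sum_(1 <= m < N.+1) lorentz rho m ^+ 2 +
    2 * \sum_(1 <= m < N.+1) lorentz rho m * \sum_(1 <= n < N.+1) (n%:R ^+ 2 - m%:R ^+ 2)^-1.
  rewrite expr2 big_distrlr /=.
  under eq_bigr do under eq_bigr do rewrite pp mulrBl.
  under eq_bigr do rewrite big_split /= sumrB.
  rewrite big_split /= addrC sumrB; congr (_ + _).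
    apply: eq_big_nat => m mN.
    rewrite (bigD1_seq m) /= ?mem_index_iota ?iota_uniq // eqxx mul1r big1 ?addr0 // => n nm.
    by rewrite eq_sym (negbTE nm) mul0r.
  rewrite [X in _ - X]exchange_big /= -sumrB mulr_sumr; apply: eq_bigr => m _.
  rewrite mulr_sumr -sumrB mulr_sumr; apply: eq_bigr => n _.
  by rewrite -[(m%:R ^+ 2 - _)^-1]opprK -invrN opprB; ring.
rewrite sqrrD exprMn sq.
under [X in _ + 2 * X]eq_bigr do [].
have -> : \sum_(1 <= m < N.+1) lorentz rho m * \sum_(1 <= n < N.+1) (n%:R ^+ 2 - m%:R ^+ 2)^-1 =
   3 / 4 * \sum_(1 <= m < N.+1) lorentz rho m / m%:R ^+ 2 -
   2^-1 * \sum_(1 <= m < N.+1) lorentz rho m * harm_window N m / m%:R.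
  rewrite !mulr_sumr -sumrB; apply: eq_big_nat => m /andP[m1 mN].
  rewrite sum_inv_sqrB //; have mR : m%:R != 0 :> R by rewrite pnatr_eq0 -lt0n.
  by field.
have -> : \sum_(1 <= m < N.+1) (m%:R ^+ 2)^-1 = \sum_(1 <= m < N.+1) lorentz rho m +
   rho ^+ 2 * \sum_(1 <= m < N.+1) lorentz rho m / m%:R ^+ 2.
  rewrite mulr_sumr -big_split /=; apply: eq_big_nat => m /andP[m1 mN].
  have mR : m%:R != 0 :> R by rewrite pnatr_eq0 -lt0n.
  by rewrite /lorentz; field; rewrite mR q0.
rewrite sumrB -mulr_sumr; field.
by rewrite gt_eqF.
Qed.

(** Each term is at most 2 / (m^2 (N + 1 - m)), hence by partial fractions at most 2 / ((N + 1) m^2)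
    + 4 / (N + 1)^2. Each of the two sums over m is at most 4 / (N + 1). *)
Lemma eisenstein_remainder rho N : 0 < rho ->
  0 <= \sum_(1 <= m < N.+1) lorentz rho m * harm_window N m / m%:R <= 8 / N.+1%:R.
Proof.
move=> r0.
have pb m : (0 < m)%N -> 0 <= lorentz rho m <= (m%:R ^+ 2)^-1.
  move=> m0; rewrite /lorentz invr_ge0 addr_ge0 ?sqr_ge0 //=.
  rewrite lef_pV2 ?posrE ?lerDl ?sqr_ge0 ?ltr_wpDr ?sqr_ge0 //;
  by rewrite exprn_gt0 // ltr0n.
apply/andP; split.
  rewrite big_nat; apply: sumr_ge0 => m /andP[m1 mN].
  have /andP[p0 _] := pb _ m1; have /andP[e0 _] := harm_window_bound (m := m) (N := N) mN.
  by rewrite divr_ge0 // mulr_ge0.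
apply: le_trans (_ : \sum_(1 <= m < N.+1)
   (2 / N.+1%:R * (m%:R ^+ 2)^-1 + 4 / N.+1%:R ^+ 2) <= _).
  rewrite big_nat [X in _ <= X]big_nat; apply: ler_sum => m /andP[m1 mN].
  have /andP[p0 p1] := pb _ m1; have /andP[e0 e1] := harm_window_bound (m := m) (N := N) mN.
  have m0 : 0 < m%:R :> R by rewrite ltr0n.
  have m1R : 1 <= m%:R :> R by rewrite ler1n.
  have mNR : m%:R + 1 <= N.+1%:R :> R by rewrite natr1 ler_nat.
  apply: le_trans (_ : (m%:R ^+ 2)^-1 * (2 * m%:R / (N.+1%:R - m%:R)) / m%:R <= _).
    by apply: ler_wpM2r; [rewrite invr_ge0 ltW | apply: ler_pM].
  move: (N.+1%:R : R) (m%:R : R) m0 m1R mNR => y x x0 x1 xy.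
  rewrite (_ : (x ^+ 2)^-1 * _ / x = 2 / y * (x ^+ 2)^-1 + 2 / y ^+ 2 * (x^-1 + (y - x)^-1)); last first.
    by field; apply/and3P; split; lra.
  rewrite lerD2l (_ : 4 / y ^+ 2 = 2 / y ^+ 2 * 2); last by rewrite mulrAC; congr (_ / _); ring.
  rewrite ler_wpM2l ?divr_ge0 ?sqr_ge0 //.
  have : x^-1 <= 1 by rewrite invf_le1.
  have : (y - x)^-1 <= 1 by rewrite invf_le1; lra.
  lra.
rewrite big_split /= -mulr_sumr sumr_const_nat subSS subn0.
have := sum_inv_sqr_le R N; set S := \sum_(_ <= _ < _) _ => SB.
have y0 : 0 < N.+1%:R :> R by [].
have -> : 4 / N.+1%:R ^+ 2 *+ N = 4 / N.+1%:R * (N%:R / N.+1%:R) :> R.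
  by rewrite -mulr_natr; field; rewrite gt_eqF.
have : N%:R / N.+1%:R <= 1 :> R by rewrite ler_pdivrMr // mul1r ler_nat.
have : 0 < N.+1%:R^-1 :> R by rewrite invr_gt0.
move=> v0; move: (N%:R / N.+1%:R) => u u1; move: (N.+1%:R^-1) v0 => v v0; nra.
Qed.

End Eisenstein.

(** * Sums of the powers (rho + i m)^-q over m *)

Section LatticeSums.
Variable R : realType.
Local Notation C := R[i].
Implicit Types (rho h : R) (q : nat).
Local Notation N := Normc.normc.

Local Arguments Normc.normc : simpl never.

Lemma normcX (z : C) n : N (z ^+ n) = N z ^+ n.
Proof.
elim: n => [|n IH]; first by rewrite !expr0 Normc.normc1.
by rewrite !exprS Normc.normcM IH.
Qed.

Lemma normc_ge0 (z : C) : 0 <= N z.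
Proof. by case: z => a b; rewrite /Normc.normc sqrtr_ge0. Qed.

Lemma normc_sqr (z : C) : N z ^+ 2 = complex.Re z ^+ 2 + complex.Im z ^+ 2.
Proof. by case: z => a b; rewrite /Normc.normc sqr_sqrtr // addr_ge0 ?sqr_ge0. Qed.

Lemma Re_le_normc (z : C) : `|complex.Re z| <= N z.
Proof.
rewrite -(@ler_pXn2r _ 2) ?nnegrE ?normc_ge0 ?normr_ge0 //.
by rewrite normc_sqr real_normK ?num_real // lerDl sqr_ge0.
Qed.

Definition latz rho (m : int) : C := ((rho +i* m%:~R)%C)^-1.

(** The imaginary part is odd in [m] and drops out of symmetric sums, so the real part carries the
    whole sum. *)
Definition phi q rho (m : int) : R := complex.Re (latz rho m ^+ q).

Lemma latz_conj rho m : latz rho (- m) = ((latz rho m)^*)%C.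
Proof. by rewrite /latz conjc_inv /= rmorphN. Qed.

Lemma phi_even q rho m : phi q rho (- m) = phi q rho m.
Proof.
rewrite /phi latz_conj -(rmorphXn (@conjc R)).
by case: (_ ^+ q).
Qed.

Lemma Im_latz_odd q rho m :
  complex.Im (latz rho (- m) ^+ q) = - complex.Im (latz rho m ^+ q).
Proof. by rewrite latz_conj -(rmorphXn (@conjc R)); case: (_ ^+ q). Qed.

Lemma normc_latz_sqr rho m : N (latz rho m) ^+ 2 = (m%:~R ^+ 2 + rho ^+ 2)^-1.
Proof. by rewrite /latz Normc.normcV exprVn normc_sqr /= addrC. Qed.

Lemma normc_latz_le rho m : 0 < rho -> N (latz rho m) <= rho^-1.
Proof.
move=> r0; rewrite -(@ler_pXn2r _ 2) ?nnegrE ?normc_ge0 ?invr_ge0 ?(ltW r0) //.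
rewrite normc_latz_sqr exprVn lef_pV2 ?posrE ?lerDr ?sqr_ge0 ?exprn_gt0 //.
by rewrite ltr_wpDl ?sqr_ge0 ?exprn_gt0.
Qed.

Lemma latzE rho m : latz rho m =
  ((rho / (rho ^+ 2 + m%:~R ^+ 2)) -i* (m%:~R / (rho ^+ 2 + m%:~R ^+ 2)))%C.
Proof. by rewrite /latz /GRing.inv. Qed.

Lemma phi1E rho m : phi 1 rho m = rho * N (latz rho m) ^+ 2.
Proof. by rewrite normc_latz_sqr /phi expr1 latzE /= addrC. Qed.

Lemma phi2E rho m : rho != 0 -> phi 2 rho m =
  2 * rho ^+ 2 * (N (latz rho m) ^+ 2) ^+ 2 - N (latz rho m) ^+ 2.
Proof.
move=> r0; rewrite normc_latz_sqr /phi latzE expr2 /= [rho ^+ 2 + _]addrC.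
have q0 : m%:~R ^+ 2 + rho ^+ 2 != 0.
  by rewrite gt_eqF // ltr_wpDl ?sqr_ge0 // exprn_even_gt0.
by field.
Qed.

Lemma phi1_ge0 rho m : 0 < rho -> 0 <= phi 1 rho m.
Proof. by move=> r0; rewrite phi1E mulr_ge0 ?sqr_ge0 ?(ltW r0). Qed.

Lemma normc_latz_nat rho (m : nat) : N (latz rho m%:Z) ^+ 2 = lorentz rho m.
Proof. by rewrite normc_latz_sqr. Qed.

Lemma phi_bound q rho (m : int) : 0 < rho -> (0 < q)%N ->
  `|phi q rho m| <= rho^-1 ^+ q.-1 * phi 1 rho m.
Proof.
case: q => // -[r0 _|q r0 _]; first by rewrite expr0 mul1r ger0_norm ?phi1_ge0.
apply: le_trans (Re_le_normc _) _; rewrite normcX phi1E /=.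
rewrite [rho^-1 ^+ _]exprSr -mulrA mulKf ?gt_eqF //.
rewrite -[q.+2]addn2 exprD ler_wpM2r ?sqr_ge0 //.
by rewrite lerXn2r ?nnegrE ?normc_ge0 ?invr_ge0 ?(ltW r0) // normc_latz_le.
Qed.

Lemma ssum_phi_ex q rho : 0 < rho -> (0 < q)%N -> exists s, ssum (phi q rho) s.
Proof.
move=> r0 q0; have [||s hs _] := @ssum_bound R (phi q rho) (2 * (rho^-1 ^+ q.-1 * rho)).
- by rewrite mulr_ge0 // mulr_ge0 ?exprn_ge0 ?invr_ge0 ?(ltW r0).
- move=> m m0; rewrite phi_even (_ : _ + _ = 2 * phi q rho m%:Z); last by ring.
  rewrite normrM ger0_norm // -!mulrA ler_wpM2l //.
  apply: le_trans (phi_bound _ r0 q0) _.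
  rewrite ler_wpM2l ?exprn_ge0 ?invr_ge0 ?(ltW r0) // phi1E ler_wpM2l ?(ltW r0) //.
  rewrite normc_latz_nat lef_pV2 ?posrE ?lerDl ?sqr_ge0 ?exprn_gt0 ?ltr0n //.
  by rewrite ltr_wpDl ?sqr_ge0 ?exprn_gt0.
by exists s.
Qed.

Definition lsum q rho : R := lim (symsum (phi q rho) N @[N --> \oo]).

Lemma ssum_phi q rho : 0 < rho -> (0 < q)%N -> ssum (phi q rho) (lsum q rho).
Proof.
move=> r0 q0; have [s hs] := ssum_phi_ex r0 q0.
by rewrite /ssum /lsum (cvg_lim _ hs).
Qed.

Lemma symsum_phi1 rho N : 0 < rho -> symsum (phi 1 rho) N =
  rho^-1 + 2 * rho * \sum_(1 <= m < N.+1) lorentz rho m.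
Proof.
move=> r0; rewrite /symsum; congr (_ + _).
  by rewrite phi1E normc_latz_sqr expr0n add0r; field; rewrite gt_eqF.
rewrite mulr_sumr; apply: eq_bigr => m _.
by rewrite phi_even phi1E normc_latz_nat; ring.
Qed.

Lemma symsum_phi2 rho N : 0 < rho -> symsum (phi 2 rho) N =
  rho^-1 ^+ 2 + 2 * \sum_(1 <= m < N.+1) (2 * rho ^+ 2 * lorentz rho m ^+ 2 - lorentz rho m).
Proof.
move=> r0; have r1 : rho != 0 by rewrite gt_eqF.
rewrite /symsum; congr (_ + _).
  by rewrite phi2E // normc_latz_sqr expr0n add0r; field.
rewrite mulr_sumr; apply: eq_bigr => m _.
by rewrite phi_even phi2E // normc_latz_nat; ring.
Qed.

Lemma symsum_le (f g : int -> R) n : (forall m, `|f m| <= g m) ->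
  `|symsum f n| <= symsum g n.
Proof.
move=> fg; apply: le_trans (ler_normD _ _) _; apply: lerD => //.
apply: le_trans (ler_norm_sum _ _ _) _; apply: ler_sum => m _.
by apply: le_trans (ler_normD _ _) _; apply: lerD.
Qed.

Lemma ssum_le (f g : int -> R) s t : (forall m, `|f m| <= g m) ->
  ssum f s -> ssum g t -> `|s| <= t.
Proof.
move=> fg fs gt; apply: (ler_cvg_to (cvg_norm fs) gt).
by near=> n; exact: symsum_le.
Unshelve. all: by end_near. Qed.

Lemma inv_natS_cvg0 (k : R) : k / N.+1%:R @[N --> \oo] --> (0 : R).
Proof. by rewrite -[0](mulr0 k); apply: cvgMl_tmp; exact: cvg_harmonic. Qed.

Lemma lsum_eisenstein_ex : exists c : R, forall rho, 0 < rho ->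
  lsum 1 rho ^+ 2 - lsum 2 rho = c.
Proof.
have key rho : 0 < rho -> 6 * (\sum_(1 <= m < N.+1) (m%:R ^+ 2)^-1 : R) @[N --> \oo] -->
    lsum 1 rho ^+ 2 - lsum 2 rho.
  move=> r0; have h1 := ssum_phi r0 (isT : (0 < 1)%N); have h2 := ssum_phi r0 (isT : (0 < 2)%N).
  have hd : symsum (phi 1 rho) N ^+ 2 - symsum (phi 2 rho) N @[N --> \oo] -->
      lsum 1 rho ^+ 2 - lsum 2 rho.
    by apply: cvgB => //; rewrite expr2; apply: cvgM.
  have hr : 4 * rho ^+ 2 * (\sum_(1 <= m < N.+1) lorentz rho m * harm_window R N m / m%:R)
      @[N --> \oo] --> (0 : R).
    have l : \sum_(1 <= m < N.+1) lorentz rho m * harm_window R N m / m%:R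
        @[N --> \oo] --> (0 : R).
      apply: (squeeze_cvgr _ (cvg_cst 0) (inv_natS_cvg0 8)).
      by near=> n; exact: eisenstein_remainder.
    apply: cvg_eqf; first exact: (cvgMl_tmp (a := 4 * rho ^+ 2) l); first by [].
    by rewrite mulr0.
  apply: cvg_eqf; first exact: (cvgD hd hr); last by rewrite addr0.
  by move=> n /=; rewrite symsum_phi1 // symsum_phi2 // eisenstein_finite //=; ring.
exists (lsum 1 1 ^+ 2 - lsum 2 1) => rho r0.
exact: cvg_unique (key _ r0) (key _ ltr01).
Unshelve. all: by end_near. Qed.

End LatticeSums.

(** * The hyperbolic cotangent and exponential decay of its derivatives *)

Section HyperbolicCotangent.
Variable R : realType.
Local Notation C := R[i].
Implicit Types (rho h : R) (q : nat).
Local Arguments Normc.normc : simpl never.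

Lemma phi1_nat rho (m : nat) : phi 1 rho m%:Z = rho / (m%:R ^+ 2 + rho ^+ 2).
Proof. by rewrite phi1E normc_latz_sqr. Qed.

Lemma atan_step rho (m : nat) : 0 < rho ->
  phi 1 rho m.+1%:Z <= atan (m.+1%:R / rho) - atan (m%:R / rho) <= phi 1 rho m%:Z.
Proof.
move=> r0; pose A (x : R) := atan (x / rho).
have dA (x : R) : is_derive x (1 : R) A (rho / (x ^+ 2 + rho ^+ 2)).
  have dl : is_derive x (1 : R) (fun y : R => y / rho) rho^-1.
    by apply: is_derive_eq; rewrite /GRing.scale /=; ring.
  have := @is_derive1_comp _ atan (fun y => y / rho) x _ _ (is_derive1_atan (x / rho)) dl.
  move/is_derive_eq; apply; rewrite /GRing.scale /=.
  have q0 : x ^+ 2 + rho ^+ 2 != 0 by rewrite gt_eqF // ltr_wpDl ?sqr_ge0 // exprn_gt0.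
  have r1 : rho != 0 by rewrite gt_eqF.
  rewrite (_ : 1 + _ = (x ^+ 2 + rho ^+ 2) / rho ^+ 2); last by field.
  by field; rewrite r1 q0.
have lt1 : m%:R < m.+1%:R :> R by rewrite ltr_nat.
have cA : {within `[m%:R : R, m.+1%:R], continuous A}.
  by apply: derivable_within_continuous => t _; have [] := dA t.
have [c] := MVT lt1 (fun z _ => dA z) cA; rewrite in_itv /= => /andP[mc cm].
rewrite -/(A _) -/(A _) => ->; rewrite -natrB // subSnn mulr1 !phi1_nat.
have m0 : 0 <= m%:R :> R by [].
have pos (x : R) : 0 < x ^+ 2 + rho ^+ 2 by rewrite ltr_wpDl ?sqr_ge0 // exprn_gt0.
apply/andP; split; rewrite ler_wpM2l ?(ltW r0) // lef_pV2 ?posrE // lerD2r;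
  rewrite lerXn2r ?nnegrE //; lra.
Qed.

Lemma atan_lt_pihalf (x : R) : atan x <= pi / 2.
Proof. exact/ltW/atan_ltpi2. Qed.

(** Comparison with the integral of rho / (x^2 + rho^2), whose antiderivative is atan (x / rho): the
    terms with m >= 1 add up to at most pi / 2 and at least pi / 2 - 1 / rho. *)
Lemma lsum1_pi rho : 0 < rho -> `|lsum 1 rho - pi| <= rho^-1.
Proof.
move=> r0; have := ssum_phi r0 (isT : (0 < 1)%N); rewrite /ssum => cv.
have E N : symsum (phi 1 rho) N = rho^-1 + 2 * \sum_(1 <= m < N.+1) phi 1 rho m%:Z.
  rewrite /symsum phi1_nat expr0n add0r; congr (_ + _).
    by field; rewrite gt_eqF.
  by rewrite mulr_sumr; apply: eq_bigr => m _; rewrite phi_even; ring.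
have tele (a b : nat) : (a <= b)%N -> \sum_(a <= m < b) (atan (m.+1%:R / rho) - atan (m%:R / rho))
   = atan (b%:R / rho) - atan (a%:R / rho).
  by move=> ab; rewrite (telescope_sumr (fun m : nat => atan (m%:R / rho))).
have up N : \sum_(1 <= m < N.+1) phi 1 rho m%:Z <= pi / 2.
  apply: le_trans (atan_lt_pihalf (N%:R / rho)).
  have := tele 0%N N isT; rewrite mul0r atan0 subr0 => <-; rewrite big_add1 /=.
  by apply: ler_sum => m _; have /andP[] := atan_step m r0.
have lo N : atan (N.+1%:R / rho) - rho^-1 <= \sum_(1 <= m < N.+1) phi 1 rho m%:Z.
  apply: le_trans (_ : \sum_(1 <= m < N.+1) (atan (m.+1%:R / rho) - atan (m%:R / rho)) <= _).
    rewrite tele // lerD2l lerN2.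
    have /andP[_] := atan_step 0 r0; rewrite mul0r atan0 subr0 phi1_nat expr0n add0r.
    by rewrite expr2 invfM mulrA divff ?mul1r ?gt_eqF.
  by apply: ler_sum => m _; have /andP[] := atan_step m r0.
have lim_at : atan (N.+1%:R / rho) @[N --> \oo] --> pi / 2.
  apply: (cvg_comp _ _ _ (@cvgy_atan R)).
  apply/cvgryPge => A; near=> n; rewrite ler_pdivlMr //.
  apply: le_trans (_ : n%:R <= _); last by rewrite ler_nat.
  by near: n; exact: nbhs_infty_ger.
rewrite ler_distl; apply/andP; split.
  have l2 : 2 * atan (N.+1%:R / rho) - rho^-1 @[N --> \oo] --> pi - rho^-1.
    apply: cvgB; last exact: cvg_cst.
    apply: cvg_eqf; first exact: (cvgMl_tmp (a := 2) lim_at); first by [].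
    by field.
  apply: (ler_cvg_to l2 cv); near=> n; rewrite E.
  by have := lo n; lra.
apply: (cvgr_to_le cv); near=> n; rewrite E; have := up n; lra.
Unshelve. all: by end_near. Qed.

Lemma small_of_inv (x K : R) : 0 <= K -> (forall rho, 1 <= rho -> `|x| <= K / rho) -> x = 0.
Proof.
move=> K0 h; apply/eqP; apply: contraT; rewrite -normr_gt0 => x0.
have r1 : 1 <= (K + `|x|) / `|x| by rewrite ler_pdivlMr // mul1r lerDr.
have s0 : 0 < K + `|x| by rewrite ltr_wpDl.
have := h _ r1; rewrite invf_div mulrA ler_pdivlMr //; nra.
Qed.

Lemma lsum2_le rho : 0 < rho -> `|lsum 2 rho| <= lsum 1 rho / rho.
Proof.
move=> r0; rewrite mulrC.
have h2 := ssum_phi r0 (isT : (0 < 2)%N).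
have h1 := ssumZ (k := rho^-1) (ssum_phi r0 (isT : (0 < 1)%N)).
apply: ssum_le h2 h1 => m; by have := phi_bound m r0 (isT : (0 < 2)%N); rewrite expr1.
Qed.

(** The left side does not depend on [rho]; as [rho] grows, [lsum 1 rho] tends to pi and
    [lsum 2 rho] to 0. *)
Lemma lsum_eisenstein rho : 0 < rho -> lsum 1 rho ^+ 2 - lsum 2 rho = pi ^+ 2.
Proof.
move=> r0; have [c hc] := @lsum_eisenstein_ex R; rewrite hc //.
apply/eqP; rewrite -subr_eq0; apply/eqP.
have p0 := @pi_gt0 R.
(* With v = 1 / x at most 1, the constant collects (T - pi)^2 <= v, 2 pi |T - pi| <= 2 pi v and |U|
   <= (pi + 1) v. *)
apply: (@small_of_inv _ (3 * pi + 2)) => [|x x1]; first by lra.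
have x0 : 0 < x by lra.
rewrite -(hc x x0); have := lsum1_pi x0; have := lsum2_le x0.
have v0 : 0 < x^-1 by rewrite invr_gt0.
have v1 : x^-1 <= 1 by rewrite invf_le1.
move: (lsum 1 x) (lsum 2 x) x^-1 v0 v1 => T U v v0 v1 h2 h1.
rewrite (_ : _ - _ - _ = (T - pi) * (T - pi) + (T - pi) * (2 * pi) - U); last by ring.
apply: le_trans (ler_normB _ _) _.
apply: le_trans (lerD (ler_normD _ _) (lexx _)) _.
rewrite !normrM (@ger0_norm _ 2) // (@gtr0_norm _ pi) //.
have Tb : T <= pi + v by have := ler_norm (T - pi); lra.
have : `|T - pi| * `|T - pi| <= v * v by apply: ler_pM.
move: `|T - pi| `|U| h1 h2 (normr_ge0 (T - pi)) (normr_ge0 U) => a b *; nra.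
Qed.

Lemma normc_real (x : R) : Normc.normc (x%:C)%C = `|x|.
Proof. by rewrite /Normc.normc /= expr0n addr0 sqrtr_sqr. Qed.

Lemma normc_nat n : Normc.normc (n%:R : C) = n%:R.
Proof. by rewrite -(rmorph_nat (real_complex R)) normc_real ger0_norm. Qed.

Lemma latz_step rho h m : 0 < rho -> 0 < rho + h ->
  h%:C%C * latz rho m * latz (rho + h) m = latz rho m - latz (rho + h) m.
Proof.
move=> r0 rh0; have zn (x : R) : 0 < x -> (x +i* m%:~R)%C != 0.
  by move=> x0; rewrite eq_complex /= gt_eqF.
rewrite /latz; have z1 := zn _ r0; have z2 := zn _ rh0.
have E : ((rho + h) +i* m%:~R)%C = (rho +i* m%:~R)%C + h%:C%C.
  by apply/eqP; rewrite eq_complex /= addr0 !eqxx.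
by rewrite E in z2 *; field; rewrite z1 z2.
Qed.

(** A first-order expansion in [h] whose remainder is summable over [m]. The induction multiplies by
    [W] and rewrites with h Z W = Z - W, all moduli being at most 1 because [rho] is at least 1. *)
Lemma lsum_taylor_term q rho h m : 1 <= rho -> 0 <= h -> 
  Normc.normc (latz (rho + h) m ^+ q - latz rho m ^+ q
     + q%:R * h%:C%C * latz rho m ^+ q.+1) <= q%:R ^+ 2 * h ^+ 2 * Normc.normc (latz rho m) ^+ 2.
Proof.
move=> r1 h0; set Z := latz rho m; set W := latz (rho + h) m.
have hZW : h%:C%C * Z * W = Z - W by apply: latz_step; lra.
have NZ : Normc.normc Z <= 1.
  by apply: le_trans (normc_latz_le _ _) _; [lra | rewrite invf_le1; lra].
have NW : Normc.normc W <= 1.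
  by apply: le_trans (normc_latz_le _ _) _; [lra | rewrite invf_le1; lra].
have Nh : Normc.normc (h%:C)%C = h by rewrite normc_real ger0_norm.
elim: q => [|q IH].
  by rewrite !expr0 subrr !mul0r addr0 Normc.normc0 expr0n mul0r mul0r.
rewrite (_ : _ + _ = W * (W ^+ q - Z ^+ q + q%:R * h%:C%C * Z ^+ q.+1) +
    q.+1%:R * h%:C%C ^+ 2 * Z ^+ q.+2 * W); last first.
  rewrite -[q.+1%:R]natr1 !exprS; move: (W ^+ q) (Z ^+ q) (h%:C)%C hZW => Wq Zq k hZW.
  by ring: hZW.
apply: le_trans (le_normcD _ _) _.
rewrite (Normc.normcM W) (Normc.normcM _ W) (Normc.normcM _ (Z ^+ _)) (Normc.normcM q.+1%:R) !normcX Nh normc_nat -[q.+2]addn2 exprD.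
have Zq : Normc.normc Z ^+ q <= 1 by rewrite exprn_ile1 ?normc_ge0.
have Z0 := normc_ge0 Z; have W0 := normc_ge0 W.
have Z2 : 0 <= Normc.normc Z ^+ 2 by rewrite sqr_ge0.
apply: le_trans (_ : q%:R ^+ 2 * h ^+ 2 * Normc.normc Z ^+ 2 +
   q.+1%:R * (h ^+ 2 * Normc.normc Z ^+ 2) <= _).
  apply: lerD.
    by apply: le_trans IH; rewrite -[X in _ <= X]mul1r ler_wpM2r ?normc_ge0.
  rewrite [X in X <= _](_ : _ = q.+1%:R * (h ^+ 2 * Normc.normc Z ^+ 2) *
    (Normc.normc Z ^+ q * Normc.normc W)); last by ring.
  rewrite -[X in _ <= X]mulr1; apply: ler_wpM2l.
    by apply: mulr_ge0 => //; apply: mulr_ge0 => //; exact: sqr_ge0.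
  by apply: mulr_ile1 => //; exact: exprn_ge0.
rewrite -[q.+1%:R]natr1 -(mulrA (q%:R ^+ 2)) -(mulrA ((q%:R + 1) ^+ 2)).
have : 0 <= h ^+ 2 * Normc.normc Z ^+ 2 by apply: mulr_ge0 => //; exact: sqr_ge0.
have : 0 <= q%:R :> R by [].
by move: (h ^+ 2 * Normc.normc Z ^+ 2) (q%:R : R) => k x; nra.
Qed.

Lemma lsum1_le rho : 1 <= rho -> lsum 1 rho <= pi + 1.
Proof.
move=> r1; have r0 : 0 < rho by lra.
have := le_trans (ler_norm _) (lsum1_pi r0).
have : rho^-1 <= 1 by rewrite invf_le1.
lra.
Qed.

Lemma lsum_taylor q rho h : (0 < q)%N -> 1 <= rho -> 0 <= h ->
  `|lsum q (rho + h) - lsum q rho + q%:R * h * lsum q.+1 rho|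
    <= q%:R ^+ 2 * (pi + 1) * h ^+ 2.
Proof.
move=> q0 r1 h0; have r0 : 0 < rho by lra.
have rh0 : 0 < rho + h by lra.
have s1 := ssumD (ssumD (ssum_phi rh0 q0) (ssumZ (k := (-1)) (ssum_phi r0 q0)))
  (ssumZ (k := (q%:R * h)) (ssum_phi r0 (isT : (0 < q.+1)%N))).
have s2 := ssumZ (k := (q%:R ^+ 2 * h ^+ 2 / rho)) (ssum_phi r0 (isT : (0 < 1)%N)).
rewrite mulN1r in s1; apply: le_trans (ssum_le _ s1 s2) _ => [m|].
  rewrite phi1E [X in _ <= X](_ : _ = q%:R ^+ 2 * h ^+ 2 * Normc.normc (latz rho m) ^+ 2); last first.
    by field; rewrite gt_eqF.
  apply: le_trans (lsum_taylor_term q m r1 h0).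
  apply: le_trans (Re_le_normc _); rewrite /phi mulN1r.
  have ReB (a b : C) : complex.Re (a - b) = complex.Re a - complex.Re b.
    by case: a b => [? ?] [? ?].
  rewrite ReD ReB; set X := complex.Re (q%:R * _ * _); suff -> : X = q%:R * h * complex.Re (latz rho m ^+ q.+1) by [].
  rewrite /X (_ : q%:R * h%:C%C = (q%:R * h)%:C%C :> C); last by rewrite rmorphM rmorph_nat.
  by rewrite ReM /= oppr0 mul0r addr0.
rewrite [X in X <= _](_ : _ = q%:R ^+ 2 * h ^+ 2 * (rho^-1 * lsum 1 rho)); last by ring.
rewrite [X in _ <= X](_ : _ = q%:R ^+ 2 * h ^+ 2 * (pi + 1)); last by ring.
apply: ler_wpM2l; first by apply: mulr_ge0; exact: sqr_ge0.
have := lsum1_le r1; have : rho^-1 <= 1 by rewrite invf_le1.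
have : 0 < rho^-1 by rewrite invr_gt0.
have p0 := @pi_gt0 R.
by move: (lsum _ _) rho^-1 => T v; nra.
Qed.

Lemma derive_of_quadratic (f : R -> R) x l K d : 0 < d ->
  (forall h, `|h| < d -> `|f (x + h) - f x - h * l| <= K * h ^+ 2) ->
  is_derive x (1 : R) f l.
Proof.
move=> d0 H.
have cv : h^-1 *: (f (h *: 1 + x) - f x) @[h --> 0^'] --> l.
  apply/cvgrPdist_le => /= eps e0; near=> h.
  have h0 : h != 0 by near: h; exact: nbhs_dnbhs_neq.
  have hd : `|h| < d.
    near: h; apply: dnbhs0_lt => //.
  have he : `|h| < eps / (`|K| + 1).
    by near: h; apply: dnbhs0_lt; rewrite divr_gt0 // ltr_wpDl.
  rewrite distrC /GRing.scale /= mulr1 addrC [h + x]addrC.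
  rewrite (_ : - l + _ = h^-1 * (f (x + h) - f x - h * l)); last by field.
  rewrite normrM normfV ler_pdivrMl ?normr_gt0 //.
  apply: le_trans (H h hd) _.
  apply: le_trans (_ : `|K| * `|h| ^+ 2 <= _).
    by rewrite real_normK ?num_real // ler_wpM2r ?sqr_ge0 ?ler_norm.
  rewrite expr2 mulrCA ler_wpM2l //.
  move: he; rewrite ltr_pdivlMr ?ltr_wpDl //; have := normr_ge0 h; have := normr_ge0 K; nra.
apply: DeriveDef; last exact: cvg_lim cv.
by apply/cvg_ex; exists l.
Unshelve. all: by end_near. Qed.

Lemma is_derive_lsum1 rho : 0 < rho -> is_derive rho (1 : R) (@lsum R 1) (- lsum 2 rho).
Proof.
move=> r0; apply: (@derive_of_quadratic _ _ _ (2 / rho ^+ 2 * lsum 1 rho) (rho / 2)).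
  by rewrite divr_gt0.
move=> h; rewrite ltr_norml => /andP[h1 h2].
have rh0 : 0 < rho + h by lra.
have s1 := ssumD (ssumD (ssum_phi rh0 (isT : (0 < 1)%N)) (ssumZ (k := (-1)) (ssum_phi r0 (isT : (0 < 1)%N))))
  (ssumZ (k := h) (ssum_phi r0 (isT : (0 < 2)%N))).
have s2 := ssumZ (k := (2 / rho ^+ 2 * h ^+ 2)) (ssum_phi r0 (isT : (0 < 1)%N)).
rewrite (_ : _ - _ - _ = lsum 1 (rho + h) + -1 * lsum 1 rho + h * lsum 2 rho); last by ring.
rewrite mulrAC; apply: (ssum_le _ s1 s2) => m.
have W2 : Normc.normc (latz (rho + h) m) <= 2 / rho.
  apply: le_trans (normc_latz_le _ rh0) _.
  by rewrite -invf_div lef_pV2 ?posrE ?divr_gt0 //; lra.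
rewrite [phi 1 rho m in X in _ <= X]phi1E [X in _ <= X](_ : _ =
  h ^+ 2 * Normc.normc (latz rho m) ^+ 2 * (2 / rho)); last first.
  by field; rewrite gt_eqF.
apply: le_trans (_ : Normc.normc (h%:C%C ^+ 2 * latz rho m ^+ 2 * latz (rho + h) m) <= _); last first.
  rewrite (Normc.normcM _ (latz _ _)) (Normc.normcM _ (_ ^+ _)) !normcX normc_real real_normK ?num_real //.
  by rewrite ler_wpM2l // mulr_ge0 ?sqr_ge0.
have -> : h%:C%C ^+ 2 * latz rho m ^+ 2 * latz (rho + h) m =
    latz (rho + h) m - latz rho m + h%:C%C * latz rho m ^+ 2.
  by have := latz_step m r0 rh0; move: (latz _ _) (latz _ _) (h%:C)%C => Z W k kZW; ring: kZW.
apply: le_trans (Re_le_normc _); rewrite /phi !expr1 mulN1r.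
move: (latz rho m ^+ 2) => Z2; rewrite !ReD ReM /= oppr0 mul0r addr0.
by case: (latz rho m).
Qed.

Lemma lsum1_ge rho : 0 < rho -> rho^-1 <= lsum 1 rho.
Proof.
move=> r0; apply: (cvgr_to_ge (ssum_phi r0 (isT : (0 < 1)%N))); near=> n.
rewrite symsum_phi1 // lerDl mulr_ge0 ?mulr_ge0 ?(ltW r0) // sumr_ge0 // => m _.
by rewrite /lorentz invr_ge0 addr_ge0 ?sqr_ge0.
Unshelve. all: by end_near. Qed.

(* The Riccati equation T' = pi^2 - T^2 makes (T - pi) / (T + pi) * exp (2 pi rho) constant. *)
Lemma lsum1_coth rho : 0 < rho ->
  (lsum 1 rho - pi) * expR (2 * pi * rho) = lsum 1 rho + pi.
Proof.
have p0 := @pi_gt0 R.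
have T0 (x : R) : 0 < x -> 0 < lsum 1 x.
  by move=> x0; apply: lt_le_trans (lsum1_ge x0); rewrite invr_gt0.
pose V x := (lsum 1 x - pi) / (lsum 1 x + pi) * expR (2 * pi * x) : R.
have dV (x : R) : 0 < x -> is_derive x (1 : R) V 0.
  move=> x0; have dT := is_derive_lsum1 x0.
  have T1 : lsum 1 x + pi != 0 by have := T0 x x0; lra.
  have dTp : is_derive x (1 : R) (fun y => lsum 1 y + pi) (- lsum 2 x).
    by rewrite -[X in is_derive _ _ _ X]addr0; apply: is_deriveD.
  have dI := @is_deriveV _ (fun y => lsum 1 y + pi) x _ _ T1 dTp.
  have dTm : is_derive x (1 : R) (fun y => lsum 1 y - pi) (- lsum 2 x).
    by rewrite -[X in is_derive _ _ _ X]subr0; apply: is_deriveB.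
  have dl : is_derive x (1 : R) (fun y : R => 2 * pi * y) (2 * pi).
    by apply: is_derive_eq; rewrite /GRing.scale /=; ring.
  have dE := @is_derive1_comp _ (@expR R) (fun y => 2 * pi * y) x _ _ (is_derive_expR _) dl.
  apply: (is_derive_eq (is_deriveM (is_deriveM dTm dI) dE)).
  rewrite /GRing.scale /= fctE.
  have := lsum_eisenstein x0; move: (lsum 1 x) (lsum 2 x) T1 => T U T1 e.
  have -> : U = T ^+ 2 - pi ^+ 2 by rewrite -e; ring.
  have G (E p t : R) : t + p != 0 -> (t - p) / (t + p) * (E * (2 * p)) +
      E * ((t - p) * (- (t + p) ^- 2 * - (t ^+ 2 - p ^+ 2)) + (t + p)^-1 * - (t ^+ 2 - p ^+ 2)) = 0.
    by move=> tp; field.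
  exact: G.
have Vc x y : 0 < x -> x < y -> V x = V y.
  move=> x0 xy; have cV : {within `[x, y], continuous V}.
    apply: derivable_within_continuous => t; rewrite in_itv /= => /andP[xt _].
    by have [] := dV t (lt_le_trans x0 xt).
  have dV' z : z \in `]x, y[%R -> is_derive z (1 : R) V 0.
    by rewrite in_itv /= => /andP[xz _]; apply: dV; apply: lt_trans xz.
  have [c _] := MVT xy dV' cV.
  by rewrite mul0r => /eqP; rewrite subr_eq0 => /eqP.
(* The constant value of [V] is read off as its argument tends to 0 along 1 / (n + 2): there
   [lsum 1] is at least the inverse of the argument, so the quotient tends to 1. *)
have V1 : V 1 = 1.
  pose W n := V (n.+2%:R^-1).
  have WE n : W n = V 1 by apply: Vc; rewrite ?invr_gt0 ?invf_lt1 ?ltr1n ?ltr0n.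
  have x_0 : (n.+2%:R^-1 : R) @[n --> \oo] --> (0 : R).
    by rewrite (cvg_shiftS (fun n => n.+1%:R^-1 : R)); exact: cvg_harmonic.
  have lE : expR (2 * pi * n.+2%:R^-1) @[n --> \oo] --> (1 : R).
    have l0 : 2 * pi * n.+2%:R^-1 @[n --> \oo] --> (0 : R).
      by apply: cvg_eqf; [exact: (cvgMl_tmp (a := 2 * pi) x_0)|by []|rewrite mulr0].
    have l1 := cvg_comp _ _ l0 (@continuous_expR R 0).
    by apply: cvg_eqf; [exact: l1|by []|rewrite expR0].
  have lQ : (lsum 1 (n.+2%:R^-1) - pi) / (lsum 1 (n.+2%:R^-1) + pi) @[n --> \oo] --> (1 : R).
    have l1 : 1 - 2 * pi * n.+2%:R^-1 @[n --> \oo] --> (1 : R).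
      apply: cvg_eqf; first exact: (cvgB (cvg_cst (1 : R)) (cvgMl_tmp (a := 2 * pi) x_0)).
        by [].
      by rewrite mulr0 subr0.
    apply: (@squeeze_cvgr _ _ _ _ (fun n : nat => 1 - 2 * pi * n.+2%:R^-1) (fun=> 1)); last 2 first.
    - exact: l1.
    - exact: cvg_cst.
    near=> n.
    have y0 : 0 < n.+2%:R^-1 :> R by rewrite invr_gt0.
    have := lsum1_ge y0; have := T0 _ y0; move: (lsum 1 _) => T T00 T1.
    rewrite invrK in T1; have Tp : 0 < T + pi by lra.
    rewrite ler_pdivlMr // ler_pdivrMr //.
    have : 1 <= n.+2%:R^-1 * T by rewrite mulrC ler_pdivlMr // mul1r.
    move: (n.+2%:R^-1) (pi : R) y0 p0 {Tp T1 l1 lE} => y p y0 p0 yT.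
    apply/andP; split; nra.
  have lV : V 1 @[n --> \oo] --> (1 : R).
    by apply: cvg_eqf; [exact: (cvgM lQ lE)|move=> n; exact: WE|rewrite mulr1].
  have lC : V 1 @[n --> \oo] --> V 1 by exact: cvg_cst.
  exact: (cvg_unique _ lC lV).
move=> r0; have : V rho = 1.
  have [r1|r1|r1] := ltgtP rho 1; first by rewrite (Vc _ _ r0 r1).
    by rewrite -(Vc _ _ ltr01 r1).
  by rewrite r1.
have T1 : lsum 1 rho + pi != 0 by have := T0 rho r0; lra.
by rewrite /V mulrAC => /(canRL (mulfVK T1)); rewrite mul1r.
Unshelve. all: by end_near. Qed.

Definition lsum_main q : R := if q == 1%N then pi else 0.

(** Induction on [q], the base case being the coth formula. Up to O(h), [lsum q.+2] is proportional
    to a difference quotient of [lsum q.+1] with step h, in which the main value cancels. *)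
Lemma lsum_decay q : (0 < q)%N -> exists K c : R, [/\ 0 < c, 0 <= K &
  forall rho, 1 <= rho -> `|lsum q rho - lsum_main q| <= K * expR (- (c * rho))].
Proof.
have p0 := @pi_gt0 R.
case: q => // q _; elim: q => [|q [K [c [c0 K0 IH]]]].
  exists (2 * pi + 1), (2 * pi); split; [by lra|by lra|move=> rho r1].
  have r0 : 0 < rho by lra.
  have h := lsum1_coth r0; rewrite /lsum_main eqxx.
  have Tle := lsum1_le r1.
  have -> : lsum 1 rho - pi = (lsum 1 rho + pi) * expR (- (2 * pi * rho)).
    by rewrite -h expRN mulfK // gt_eqF // expR_gt0.
  have Tge := lsum1_ge r0; have v0 : 0 < rho^-1 by rewrite invr_gt0.
  by rewrite normrM !ger0_norm ?expR_ge0 ?ler_wpM2r ?expR_ge0 //; lra.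
have pi1 : 0 <= pi + 1 :> R by lra.
pose K' := (2 * K + q.+1%:R ^+ 2 * (pi + 1)) / q.+1%:R.
have q0 : 0 < q.+1%:R :> R by [].
have K'0 : 0 <= K'.
  by apply: divr_ge0 => //; apply: addr_ge0; apply: mulr_ge0 => //; exact: sqr_ge0.
exists K', (c / 2); split => //; first by rewrite divr_gt0.
move=> rho r1; rewrite /lsum_main /= subr0.
(* The step balances the Taylor error O(h) against the error exp (- c rho) / h of the quotient, at
   the price of half the rate. *)
set h := expR (- (c / 2 * rho)).
have h0 : 0 < h by exact: expR_gt0.
have hh : expR (- (c * rho)) = h * h by rewrite /h -expRD; congr expR; field.
have b1 := IH _ r1; rewrite hh in b1.
have rh : 1 <= rho + h by lra.
have b2 : `|lsum q.+1 (rho + h) - lsum_main q.+1| <= K * (h * h).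
  apply: le_trans (IH _ rh) _; rewrite ler_wpM2l // -hh ler_expR lerN2.
  by rewrite ler_pM2l // lerDl ltW.
have := lsum_taylor (isT : (0 < q.+1)%N) r1 (ltW h0).
move: (lsum q.+1 (rho + h)) (lsum q.+1 rho) (lsum_main q.+1) b1 b2 => A B M b1 b2.
move: (lsum q.+2 rho) => S bS.
have bB : `|q.+1%:R * h * S| <= (2 * K + q.+1%:R ^+ 2 * (pi + 1)) * (h * h).
  rewrite (_ : q.+1%:R * h * S = (A - B + q.+1%:R * h * S) - (A - M) + (B - M)); last by ring.
  apply: le_trans (ler_normD _ _) _; apply: le_trans (lerD (ler_normB _ _) (lexx _)) _.
  by rewrite expr2 in bS; lra.
rewrite !normrM (gtr0_norm q0) (gtr0_norm h0) in bB.
rewrite /K' mulrAC ler_pdivlMr // -(ler_pM2r h0); lra.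
Qed.

End HyperbolicCotangent.

(** * Even zeta values and Bernoulli numbers *)

Section Zeta.
Variable R : realType.

Lemma eseries_EFin (u : nat -> R) m s :
  \sum_(m <= k < N) u k @[N --> \oo] --> s ->
  (\sum_(m <= k <oo) (u k)%:E)%E = s%:E.
Proof.
move=> us; apply: cvg_lim => //; apply/fine_cvgP; split.
  by near=> n; rewrite sumEFin.
by apply: cvg_eqf; [exact: us|move=> n /=; rewrite sumEFin|].
Unshelve. all: by end_near. Qed.

Lemma zeta_cvg s : (1 < s)%N ->
  \sum_(1 <= m < N) (m%:R ^+ s)^-1 @[N --> \oo] --> zeta R s.
Proof.
move=> s1; pose f (m : int) : R := ((absz m)%:R ^+ s)^-1 / 2.
have f0 : f 0 = 0 by rewrite /f /= expr0n; case: s s1 {f} => //= s _; rewrite invr0 mul0r.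
have fE (m : nat) : f m%:Z + f (- m%:Z) = (m%:R ^+ s)^-1.
  by rewrite /f abszN absz_nat -splitr.
have [||z zs _] := @ssum_bound R f 1 _.
- by [].
- move=> m m0; rewrite fE ger0_norm ?invr_ge0 ?exprn_ge0 // mul1r.
  rewrite lef_pV2 ?posrE ?exprn_gt0 ?ltr0n // -(subnK s1) exprD ler_peMl ?exprn_ge0 //.
  by rewrite exprn_ege1 // ler1n.
have cz : \sum_(1 <= m < N) (m%:R ^+ s)^-1 @[N --> \oo] --> z.
  rewrite -(cvg_shiftS (fun N => \sum_(1 <= m < N) (m%:R ^+ s)^-1 : R)).
  apply: cvg_eqf; [exact: zs|move=> n|by []].
  by rewrite /symsum f0 add0r; apply: eq_bigr => m _; rewrite fE.
by rewrite /zeta (eseries_EFin cz).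
Qed.

Lemma zeta_ge1 s : (1 < s)%N -> 1 <= zeta R s.
Proof.
move=> s1; apply: (cvgr_to_ge (zeta_cvg s1)); near=> n.
have n2 : (1 < n)%N by near: n; exact: nbhs_infty_gt.
rewrite big_ltn // expr1n invr1 lerDl big_nat.
by apply: sumr_ge0 => m _; rewrite invr_ge0 exprn_ge0.
Unshelve. all: by end_near. Qed.

(** After factoring out x^n, the tail is dominated term by term by the exponential series, since (j
    + n)! >= j!. *)
Lemma expR_taylor (x : R) n : 0 <= x ->
  0 <= expR x - \sum_(0 <= j < n) x ^+ j / j`!%:R <= x ^+ n * expR x.
Proof.
move=> x0; have cE : series (exp_coeff x) N @[N --> \oo] --> expR x.
  by rewrite /expR; exact: is_cvg_series_exp_coeff.
have t0 j : 0 <= x ^+ j / j`!%:R by rewrite divr_ge0 ?exprn_ge0.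
have part M : (n <= M)%N -> 0 <= series (exp_coeff x) M - \sum_(0 <= j < n) x ^+ j / j`!%:R
    <= x ^+ n * expR x.
  move=> nM; rewrite /series /= /exp_coeff /= (big_cat_nat (n := n)) //= addrAC subrr add0r.
  apply/andP; split; first by apply: sumr_ge0 => j _.
  rewrite -{1}[n]add0n big_addn.
  apply: le_trans (_ : x ^+ n * \sum_(0 <= j < M - n) x ^+ j / j`!%:R <= _).
    rewrite mulr_sumr; apply: ler_sum => j _; rewrite exprD mulrA [x ^+ n * _]mulrC.
    rewrite ler_wpM2l ?mulr_ge0 ?exprn_ge0 // lef_pV2 ?posrE ?ltr0n ?fact_gt0 //.
    by rewrite ler_nat leq_fact // leq_addr.
  rewrite ler_wpM2l ?exprn_ge0 //; apply: (cvgr_to_ge cE); near=> N.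
  have MN : (M - n <= N)%N by near: N; exact: nbhs_infty_ge.
  by rewrite /series /= [X in _ <= X](big_cat_nat (n := (M - n)%N)) //= lerDl; apply: sumr_ge0 => j _; exact: t0.
have cD : series (exp_coeff x) N - \sum_(0 <= j < n) x ^+ j / j`!%:R @[N --> \oo] -->
   expR x - \sum_(0 <= j < n) x ^+ j / j`!%:R by apply: cvgB => //; exact: cvg_cst.
apply/andP; split.
  apply: (cvgr_to_ge cD); near=> N; have nN : (n <= N)%N by near: N; exact: nbhs_infty_ge.
  by have /andP[] := part N nN.
apply: (cvgr_to_le cD); near=> N; have nN : (n <= N)%N by near: N; exact: nbhs_infty_ge.
by have /andP[] := part N nN.
Unshelve. all: by end_near. Qed.

Lemma poly_bounded01 (p : {poly R}) : exists K : R,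
  forall x, 0 <= x -> x <= 1 -> `|p.[x]| <= K.
Proof.
exists (\sum_(i < size p) `|p`_i|) => x x0 x1; rewrite horner_coef.
apply: le_trans (ler_norm_sum _ _ _) _; apply: ler_sum => i _.
by rewrite normrM ler_piMr // normrX exprn_ile1 ?normr_ge0 // ger0_norm.
Qed.

(** The constant coefficient is O(x) as x tends to 0, hence zero; dividing by the variable lowers
    [N] by one. *)
Lemma poly_small_coef (p : {poly R}) N (K d : R) : 0 < d ->
  (forall x, 0 < x -> x < d -> `|p.[x]| <= K * x ^+ N) ->
  forall i, (i < N)%N -> p`_i = 0.
Proof.
elim/poly_ind: p N K d => [|p c IH] N K d d0 H i iN; first by rewrite coef0.
case: N => // N in H iN *.
have [Q Qb] := poly_bounded01 p.
have Q0 : 0 <= Q by apply: le_trans (normr_ge0 p.[0]) (Qb 0 _ _).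
have c0 : c = 0.
  apply: (@small_of_inv R c (`|K| + Q)) => [|rho r1]; first by rewrite addr_ge0.
  have di : 0 < d^-1 by rewrite invr_gt0.
  pose x := (rho * (1 + d^-1))^-1.
  have rp : 0 < rho * (1 + d^-1) by rewrite mulr_gt0 //; lra.
  have x0 : 0 < x by rewrite invr_gt0.
  have x1 : x <= 1 by rewrite invf_le1 //; nra.
  have xr : x <= rho^-1 by rewrite lef_pV2 ?posrE //; nra.
  have xd : x < d by rewrite -[d]invrK ltf_pV2 ?posrE //; nra.
  have := H _ x0 xd; rewrite hornerMXaddC => h.
  rewrite (_ : c = (p.[x] * x + c) - p.[x] * x); last by ring.
  apply: le_trans (ler_normB _ _) _; rewrite [`|_ * x|]normrM (gtr0_norm x0).
  have h1 := Qb x (ltW x0) x1.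
  have h2 : K * x ^+ N.+1 <= `|K| * x.
    apply: le_trans (_ : `|K| * x ^+ N.+1 <= _).
      by apply: ler_wpM2r; [exact: exprn_ge0 (ltW x0)|exact: ler_norm].
    apply: ler_wpM2l => //; rewrite exprS ler_piMr ?(ltW x0) //.
    by rewrite exprn_ile1 ?(ltW x0).
  have h3 : `|p.[x]| * x <= Q * x by rewrite ler_wpM2r ?(ltW x0).
  apply: le_trans (_ : (`|K| + Q) * x <= _); first by lra.
  by rewrite ler_wpM2l ?addr_ge0.
rewrite {}c0 in H *; rewrite coefD coefMX coefC.
case: i => [|i] in iN * => /=; first by rewrite addr0.
rewrite addr0; apply: (IH N K d) => // x x0 xd.
have := H x x0 xd; rewrite hornerMXaddC addr0 normrM (gtr0_norm x0) exprSr mulrA.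
by rewrite ler_pM2r.
Qed.

(** The coefficient of x^n in x / (e^x - 1), written as Euler's formula predicts. That it equals B_n
    / n! is shown afterwards, by checking the Bernoulli recursion. *)
Definition bern_egf (n : nat) : R := if n == 0%N then 1 else if n == 1%N then - 2^-1
  else if odd n then 0
  else 2 * (-1) ^+ (n./2).+1 * zeta R n / (2 * pi) ^+ n.

(** Each rho^2 / (m^2 + rho^2) is a finite geometric sum with an exact remainder; the 4 is twice the
    bound 2 for the sum of 1 / m^2. *)
Lemma lsum1_expansion n rho : 0 < rho ->
  `|rho * lsum 1 rho - 1 - \sum_(1 <= k < n.+1) 2 * (-1) ^+ k.+1 * zeta R (2 * k) * rho ^+ (2 * k)|
   <= 4 * rho ^+ (2 * n.+1).
Proof.
move=> r0; have r1 : rho != 0 by rewrite gt_eqF.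
have cT : rho * symsum (phi 1 rho) N - 1 @[N --> \oo] --> rho * lsum 1 rho - 1.
  have sp := ssum_phi r0 (isT : (0 < 1)%N).
  by apply: cvgB; [apply: cvgMl_tmp; exact: sp|exact: cvg_cst].
pose Z N : R := \sum_(1 <= k < n.+1) 2 * (-1) ^+ k.+1 *
   (\sum_(1 <= m < N.+1) (m%:R ^+ (2 * k))^-1) * rho ^+ (2 * k).
have cZ : Z N @[N --> \oo] --> \sum_(1 <= k < n.+1) 2 * (-1) ^+ k.+1 * zeta R (2 * k) * rho ^+ (2 * k).
  rewrite /Z big_nat; under eq_fun do rewrite big_nat.
  apply: cvg_big => [|k /andP[k1 _]]; first exact: add_continuous.
  apply: cvgMr_tmp; apply: cvgMl_tmp.
  rewrite (cvg_shiftS (fun N => \sum_(1 <= m < N) (m%:R ^+ (2 * k))^-1 : R)).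
  by apply: zeta_cvg; lia.
apply: (cvgr_to_le (cvg_norm (cvgB cT cZ))); near=> N.
rewrite !fctE symsum_phi1 // mulrDr divff // [1 + _]addrC addrK.
have E (m : nat) : (0 < m)%N -> rho * (2 * rho) * lorentz rho m =
  \sum_(1 <= k < n.+1) 2 * (-1) ^+ k.+1 * (m%:R ^+ (2 * k))^-1 * rho ^+ (2 * k)
  + 2 * (-1) ^+ n * rho ^+ (2 * n.+1) * (m%:R ^+ (2 * n))^-1 * lorentz rho m.
  move=> m0; have mR : m%:R != 0 :> R by rewrite pnatr_eq0 -lt0n.
  have q0 : m%:R ^+ 2 + rho ^+ 2 != 0.
    by rewrite gt_eqF // ltr_wpDl ?sqr_ge0 // exprn_gt0.
  elim: n {cT Z cZ} => [|j IH].
    by rewrite big_nil add0r muln0 !expr0 invr1; ring.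
  rewrite big_nat_recr //= -addrA IH; congr (_ + _).
  rewrite (_ : 2 * j.+2 = 2 * j.+1 + 2)%N; last by lia.
  rewrite (_ : 2 * j.+1 = 2 * j + 2)%N; last by lia.
  rewrite !exprD !exprS /lorentz; field.
  by rewrite q0 mR expf_neq0.
rewrite mulrA mulr_sumr; under eq_big_nat => m /andP[m1 _] do rewrite E //.
rewrite big_split /= exchange_big /= /Z.
rewrite [X in X + _ - _](_ : _ = Z N); last first.
  by apply: eq_bigr => k _; rewrite mulr_sumr mulr_suml.
rewrite -/(Z N) addrAC subrr add0r; apply: le_trans (ler_norm_sum _ _ _) _.
apply: le_trans (_ : \sum_(1 <= m < N.+1) 2 * rho ^+ (2 * n.+1) * (m%:R ^+ 2)^-1 <= _).
  rewrite big_nat [X in _ <= X]big_nat; apply: ler_sum => m /andP[m1 _].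
  have m0 : 0 < m%:R :> R by rewrite ltr0n.
  rewrite !normrM normrX normrN normr1 expr1n mulr1 !ger0_norm ?invr_ge0 ?exprn_ge0 ?(ltW r0) //; last first.
    by rewrite addr_ge0 ?sqr_ge0.
  rewrite -!mulrA ler_wpM2l // ler_wpM2l ?exprn_ge0 ?(ltW r0) //.
  rewrite -[X in _ <= X]mul1r; apply: ler_pM; rewrite ?invr_ge0 ?exprn_ge0 ?addr_ge0 ?sqr_ge0 //.
    by rewrite invf_le1 ?exprn_gt0 // exprn_ege1 // ler1n.
  by rewrite lef_pV2 ?posrE ?exprn_gt0 ?ltr_wpDr ?sqr_ge0 ?exprn_gt0 // lerDl sqr_ge0.
rewrite -mulr_sumr; have := sum_inv_sqr_le R N.
have : 0 <= rho ^+ (2 * n.+1) by rewrite exprn_ge0 ?(ltW r0).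
move: (\sum_(_ <= _ < _) _) (rho ^+ _) => s t; nra.
Unshelve. all: by end_near. Qed.

Lemma bern_egf_even k : (0 < k)%N ->
  bern_egf (2 * k) = 2 * (-1) ^+ k.+1 * zeta R (2 * k) / (2 * pi) ^+ (2 * k).
Proof.
move=> k0; rewrite /bern_egf.
rewrite (_ : (2 * k == 0)%N = false); last by lia.
rewrite (_ : (2 * k == 1)%N = false); last by lia.
rewrite (_ : odd (2 * k) = false); last by lia.
by rewrite (_ : ((2 * k)./2 = k)%N); last by lia.
Qed.

Lemma bern_egf_odd k : (0 < k)%N -> bern_egf (2 * k).+1 = 0.
Proof.
move=> k0; rewrite /bern_egf.
rewrite (_ : ((2 * k).+1 == 1)%N = false); last by lia.
by rewrite (_ : odd (2 * k).+1 = true); last by lia.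
Qed.

Lemma bern_egf_sum k rho :
  \sum_(0 <= i < 2 * k.+1) bern_egf i.+1 * (2 * pi * rho) ^+ i.+1 =
  - (pi * rho) + \sum_(1 <= k < k.+2) 2 * (-1) ^+ k.+1 * zeta R (2 * k) * rho ^+ (2 * k).
Proof.
have pn : pi != 0 :> R by rewrite gt_eqF ?pi_gt0.
elim: k => [|k IH].
  rewrite muln1 big_nat1 big_nat_recr //= big_nat1 /bern_egf /=.
  by rewrite muln1 expr1 !exprMn -signr_odd /=; move: (@pi R) pn => p pn; field.
rewrite (_ : (2 * k.+2 = (2 * k.+1).+2)%N); last by lia.
rewrite 2?big_nat_recr //= IH -!addrA; congr (_ + _).
rewrite [in RHS]big_nat_recr //=; congr (_ + _).
rewrite bern_egf_odd // mul0r add0r (_ : ((2 * k.+1).+2 = 2 * k.+2)%N); last by lia.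
rewrite bern_egf_even //.
by rewrite (exprMn _ (2 * pi) rho) mulrA divfK // expf_neq0 // mulf_neq0.
Qed.

(** At x = 2 pi rho the coth formula says that e^x - 1 times rho ([lsum 1 rho] - pi) equals x. For
    the truncated series [E] and [P] of the two factors, E P - X is therefore O(x^(2n+2)), so its
    coefficient at [m] vanishes; this is the Bernoulli recursion. *)
Lemma sum_bin_bern_egf m : (0 < m)%N ->
  \sum_(0 <= i < m) ('C(m, i))%:R * bern_egf i * i`!%:R = (m == 1%N)%:R.
Proof.
case: m => // m' _; set m := m'.+1; have p0 := @pi_gt0 R.
pose n := m.
pose P : {poly R} := \poly_(i < (2 * n).+1) bern_egf i.
pose E : {poly R} := \poly_(j < (2 * n).+2) (if j == 0%N then 0 else (j`!%:R)^-1).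
have Pval rho : 0 < rho -> `|P.[2 * pi * rho] - (rho * lsum 1 rho - pi * rho)| <= 4 * rho ^+ (2 * n.+1).
  move=> r0; apply: le_trans (lsum1_expansion n r0); rewrite distrC.
  rewrite le_eqVlt (_ : _ - _ = rho * lsum 1 rho - 1 -
    \sum_(1 <= k < n.+1) 2 * (-1) ^+ k.+1 * zeta R (2 * k) * rho ^+ (2 * k)) ?eqxx //.
  rewrite horner_poly (big_ord_recl (2 * n)) -(big_mkord xpredT (fun i => bern_egf i.+1 * (2 * pi * rho) ^+ i.+1)).
  have -> : \sum_(0 <= i < 2 * n) bern_egf i.+1 * (2 * pi * rho) ^+ i.+1 =
      - (pi * rho) + \sum_(1 <= k < n.+1) 2 * (-1) ^+ k.+1 * zeta R (2 * k) * rho ^+ (2 * k).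
    exact: bern_egf_sum.
  by rewrite /bern_egf /= mul1r expr0; ring.
have Eval x : 0 <= x -> `|E.[x] - (expR x - 1)| <= x ^+ (2 * n).+2 * expR x.
  move=> x0; have := expR_taylor (2 * n).+2 x0.
  rewrite big_nat_recl // expr0 fact0 divr1.
  suff -> : E.[x] = \sum_(0 <= i < (2 * n).+1) x ^+ i.+1 / i.+1`!%:R.
    by rewrite distrC => /andP[h1 h2]; rewrite ger0_norm; lra.
  rewrite horner_poly (big_ord_recl (2 * n).+1) /= mul0r add0r.
  rewrite -(big_mkord xpredT (fun i => (i.+1`!%:R)^-1 * x ^+ i.+1)).
  by apply: eq_bigr => i _; rewrite mulrC.
have coth (rho : R) : 0 < rho -> (expR (2 * pi * rho) - 1) * (rho * lsum 1 rho - pi * rho) = 2 * pi * rho.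
  move=> r0; have := lsum1_coth r0; move: (expR _) (lsum 1 rho) => e T h.
  have -> : (e - 1) * (rho * T - pi * rho) = rho * ((T - pi) * e) - rho * (T - pi) by ring.
  by rewrite h; ring.
have [QP hQP] := poly_bounded01 P; have [QE hQE] := poly_bounded01 E.
have small x : 0 < x -> x < 1 -> `|(E * P - 'X).[x]| <= (QP * expR 1 + (QE + expR 1) * 4) * x ^+ (2 * n).+2.
  move=> x0 x1; pose rho := x / (2 * pi).
  have tp : 0 < 2 * pi :> R by rewrite mulr_gt0.
  have r0 : 0 < rho by rewrite divr_gt0.
  have xr : x = 2 * pi * rho by rewrite /rho mulrC divfK // gt_eqF.
  have rx : rho <= x.
    by rewrite /rho ler_pdivrMr // ler_peMr ?(ltW x0) //; have := pi_ge2 R; lra.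
  have := Pval _ r0; rewrite -xr => hP; have hE := Eval x (ltW x0).
  have := coth _ r0; rewrite -xr => hc.
  rewrite hornerD hornerN hornerX hornerM -[X in _ - X]hc.
  have ex : expR x <= expR 1 by rewrite ler_expR ltW.
  have e1 : 0 <= expR x by exact: expR_ge0.
  have bP := hQP x (ltW x0) (ltW x1); have bE := hQE x (ltW x0) (ltW x1).
  have rn : rho ^+ (2 * n.+1) <= x ^+ (2 * n).+2.
    by rewrite mulnS add2n lerXn2r ?nnegrE ?(ltW x0) ?(ltW r0).
  have xn : 0 <= x ^+ (2 * n).+2 by rewrite exprn_ge0 ?(ltW x0).
  have e2 : `|expR x - 1| <= expR 1.
    by rewrite ger0_norm; [lra|rewrite subr_ge0 -(expR0 R) ler_expR ltW].
  move: (expR x - 1) (rho * lsum 1 rho - pi * rho) hP hE e2 => u v hP hE e2.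
  rewrite (_ : _ - _ = P.[x] * (E.[x] - u) + u * (P.[x] - v)); last by ring.
  apply: le_trans (ler_normD _ _) _; rewrite !normrM mulrDl; apply: lerD.
    rewrite -mulrA [expR 1 * _]mulrC; apply: ler_pM => //.
    by apply: le_trans hE _; rewrite ler_wpM2l.
  have QE0 : 0 <= QE by apply: le_trans bE.
  apply: le_trans (_ : expR 1 * (4 * x ^+ (2 * n).+2) <= _).
    apply: ler_pM => //; apply: le_trans hP _; rewrite ler_wpM2l //.
  by have := mulr_ge0 QE0 xn; lra.
have := poly_small_coef ltr01 small.
move=> /(_ m); rewrite coefB coefX coefM => /(_ _)/eqP; rewrite subr_eq0 => H.
have {}H : (m < (2 * n).+2)%N -> \sum_(j < m.+1) E`_j * P`_(m - j) = (m == 1%N)%:R by move=> /H/eqP.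
have {}H := H ltac:(by rewrite /n; lia).
have -> : \sum_(0 <= i < m) ('C(m, i))%:R * bern_egf i * i`!%:R =
   m`!%:R * \sum_(j < m.+1) E`_j * P`_(m - j).
  rewrite mulr_sumr big_ord_recl coef_poly /= mul0r mulr0 add0r.
  rewrite big_nat_rev /= big_mkord; apply: eq_bigr => i _.
  rewrite !coef_poly /= /bump /= add0n add1n.
  have im : (i < m)%N := ltn_ord i.
  rewrite (_ : (i.+1 < (2 * n).+2)%N = true); last by rewrite /n; lia.
  rewrite (_ : (m - i.+1 < (2 * n).+1)%N = true); last by rewrite /n; lia.
  have -> : m`!%:R = ('C(m, m - i.+1))%:R * ((m - i.+1)`!%:R * (i.+1)`!%:R) :> R.
    rewrite -!natrM; congr (_%:R); rewrite -(bin_fact (leq_subr i.+1 m)).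
    by rewrite subKn.
  have f0 : (i.+1)`!%:R != 0 :> R by rewrite pnatr_eq0 -lt0n fact_gt0.
  move: (i.+1`!%:R : R) f0 => f f0.
  by field.
rewrite H; case: (m =P 1%N) => [->|_]; first by rewrite mulr1.
by rewrite mulr0.
Qed.

Lemma bern_egfE n : bern_egf n * n`!%:R = ratr (bernoulli n) :> R.
Proof.
have [N] := ubnP n; elim: N n => // N IH n nN.
have h1 := sum_bin_bern_egf (isT : (0 < n.+1)%N).
have h2 := congr1 (@ratr R) (bernoulli_rec n).
rewrite rmorph_sum big_ord_recr /= -(big_mkord xpredT (fun i => ratr ('C(n.+1, i)%:R * bernoulli i))) in h2.
rewrite big_nat_recr //= eqSS -[RHS](ratr_nat R) -h2 in h1.
have E : \sum_(0 <= i < n) ('C(n.+1, i))%:R * bern_egf i * i`!%:R =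
   \sum_(0 <= i < n) ratr ('C(n.+1, i)%:R * bernoulli i) :> R.
  apply: eq_big_nat => i /andP[_ iN]; rewrite rmorphM /= ratr_nat -IH ?mulrA //.
  by apply: leq_trans iN _.
rewrite E in h1; move/addrI: h1; rewrite binSn rmorphM /= ratr_nat -mulrA.
by apply: mulfI; rewrite pnatr_eq0.
Qed.

Lemma zeta_even k : (0 < k)%N ->
  2 * zeta R (2 * k) = (-1) ^+ k.+1 * (2 * pi) ^+ (2 * k) * (ratr (bernoulli (2 * k)) / (2 * k)`!%:R).
Proof.
move=> k0; rewrite -bern_egfE mulfK ?pnatr_eq0 -?lt0n ?fact_gt0 // bern_egf_even //.
have tp : (2 * pi : R) ^+ (2 * k) != 0 by rewrite expf_neq0 // mulf_neq0 // gt_eqF ?pi_gt0.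
have ss : (-1) ^+ k.+1 * (-1) ^+ k.+1 = 1 :> R by rewrite -exprMn mulN1r opprK expr1n.
move: (_ ^+ (2 * k)) tp ((-1) ^+ k.+1) ss (zeta _ _) => t tp s ss z.
rewrite (_ : s * t * _ = 2 * z * (s * s)); first by rewrite ss mulr1.
by field.
Qed.

End Zeta.

(** * Complex symmetric sums and shifted cotangents *)

Section ComplexSums.
Variable R : realType.
Local Notation C := R[i].
Implicit Types (F G : int -> C).

Definition csum F (s : C) :=
  ssum (fun m => complex.Re (F m)) (complex.Re s) /\
  ssum (fun m => complex.Im (F m)) (complex.Im s).

Lemma csum_ext F G s : F =1 G -> csum F s -> csum G s.
Proof. by move=> /funext ->. Qed.

Lemma csum0 : csum (fun=> 0) 0.
Proof. by split; exact: ssum0. Qed.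

Lemma csumD F G s t : csum F s -> csum G t -> csum (fun m => F m + G m) (s + t).
Proof.
move=> [rF iF] [rG iG]; split; [rewrite ReD; apply: ssum_ext (ssumD rF rG)
  |rewrite ImD; apply: ssum_ext (ssumD iF iG)] => m; by rewrite (ReD, ImD).
Qed.

Lemma csumZ (k : C) F s : csum F s -> csum (fun m => k * F m) (k * s).
Proof.
move=> [re im]; split.
  rewrite ReM; apply: ssum_ext (ssumD (ssumZ (k := complex.Re k) re)
    (ssumZ (k := - complex.Im k) im)) => m; by rewrite ReM.
rewrite ImM; apply: ssum_ext (ssumD (ssumZ (k := complex.Re k) im)
  (ssumZ (k := complex.Im k) re)) => m; by rewrite ImM.
Qed.

Lemma csum_conj F s : csum F s -> csum (fun m => (F m)^*%C) (s^*)%C.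
Proof.
move=> [re im]; case: s re im => a b /= re im; split=> /=.
  by apply: ssum_ext re => m; case: (F m).
have := ssumZ (k := -1) im; rewrite mulN1r; apply: ssum_ext => m.
by rewrite mulN1r; case: (F m).
Qed.

Lemma csum_latz q rho : 0 < rho -> (0 < q)%N ->
  csum (fun m => latz rho m ^+ q) (lsum q rho)%:C%C.
Proof.
move=> r0 q0; split=> /=; first exact: ssum_phi.
by apply: ssum_odd => m; exact: Im_latz_odd.
Qed.

Definition ishift (rho : R) (m : int) : C := ((m%:~R : R) +i* rho)%C^-1.

Lemma ishiftE rho m : ishift rho m =
  ((m%:~R / (m%:~R ^+ 2 + rho ^+ 2)) -i* (rho / (m%:~R ^+ 2 + rho ^+ 2)))%C.
Proof. by rewrite /ishift /GRing.inv. Qed.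

Lemma ishift_pos rho m : ishift rho m = - 'i%C * (latz rho m)^*%C.
Proof.
rewrite ishiftE latzE [rho ^+ 2 + _]addrC; apply/eqP; rewrite eq_complex /=.
by apply/andP; split; apply/eqP; ring.
Qed.

Lemma ishift_neg rho m : ishift (- rho) m = (ishift rho m)^*%C.
Proof. by rewrite /ishift conjc_inv. Qed.

Definition ishift_main (q : nat) (rho : R) : C :=
  if q == 1%N then Complex 0 (- (pi * Num.sg rho)) else 0.

(** Transferred from [lsum] through m + i rho = i (rho - i m), and to negative [rho] by conjugation.
    The main value is the limit at infinity of the cotangent for [q = 1], and zero for its
    derivatives. *)
Lemma csum_ishift q : (0 < q)%N -> exists K c : R, [/\ 0 < c, 0 <= K &
  forall rho, 1 <= `|rho| -> exists2 s, csum (fun m => ishift rho m ^+ q) s &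
    Normc.normc (s - ishift_main q rho) <= K * expR (- (c * `|rho|))].
Proof.
move=> q0; have [K [c [c0 K0 H]]] := @lsum_decay R q q0.
exists K, c; split => // rho.
have pos (r : R) : 1 <= r -> exists2 s, csum (fun m => ishift r m ^+ q) s &
    Normc.normc (s - ishift_main q r) <= K * expR (- (c * r)).
  move=> r1; have r0 : 0 < r by lra.
  exists ((- 'i%C) ^+ q * (lsum q r)%:C%C).
    have := csumZ ((- 'i%C) ^+ q) (csum_conj (csum_latz r0 q0)).
    rewrite conjc_real; apply: csum_ext => m.
    by rewrite ishift_pos exprMn (rmorphXn (@conjc R)).
  rewrite (_ : ishift_main q r = (- 'i%C) ^+ q * (lsum_main R q)%:C%C).
    rewrite -mulrBr -rmorphB /= Normc.normcM normcX normc_real.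
    have -> : Normc.normc (- 'i%C : C) = 1.
      by rewrite /Normc.normc /= oppr0 expr0n add0r sqrrN expr1n sqrtr1.
    by rewrite expr1n mul1r; exact: H.
  rewrite /ishift_main /lsum_main; case: eqP => [->|_]; last by rewrite mulr0.
  apply/eqP; rewrite expr1 eq_complex /= gtr0_sg //.
  by apply/andP; split; apply/eqP; ring.
have [r0|r0] := leP 0 rho; first by rewrite (ger0_norm r0); exact: pos.
rewrite (ltr0_norm r0) => /pos[s hs bs]; exists (s^*)%C.
  apply: csum_ext (csum_conj hs) => m.
  by rewrite (rmorphXn (@conjc R)) -[in RHS](opprK rho) (ishift_neg (- rho)).
rewrite (_ : ishift_main q rho = (ishift_main q (- rho))^*%C).
  rewrite -(rmorphB (@conjc R)); move: bs; congr (_ <= _).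
  by case: (s - _) => u v; rewrite /Normc.normc /= sqrrN.
rewrite /ishift_main; case: eqP => _; last by rewrite conjc0.
by apply/eqP; rewrite eq_complex /= sgrN; apply/andP; split; apply/eqP; ring.
Qed.

End ComplexSums.

(** * Estimates uniform in a family of lattice classes *)

Section Families.
Variable R : realType.
Local Notation C := R[i].
Variables (I : Type) (T X : I -> R).
Hypotheses (T1 : forall i, 1 <= T i) (X1 : forall i, 1 <= X i).
Implicit Types (F G : I -> int -> C) (v w a : I -> C).

Definition polyb a := exists K E, forall i, Normc.normc (a i) <= K * X i ^+ E.

(** The constants do not depend on the index, so the errors of all classes can later be added. The
    power of [X i] leaves room for coefficients that are only polynomially bounded, as in
    [polyb]. *)
Definition csumP F v := exists K c E, [/\ 0 < c, 0 <= K & forall i,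
  exists2 s, csum (F i) s & Normc.normc (s - v i) <= K * X i ^+ E * expR (- (c * (T i * X i)))].

Lemma csumP_ext F G v w : (forall i, F i =1 G i) -> v =1 w -> csumP F v -> csumP G w.
Proof.
move=> FG vw; have -> : F = G by apply/funext => i; apply/funext => m; exact: FG.
by have -> : v = w by apply/funext => i; exact: vw.
Qed.

Let TX i : 1 <= T i * X i.
Proof. by have := T1 i; have := X1 i; nra. Qed.

Let err_mono K K' c c' E E' i : 0 <= K -> K <= K' -> c' <= c -> (E <= E')%N ->
  K * X i ^+ E * expR (- (c * (T i * X i))) <= K' * X i ^+ E' * expR (- (c' * (T i * X i))).
Proof.
move=> K0 KK cc EE; have X0 : 0 <= X i by have := X1 i; lra.
apply: ler_pM => //; first by rewrite mulr_ge0 ?exprn_ge0.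
- by apply: ler_pM => //; [exact: exprn_ge0|exact: ler_weXn2l].
- by rewrite ler_expR lerN2 ler_wpM2r //; have := TX i; lra.
Qed.

Lemma csumP0 : csumP (fun _ _ => 0) (fun=> 0).
Proof.
exists 0, 1, 0%N; split => // i; exists 0; first exact: csum0.
by rewrite subrr Normc.normc0 !mul0r.
Qed.

Lemma csumPD F G v w : csumP F v -> csumP G w ->
  csumP (fun i m => F i m + G i m) (fun i => v i + w i).
Proof.
move=> [K [c [E [c0 K0 H]]]] [K' [c' [E' [c0' K0' H']]]].
exists (K + K'), (Num.min c c'), (E + E')%N; split; [by rewrite lt_min c0|exact: addr_ge0|].
move=> i; have [s hs bs] := H i; have [t ht bt] := H' i.
exists (s + t); first exact: csumD.
rewrite opprD addrACA; apply: le_trans (le_normcD _ _) _.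
rewrite mulrDl mulrDl; apply: lerD.
  by apply: le_trans bs (err_mono _ _ _ _ _); rewrite ?ge_min ?lexx ?leq_addr.
by apply: le_trans bt (err_mono _ _ _ _ _); rewrite ?ge_min ?lexx ?orbT ?leq_addl.
Qed.

Lemma csumPZ a F v : polyb a -> csumP F v -> csumP (fun i m => a i * F i m) (fun i => a i * v i).
Proof.
move=> [A [E' ha]] [K [c [E [c0 K0 H]]]].
exists (`|A| * K), c, (E' + E)%N; split => //; first by rewrite mulr_ge0.
move=> i; have [s hs bs] := H i; exists (a i * s); first exact: csumZ.
rewrite -mulrBr Normc.normcM exprD (_ : _ * _ * _ = (`|A| * X i ^+ E') * (K * X i ^+ E * expR (- (c * (T i * X i))))); last by ring.
apply: ler_pM; rewrite ?normc_ge0 //; apply: le_trans (ha i) _.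
by rewrite ler_wpM2r ?ler_norm // exprn_ge0 //; have := X1 i; lra.
Qed.

Lemma csumP_sum (J : eqType) (r : seq J) (F : J -> I -> int -> C) (v : J -> I -> C) :
  (forall j, j \in r -> csumP (F j) (v j)) ->
  csumP (fun i m => \sum_(j <- r) F j i m) (fun i => \sum_(j <- r) v j i).
Proof.
elim: r => [|j r IH] H.
  by apply: csumP_ext csumP0 => [i m|i]; rewrite big_nil.
apply: csumP_ext (csumPD (H j _) (IH _)) => [i m|i||k kr]; rewrite ?big_cons ?mem_head //.
by apply: H; rewrite in_cons kr orbT.
Qed.

Lemma polyb_bounded a K : (forall i, Normc.normc (a i) <= K) -> polyb a.
Proof. by move=> aK; exists K, 0%N => i; rewrite expr0 mulr1. Qed.

Lemma polyb_cst (z : C) : polyb (fun=> z).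
Proof. exact: (@polyb_bounded _ (Normc.normc z)). Qed.

Lemma polybM a b : polyb a -> polyb b -> polyb (fun i => a i * b i).
Proof.
move=> [K [E ha]] [K' [E' hb]]; exists (`|K| * `|K'|), (E + E')%N => i.
have X0 : 0 <= X i by have := X1 i; lra.
rewrite Normc.normcM exprD mulrACA; apply: ler_pM; rewrite ?normc_ge0 //.
  by apply: le_trans (ha i) _; rewrite ler_wpM2r ?ler_norm ?exprn_ge0.
by apply: le_trans (hb i) _; rewrite ler_wpM2r ?ler_norm ?exprn_ge0.
Qed.

Lemma polybX a n : polyb a -> polyb (fun i => a i ^+ n).
Proof.
move=> ha; elim: n => [|n IH]; first exact: polyb_cst.
rewrite (_ : (fun i => _) = (fun i => a i * a i ^+ n)); first exact: polybM.
by apply/funext => i; rewrite exprS.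
Qed.

Lemma polybN a : polyb a -> polyb (fun i => - a i).
Proof. by move=> [K [E ha]]; exists K, E => i; rewrite normcN. Qed.

Lemma csumP_ishift q (rho : I -> R) : (forall i, T i * X i <= `|rho i|) ->
  csumP (fun i m => ishift (rho i) m ^+ q.+1) (fun i => ishift_main q.+1 (rho i)).
Proof.
move=> hr; have [K [c [c0 K0 H]]] := @csum_ishift R q.+1 isT.
exists K, c, 0%N; split => // i; have r1 := le_trans (TX i) (hr i).
have [s hs bs] := H _ r1; exists s => //; apply: le_trans bs _.
by rewrite expr0 mulr1 ler_wpM2l // ler_expR lerN2 ler_wpM2l // ltW.
Qed.

Lemma csumP_pf (Y : I -> int -> C) (v1 : I -> C) (D : I -> C) p q :
  (forall k, csumP (fun i m => Y i m ^+ k.+1) (fun i => if k == 0%N then v1 i else 0)) ->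
  polyb D ->
  csumP (fun i m => pf (Y i m) (D i) p.+1 q)
   (fun i => (-1) ^+ p * ('C(q + p - 1, p))%:R * D i ^+ (q + p) * v1 i).
Proof.
move=> hY hD; rewrite /pf.
have E i : (-1) ^+ p * ('C(q + p - 1, p))%:R * D i ^+ (q + p) * v1 i =
  \sum_(0 <= k < p.+1) (-1) ^+ k * ('C(q + k - 1, k))%:R * D i ^+ (q + k) *
     (if (p - k)%N == 0%N then v1 i else 0).
  rewrite big_nat_recr //= subnn eqxx big1_seq ?add0r // => k; rewrite mem_index_iota /= => kp.
  by rewrite subn_eq0 leqNgt kp mulr0.
apply: csumP_ext (fun i m => erefl) (fun i => esym (E i)) _.
apply: csumP_sum => k; rewrite mem_index_iota /= ltnS => kp.
under eq_fun do under eq_fun do rewrite subSn //.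
apply: csumPZ (hY _); apply: polybM (polybX _ hD); exact: polyb_cst.
Qed.

(** Partial fractions in m separate the shifts. Only the two simple poles have nonzero main values;
    these agree, the shifts having the same sign, and their coefficients are opposite. The distance
    between the shifts keeps [D] bounded. *)
Lemma csumP_ishift2 (rho1 rho2 : I -> R) p q :
  (forall i, T i * X i <= `|rho1 i|) -> (forall i, T i * X i <= `|rho2 i|) ->
  (forall i, Num.sg (rho1 i) = Num.sg (rho2 i)) ->
  (forall i, 1 <= `|rho2 i - rho1 i|) ->
  csumP (fun i m => ishift (rho1 i) m ^+ p.+1 * ishift (rho2 i) m ^+ q.+1) (fun=> 0).
Proof.
move=> h1 h2 hs hd; pose D i : C := (Complex 0 (rho2 i - rho1 i))^-1.
have hD : polyb D.
  apply: (@polyb_bounded _ 1) => i; rewrite Normc.normcV invf_le1.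
    by rewrite /Normc.normc expr0n add0r sqrtr_sqr.
  by rewrite /Normc.normc expr0n add0r sqrtr_sqr; have := hd i; lra.
have c1 k := csumP_ishift k h1; have c2 k := csumP_ishift k h2.
have e k (rho : I -> R) i : ishift_main k.+1 (rho i) = if k == 0%N then Complex 0 (- (pi * Num.sg (rho i))) else 0 :> C by [].
have k1 := csumP_pf p q.+1 (fun k => csumP_ext (fun _ _ => erefl) (e k rho1) (c1 k)) hD.
have k2 := csumP_pf q p.+1 (fun k => csumP_ext (fun _ _ => erefl) (e k rho2) (c2 k)) (polybN hD).
apply: csumP_ext (csumPD k1 k2) => [i m|i].
  rewrite -partial_fractions // /ishift /D.
  have nz (x y : R) : y != 0 -> (x +i* y)%C != 0 by move=> y0; rewrite eq_complex /= negb_and y0 orbT.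
  have z1 : (m%:~R +i* rho1 i)%C != 0.
    by apply: nz; rewrite -normr_gt0; have := h1 i; have := TX i; lra.
  have z2 : (m%:~R +i* rho2 i)%C != 0.
    by apply: nz; rewrite -normr_gt0; have := h2 i; have := TX i; lra.
  have z3 : Complex 0 (rho2 i - rho1 i) != 0.
    by apply: nz; rewrite -normr_gt0; have := hd i; lra.
  have E : (m%:~R +i* rho2 i)%C = (m%:~R +i* rho1 i)%C + Complex 0 (rho2 i - rho1 i).
    by apply/eqP; rewrite eq_complex /= addr0 addrC subrK !eqxx.
  by rewrite E in z2 *; field; rewrite z1 z2 z3.
rewrite hs; rewrite !addSn !subn1 /= [(q + p)%N]addnC -(@bin_sub (p + q) q) ?leq_addl //.
rewrite addnK (exprNn (D i)) [(-1) ^+ (p + q).+1]exprS [(-1) ^+ (p + q)]exprD.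
have : (-1) ^+ q * (-1) ^+ q = 1 :> C by rewrite -exprMn mulN1r opprK expr1n.
move: ((-1) ^+ q) ((-1) ^+ p) => s t ss; ring: ss.
Qed.

End Families.

(** * Sums over M of integrals over y *)

Section Double.
Variable R : realType.
Local Notation C := R[i].
Variables (I : Type) (T X : I -> R).
Hypotheses (T1 : forall i, 1 <= T i) (X1 : forall i, 1 <= X i).
Implicit Types (G H : I -> int -> R -> C) (v w a : I -> C).

Definition dbl G v := exists2 W : I -> int -> C,
  forall i M, has_pv (G i M) (W i M) & csumP T X W v.

Lemma dbl_ext G H v w : (forall i M y, G i M y = H i M y) -> v =1 w -> dbl G v -> dbl H w.
Proof.
move=> GH vw [W hW cW]; exists W; last by apply: csumP_ext vw cW.
by move=> i M; apply: has_pv_ext (hW i M) => y; exact: GH.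
Qed.

Lemma dblD G H v w : dbl G v -> dbl H w ->
  dbl (fun i M y => G i M y + H i M y) (fun i => v i + w i).
Proof.
move=> [V hV cV] [W hW cW]; exists (fun i M => V i M + W i M); last exact: csumPD.
by move=> i M; exact: has_pvD.
Qed.

Lemma dblZ a G v : polyb X a -> dbl G v ->
  dbl (fun i M y => a i * G i M y) (fun i => a i * v i).
Proof.
move=> ha [V hV cV]; exists (fun i M => a i * V i M); last exact: csumPZ.
by move=> i M; exact: has_pvZ.
Qed.

Lemma dbl_sum (J : eqType) (r : seq J) (G : J -> I -> int -> R -> C) (v : J -> I -> C) :
  (forall j, j \in r -> dbl (G j) (v j)) ->
  dbl (fun i M y => \sum_(j <- r) G j i M y) (fun i => \sum_(j <- r) v j i).
Proof.
elim: r => [|j r IH] h.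
  exists (fun _ _ => 0) => [i M|].
    by apply: has_pv_ext (has_pv0 R) => y; rewrite big_nil.
  by apply: csumP_ext (csumP0 T X) => // i; rewrite big_nil.
apply: dbl_ext (dblD (h j _) (IH _)) => [i M y|i||k kr]; rewrite ?big_cons ?mem_head //.
by apply: h; rewrite in_cons kr orbT.
Qed.

(** Of the double expansion only the product of two simple poles has a nonzero value. *)
Lemma dbl_pf_pf (A B : I -> int -> R -> C) D D' v p q p' q' :
  (forall r s, dbl (fun i M y => A i M y ^+ r.+1 * B i M y ^+ s.+1)
     (fun i => if (r == 0%N) && (s == 0%N) then v i else 0)) ->
  polyb X D -> polyb X D' ->
  dbl (fun i M y => pf (A i M y) (D i) p.+1 q * pf (B i M y) (D' i) p'.+1 q')
   (fun i => (-1) ^+ p * ('C(q + p - 1, p))%:R * D i ^+ (q + p) *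
     ((-1) ^+ p' * ('C(q' + p' - 1, p'))%:R * D' i ^+ (q' + p')) * v i).
Proof.
move=> hAB hD hD'.
pose c k i : C := (-1) ^+ k * ('C(q + k - 1, k))%:R * D i ^+ (q + k).
pose c' k i : C := (-1) ^+ k * ('C(q' + k - 1, k))%:R * D' i ^+ (q' + k).
have hc k : polyb X (c k) by apply: polybM (polybX _ _ hD) => //; exact: polyb_cst.
have hc' k : polyb X (c' k) by apply: polybM (polybX _ _ hD') => //; exact: polyb_cst.
have h : dbl (fun i M y => \sum_(k <- index_iota 0 p.+1) \sum_(l <- index_iota 0 p'.+1)
    (c k i * c' l i) * (A i M y ^+ (p - k).+1 * B i M y ^+ (p' - l).+1))
   (fun i => \sum_(k <- index_iota 0 p.+1) \sum_(l <- index_iota 0 p'.+1)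
    (c k i * c' l i) * (if (p - k == 0)%N && (p' - l == 0)%N then v i else 0)).
  apply: dbl_sum => k _; apply: dbl_sum => l _; apply: dblZ (hAB _ _).
  exact: polybM.
apply: dbl_ext h => [i M y|i].
  rewrite /pf big_distrlr /=; apply: eq_big_nat => k /andP[_ kp].
  apply: eq_big_nat => l /andP[_ lp].
  by rewrite !subSn // /c /c'; ring.
rewrite big_nat_recr //= big_nat_recr //= !subnn !eqxx /=.
rewrite big1_seq ?add0r; last first.
  move=> k; rewrite mem_index_iota /= => kp; apply: big1 => l _.
  by rewrite subn_eq0 leqNgt kp mulr0.
rewrite big1_seq ?add0r // => l; rewrite mem_index_iota /= => lp.
by rewrite subn_eq0 leqNgt lp mulr0.
Qed.

Lemma dbl_pf_zero G (A : I -> int -> R -> C) D p q :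
  (forall r, dbl (fun i M y => G i M y * A i M y ^+ r.+1) (fun=> 0)) -> polyb X D ->
  dbl (fun i M y => G i M y * pf (A i M y) (D i) p q) (fun=> 0).
Proof.
move=> hG hD.
pose c k i : C := (-1) ^+ k * ('C(q + k - 1, k))%:R * D i ^+ (q + k).
have hc k : polyb X (c k) by apply: polybM (polybX _ _ hD) => //; exact: polyb_cst.
have h : dbl (fun i M y => \sum_(k <- index_iota 0 p) c k i * (G i M y * A i M y ^+ (p - k)))
   (fun i => \sum_(k <- index_iota 0 p) c k i * 0).
  apply: dbl_sum => k; rewrite mem_index_iota => /andP[_ kp]; apply: dblZ => //.
  by rewrite -(prednK (_ : 0 < p - k)%N) ?subn_gt0 //; exact: hG.
apply: dbl_ext h => [i M y|i].
  by rewrite /pf mulr_sumr; apply: eq_bigr => k _; rewrite /c; ring.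
by rewrite big1 // => k _; rewrite mulr0.
Qed.

Implicit Types (c : I -> R).

(** [lo] and [up] are the two poles in y of 1 / ((y + c M)^2 + T^2); as M varies they move along
    lines of slope governed by [c], at height -T and T. *)
Definition lo c i (M : int) : C := Complex (- (c i * M%:~R)) (- T i).
Definition up c i (M : int) : C := Complex (- (c i * M%:~R)) (T i).

Let T0 i : 0 < T i. Proof. by have := T1 i; lra. Qed.

Lemma dbl_same (a b : I -> int -> C) p q :
  (forall i M, 0 < complex.Im (a i M) * complex.Im (b i M)) ->
  dbl (fun i M y => resolvent (a i M) y ^+ p.+1 * resolvent (b i M) y ^+ q.+1) (fun=> 0).
Proof.
by move=> ab; exists (fun _ _ => 0) => [i M|]; [exact: has_pv2_same|exact: csumP0].
Qed.

Lemma lo_up c c' i M : c i != c' i ->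
  (lo c i M - up c' i M)^-1 = - ((c i - c' i)^-1)%:C%C * ishift (2 * T i / (c i - c' i)) M.
Proof.
move=> cc; have d0 : c i - c' i != 0 by rewrite subr_eq0.
rewrite /ishift fmorphV -invrN -invfM /lo /up; congr (_^-1).
apply/eqP; rewrite eq_complex /=; apply/andP; split; apply/eqP; field; exact: d0.
Qed.

Lemma up_lo c c' i M : c i != c' i ->
  (up c' i M - lo c i M)^-1 = ((c i - c' i)^-1)%:C%C * ishift (2 * T i / (c i - c' i)) M.
Proof.
by move=> cc; rewrite -opprB invrN lo_up // mulNr opprK.
Qed.

(** With one pole on each side of the real axis, the integral is a multiple of a power of the
    inverse distance of the poles, which is an [ishift] in M. Its sum has a nonzero main value only
    for exponent one. *)
Lemma dbl_pair c c' p q :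
  (forall i, X i <= `|(c i - c' i)^-1|) -> polyb X (fun i => ((c i - c' i)^-1)%:C%C) ->
  dbl (fun i M y => resolvent (lo c i M) y ^+ p.+1 * resolvent (up c' i M) y ^+ q.+1)
    (fun i => if (p == 0%N) && (q == 0%N) then (2 * pi ^+ 2 * `|(c i - c' i)^-1|)%:C%C else 0).
Proof.
move=> hX hp; pose d i := (c i - c' i)^-1.
have cc i : c i != c' i.
  by have := hX i; apply: contraTneq => ->; rewrite subrr invr0 normr0 -ltNge; have := X1 i; lra.
pose rho i := 2 * T i * d i.
have hr i : T i * X i <= `|rho i|.
  have t2 : 0 < 2 * T i by rewrite mulr_gt0.
  rewrite /rho normrM (gtr0_norm t2); have := T0 i; have := X1 i => x1 t0.
  by apply: ler_pM; [lra|lra|lra|exact: hX].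
pose k i : C := (-1) ^+ p * ('C(p + q, p))%:R * (- (d i)%:C%C) ^+ (p + q).+1 * Complex 0 (- (2 * pi)).
have hk : polyb X k.
  apply: polybM => //; last exact: polyb_cst.
  by apply: polybM => //; [exact: polyb_cst|apply: polybX => //; exact: polybN].
exists (fun i M => k i * ishift (rho i) M ^+ (p + q).+1) => [i M|].
  have lu : complex.Im (lo c i M) * complex.Im (up c' i M) < 0 by rewrite /=; have := T0 i; nra.
  have := has_pv2_opp p q lu; rewrite lo_up // -/(rho i) exprMn.
  rewrite (_ : pv2 (lo c i M) = Complex 0 (- (2 * pi))).
    rewrite /k; set u := (X in has_pv _ X -> _); set u' := (X in _ -> has_pv _ X).
    by have -> : u = u' by rewrite /u /u'; ring.
  by rewrite /pv2 /= ltr0_sg ?oppr_lt0 // mulrN1.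
have h1 := csumP_ishift T1 X1 (p + q)%N hr.
have h2 := csumPZ X1 hk h1.
apply: csumP_ext h2 => // i.
rewrite /k /ishift_main eqSS addn_eq0; case: andP => [[/eqP -> /eqP ->]|_]; last by rewrite mulr0.
rewrite !expr0 bin0 !mul1r expr1.
have -> : `|(c i - c' i)^-1| = d i * Num.sg (rho i).
  rewrite -/(d i) /rho sgrM gtr0_sg ?mul1r; last by rewrite mulr_gt0.
  by rewrite mulrC -normrEsg.
apply/eqP; rewrite eq_complex /=; apply/andP; split; apply/eqP; ring.
Qed.

(** The residue at the isolated pole [a] is a sum of products of two [ishift] powers whose shifts
    have the same sign, so [csumP_ishift2] makes each main value zero. *)
Lemma dbl_triple (a b1 b2 : I -> int -> C) (k1 k2 r1 r2 : I -> R) (pvc : I -> C) l p q :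
  (forall i M, complex.Im (a i M) * complex.Im (b1 i M) < 0) ->
  (forall i M, complex.Im (a i M) * complex.Im (b2 i M) < 0) ->
  (forall i M, (a i M - b1 i M)^-1 = (k1 i)%:C%C * ishift (r1 i) M) ->
  (forall i M, (a i M - b2 i M)^-1 = (k2 i)%:C%C * ishift (r2 i) M) ->
  (forall i M, pv2 (a i M) = pvc i) ->
  polyb X (fun i => (k1 i)%:C%C) -> polyb X (fun i => (k2 i)%:C%C) -> polyb X pvc ->
  (forall i, T i * X i <= `|r1 i|) -> (forall i, T i * X i <= `|r2 i|) ->
  (forall i, Num.sg (r1 i) = Num.sg (r2 i)) -> (forall i, 1 <= `|r2 i - r1 i|) ->
  dbl (fun i M y => resolvent (a i M) y ^+ l.+1 * resolvent (b1 i M) y ^+ p.+1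
     * resolvent (b2 i M) y ^+ q.+1) (fun=> 0).
Proof.
move=> ab1 ab2 e1 e2 ep hk1 hk2 hpv hr1 hr2 hs hd.
pose cf k i : C := (-1) ^+ l * (('C(p + k, k))%:R * ('C(q + (l - k), l - k))%:R)
  * (k1 i)%:C%C ^+ (p + k).+1 * (k2 i)%:C%C ^+ (q + (l - k)).+1 * pvc i.
have hcf k : polyb X (cf k).
  apply: polybM => //; apply: polybM => //; last exact: polybX.
  by apply: polybM => //; [exact: polyb_cst|exact: polybX].
exists (fun i M => \sum_(k <- index_iota 0 l.+1)
   cf k i * (ishift (r1 i) M ^+ (p + k).+1 * ishift (r2 i) M ^+ (q + (l - k)).+1)) => [i M|].
  have := has_pv3 l p q (ab1 i M) (ab2 i M); rewrite e1 e2 ep /residue3.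
  set u := (X in has_pv _ X -> _); set u' := (X in _ -> has_pv _ X).
  have -> // : u = u'.
  rewrite /u /u' mulr_sumr mulr_suml; apply: eq_bigr => k _.
  by rewrite /cf !exprMn; ring.
pose F k i M := cf k i * (ishift (r1 i) M ^+ (p + k).+1 * ishift (r2 i) M ^+ (q + (l - k)).+1).
have h : csumP T X (fun i M => \sum_(k <- index_iota 0 l.+1) F k i M)
    (fun i => \sum_(k <- index_iota 0 l.+1) cf k i * 0).
  apply: csumP_sum => // k _; apply: csumPZ => //; exact: csumP_ishift2.
by apply: csumP_ext h => // i; rewrite big1 // => k _; rewrite mulr0.
Qed.

End Double.

(** * Configurations of poles on two or three lines *)

Lemma distrC_inv (R : realType) (x y : R) : `|(x - y)^-1| = `|(y - x)^-1|.
Proof. by rewrite -(opprB y x) invrN normrN. Qed.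

Lemma diag_sign (K : comNzRingType) (k l k' l' : nat) (A B d e : K) :
  (-1) ^+ k * A * d ^+ (k + l).+1 * ((-1) ^+ l' * B * (- d) ^+ (k' + l').+1) * e +
  (-1) ^+ l * A * (- d) ^+ (k + l).+1 * ((-1) ^+ k' * B * d ^+ (k' + l').+1) * e
  = 2 * e * A * B * (-1) ^+ (k + k').+1 * d ^+ ((k + l).+1 + (k' + l').+1).
Proof.
rewrite !(exprNn d) (exprD d) !(exprS (-1)) !(exprD (-1)).
have sq (n : nat) : (-1) ^+ n * (-1) ^+ n = 1 :> K by rewrite -exprMn mulN1r opprK expr1n.
have := sq l; have := sq l'.
move: ((-1) ^+ l) ((-1) ^+ l') ((-1) ^+ k) ((-1) ^+ k') => s s' r r' ss' ss.
by move: (d ^+ _) (d ^+ _) => d1 d2; ring: ss ss'.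
Qed.

Section Lines.
Variable R : realType.
Local Notation C := R[i].
Variables (I : Type) (T X : I -> R).
Hypotheses (T1 : forall i, 1 <= T i) (X1 : forall i, 1 <= X i).

Local Notation L c i M y := (resolvent (lo T c i M) y).
Local Notation U c i M y := (resolvent (up T c i M) y).

Definition lowup i : C := (Complex 0 (- (2 * T i)))^-1.

Let T0 i : 0 < T i. Proof. by have := T1 i; lra. Qed.

Lemma polyb_lowup : polyb X lowup.
Proof.
apply: (@polyb_bounded _ _ _ _ 1) => i; rewrite Normc.normcV invf_le1.
  by rewrite /Normc.normc expr0n add0r sqrtr_sqr normrN; have := T1 i; have := ler_norm (2 * T i); lra.
by rewrite /Normc.normc expr0n add0r sqrtr_sqr normrN normr_gt0; have := T0 i; lra.
Qed.

Lemma lo_upE c i M y : L c i M y * U c i M y = lowup i * (L c i M y - U c i M y).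
Proof.
have nz (x z : R) : z != 0 -> (x +i* z)%C != 0 by move=> z0; rewrite eq_complex /= negb_and z0 orbT.
have t0 := lt0r_neq0 (T0 i).
have z1 : (y%:C%C - lo T c i M) != 0 by apply: nz => /=; rewrite sub0r opprK.
have z2 : (y%:C%C - up T c i M) != 0 by apply: nz => /=; rewrite sub0r oppr_eq0.
have z3 : Complex 0 (- (2 * T i)) != 0 by apply: nz; rewrite oppr_eq0 mulf_neq0 // pnatr_eq0.
have E : y%:C%C - lo T c i M = y%:C%C - up T c i M - Complex 0 (- (2 * T i)).
  by apply/eqP; rewrite eq_complex /=; apply/andP; split; apply/eqP; ring.
by rewrite /resolvent /lowup E in z1 *; field; rewrite z1 z2 z3.
Qed.

Lemma lo_up_pf c i M y p q : L c i M y ^+ p.+1 * U c i M y ^+ q.+1 =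
  pf (L c i M y) (lowup i) p.+1 q.+1 + pf (U c i M y) (- lowup i) q.+1 p.+1.
Proof. by apply: partial_fractions => //; exact: lo_upE. Qed.

(** On each line the lower and upper poles are separated by partial fractions. Products of two poles
    on the same side vanish; the two crossed products are given by [dbl_pair] and are equal by
    [diag_sign]. *)
Lemma dbl_diag c c' k l k' l' :
  (forall i, X i <= `|(c i - c' i)^-1|) -> polyb X (fun i => ((c i - c' i)^-1)%:C%C) ->
  dbl T X (fun i M y => L c i M y ^+ k.+1 * U c i M y ^+ l.+1 *
       (L c' i M y ^+ k'.+1 * U c' i M y ^+ l'.+1))
    (fun i => (4 * pi ^+ 2 * 'C(k + l, k)%:R * 'C(k' + l', k')%:R * `|(c i - c' i)^-1|)%:C%C
       * (-1) ^+ (k + k').+1 * lowup i ^+ ((k + l).+1 + (k' + l').+1)).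
Proof.
move=> hX hp.
have hX' i : X i <= `|(c' i - c i)^-1| by rewrite distrC_inv.
have hp' : polyb X (fun i => ((c' i - c i)^-1)%:C%C).
  by case: hp => K [e H]; exists K, e => i; rewrite normc_real distrC_inv -normc_real.
have hD := polyb_lowup; have hD' := polybN hD.
have ll p q : dbl T X (fun i M y => L c i M y ^+ p.+1 * L c' i M y ^+ q.+1)
    (fun i => if (p == 0%N) && (q == 0%N) then 0 else 0).
  apply: dbl_ext (dbl_same T X p q _) => [//|i|i M]; first by case: ifP.
  by rewrite /= mulrNN mulr_gt0.
have uu p q : dbl T X (fun i M y => U c i M y ^+ p.+1 * U c' i M y ^+ q.+1)
    (fun i => if (p == 0%N) && (q == 0%N) then 0 else 0).
  apply: dbl_ext (dbl_same T X p q _) => [//|i|i M]; first by case: ifP.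
  by rewrite /= mulr_gt0.
have lu p q := dbl_pair T1 X1 p q hX hp.
have ul p q : dbl T X (fun i M y => U c i M y ^+ p.+1 * L c' i M y ^+ q.+1)
    (fun i => if (p == 0%N) && (q == 0%N) then (2 * pi ^+ 2 * `|(c i - c' i)^-1|)%:C%C else 0).
  apply: dbl_ext (dbl_pair T1 X1 q p hX' hp') => [i M y|i]; first by rewrite mulrC.
  by rewrite andbC distrC_inv.
have h1 := dbl_pf_pf T1 X1 k l.+1 k' l'.+1 ll hD hD.
have h2 := dbl_pf_pf T1 X1 l k.+1 l' k'.+1 uu hD' hD'.
have h3 := dbl_pf_pf T1 X1 k l.+1 l' k'.+1 lu hD hD'.
have h4 := dbl_pf_pf T1 X1 l k.+1 k' l'.+1 ul hD' hD.
apply: dbl_ext (dblD T1 X1 (dblD T1 X1 h1 h2) (dblD T1 X1 h3 h4)) => [i M y|i].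
  by rewrite !lo_up_pf; do 4 (move: (pf _ _ _ _) => ?); ring.
rewrite !mulr0 !add0r !addSn !subn1 /=.
rewrite ![(l + k)%N]addnC ![(l' + k')%N]addnC.
have e1 : 'C(k + l, l) = 'C(k + l, k) by rewrite -(@bin_sub (k + l) k) ?leq_addr // addKn.
have e2 : 'C(k' + l', l') = 'C(k' + l', k') by rewrite -(@bin_sub (k' + l') k') ?leq_addr // addKn.
rewrite e1 e2 diag_sign -addSn.
have -> : (4 * pi ^+ 2 * 'C(k + l, k)%:R * 'C(k' + l', k')%:R * `|(c i - c' i)^-1|)%:C%C =
    2 * (2 * pi ^+ 2 * `|(c i - c' i)^-1|)%:C%C * 'C(k + l, k)%:R * 'C(k' + l', k')%:R :> C.
  rewrite -!(rmorph_nat (@real_complex R)) -!(rmorphM (@real_complex R)); congr (real_complex _ _); ring.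
by [].
Qed.

(** The sign hypotheses say that [c''] lies strictly between [c] and [c']. Once the pair of poles on
    the line [c''] is separated, one pole is isolated on its side of the axis, and its shifts to the
    two opposite poles have the same sign, as [dbl_triple] requires. *)
Lemma dbl_offdiag c c' c'' k l k' l' (e1 e2 e3 : I -> R) :
  (forall i, c i != c' i) -> (forall i, c i != c'' i) -> (forall i, c'' i != c' i) ->
  (forall i, (c i - c' i)^-1 = e1 i) -> (forall i, (c i - c'' i)^-1 = e2 i) ->
  (forall i, (c'' i - c' i)^-1 = e3 i) ->
  polyb X (fun i => (e1 i)%:C%C) -> polyb X (fun i => (e2 i)%:C%C) -> polyb X (fun i => (e3 i)%:C%C) ->
  (forall i, X i <= `|e1 i|) -> (forall i, X i <= `|e2 i|) -> (forall i, X i <= `|e3 i|) ->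
  (forall i, Num.sg (e1 i) = Num.sg (e2 i)) -> (forall i, Num.sg (e1 i) = Num.sg (e3 i)) ->
  (forall i, 1 <= `|e2 i - e1 i|) -> (forall i, 1 <= `|e3 i - e1 i|) ->
  dbl T X (fun i M y => L c i M y ^+ k.+1 * U c' i M y ^+ l.+1 *
       (L c'' i M y ^+ k'.+1 * U c'' i M y ^+ l'.+1)) (fun=> 0).
Proof.
move=> n1 n2 n3 E1 E2 E3 p1 p2 p3 x1 x2 x3 s2 s3 d2 d3.
have hD := polyb_lowup; have hD' := polybN hD.
have rr (e : I -> R) : (forall i, X i <= `|e i|) -> forall i, T i * X i <= `|2 * T i * e i|.
  move=> xe i; rewrite normrM gtr0_norm ?mulr_gt0 //; have := T0 i; have := X1 i => y1 t0.
  by apply: ler_pM; [lra|lra|lra|exact: xe].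
have sg (e e' : I -> R) : (forall i, Num.sg (e i) = Num.sg (e' i)) ->
    forall i, Num.sg (2 * T i * e i) = Num.sg (2 * T i * e' i).
  by move=> h i; rewrite !sgrM h.
have dd (e e' : I -> R) : (forall i, 1 <= `|e' i - e i|) ->
    forall i, 1 <= `|2 * T i * e' i - 2 * T i * e i|.
  move=> h i; rewrite -mulrBr normrM gtr0_norm ?mulr_gt0 //.
  by have := T1 i; have := h i; nra.
have pn (e : I -> R) : polyb X (fun i => (e i)%:C%C) -> polyb X (fun i => (- e i)%:C%C).
  by move=> h; case: h => K [n H]; exists K, n => i; rewrite normc_real normrN -normc_real.
have imlu (b b' : I -> R) i M : complex.Im (lo T b i M) * complex.Im (up T b' i M) < 0.
  by rewrite /= mulNr oppr_lt0 mulr_gt0.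
have imul (b b' : I -> R) i M : complex.Im (up T b i M) * complex.Im (lo T b' i M) < 0.
  by rewrite mulrC.
have g1 r : dbl T X (fun i M y => (L c i M y ^+ k.+1 * U c' i M y ^+ l.+1) * U c'' i M y ^+ r.+1) (fun=> 0).
  apply: (@dbl_triple _ _ T X T1 X1 (lo T c) (up T c') (up T c'') (fun i => - e1 i) (fun i => - e2 i)
    (fun i => 2 * T i * e1 i) (fun i => 2 * T i * e2 i) (fun=> pv2 (Complex 0 (-1)))) => //.
  - by move=> i M; rewrite lo_up // E1 rmorphN.
  - by move=> i M; rewrite lo_up // E2 rmorphN.
  - by move=> i M; rewrite /pv2 /= !ltr0_sg ?oppr_lt0.
  - exact: pn.
  - exact: pn.
  - exact: polyb_cst.
  - exact: rr.
  - exact: rr.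
  - exact: sg.
  - exact: dd.
have g2 r : dbl T X (fun i M y => (L c i M y ^+ k.+1 * U c' i M y ^+ l.+1) * L c'' i M y ^+ r.+1) (fun=> 0).
  apply: (@dbl_ext _ _ T X (fun i M y => U c' i M y ^+ l.+1 * L c i M y ^+ k.+1 * L c'' i M y ^+ r.+1) _ (fun=> 0)) => //.
    by move=> i M y; rewrite [X in _ = X * _]mulrC.
  apply: (@dbl_triple _ _ T X T1 X1 (up T c') (lo T c) (lo T c'') e1 e3
    (fun i => 2 * T i * e1 i) (fun i => 2 * T i * e3 i) (fun=> pv2 (Complex 0 1))) => //.
  - by move=> i M; rewrite up_lo // E1.
  - by move=> i M; rewrite up_lo // E3.
  - by move=> i M; rewrite /pv2 /= !gtr0_sg.
  - exact: polyb_cst.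
  - exact: rr.
  - exact: rr.
  - exact: sg.
  - exact: dd.
have h1 := dbl_pf_zero T1 X1 k'.+1 l'.+1 g2 hD.
have h2 := dbl_pf_zero T1 X1 l'.+1 k'.+1 g1 hD'.
apply: dbl_ext (dblD T1 X1 h1 h2) => [i M y|i]; last by rewrite addr0.
by rewrite -mulrDr -lo_up_pf.
Qed.

End Lines.

(** * Expansion of a triple product of inverse linear forms *)

Section Expansion.
Variable K : comNzRingType.

(** For [P], [Q], [P'] the inverses of z1, z2 and z1 + z2, this is the part of P^a Q^b P'^c, of
    total degree [w], that contains powers of [P]. The binomials are those of Z in the summation
    index counted from 0. *)
Definition pexp (a b w : nat) (P P' : K) : K :=
  \sum_(0 <= k < a) 'C(a + b - k - 2, b - 1)%:R * (P ^+ k.+1 * P' ^+ (w - k - 1)).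

Let sq (n : nat) : (-1) ^+ n * (-1) ^+ n = 1 :> K.
Proof. by rewrite -exprMn mulN1r opprK expr1n. Qed.

Lemma pexp_rev a b c (P P' : K) : (0 < b)%N ->
  pexp a b (a + b + c) P P' =
  \sum_(0 <= k < a) 'C(b + k - 1, k)%:R * P' ^+ (b + k) * P ^+ (a - k) * P' ^+ c.
Proof.
move=> b0; rewrite /pexp big_nat_rev /= add0n.
apply: eq_big_nat => k ka.
have -> : (a + b - (a - k.+1) - 2 = b + k - 1)%N by lia.
have -> : (a - k.+1).+1 = (a - k)%N by lia.
have -> : (a + b + c - (a - k.+1) - 1 = b + k + c)%N by lia.
have -> : 'C(b + k - 1, b - 1) = 'C(b + k - 1, k).
  by rewrite -bin_sub; [congr ('C(_, _)); lia|lia].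
by rewrite !exprD; ring.
Qed.

(** This is [partial_fractions] for [P] and [- Q] with [D] equal to [- P']; all signs cancel, which
    leaves positive coefficients. *)
Lemma pexpE a b c (P Q P' : K) : (0 < a)%N -> (0 < b)%N -> P * Q = P' * (P + Q) ->
  P ^+ a * Q ^+ b * P' ^+ c = pexp a b (a + b + c) P P' + pexp b a (a + b + c) Q P'.
Proof.
move=> a0 b0 h.
have h1 : P * - Q = - P' * (P - - Q) by rewrite mulrN h opprK mulNr.
have E := partial_fractions (p := a) (q := b) h1 (ltn_addl _ b0).
rewrite (exprNn Q) in E.
have {E} -> : P ^+ a * Q ^+ b = (-1) ^+ b * pf P (- P') a b + (-1) ^+ b * pf (- Q) (- - P') b a.
  by rewrite -mulrDr -E; have := sq b; move: ((-1) ^+ b) => s ss; ring: ss.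
rewrite mulrDl /pf opprK pexp_rev // [in pexp b a _ _ _](addnC a) pexp_rev //.
congr (_ + _); rewrite mulr_sumr mulr_suml; apply: eq_big_nat => k kb.
  rewrite (exprNn P') (exprD (-1)).
  have := sq b; have := sq k; move: ((-1) ^+ k) ((-1) ^+ b) => s t ss tt.
  by move: (P' ^+ (b + k)) => d; ring: ss tt.
rewrite (exprNn Q); have e : (-1) ^+ b = (-1) ^+ (b - k) * (-1) ^+ k :> K by rewrite -exprD subnK // ltnW // (andP kb).2.
rewrite e; have := sq k; have := sq (b - k)%N; move: ((-1) ^+ k) ((-1) ^+ (b - k)) => s t ss tt.
ring: ss tt.
Qed.

End Expansion.

(** * Classes with n_1 and n_2 of the same sign *)

Section SameSign.
Variable R : realType.
Local Notation C := R[i].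
Variables (I : Type) (T X : I -> R).
Hypotheses (T1 : forall i, 1 <= T i) (X1 : forall i, 1 <= X i).
Implicit Types (x c : I -> R).

Definition Lo x c i M y : C := ((x i)^-1)%:C%C * resolvent (lo T c i M) y.
Definition Up x c i M y : C := ((x i)^-1)%:C%C * resolvent (up T c i M) y.

(** The contribution of one class to Z, with x = n_1 and x' = n_1 + n_2: summation over positive
    n_1, n_2 turns each monomial into a depth-two zeta value. *)
Definition zcoef (a b w : nat) (x x' : R) : R :=
  \sum_(0 <= k < a) \sum_(0 <= l < a)
    'C(a + b - k - 2, b - 1)%:R * 'C(a + b - l - 2, b - 1)%:R * 'C(k + l, k)%:R
    * 'C(2 * w - k - l - 4, w - k - 2)%:R * x^-1 ^+ (k + l + 1) * x'^-1 ^+ (2 * w - k - l - 3).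

Let T0 i : 0 < T i. Proof. by have := T1 i; lra. Qed.

Lemma polyb_invr x n : (forall i, 1 <= x i) -> polyb X (fun i => ((x i)^-1)%:C%C ^+ n).
Proof.
move=> x1; apply: polybX => //; apply: (@polyb_bounded _ _ _ _ 1) => i.
by rewrite normc_real ger0_norm ?invr_ge0 ?invf_le1 //; have := x1 i; lra.
Qed.

(** The factor 1 / |c - c'| = x x' from [dbl_diag] lowers both exponents of the inverses by one,
    which produces the exponents of [zcoef]. *)
Lemma dbl_pexp_diag x x' c c' a b w :
  (forall i, 1 <= x i) -> (forall i, 1 <= x' i) -> (0 < b)%N -> (a + b < w)%N ->
  (forall i, X i <= `|(c i - c' i)^-1|) -> polyb X (fun i => ((c i - c' i)^-1)%:C%C) ->
  (forall i, `|(c i - c' i)^-1| = x i * x' i) ->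
  dbl T X (fun i M y => pexp a b w (Lo x c i M y) (Lo x' c' i M y)
                      * pexp a b w (Up x c i M y) (Up x' c' i M y))
    (fun i => (4 * pi ^+ 2 * (2 * T i)^-1 ^+ (2 * w - 2) * zcoef a b w (x i) (x' i))%:C%C).
Proof.
move=> x1 x1' b0 abw hX hp he.
pose cf k l i : C := 'C(a + b - k - 2, b - 1)%:R * 'C(a + b - l - 2, b - 1)%:R *
   (((x i)^-1)%:C%C ^+ (k + l + 2) * ((x' i)^-1)%:C%C ^+ (2 * w - k - l - 2)).
have hcf k l : polyb X (cf k l).
  apply: polybM => //; first exact: polyb_cst.
  by apply: polybM => //; exact: polyb_invr.
have h : dbl T X (fun i M y => \sum_(k <- index_iota 0 a) \sum_(l <- index_iota 0 a)
   cf k l i * (resolvent (lo T c i M) y ^+ k.+1 * resolvent (up T c i M) y ^+ l.+1 *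
     (resolvent (lo T c' i M) y ^+ (w - k - 2).+1 * resolvent (up T c' i M) y ^+ (w - l - 2).+1)))
   (fun i => \sum_(k <- index_iota 0 a) \sum_(l <- index_iota 0 a) cf k l i *
     ((4 * pi ^+ 2 * 'C(k + l, k)%:R * 'C((w - k - 2) + (w - l - 2), (w - k - 2))%:R * `|(c i - c' i)^-1|)%:C%C
       * (-1) ^+ (k + (w - k - 2)).+1 * lowup T i ^+ ((k + l).+1 + ((w - k - 2) + (w - l - 2)).+1))).
  apply: dbl_sum => // k _; apply: dbl_sum => // l _; apply: dblZ => //.
  exact: dbl_diag.
apply: dbl_ext h => [i M y|i].
  rewrite /pexp big_distrlr /=; apply: eq_big_nat => k /= ka; apply: eq_big_nat => l /= la.
  rewrite /cf /Lo /Up !exprMn.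
  have -> : (k + l + 2 = k.+1 + l.+1)%N by lia.
  have -> : (2 * w - k - l - 2 = (w - k - 1) + (w - l - 1))%N by lia.
  have -> : (w - k - 2).+1 = (w - k - 1)%N by lia.
  have -> : (w - l - 2).+1 = (w - l - 1)%N by lia.
  by rewrite !(exprD _ _ (_ - _ - _)) (exprD _ k.+1); ring.
have t0 := lt0r_neq0 (T0 i).
have lw : (-1) ^+ w.-1 * lowup T i ^+ (2 * w - 2) = ((2 * T i)^-1 ^+ (2 * w - 2))%:C%C.
  have -> : (2 * w - 2 = 2 * w.-1)%N by lia.
  rewrite !exprM -exprMn rmorphXn /=; congr (_ ^+ _).
  have -> : lowup T i = Complex 0 ((2 * T i)^-1).
    have z3 : Complex 0 (- (2 * T i)) != 0 :> C by rewrite eq_complex /= eqxx /= oppr_eq0 mulf_neq0 // pnatr_eq0.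
    apply: (mulfI z3); rewrite /lowup mulfV //.
    by apply/eqP; rewrite eq_complex /=; apply/andP; split; apply/eqP; field.
  by apply/eqP; rewrite mulN1r eq_complex /=; apply/andP; split; apply/eqP; ring.
rewrite (rmorphM (@real_complex R)) (rmorphM (@real_complex R)) /= -lw.
have e0 : (2 * w - 2 = w.-1 + w.-1)%N by lia.
rewrite /zcoef (rmorph_sum (@real_complex R)) mulr_sumr; apply: eq_big_nat => k /= ka.
rewrite (rmorph_sum (@real_complex R)) mulr_sumr; apply: eq_big_nat => l /= la.
have -> : (k + (w - k - 2)).+1 = w.-1 by lia.
have -> : ((k + l).+1 + (w - k - 2 + (w - l - 2)).+1 = 2 * w - 2)%N by lia.
have -> : (w - k - 2 + (w - l - 2) = 2 * w - k - l - 4)%N by lia.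
rewrite he /cf -!rmorphXn -!(rmorph_nat (@real_complex R)) /=.
have -> : (2 * w - k - l - 2 = (2 * w - k - l - 3).+1)%N by lia.
have -> : (k + l + 2 = (k + l + 1).+1)%N by lia.
have x0 : x i != 0 by have := x1 i; move=> ?; apply/eqP; lra.
have x0' : x' i != 0 by have := x1' i; move=> ?; apply/eqP; lra.
have gather (r1 r2 r3 r4 : R) (s d : C) : r1 * r2 = r3 * r4 ->
    r1%:C%C * (r2%:C%C * s * d) = r3%:C%C * (s * d) * r4%:C%C.
  move=> e; rewrite (_ : _ * _ = (r1%:C%C * r2%:C%C) * (s * d)); last by ring.
  by rewrite -(rmorphM (@real_complex R)) e (rmorphM (@real_complex R)) /=; ring.
rewrite -!(rmorphM (@real_complex R)); apply: gather.
rewrite !exprS; have xx : (x i)^-1 * x i = 1 by rewrite mulVf.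
have xx' : (x' i)^-1 * x' i = 1 by rewrite mulVf.
move: ((x i)^-1 ^+ _) ((x' i)^-1 ^+ _) => y y'.
by move: (x i)^-1 (x' i)^-1 xx xx' => z z' xx xx'; ring: xx xx'.
Qed.

Lemma dbl_pexp_off x y z c c' c'' a a' b b' w (e1 e2 e3 : I -> R) :
  (forall i, 1 <= x i) -> (forall i, 1 <= y i) -> (forall i, 1 <= z i) ->
  (a + 1 < w)%N -> (a' + 1 < w)%N ->
  (forall i, c i != c' i) -> (forall i, c i != c'' i) -> (forall i, c'' i != c' i) ->
  (forall i, (c i - c' i)^-1 = e1 i) -> (forall i, (c i - c'' i)^-1 = e2 i) ->
  (forall i, (c'' i - c' i)^-1 = e3 i) ->
  polyb X (fun i => (e1 i)%:C%C) -> polyb X (fun i => (e2 i)%:C%C) -> polyb X (fun i => (e3 i)%:C%C) ->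
  (forall i, X i <= `|e1 i|) -> (forall i, X i <= `|e2 i|) -> (forall i, X i <= `|e3 i|) ->
  (forall i, Num.sg (e1 i) = Num.sg (e2 i)) -> (forall i, Num.sg (e1 i) = Num.sg (e3 i)) ->
  (forall i, 1 <= `|e2 i - e1 i|) -> (forall i, 1 <= `|e3 i - e1 i|) ->
  dbl T X (fun i M s => pexp a b w (Lo x c i M s) (Lo z c'' i M s)
                      * pexp a' b' w (Up y c' i M s) (Up z c'' i M s)) (fun=> 0).
Proof.
move=> x1 y1 z1 aw aw' n1 n2 n3 E1 E2 E3 p1 p2 p3 l1 l2 l3 s2 s3 d2 d3.
pose cf k l i : C := 'C(a + b - k - 2, b - 1)%:R * 'C(a' + b' - l - 2, b' - 1)%:R *
   (((x i)^-1)%:C%C ^+ k.+1 * ((y i)^-1)%:C%C ^+ l.+1 * ((z i)^-1)%:C%C ^+ (2 * w - k - l - 2)).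
have hcf k l : polyb X (cf k l).
  apply: polybM => //; first exact: polyb_cst.
  by apply: polybM => //; [apply: polybM => //|]; exact: polyb_invr.
have h : dbl T X (fun i M s => \sum_(k <- index_iota 0 a) \sum_(l <- index_iota 0 a')
   cf k l i * (resolvent (lo T c i M) s ^+ k.+1 * resolvent (up T c' i M) s ^+ l.+1 *
     (resolvent (lo T c'' i M) s ^+ (w - k - 2).+1 * resolvent (up T c'' i M) s ^+ (w - l - 2).+1)))
   (fun i => \sum_(k <- index_iota 0 a) \sum_(l <- index_iota 0 a') cf k l i * 0).
  apply: dbl_sum => // k _; apply: dbl_sum => // l _; apply: dblZ => //.
  exact: (dbl_offdiag T1 X1 _ _ _ _ n1 n2 n3 E1 E2 E3).
apply: dbl_ext h => [i M s|i]; last by rewrite big1 // => k _; rewrite big1 // => l _; rewrite mulr0.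
rewrite /pexp big_distrlr /=; apply: eq_big_nat => k /= ka; apply: eq_big_nat => l /= la.
rewrite /cf /Lo /Up !exprMn.
have -> : (2 * w - k - l - 2 = (w - k - 1) + (w - l - 1))%N by lia.
have -> : (w - k - 2).+1 = (w - k - 1)%N by lia.
have -> : (w - l - 2).+1 = (w - l - 1)%N by lia.
by rewrite (exprD _ (w - k - 1)); ring.
Qed.

End SameSign.

Section SameSignTotal.
Variable R : realType.
Local Notation C := R[i].
Variables (I : Type) (T x1 x2 u1 u2 : I -> R).
Hypotheses (T1 : forall i, 1 <= T i) (h1 : forall i, 1 <= x1 i) (h2 : forall i, 1 <= x2 i)
  (hu : forall i, u1 i * x2 i - u2 i * x1 i = 1).

Let X i := x1 i * x2 i.
Let x3 i := x1 i + x2 i.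
Let c1 i := u1 i / x1 i.
Let c2 i := u2 i / x2 i.
(** The mediant of [c1] and [c2]. By the determinant condition [hu], the slopes differ by inverses
    of products of two of x1, x2, x3, and c3 lies between the other two. *)
Let c3 i := (u1 i + u2 i) / (x1 i + x2 i).

Let X1 i : 1 <= X i.
Proof. by rewrite /X; have := h1 i; have := h2 i; nra. Qed.

Let d12 i : c1 i - c2 i = (x1 i * x2 i)^-1.
Proof.
by rewrite -[RHS]mul1r -(hu i) /c1 /c2; field; rewrite !lt0r_neq0 //; have := h1 i; have := h2 i; lra.
Qed.

Let d13 i : c1 i - c3 i = (x1 i * x3 i)^-1.
Proof.
by rewrite -[RHS]mul1r -(hu i) /c1 /c3 /x3; field; rewrite !lt0r_neq0 //; have := h1 i; have := h2 i; lra.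
Qed.

Let d32 i : c3 i - c2 i = (x2 i * x3 i)^-1.
Proof.
by rewrite -[RHS]mul1r -(hu i) /c2 /c3 /x3; field; rewrite !lt0r_neq0 //; have := h1 i; have := h2 i; lra.
Qed.

Let inv_add (z1 z2 : C) : z1 != 0 -> z2 != 0 -> z1 + z2 != 0 ->
  z1^-1 * z2^-1 = (z1 + z2)^-1 * (z1^-1 + z2^-1).
Proof. by move=> n1 n2 n3; field; rewrite n1 n2 n3. Qed.

Let line_ne0 (x v y t : R) : 1 <= x -> 1 <= `|t| ->
  x%:C%C * (y%:C%C - Complex (- v) t) != 0.
Proof.
move=> x0 t0; rewrite eq_complex /= negb_and; apply/orP; right.
rewrite !mul0r addr0 sub0r mulf_neq0 //; first by apply/eqP; lra.
by rewrite oppr_eq0 -normr_gt0; lra.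
Qed.

Let lineD i M (y t : R) :
  (x3 i)%:C%C * (y%:C%C - Complex (- (c3 i * M)) t) =
  (x1 i)%:C%C * (y%:C%C - Complex (- (c1 i * M)) t) + (x2 i)%:C%C * (y%:C%C - Complex (- (c2 i * M)) t).
Proof.
have x0 : x1 i != 0 by have := h1 i => ?; apply/eqP; lra.
have x0' : x2 i != 0 by have := h2 i => ?; apply/eqP; lra.
have x0'' : x1 i + x2 i != 0 by have := h1 i; have := h2 i => ? ?; apply/eqP; lra.
apply/eqP; rewrite eq_complex /= /x3 /c1 /c2 /c3; apply/andP; split; apply/eqP; field.
all: by rewrite ?x0 ?x0' ?x0''.
Qed.

Let line_add i M (y t : R) : 1 <= `|t| ->
  ((x1 i)^-1)%:C%C * (y%:C%C - Complex (- (c1 i * M)) t)^-1 *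
    (((x2 i)^-1)%:C%C * (y%:C%C - Complex (- (c2 i * M)) t)^-1) =
  ((x3 i)^-1)%:C%C * (y%:C%C - Complex (- (c3 i * M)) t)^-1 *
  (((x1 i)^-1)%:C%C * (y%:C%C - Complex (- (c1 i * M)) t)^-1 +
    ((x2 i)^-1)%:C%C * (y%:C%C - Complex (- (c2 i * M)) t)^-1).
Proof.
have e (x : R) (z : C) : (x^-1)%:C%C * z^-1 = (x%:C%C * z)^-1 by rewrite fmorphV invfM.
move=> t1; rewrite !e lineD; apply: inv_add; [exact: line_ne0|exact: line_ne0|].
by rewrite -lineD; apply: line_ne0 => //; rewrite /x3; have := h1 i; have := h2 i; lra.
Qed.

Lemma dbl_same_sign a b c : (0 < a)%N -> (0 < b)%N -> (0 < c)%N ->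
  dbl T X (fun i M y =>
     (Lo T x1 c1 i M y ^+ a * Lo T x2 c2 i M y ^+ b * Lo T x3 c3 i M y ^+ c)
   * (Up T x1 c1 i M y ^+ a * Up T x2 c2 i M y ^+ b * Up T x3 c3 i M y ^+ c))
  (fun i => (4 * pi ^+ 2 * (2 * T i)^-1 ^+ (2 * (a + b + c) - 2) *
     (zcoef a b (a + b + c) (x1 i) (x3 i) + zcoef b a (a + b + c) (x2 i) (x3 i)))%:C%C).
Proof.
move=> a0 b0 c0; set w := (a + b + c)%N.
have h3 i : 1 <= x3 i by rewrite /x3; have := h1 i; have := h2 i; lra.
have nn12 i : 1 <= x1 i * x2 i by have := X1 i.
have nn13 i : 1 <= x1 i * x3 i by have := h1 i; have := h3 i; nra.
have nn23 i : 1 <= x2 i * x3 i by have := h2 i; have := h3 i; nra.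
have le13 i : X i <= x1 i * x3 i by rewrite /X /x3; have := h1 i; have := h2 i; nra.
have le23 i : X i <= x2 i * x3 i by rewrite /X /x3; have := h1 i; have := h2 i; nra.
have XX i : X i ^+ 2 = x1 i ^+ 2 * x2 i ^+ 2 by rewrite exprMn.
have sqb (x : R) : 1 <= x -> 1 <= x ^+ 2 by move=> x1'; rewrite expr_ge1 //; lra.
have up13 i : x1 i * x3 i <= 2 * X i ^+ 2.
  rewrite XX /x3; have := h1 i; have := h2 i; have := sqb _ (h1 i); have := sqb _ (h2 i).
  have : x1 i * x2 i <= x1 i ^+ 2 * x2 i ^+ 2 by rewrite -exprMn expr2; have := nn12 i; nra.
  by rewrite mulrDr -expr2; move: (x1 i ^+ 2) (x2 i ^+ 2) => p q; nra.
have up23 i : x2 i * x3 i <= 2 * X i ^+ 2.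
  rewrite XX /x3; have := h1 i; have := h2 i; have := sqb _ (h1 i); have := sqb _ (h2 i).
  have : x1 i * x2 i <= x1 i ^+ 2 * x2 i ^+ 2 by rewrite -exprMn expr2; have := nn12 i; nra.
  by rewrite mulrDr -expr2 [x2 i * x1 i]mulrC; move: (x1 i ^+ 2) (x2 i ^+ 2) => p q; nra.
have p12 : polyb X (fun i => (x1 i * x2 i)%:C%C).
  by exists 1, 1%N => i; rewrite normc_real expr1 mul1r ger0_norm //; have := nn12 i; lra.
have p13 : polyb X (fun i => (x1 i * x3 i)%:C%C).
  by exists 2, 2%N => i; rewrite normc_real ger0_norm //; have := nn13 i; lra.
have p23 : polyb X (fun i => (x2 i * x3 i)%:C%C).
  by exists 2, 2%N => i; rewrite normc_real ger0_norm //; have := nn23 i; lra.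
have pn (e : I -> R) : polyb X (fun i => (e i)%:C%C) -> polyb X (fun i => (- e i)%:C%C).
  by move=> h; case: h => K [n H]; exists K, n => i; rewrite normc_real normrN -normc_real.
have E12 i : (c1 i - c2 i)^-1 = x1 i * x2 i by rewrite d12 invrK.
have E13 i : (c1 i - c3 i)^-1 = x1 i * x3 i by rewrite d13 invrK.
have E32 i : (c3 i - c2 i)^-1 = x2 i * x3 i by rewrite d32 invrK.
have E21 i : (c2 i - c1 i)^-1 = - (x1 i * x2 i) by rewrite -opprB invrN E12.
have E31 i : (c3 i - c1 i)^-1 = - (x1 i * x3 i) by rewrite -opprB invrN E13.
have E23 i : (c2 i - c3 i)^-1 = - (x2 i * x3 i) by rewrite -opprB invrN E32.
have ne (s t : R) : 1 <= `|(s - t)^-1| -> s != t.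
  by apply: contraTneq => ->; rewrite subrr invr0 normr0; apply/negP; lra.
have abs (s : R) : 1 <= s -> `|s| = s by move=> s1; rewrite ger0_norm //; lra.
have sgp (s : R) : 1 <= s -> Num.sg s = 1 by move=> s1; rewrite gtr0_sg //; lra.
have sgn (s : R) : 1 <= s -> Num.sg (- s) = -1 by move=> s1; rewrite ltr0_sg //; lra.
have n12 i : c1 i != c2 i by apply: ne; rewrite E12 abs.
have n13 i : c1 i != c3 i by apply: ne; rewrite E13 abs.
have n32 i : c3 i != c2 i by apply: ne; rewrite E32 abs.
have g1 := @dbl_pexp_diag R I T X T1 X1 x1 x3 c1 c3 a b w h1 h3 b0.
have g2 := @dbl_pexp_diag R I T X T1 X1 x2 x3 c2 c3 b a w h2 h3 a0.
have g3 := @dbl_pexp_off R I T X T1 X1 x1 x2 x3 c1 c2 c3 a b b a w _ _ _ h1 h2 h3.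
have g4 := @dbl_pexp_off R I T X T1 X1 x2 x1 x3 c2 c1 c3 b a a b w _ _ _ h2 h1 h3.
have dp i : 1 <= `|x1 i * x3 i - x1 i * x2 i|.
  by rewrite -mulrBr /x3 addrK -expr2 abs; exact: sqb.
have dq i : 1 <= `|x2 i * x3 i - x1 i * x2 i|.
  by rewrite [x1 i * _]mulrC -mulrBr /x3 [x1 i + _]addrC addrK -expr2 abs; exact: sqb.
have w1 : (a + b < w)%N by rewrite /w; lia.
have w2 : (b + a < w)%N by rewrite /w; lia.
have w3 : (a + 1 < w)%N by rewrite /w; lia.
have w4 : (b + 1 < w)%N by rewrite /w; lia.
have X13 i : X i <= `|(c1 i - c3 i)^-1| by rewrite E13 abs.
have X23 i : X i <= `|(c2 i - c3 i)^-1| by rewrite E23 normrN abs.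
have V13 i : `|(c1 i - c3 i)^-1| = x1 i * x3 i by rewrite E13 abs.
have V23 i : `|(c2 i - c3 i)^-1| = x2 i * x3 i by rewrite E23 normrN abs.
have P13 : polyb X (fun i => ((c1 i - c3 i)^-1)%:C%C).
  by rewrite (_ : (fun i => _) = fun i => (x1 i * x3 i)%:C%C) //; apply/funext => i; rewrite E13.
have P23 : polyb X (fun i => ((c2 i - c3 i)^-1)%:C%C).
  by rewrite (_ : (fun i => _) = fun i => (- (x2 i * x3 i))%:C%C); [exact: pn|apply/funext => i; rewrite E23].
have k1 := g1 w1 X13 P13 V13.
have k2 := g2 w2 X23 P23 V23.
have k3 := g3 _ _ _ w3 w4 n12 n13 n32 E12 E13 E32 p12 p13 p23.
have k4 := g4 _ _ _ w4 w3 _ _ _ E21 E23 E31 (pn _ p12) (pn _ p23) (pn _ p13).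
have {}k3 : dbl T X (fun i M s => pexp a b w (Lo T x1 c1 i M s) (Lo T x3 c3 i M s)
    * pexp b a w (Up T x2 c2 i M s) (Up T x3 c3 i M s)) (fun=> 0).
  by apply: k3 => i; rewrite ?(sgp _ (nn12 i)) ?(sgp _ (nn13 i)) ?(sgp _ (nn23 i)) ?(abs _ (nn12 i)) ?(abs _ (nn13 i)) ?(abs _ (nn23 i)).
have {}k4 : dbl T X (fun i M s => pexp b a w (Lo T x2 c2 i M s) (Lo T x3 c3 i M s)
    * pexp a b w (Up T x1 c1 i M s) (Up T x3 c3 i M s)) (fun=> 0).
  have dn (p q : R) : `|- p - - q| = `|p - q| by rewrite -opprD normrN.
  have nsym (p q : R) : p != q -> q != p by rewrite eq_sym.
  by apply: k4 => i; rewrite ?dn ?normrN ?(sgn _ (nn12 i)) ?(sgn _ (nn13 i)) ?(sgn _ (nn23 i)) ?(abs _ (nn12 i)) ?(abs _ (nn13 i)) ?(abs _ (nn23 i)) //; exact: nsym.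
apply: dbl_ext (dblD T1 X1 (dblD T1 X1 k1 k2) (dblD T1 X1 k3 k4)) => [i M y|i]; last first.
  by rewrite !addr0 -(rmorphD (@real_complex R)) -mulrDr.
rewrite /w !pexpE // ?[in pexp b a _ _ _](addnC a).
- by move: (pexp _ _ _ _ _) (pexp _ _ _ _ _) => P Q; ring.
- by apply: line_add; rewrite ger0_norm //; have := T1 i; lra.
- by apply: line_add; rewrite normrN ger0_norm //; have := T1 i; lra.
Qed.

End SameSignTotal.

(** * Finite reindexings and sums of m^-k over nonzero m *)

Section SumReindexing.
Variable V : nmodType.

Lemma sum_nat_even (h : nat -> V) P N : (P < 2 * N)%N -> (forall l, odd l -> h l = 0) ->
  \sum_(0 <= l < P.+1) h l = \sum_(0 <= j < N) (if (2 * j <= P)%N then h (2 * j)%N else 0).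
Proof.
move=> PN odd0; pose h' l := if (l <= P)%N then h l else 0.
have -> : \sum_(0 <= l < P.+1) h l = \sum_(0 <= l < 2 * N) h' l.
  rewrite [RHS](big_cat_nat (n := P.+1)) //= [X in _ = _ + X]big1_seq ?addr0.
    by apply: eq_big_nat => l /andP[_ lP]; rewrite /h' -ltnS lP.
  by move=> l; rewrite mem_index_iota /h' => /andP[_ /andP[lP _]]; rewrite leqNgt lP.
elim: N {PN} => [|N IH]; first by rewrite !big_nil.
rewrite [in RHS]big_nat_recr //= -IH mulnS addnC addn2 !big_nat_recr //= -addrA.
have -> : h' (2 * N).+1 = 0 by rewrite /h' odd0 ?if_same //= mul2n odd_double.
by rewrite addr0.
Qed.

Lemma sum_triangle (F : nat -> nat -> V) a :
  \sum_(0 <= i < a) \sum_(0 <= j < a - i) F i j = \sum_(0 <= j < a) \sum_(0 <= i < a - j) F i j.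
Proof.
have w i (f : nat -> V) : \sum_(0 <= j < a - i) f j = \sum_(0 <= j < a) (if (j + i < a)%N then f j else 0).
  rewrite (big_nat_widen _ _ _ _ _ (leq_subr i a)) big_mkcond; apply: eq_big_nat => j _.
  by rewrite ltn_subRL addnC.
under eq_bigr do rewrite w; rewrite exchange_big; apply: eq_bigr => j _ /=.
by rewrite w; apply: eq_bigr => i _; rewrite addnC.
Qed.

End SumReindexing.

Lemma hockey_stick p q : (\sum_(0 <= i < q.+1) 'C(p + i, i) = 'C((p + q).+1, q))%N.
Proof.
elim: q => [|q IH]; first by rewrite big_nat1 !bin0.
by rewrite big_nat_recr //= IH addnS [RHS]binS addnC.
Qed.

Section ZetaValues.
Variable R : realType.
Local Notation C := R[i].

(* The symmetric sum of 1/m^k over the nonzero integers; the value -1 at k = 0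
   accounts for the omitted term m = 0, as the sum of 1 over Z is 0. *)
Definition zs (k : nat) : R :=
  if odd k then 0
  else (-1) ^+ (k./2).+1 * (2 * pi) ^+ k * (ratr (bernoulli k) / k`!%:R).

Lemma zs0 : zs 0 = -1.
Proof. by rewrite /zs /= expr0 expr1 fact0 divr1 rmorph1 !mulr1. Qed.

Lemma csum_real (f : int -> R) s : ssum f s -> csum (fun m => (f m)%:C%C) s%:C%C.
Proof. by move=> fs; split=> //=; exact: ssum0. Qed.

(** The term m = 0 is a positive power of 1/0 = 0, so it is omitted by itself. *)
Lemma csum_inv_pow k : (0 < k)%N ->
  csum (fun m => ((m%:~R : R)^-1)%:C%C ^+ k) (zs k)%:C%C.
Proof.
move=> k0; apply: csum_ext (csum_real (f := fun m : int => (m%:~R : R)^-1 ^+ k) _).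
  by move=> m; rewrite rmorphXn.
case: (boolP (odd k)) => ok; rewrite /zs ?ok ?(negPf ok).
  by apply: ssum_odd => m; rewrite rmorphN invrN -mulN1r exprMn -signr_odd ok expr1 mulN1r.
have ek : k = (2 * k./2)%N by rewrite mul2n even_halfK.
have h0 : (0 < k./2)%N by rewrite half_gt0; case: k k0 ok {ek} => [|[|]].
rewrite [in X in ssum _ X]ek mul2n doubleK -mul2n -zeta_even //.
have z := zeta_cvg (R := R) (s := (2 * k./2)%N) _.
have {}z : \sum_(1 <= m < N.+1) (m%:R ^+ (2 * k./2) : R)^-1 @[N --> \oo] --> zeta R (2 * k./2).
  by have := z ltac:(lia); rewrite -cvg_shiftS.
rewrite /ssum; apply: cvg_eqf; [exact: (cvgMl_tmp (a := 2) z)|move=> N /=|by []].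
rewrite /symsum invr0 expr0n -ek (gtn_eqF k0) add0r mulr_sumr; apply: eq_bigr => m _.
rewrite rmorphN /= invrN -[- _]mulN1r exprMn.
have -> : (-1 : R) ^+ k = 1 by rewrite -signr_odd (negPf ok).
by rewrite mul1r exprVn; ring.
Qed.

Lemma csum_delta (k : C) : csum (fun m => if m == 0 then k else 0) k.
Proof.
have d (r : R) : ssum (fun m => if m == 0 then r else 0) r.
  rewrite /ssum (_ : symsum _ = fun=> r); first exact: cvg_cst.
  apply/funext => N; rewrite /symsum eqxx big_nat big1 ?addr0 // => m /andP[m0 _].
  by rewrite oppr_eq0 eqz_nat (gtn_eqF m0) addr0.
by split; [apply: ssum_ext (d (complex.Re k))|apply: ssum_ext (d (complex.Im k))] => m; case: ifP.
Qed.

Lemma csum_neg (F : int -> C) s : csum F s -> csum (fun m => F (- m)) s.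
Proof.
have e f t : ssum f t -> ssum (fun m : int => f (- m) : R) t.
  rewrite /ssum (_ : symsum (fun m => f (- m)) = symsum f) //.
  by apply/funext => N; rewrite /symsum oppr0; congr (_ + _); apply: eq_bigr => m _; rewrite opprK addrC.
by case=> re im; split; [exact: (e _ _ re)|exact: (e _ _ im)].
Qed.

End ZetaValues.

(** * Classes in which one n_r vanishes *)

Section OneVanishing.
Variable R : realType.
Local Notation C := R[i].
Variables (I : Type) (T : I -> R).
Hypothesis T1 : forall i, 1 <= T i.

Let X (i : I) : R := 1.
Let X1 i : 1 <= X i. Proof. exact: lexx. Qed.
Let T0 i : 0 < T i. Proof. by have := T1 i; lra. Qed.
Let d i : C := lowup T i.
Let e i m : C := ishift (- (2 * T i)) m.
Let D (m : int) : C := ((m%:~R : R)^-1)%:C%C.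

Lemma csumP_exact (F : I -> int -> C) v : (forall i, csum (F i) (v i)) -> csumP T X F v.
Proof.
move=> h; exists 0, 1, 0%N; split => // i; exists (v i); first exact: h.
by rewrite subrr Normc.normc0 !mul0r.
Qed.

Lemma csumP_neg (F : I -> int -> C) v : csumP T X F v -> csumP T X (fun i m => F i (- m)) v.
Proof.
move=> [K [c [E [c0 K0 h]]]]; exists K, c, E; split => // i.
by have [s hs bs] := h i; exists s => //; exact: csum_neg.
Qed.

(** The main value of the sum over m <> 0 of m^-P (m - 2 i T)^-Q: the first part comes from the pole
    at m = 0, the last term from the cotangent at the shifted pole. The index [k = P], where [zs] is
    -1, removes the term m = 0 from the expansion at the shifted pole. *)
Definition inv_shift_value (P Q : nat) i : C :=
  \sum_(0 <= k < P.+1) (-1) ^+ k * 'C(Q + k - 1, k)%:R * d i ^+ (Q + k) * (zs R (P - k))%:C%C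
  + (-1) ^+ (Q - 1) * 'C(P + Q - 2, Q - 1)%:R * (- d i) ^+ (P + Q - 1) * Complex 0 pi.

Let lowupE i : d i = Complex 0 ((2 * T i)^-1).
Proof.
have t0 := lt0r_neq0 (T0 i).
have z3 : Complex 0 (- (2 * T i)) != 0 :> C by rewrite eq_complex /= eqxx /= oppr_eq0 mulf_neq0 // pnatr_eq0.
apply: (mulfI z3); rewrite /d /lowup mulfV //.
by apply/eqP; rewrite eq_complex /=; apply/andP; split; apply/eqP; field.
Qed.

(** At m = 0 the left side is zero by 1/0 = 0, but the expansion at the shifted pole leaves a
    constant. The hockey-stick identity evaluates it, and the last summand subtracts it. *)
Let shift_split i m P Q : D m ^+ P.+1 * e i m ^+ Q.+1 =
  pf (D m) (d i) P.+1 Q.+1 + pf (e i m) (- d i) Q.+1 P.+1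
  + (if m == 0 then - ((-1) ^+ P.+1 * 'C(P.+1 + Q, P.+1)%:R * d i ^+ (P.+1 + Q.+1)) else 0).
Proof.
have t0 := lt0r_neq0 (T0 i).
have z3 : Complex 0 (- (2 * T i)) != 0 :> C by rewrite eq_complex /= eqxx /= oppr_eq0 mulf_neq0 // pnatr_eq0.
case: eqP => [->|/eqP m0].
  have -> : D 0 = 0 by rewrite /D invr0.
  have -> : e i 0 = d i by [].
  rewrite expr0n /= mul0r /pf big1_seq ?add0r; last first.
    by move=> k; rewrite mem_index_iota /= => kP; rewrite expr0n subn_eq0 leqNgt kP mulr0.
  apply/esym/eqP; rewrite subr_eq0; apply/eqP.
  have -> : 'C(P.+1 + Q, P.+1) = (\sum_(0 <= k < Q.+1) 'C(P + k, k))%N.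
    by rewrite hockey_stick -bin_sub ?leq_addr // addKn addSn.
  rewrite natr_sum mulr_sumr mulr_suml; apply: eq_big_nat => k /andP[_ kQ].
  rewrite addSn subn1 /= (exprNn (d i)).
  have -> : d i ^+ (P.+1 + Q.+1) = d i ^+ (P + k).+1 * d i ^+ (Q.+1 - k).
    by rewrite -[in RHS]exprD; congr (_ ^+ _); lia.
  have : (-1) ^+ k * (-1) ^+ k = 1 :> C by rewrite -exprMn mulN1r opprK expr1n.
  rewrite -addSn !(exprD (-1)); move: ((-1) ^+ k) ((-1) ^+ P.+1) => s t ss; ring: ss.
rewrite addr0 -partial_fractions // /D /e /ishift /d /lowup.
have m0' : (m%:~R : R)%:C%C != 0 :> C by rewrite eq_complex /= negb_and intr_eq0 m0.
have z2 : (m%:~R +i* - (2 * T i))%C != 0 by rewrite eq_complex /= negb_and intr_eq0 m0.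
have E : (m%:~R +i* - (2 * T i))%C = (m%:~R : R)%:C%C + Complex 0 (- (2 * T i)).
  by apply/eqP; rewrite eq_complex /= addr0 add0r !eqxx.
have -> : ((m%:~R : R)^-1)%:C%C = ((m%:~R : R)%:C%C)^-1 by exact: fmorphV.
rewrite E in z2 *; move: ((m%:~R : R)%:C%C) (Complex 0 _) m0' z2 z3 => y z m0' z2 z3.
by field; rewrite m0' z2 z3.
Qed.

Lemma csumP_inv_shift P Q :
  csumP T X (fun i m => D m ^+ P.+1 * e i m ^+ Q.+1) (inv_shift_value P.+1 Q.+1).
Proof.
have hd : polyb X d := polyb_lowup X T1.
have h1 : csumP T X (fun i m => pf (D m) (d i) P.+1 Q.+1)
    (fun i => \sum_(k <- index_iota 0 P.+1)
       (-1) ^+ k * 'C(Q.+1 + k - 1, k)%:R * d i ^+ (Q.+1 + k) * (zs R (P.+1 - k))%:C%C).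
  apply: (csumP_sum T1 X1) => k; rewrite mem_index_iota /= => kP; apply: (csumPZ X1).
    by apply: polybM => //; [exact: polyb_cst|exact: polybX].
  by apply: csumP_exact => i; apply: csum_inv_pow; rewrite subn_gt0.
have h2 : csumP T X (fun i m => pf (e i m) (- d i) Q.+1 P.+1)
   (fun i => (-1) ^+ Q * 'C(P.+1 + Q - 1, Q)%:R * (- d i) ^+ (P.+1 + Q) * Complex 0 pi).
  apply: (csumP_pf T1 X1); last exact: polybN.
  move=> k; have h := @csumP_ishift R I T X T1 X1 k (fun i => - (2 * T i)) _.
  have {}h := h _; apply: csumP_ext (h _) => // [i|i].
    by rewrite /ishift_main eqSS; case: eqP => // _; rewrite sgrN gtr0_sg ?mulr_gt0 // mulrN1 opprK.
  by rewrite mulr1 normrN ger0_norm; have := T0 i; lra.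
have h3 : csumP T X (fun i m => if m == 0 then - ((-1) ^+ P.+1 * 'C(P.+1 + Q, P.+1)%:R * d i ^+ (P.+1 + Q.+1)) else 0)
    (fun i => - ((-1) ^+ P.+1 * 'C(P.+1 + Q, P.+1)%:R * d i ^+ (P.+1 + Q.+1))).
  by apply: csumP_exact => i; exact: csum_delta.
apply: csumP_ext (csumPD T1 X1 (csumPD T1 X1 h1 h2) h3) => [i m|i].
  by rewrite -shift_split.
rewrite /inv_shift_value [in RHS]big_nat_recr //= subnn zs0 rmorphN rmorph1 mulrN1.
have -> : (Q.+1 + P.+1 - 1 = P.+1 + Q)%N by lia.
have -> : (Q.+1 + P.+1 = P.+1 + Q.+1)%N by lia.
have -> : (Q.+1 - 1 = Q)%N by lia.
have -> : (P.+1 + Q.+1 - 2 = P.+1 + Q - 1)%N by lia.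
have -> : (P.+1 + Q.+1 - 1 = P.+1 + Q)%N by lia.
by rewrite addrAC.
Qed.

Let s i : R := (2 * T i)^-1.

Let lowup_even i n : d i ^+ (2 * n) = ((-1) ^+ n * s i ^+ (2 * n))%:C%C.
Proof.
rewrite !exprM -exprMn rmorphXn /= lowupE -/(s i); congr (_ ^+ _).
by apply/eqP; rewrite eq_complex /=; apply/andP; split; apply/eqP; ring.
Qed.

Let lowup_odd i n : Complex 0 (- (2 * pi)) * d i ^+ (2 * n).+1 =
  (2 * pi * (-1) ^+ n * s i ^+ (2 * n).+1)%:C%C.
Proof.
rewrite exprS lowup_even lowupE -/(s i) exprS; move: ((-1) ^+ n) (s i ^+ _) => u v.
by apply/eqP; rewrite eq_complex /=; apply/andP; split; apply/eqP; ring.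
Qed.

(** Only even arguments 2 (w - 1 - k) of [zs] contribute. The total power of the imaginary number
    [d i] is then 2 k + 1, so that the product with the imaginary residue constant is real. *)
Lemma inv_shift_real i n0 P Q w : (n0 + Q + P = 2 * w - 1)%N -> (0 < Q)%N -> (0 < w)%N ->
  (P < 2 * (w - 1))%N ->
  Complex 0 (- (2 * pi)) * d i ^+ n0 * inv_shift_value P Q i =
  (\sum_(1 <= k < w) (if (2 * (w - 1 - k) <= P)%N then
       (-1) ^+ P * 'C(2 * k - n0, Q - 1)%:R else 0) * (2 * pi * (-1) ^+ k * s i ^+ (2 * k).+1 * zs R (2 * (w - 1 - k)))
   + 2 * pi ^+ 2 * ((-1) ^+ (P + w - 1) * 'C(P + Q - 2, Q - 1)%:R * s i ^+ (2 * w - 2)))%:C%C.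
Proof.
move=> en Q0 w0 Pw; rewrite /inv_shift_value mulrDr (rmorphD (@real_complex R)) /=; congr (_ + _).
  rewrite [X in _ * X]big_nat_rev /= add0n.
  under [X in _ * X]eq_big_nat => l /andP[_ lP] do rewrite subSS (subKn (_ : l <= P)%N) //.
  rewrite (sum_nat_even (N := w - 1)) //; last by move=> l ol; rewrite /zs ol rmorph0 mulr0.
  rewrite mulr_sumr big_add1 (_ : w.-1 = (w - 1)%N); last by rewrite subn1.
  rewrite [in RHS]big_nat_rev /= add0n.
  rewrite (rmorph_sum (@real_complex R)) /=; apply: eq_big_nat => j /andP[_ jw].
  have -> : (w - 1 - (w - 1 - j.+1).+1 = j)%N by lia.
  case: ifP => jP; last by rewrite mul0r rmorph0 mulr0.
  set k := (w - 1 - j.+1).+1.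
  have -> : (-1) ^+ (P - 2 * j) = ((-1) ^+ P)%:C%C :> C.
    rewrite -[in RHS](subnK jP) exprD exprM sqrrN expr1n expr1n mulr1.
    by rewrite rmorphXn /= rmorphN rmorph1.
  have -> : 'C(Q + (P - 2 * j) - 1, P - 2 * j) = 'C(2 * k - n0, Q - 1).
    have -> : (2 * k - n0 = Q + (P - 2 * j) - 1)%N by rewrite /k; lia.
    by rewrite -bin_sub; [congr ('C(_, _)); lia|lia].
  rewrite (_ : _ * _ = ((-1) ^+ P)%:C%C * 'C(2 * k - n0, Q - 1)%:R *
     (Complex 0 (- (2 * pi)) * (d i ^+ n0 * d i ^+ (Q + (P - 2 * j)))) * (zs R (2 * j))%:C%C); last by ring.
  rewrite -exprD (_ : (n0 + _ = (2 * k).+1)%N); last by rewrite /k; lia.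
  by rewrite lowup_odd -(rmorph_nat (@real_complex R)) -!(rmorphM (@real_complex R)) /=; congr (_%:C%C); ring.
rewrite (exprNn (d i)).
have sq (n : nat) : (-1) ^+ n * (-1) ^+ n = 1 :> C by rewrite -exprMn mulN1r opprK expr1n.
have -> : (P + Q - 1 = P + (Q - 1))%N by lia.
rewrite (exprD (-1) P (Q - 1)).
set dq := d i ^+ (P + (Q - 1)).
rewrite [LHS](_ : _ = (-1) ^+ P * ((-1) ^+ (Q - 1) * (-1) ^+ (Q - 1)) * 'C(P + Q - 2, Q - 1)%:R *
     (Complex 0 (- (2 * pi)) * Complex 0 pi) * (d i ^+ n0 * dq)); last by ring.
rewrite /dq {dq}.
rewrite sq mulr1 -(exprD _ n0) (_ : (n0 + _ = 2 * (w - 1))%N); last by lia.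
rewrite lowup_even (_ : Complex 0 (- (2 * pi)) * Complex 0 pi = (2 * pi ^+ 2)%:C%C :> C); last first.
  by apply/eqP; rewrite eq_complex /=; apply/andP; split; apply/eqP; ring.
have -> : (2 * w - 2 = 2 * (w - 1))%N by lia.
have -> : (P + w - 1 = P + (w - 1))%N by lia.
have -> : (-1) ^+ P = ((-1) ^+ P)%:C%C :> C by rewrite rmorphXn /= rmorphN rmorph1.
by rewrite -(rmorph_nat (@real_complex R)) -!(rmorphM (@real_complex R)) /= exprD; congr (_%:C%C); ring.
Qed.

(** One half of the integral over y for two lines. The two lower poles are separated by partial
    fractions, [x] being the inverse of their difference; the terms at the first of them are
    integrated against both upper poles by [residue3]. *)
Definition residue_half (x D1 D2 : C) a b : C :=
  \sum_(0 <= k < a.+1) (-1) ^+ k * ('C(b.+1 + k - 1, k))%:R * x ^+ (b.+1 + k) *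
     (residue3 D1 D2 (a - k) a b * Complex 0 (- (2 * pi))).

Lemma has_pv_half (z1 z2 z3 x : C) a b :
  complex.Im z1 * complex.Im z2 < 0 -> complex.Im z1 * complex.Im z3 < 0 ->
  pv2 z1 = Complex 0 (- (2 * pi)) ->
  has_pv (fun y => pf (resolvent z1 y) x a.+1 b.+1 * (resolvent z2 y ^+ a.+1 * resolvent z3 y ^+ b.+1))
    (residue_half x (z1 - z2)^-1 (z1 - z3)^-1 a b).
Proof.
move=> h2 h3 e1; rewrite /residue_half.
rewrite [X in has_pv _ X]big_mkord; under eq_fun do rewrite /pf big_mkord mulr_suml.
apply: has_pv_sum => k _; rewrite subSn -1?ltnS //.
have h := has_pvZ ((-1) ^+ k * ('C(b.+1 + k - 1, k))%:R * x ^+ (b.+1 + k)) (has_pv3 (a - k) a b h2 h3).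
rewrite -e1; apply: has_pv_ext h => y.
by rewrite -!mulrA; do 4 congr (_ * _).
Qed.

(** The integer [g] of the coefficients without its sign. *)
Definition triangle_coef a b al be : R :=
  'C(2 * a - 2 - al - be, a - 1)%:R * 'C(b + al - 1, b - 1)%:R * 'C(b + be - 1, b - 1)%:R.

(** The index of the outer partial fractions becomes beta; that of [residue3], read backwards,
    becomes alpha. *)
Lemma residue_halfE (x D1 D2 : C) a b c :
  x ^+ (2 * c) * residue_half x D1 D2 a b =
  \sum_(0 <= al < a.+1) \sum_(0 <= be < a.+1 - al)
    ((-1) ^+ a * triangle_coef a.+1 b.+1 al be)%:C%C *
    (Complex 0 (- (2 * pi)) * D1 ^+ (2 * a.+1 - 1 - al - be)) *
    (x ^+ (2 * c + b.+1 + be) * D2 ^+ (b.+1 + al)).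
Proof.
rewrite [RHS]sum_triangle /residue_half mulr_sumr; apply: eq_big_nat => k /andP[_ ka].
have -> : residue3 D1 D2 (a - k) a b = (-1) ^+ (a - k) *
    \sum_(0 <= l < a.+1 - k) ('C(2 * a - k - l, a))%:R * ('C(b + l, b))%:R
     * D1 ^+ (2 * a - k - l).+1 * D2 ^+ (b + l).+1.
  rewrite /residue3 big_nat_rev /= add0n.
  have -> : ((a - k).+1 = a.+1 - k)%N by lia.
  congr (_ * _).
  apply: eq_big_nat => l /andP[_ lk]; have -> : (a.+1 - k - l.+1 = a - k - l)%N by lia.
  rewrite (subKn (_ : l <= a - k)%N); last by lia.
  have -> : (a + (a - k - l) = 2 * a - k - l)%N by lia.
  rewrite -(@bin_sub (b + l) b) ?leq_addr // addKn; congr (_%:R * _ * _ * _).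
  by rewrite -bin_sub; [congr ('C(_, _)); lia|lia].
rewrite !(mulr_sumr, mulr_suml); apply: eq_big_nat => l /andP[_ lk].
rewrite /triangle_coef !(rmorphM (@real_complex R)) /= !rmorphXn /= rmorphN rmorph1 !rmorph_nat.
have -> : (2 * a.+1 - 2 - l - k = 2 * a - k - l)%N by lia.
have -> : (2 * a.+1 - 1 - l - k = (2 * a - k - l).+1)%N by lia.
have -> : 'C(b.+1 + k - 1, k) = 'C(b + k, b).
  by rewrite addSn subn1 /= -bin_sub ?leq_addl // addnK.
have -> : (a.+1 - 1 = a)%N by lia.
have -> : (b.+1 - 1 = b)%N by lia.
have -> : (b.+1 + l - 1 = b + l)%N by lia.
have -> : (b.+1 + k - 1 = b + k)%N by lia.
have -> : (b.+1 + l = (b + l).+1)%N by lia.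
rewrite -addnA (exprD x (2 * c)).
have -> : (-1) ^+ a = (-1) ^+ k * (-1) ^+ (a - k) :> C by rewrite -exprD subnKC // -ltnS.
move: ((-1) ^+ k) ((-1) ^+ (a - k)) (x ^+ _) (x ^+ _) (D1 ^+ _) (D2 ^+ _) => u v y z p q.
by ring.
Qed.

(** Up to sign, the double sum in c_{w-2k-1} for one order of the exponents. The condition is that
    of theta multiplied by two, which absorbs the integer part. *)
Definition mid_weight k a b c : R :=
  \sum_(0 <= al < a) \sum_(0 <= be < a - al)
    triangle_coef a b al be *
    (if (2 * (a + b + c - 1 - k) <= 2 * c + b + be)%N then
       (-1) ^+ (a + b + be) * 'C(2 * k + al + be + 1 - 2 * a, b + al - 1)%:R else 0).

Definition bot_weight a b c : R :=
  \sum_(0 <= al < a) \sum_(0 <= be < a - al)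
    triangle_coef a b al be *
    ((-1) ^+ (a + b + be) * 'C(2 * b + 2 * c + al + be - 2, b + al - 1)%:R).

(** The main value of one half of the class (n, -n), without its power of tau_2 / pi; [t] is the
    height n tau_2 of the poles. *)
Definition zero_line_value a b c (t : R) : R :=
  \sum_(1 <= k < a + b + c) mid_weight k a b c *
     (2 * pi * (-1) ^+ k.+1 * (2 * t)^-1 ^+ (2 * k).+1 * zs R (2 * (a + b + c - 1 - k)))
  + bot_weight a b c * (2 * pi ^+ 2 * (-1) ^+ (a + b + c) * (2 * t)^-1 ^+ (2 * (a + b + c) - 2)).

Lemma csumP_half a b c : (0 < c)%N ->
  csumP T X (fun i m => D m ^+ (2 * c) * residue_half (D m) (d i) (e i m) a b)
    (fun i => (zero_line_value a.+1 b.+1 c (T i))%:C%C).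
Proof.
move=> c0; have hd : polyb X d := polyb_lowup X T1.
pose cf al be i := ((-1) ^+ a * triangle_coef a.+1 b.+1 al be)%:C%C *
    (Complex 0 (- (2 * pi)) * d i ^+ (2 * a.+1 - 1 - al - be)).
have h : csumP T X (fun i m => \sum_(al <- index_iota 0 a.+1) \sum_(be <- index_iota 0 (a.+1 - al))
    cf al be i * (D m ^+ (2 * c + b + be).+1 * e i m ^+ (b + al).+1))
   (fun i => \sum_(al <- index_iota 0 a.+1) \sum_(be <- index_iota 0 (a.+1 - al))
     cf al be i * inv_shift_value (2 * c + b + be).+1 (b + al).+1 i).
  apply: (csumP_sum T1 X1) => al _; apply: (csumP_sum T1 X1) => be _.
  apply: (csumPZ X1); last exact: csumP_inv_shift.
  by apply: polybM => //; [exact: polyb_cst|apply: polybM => //; [exact: polyb_cst|exact: polybX]].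
apply: csumP_ext h => [i m|i].
  rewrite residue_halfE; apply: eq_big_nat => al _; apply: eq_big_nat => be _.
  by rewrite /cf !addnS !addSn.
rewrite /zero_line_value; set w := (a.+1 + b.+1 + c)%N.
pose N k : R := 2 * pi * (-1) ^+ k * s i ^+ (2 * k).+1 * zs R (2 * (w - 1 - k)).
pose M k al be : R := if (2 * (w - 1 - k) <= 2 * c + b.+1 + be)%N then
  (-1) ^+ (b.+1 + be) * 'C(2 * k + al + be + 1 - 2 * a.+1, b.+1 + al - 1)%:R else 0.
pose B al be : R := (-1) ^+ (b.+1 + be) * 'C(2 * b.+1 + 2 * c + al + be - 2, b.+1 + al - 1)%:R.
pose N' : R := 2 * pi ^+ 2 * (-1) ^+ (w - 1) * s i ^+ (2 * w - 2).
transitivity ((\sum_(0 <= al < a.+1) \sum_(0 <= be < a.+1 - al)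
   ((-1) ^+ a * triangle_coef a.+1 b.+1 al be) *
    (\sum_(1 <= k < w) M k al be * N k + B al be * N'))%:C%C).
  rewrite (rmorph_sum (@real_complex R)); apply: eq_big_nat => al /andP[_ ala].
  rewrite (rmorph_sum (@real_complex R)); apply: eq_big_nat => be /andP[_ beb].
  rewrite /cf -mulrA (@inv_shift_real i _ _ _ w); [|rewrite /w; lia..].
  rewrite [RHS](rmorphM (@real_complex R)) /=; congr (_ * _%:C%C); congr (_ + _).
    apply: eq_big_nat => k /andP[k1 kw]; rewrite /M.
    have -> : (2 * k - (2 * a.+1 - 1 - al - be) = 2 * k + al + be + 1 - 2 * a.+1)%N by lia.
    have -> : ((2 * c + b + be).+1 = 2 * c + b.+1 + be)%N by lia.
    have -> : ((b + al).+1 - 1 = b.+1 + al - 1)%N by lia.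
    case: ifP => // _; congr (_ * _ * _).
    by rewrite -addnA (exprD (-1 : R) (2 * c)) (exprM (-1 : R) 2 c) sqrrN expr1n expr1n mul1r.
  have -> : ((2 * c + b + be).+1 + (b + al).+1 - 2 = 2 * b.+1 + 2 * c + al + be - 2)%N by lia.
  have -> : ((b + al).+1 - 1 = b.+1 + al - 1)%N by lia.
  have -> : ((2 * c + b + be).+1 + w - 1 = 2 * c + (b.+1 + be) + (w - 1))%N by rewrite /w; lia.
  rewrite /B /N' -addnA (exprD (-1 : R) (2 * c)) (exprM (-1 : R) 2 c) sqrrN expr1n expr1n mul1r (exprD (-1 : R) (b.+1 + be)); ring.
congr (_%:C%C).
transitivity (\sum_(1 <= k < w) \sum_(0 <= al < a.+1) \sum_(0 <= be < a.+1 - al)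
     ((-1) ^+ a * triangle_coef a.+1 b.+1 al be) * (M k al be * N k) +
   \sum_(0 <= al < a.+1) \sum_(0 <= be < a.+1 - al)
     ((-1) ^+ a * triangle_coef a.+1 b.+1 al be) * (B al be * N')).
  rewrite [in RHS]exchange_big -big_split; apply: eq_bigr => al _ /=.
  rewrite [in RHS]exchange_big -big_split; apply: eq_bigr => be _ /=.
  by rewrite mulrDr mulr_sumr.
congr (_ + _).
  apply: eq_big_nat => k /andP[k1 kw]; rewrite /mid_weight mulr_suml; apply: eq_big_nat => al _.
  rewrite mulr_suml; apply: eq_big_nat => be _; rewrite /M -/w; case: ifP => _; last by rewrite !(mul0r, mulr0).
  by rewrite -(addnA a.+1) (exprD (-1 : R) a.+1) (exprS (-1 : R) a) (exprS (-1 : R) k) /N /s; ring.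
rewrite /bot_weight mulr_suml; apply: eq_big_nat => al _.
rewrite mulr_suml; apply: eq_big_nat => be _; rewrite /B /N' /s -(addnA a.+1) (exprD (-1 : R) a.+1).
have -> : (-1) ^+ w = - (-1) ^+ (w - 1) :> R.
  by rewrite -[in LHS](subnK (_ : 0 < w)%N) // addn1 exprS mulN1r.
by rewrite (exprS (-1 : R) a); ring.
Qed.

(** The kernel with vanishing n_r supplies the factor M^(-2c); at M = 0 it is zero by 1/0 = 0, as
    the excluded point demands. For M <> 0 the two lower poles differ by M, and the second half is
    the first with the lines exchanged and M replaced by -M. *)
Lemma dbl_zero_line a b c : (0 < c)%N ->
  dbl T X (fun i M y => D M ^+ (2 * c) *
     ((resolvent (lo T (fun=> 0) i M) y ^+ a.+1 * resolvent (lo T (fun=> 1) i M) y ^+ b.+1) *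
      (resolvent (up T (fun=> 0) i M) y ^+ a.+1 * resolvent (up T (fun=> 1) i M) y ^+ b.+1)))
   (fun i => (zero_line_value a.+1 b.+1 c (T i) + zero_line_value b.+1 a.+1 c (T i))%:C%C).
Proof.
move=> c0; exists (fun i M => D M ^+ (2 * c) * residue_half (D M) (d i) (e i M) a b +
   D (- M) ^+ (2 * c) * residue_half (D (- M)) (d i) (e i (- M)) b a); last first.
  apply: csumP_ext (csumPD T1 X1 (csumP_half a b c0) (csumP_neg (csumP_half b a c0))) => // i.
  by rewrite -(rmorphD (@real_complex R)).
move=> i M; have DN : D (- M) = - D M by rewrite /D rmorphN invrN rmorphN.
have [->|M0] := eqVneq M 0.
  have D0 : D 0 = 0 by rewrite /D invr0.
  rewrite oppr0 D0 expr0n muln_eq0 /= (gtn_eqF c0) mul0r mul0r addr0.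
  by apply: has_pv_ext (has_pv0 R) => y; rewrite mul0r.
have DM : D M = (lo T (fun=> 0) i M - lo T (fun=> 1) i M)^-1.
  by rewrite /D fmorphV; congr (_^-1); apply/eqP; rewrite eq_complex /=; apply/andP; split; apply/eqP; ring.
have ne (f g : I -> R) : complex.Im (lo T f i M) * complex.Im (up T g i M) < 0.
  by rewrite /= mulNr oppr_lt0 mulr_gt0.
have pvl f : pv2 (lo T f i M) = Complex 0 (- (2 * pi)) by rewrite /pv2 /= ltr0_sg ?oppr_lt0 // mulrN1.
have h1 := has_pv_half (D M) a b (ne (fun=> 0) (fun=> 0)) (ne (fun=> 0) (fun=> 1)) (pvl _).
have h2 := has_pv_half (- D M) b a (ne (fun=> 1) (fun=> 1)) (ne (fun=> 1) (fun=> 0)) (pvl _).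
have E1 f : (lo T f i M - up T f i M)^-1 = d i.
  by rewrite /d /lowup; congr (_^-1); apply/eqP; rewrite eq_complex /=; apply/andP; split; apply/eqP; ring.
have E2 : (lo T (fun=> 0) i M - up T (fun=> 1) i M)^-1 = e i M.
  by rewrite /e /ishift; congr (_^-1); apply/eqP; rewrite eq_complex /=; apply/andP; split; apply/eqP; ring.
have E3 : (lo T (fun=> 1) i M - up T (fun=> 0) i M)^-1 = e i (- M).
  by rewrite /e /ishift rmorphN; congr (_^-1); apply/eqP; rewrite eq_complex /=; apply/andP; split; apply/eqP; ring.
rewrite !E1 E2 in h1; rewrite !E1 E3 in h2.
have h := has_pvZ (D M ^+ (2 * c)) (has_pvD h1 h2).
have -> : D (- M) ^+ (2 * c) = D M ^+ (2 * c) by rewrite DN exprM sqrrN -exprM.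
rewrite DN -mulrDr; apply: has_pv_ext h => y; congr (_ * _).
rewrite [resolvent (up T (fun=> 1) i M) y ^+ b.+1 * _]mulrC -mulrDl; congr (_ * _).
rewrite -partial_fractions // DM; apply: resolventM; rewrite /= ?oppr_eq0 ?(lt0r_neq0 (T0 i)) //.
by rewrite eq_complex /= negb_and mul0r oppr0 mul1r eq_sym oppr_eq0 intr_eq0 M0.
Qed.

End OneVanishing.

(** * Rearrangement of nonnegative sums and integrals *)

Section NonnegativeSums.
Variable R : realType.
Local Open Scope ereal_scope.

Lemma esum_pair (T1 T2 : choiceType) (a : T1 -> T2 -> \bar R) : (forall i j, 0 <= a i j) ->
  \esum_(p in [set: T1 * T2]) a p.1 p.2 = \esum_(i in [set: T1]) \esum_(j in [set: T2]) a i j.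
Proof.
by move=> a0; rewrite esum_esum //; congr esum; apply/seteqP; split.
Qed.

Lemma esum_swap (T1 T2 : choiceType) (a : T1 -> T2 -> \bar R) : (forall i j, 0 <= a i j) ->
  \esum_(i in [set: T1]) \esum_(j in [set: T2]) a i j =
  \esum_(j in [set: T2]) \esum_(i in [set: T1]) a i j.
Proof.
move=> a0; rewrite -!esum_pair //.
rewrite (@reindex_esum _ _ _ [set: T1 * T2] _ (fun p => (p.2, p.1))) //.
by split => [p|[u v] [u' v'] _ _ [-> ->]|[u v] _] //; exists (v, u).
Qed.

Lemma esum_nat_cvg (u : nat -> R) s : (forall k, (0 <= u k)%R) ->
  (\sum_(0 <= k < N) u k)%R @[N --> \oo] --> s -> \esum_(k in [set: nat]) (u k)%:E = s%:E.
Proof.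
by move=> u0 us; rewrite -nneseries_esumT ?(eseries_EFin us) // => k; rewrite lee_fin.
Qed.

Lemma esum_int_split (f : int -> \bar R) : (forall n, 0 <= f n) ->
  \esum_(n in [set: int]) f n =
  f 0%R + (\esum_(k in [set: nat]) f k.+1%:Z + \esum_(k in [set: nat]) f (- k.+1%:Z)%R).
Proof.
move=> f0; rewrite (esumID [set 0%R]) // setTI esum_set1 //; congr (_ + _).
rewrite setTI (esumID [set n : int | (0 < n)%R]) //; congr (_ + _).
  rewrite (@reindex_esum _ _ _ [set: nat] _ (fun k => k.+1%:Z)) //.
  split => [k _|k l _ _ [->]|n [_ /= n0]] //=.
  by exists (absz n).-1 => //=; lia.
rewrite (@reindex_esum _ _ _ [set: nat] _ (fun k => - k.+1%:Z)%R) //.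
split => [k _|k l _ _ /= e|n [/eqP /= n0 /negP /= n1]] //=.
- by move/eqP: e; rewrite eqr_opp eqz_nat => /eqP [].
- by exists (absz n).-1 => //=; lia.
Qed.

Lemma esum_nat_pairs (f : nat -> nat -> \bar R) : (forall k l, 0 <= f k l) ->
  \esum_(k in [set: nat]) \esum_(l in [set: nat]) f k l =
  \esum_(k in [set: nat]) f k k
  + (\esum_(k in [set: nat]) \esum_(l in [set: nat]) f k (k + l).+1
     + \esum_(k in [set: nat]) \esum_(l in [set: nat]) f (k + l).+1 l).
Proof.
move=> f0; rewrite -!esum_pair // (esumID [set p : nat * nat | p.1 = p.2]) // setTI.
congr (_ + _).
  rewrite (@reindex_esum _ _ _ [set: nat] _ (fun k => (k, k))) //.
  by split => [k _|k l _ _ [->]|[k l] /= ->] //; exists l.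
rewrite setTI (esumID [set p : nat * nat | (p.1 < p.2)%N]) //; congr (_ + _).
  rewrite (@reindex_esum _ _ _ [set: nat * nat] _ (fun p => (p.1, (p.1 + p.2).+1))) //.
  split => [[k l] _|[k l] [k' l'] _ _ [-> /addnI ->]|[k l] [_ /= kl]] //=.
    by split => /=; lia.
  by exists (k, (l - k).-1) => //=; congr (_, _); lia.
rewrite (@reindex_esum _ _ _ [set: nat * nat] _ (fun p => ((p.1 + p.2).+1, p.2))) //.
split => [[k l] _|[k l] [k' l'] _ _ [] /= e ll|[k l] [/= /eqP n1 /negP n2]] //=.
- by split => /=; [lia|apply/negP; lia].
- by rewrite ll in e *; congr (_, _); lia.
- by exists ((k - l).-1, l) => //=; congr (_, _); lia.
Qed.

(** The lines n_1 = 0, n_2 = 0 and n_1 + n_2 = 0 cut the plane into six rays and six open sectors.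
    The central symmetry of [F] pairs them, so three rays and three sectors, counted twice, remain
    besides the origin. *)
Lemma esum_int2_split (F : int -> int -> \bar R) (b1 b2 b3 c1 c2 c3 : \bar R) :
  (forall n m, 0 <= F n m) -> (forall n m, F (- n)%R (- m)%R = F n m) ->
  \esum_(k in [set: nat]) F k.+1%:Z (- k.+1%:Z)%R = b1 ->
  \esum_(k in [set: nat]) F k.+1%:Z 0%R = b2 ->
  \esum_(k in [set: nat]) F 0%R k.+1%:Z = b3 ->
  \esum_(k in [set: nat]) \esum_(l in [set: nat]) F k.+1%:Z l.+1%:Z = c1 ->
  \esum_(k in [set: nat]) \esum_(l in [set: nat]) F k.+1%:Z (- (k + l).+2%:Z)%R = c2 ->
  \esum_(k in [set: nat]) \esum_(l in [set: nat]) F (k + l).+2%:Z (- l.+1%:Z)%R = c3 ->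
  let half := b1 + b2 + b3 + (c1 + c2 + c3) in
  \esum_(n1 in [set: int]) \esum_(n2 in [set: int]) F n1 n2 = F 0%R 0%R + (half + half).
Proof.
move=> F0 Fopp B1 B2 B3 C1 C2 C3.
rewrite (esum_int_split (f := fun n1 => \esum_(n2 in [set: int]) F n1 n2)); last first.
  by move=> n; exact: esum_ge0.
have zero : \esum_(n2 in [set: int]) F 0%R n2 = F 0%R 0%R + (b3 + b3).
  rewrite esum_int_split // B3; congr (_ + (_ + _)); rewrite -B3.
  by apply: eq_esum => k _; rewrite -Fopp oppr0 opprK.
have pos : \esum_(k in [set: nat]) \esum_(n2 in [set: int]) F k.+1%:Z n2 =
   b2 + (c1 + (b1 + (c2 + c3))).
  under eq_esum do rewrite esum_int_split //.
  rewrite esumD => [|k _|k _]; rewrite ?adde_ge0 ?esum_ge0 // B2; congr (_ + _).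
  rewrite esumD => [|k _|k _]; rewrite ?esum_ge0 // C1; congr (_ + _).
  rewrite (esum_nat_pairs (f := fun k l => F k.+1%:Z (- l.+1%:Z)%R)) // B1; congr (_ + _).
  by rewrite C2 C3.
have neg : \esum_(k in [set: nat]) \esum_(n2 in [set: int]) F (- k.+1%:Z)%R n2 =
   \esum_(k in [set: nat]) \esum_(n2 in [set: int]) F k.+1%:Z n2.
  apply: eq_esum => k _; rewrite (@reindex_esum _ _ _ [set: int] _ (fun n => - n)%R).
    by apply: eq_esum => n _; rewrite Fopp.
  by split => [|u v _ _ /oppr_inj|u _] //; exists (- u)%R => //; rewrite opprK.
rewrite zero neg pos /=.
have -> : b1 + b2 + b3 + (c1 + c2 + c3) = b3 + (b2 + (c1 + (b1 + (c2 + c3)))).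
  by rewrite [b1 + b2 + b3]addeC -!addeA; congr (_ + _); rewrite addeCA; congr (_ + _); rewrite addeCA.
by move: (b2 + _) => y; rewrite -addeA; congr (_ + _); exact: addeACA.
Qed.

Lemma esum_ssum (f : int -> R) s : (forall m, (0 <= f m)%R) -> ssum f s ->
  \esum_(m in [set: int]) (f m)%:E = s%:E.
Proof.
move=> f0 fs; rewrite esum_int_split => [|n]; last by rewrite lee_fin.
rewrite -esumD => [|k _|k _]; try by rewrite lee_fin.
rewrite (esum_nat_cvg (u := fun k : nat => (f k.+1%:Z + f (- k.+1%:Z))%R) (s := (s - f 0)%R)).
- by rewrite -EFinD addrC subrK.
- by move=> k; rewrite addr_ge0.
- have e : (fun N : nat => symsum f N - f 0)%R =1 (fun N => \sum_(0 <= k < N) (f k.+1%:Z + f (- k.+1%:Z)))%R.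
    by move=> N; rewrite /symsum addrAC subrr add0r big_add1.
  by rewrite -(funext e); apply: cvgB => //; exact: cvg_cst.
Qed.

Lemma esum_pickle (I : countType) (a : I -> \bar R) : (forall i, 0 <= a i) ->
  \esum_(i in [set: I]) a i = \sum_(k <oo) oapp a 0 (pickle_inv k : option I).
Proof.
move=> a0; rewrite nneseries_esumT; last by move=> k; case: pickle_inv.
transitivity (\esum_(k in pickle @` [set: I]) oapp a 0 (pickle_inv k : option I)).
  rewrite esum_image; last by move=> i j _ _; exact: (pcan_inj pickleK_inv).
  by apply: eq_esum => i _; rewrite pickleK_inv.
rewrite esum_mkcond; apply: eq_esum => k _; case: ifPn => // /negP kn.
case e: (pickle_inv k) => [i|] //=; case: kn; rewrite inE; exists i => //.
by have := @pickle_invK I k; rewrite e.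
Qed.

Lemma esum_scale (I : countType) (a : I -> \bar R) (k : R) : (0 <= k)%R -> (forall i, 0 <= a i) ->
  \esum_(i in [set: I]) (k%:E * a i) = k%:E * \esum_(i in [set: I]) a i.
Proof.
move=> k0 a0; rewrite !esum_pickle // => [|i]; last by rewrite mule_ge0.
rewrite -nneseriesZl; last by move=> n _; case: (pickle_inv n).
by apply: eq_eseriesr => n _; case: (pickle_inv n) => //=; rewrite mule0.
Qed.

(** Enumeration of the countable index type by [pickle] reduces the exchange to the one for
    nonnegative series. *)
Lemma integral_esum d (T : measurableType d) (mu : {measure set T -> \bar R}) (I : countType)
    (D : set T) (f : I -> T -> \bar R) :
  measurable D -> (forall i, measurable_fun D (f i)) -> (forall i x, 0 <= f i x) ->
  \int[mu]_(x in D) (\esum_(i in [set: I]) f i x) =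
  \esum_(i in [set: I]) \int[mu]_(x in D) f i x.
Proof.
move=> mD mf f0; rewrite esum_pickle; last by move=> i; apply: integral_ge0.
under eq_integral do rewrite esum_pickle //.
rewrite integral_nneseries //.
- apply: eq_eseriesr => k _; case: (pickle_inv k) => [i|] //=; exact: integral0.
- by move=> k; case: (pickle_inv k) => [i|] //=; exact: measurable_cst.
- by move=> k x _; case: (pickle_inv k) => [i|] //=.
Qed.

End NonnegativeSums.

(** * Unrolling [0, 1] to the real line *)

Section Unrolling.
Variable R : realType.

Lemma symsum_shift (A : R -> R) (g N : nat) :
  symsum (fun j => A (j%:~R + g%:R) - A j%:~R) N =
  \sum_(0 <= i < g) (A (N%:R + 1 + i%:R) - A (- N%:R + i%:R)).
Proof.
have tel (h : nat -> R) : \sum_(0 <= i < g) (h i.+1 - h i) = h g - h 0%N by rewrite telescope_sumr.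
elim: N => [|N IH].
  rewrite /symsum big_nil addr0 /= add0r -[RHS]/(\sum_(0 <= i < g) (_ - _)).
  transitivity (\sum_(0 <= i < g) (A i.+1%:R - A i%:R)); first by rewrite (tel (fun i => A i%:R)).
  by apply: eq_bigr => i _; congr (A _ - A _); rewrite ?add0r -?natr1; ring.
rewrite /symsum in IH *; rewrite big_nat_recr //= addrA IH.
have t1 := tel (fun i => A (N%:R + 1 + i%:R)).
have t2 := tel (fun i => A (- N.+1%:R + i%:R)).
rewrite addr0 in t1; rewrite addr0 in t2.
have -> : A (N.+1%:R + g%:R) - A N.+1%:R + (A ((- N.+1%:Z)%:~R + g%:R) - A (- N.+1%:Z)%:~R) =
  \sum_(0 <= i < g) (A (N%:R + 1 + i.+1%:R) - A (N%:R + 1 + i%:R)) +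
  \sum_(0 <= i < g) (A (- N.+1%:R + i.+1%:R) - A (- N.+1%:R + i%:R)).
  by rewrite t1 t2 natr1 rmorphN.
rewrite -!big_split /=; apply: eq_bigr => i _.
have -> : - N.+1%:R + i.+1%:R = - N%:R + i%:R :> R by rewrite -!natr1; ring.
have -> : N%:R + 1 + i.+1%:R = N.+1%:R + 1 + i%:R :> R by rewrite -!natr1; ring.
ring.
Qed.

(** Each integral is 1 / g times the increment of an antiderivative over [j, j + g]. These intervals
    cover the line g times, so the value does not depend on [g]. *)
Lemma esum_unroll (phi : R -> R) (v : R) (g : nat) :
  (forall x, 0 <= phi x) -> continuous phi -> rpv phi v -> (0 < g)%N ->
  (\esum_(j in [set: int]) (\int[lebesgue_measure]_(x in `[0%R, 1%R])
      (phi (j%:~R + g%:R * x))%:E) = v%:E)%E.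
Proof.
move=> phi0 cphi [A [dA lA]] g0.
have gR : 0 < g%:R :> R by rewrite ltr0n.
have gn : g%:R != 0 :> R by rewrite pnatr_eq0 -lt0n.
pose F (j : int) x : R := g%:R^-1 * A (j%:~R + g%:R * x).
have dF j x : is_derive x (1 : R) (F j) (phi (j%:~R + g%:R * x)).
  have d1 : is_derive x (1 : R) (fun y : R => j%:~R + g%:R * y) g%:R.
    by apply: is_derive_eq; rewrite /GRing.scale /=; ring.
  have d2 : is_derive x (1 : R) (fun y => A (j%:~R + g%:R * y)) (g%:R * phi (j%:~R + g%:R * x)).
    by have := is_derive1_comp (dA _) d1; rewrite mulrC.
  by apply: is_derive_eq; rewrite /GRing.scale /= mulKf.
have e (j : int) : (\int[lebesgue_measure]_(x in `[0%R, 1%R]) (phi (j%:~R + g%:R * x))%:E =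
    (g%:R^-1 * (A (j%:~R + g%:R) - A j%:~R))%:E)%E.
  rewrite (@continuous_FTC2 _ _ (F j)) //.
  - by rewrite -EFinB /F mulr1 mulr0 addr0 mulrBr.
  - apply: continuous_subspaceT => x; apply: continuous_comp; last exact: cphi.
    by apply: cvgD; [exact: cvg_cst|apply: cvgMl_tmp; exact: cvg_id].
  - split => [x _||]; first exact: (ex_derive (is_derive := dF j x)).
      apply: cvg_at_right_filter; apply: differentiable_continuous; apply/derivable1_diffP.
      exact: (ex_derive (is_derive := dF j 0)).
    apply: cvg_at_left_filter; apply: differentiable_continuous; apply/derivable1_diffP.
    exact: (ex_derive (is_derive := dF j 1)).
  - by move=> x _; rewrite derive1E; exact: (derive_val (is_derive := dF j x)).
have mono : {homo A : x y / x <= y}.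
  move=> x y; rewrite le_eqVlt => /predU1P[-> //|xy].
  have [z _] := MVT xy (fun z _ => dA z)
    (derivable_within_continuous (fun z _ => ex_derive (is_derive := dA z))).
  by move=> /eqP; rewrite subr_eq => /eqP ->; rewrite lerDr mulr_ge0 ?subr_ge0 // ltW.
under eq_esum do rewrite e.
apply: esum_ssum => [m|].
  by rewrite mulr_ge0 ?invr_ge0 // subr_ge0; apply: mono; rewrite lerDl.
rewrite /ssum; under eq_fun do rewrite symsumZ symsum_shift.
pose B x := A x - A (- x).
have lB (k : R) : B (N%:R + k) @[N --> \oo] --> v.
  apply: cvg_comp lA => //; apply/cvgryPge => y; near=> N.
  rewrite -lerBlDr; near: N; exact: nbhs_infty_ger.
(* A symmetric partial sum is an average of [g] increments; since [A] is monotone, each lies between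
   the increments over the intervals centred at 0 of half-length N - g and N + g. *)
apply: (@squeeze_cvgr _ _ _ _ (fun N : nat => B (N%:R + - g%:R)) (fun N => B (N%:R + g%:R))).
- near=> N; rewrite !ler_pdivlMl // ler_pdivrMl //.
  have gs (c : R) : g%:R * c = \sum_(0 <= i < g) c by rewrite sumr_const_nat subn0 mulr_natl.
  rewrite !gs; apply/andP; split; apply: ler_sum_nat => i /andP[_ ig].
    have i0 : (0 : R) <= i%:R by []; have ig' : (i%:R : R) <= g%:R by rewrite ler_nat ltnW.
    by apply: lerB; apply: mono; lra.
  have i0 : (0 : R) <= i%:R by []; have ig' : (i.+1%:R : R) <= g%:R by rewrite ler_nat.
  by rewrite -natr1 in ig'; apply: lerB; apply: mono; lra.
- exact: lB.
- exact: lB.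
Unshelve. all: by end_near.
Qed.

End Unrolling.

(** * The constant mode as a sum of slices over (n_1, n_2) *)

Section Lattice.
Variable R : realType.
Implicit Types (t x y : R) (a b c : nat) (m n : int).

Definition kern t (u v : R) : R := t / (pi * (u ^+ 2 + (v * t) ^+ 2)).

Definition term a b c t x n1 n2 m1 m2 : R :=
  kern t (m1%:~R + n1%:~R * x) n1%:~R ^+ a * kern t (m2%:~R + n2%:~R * x) n2%:~R ^+ b
  * kern t ((- (m1 + m2))%:~R + (- (n1 + n2))%:~R * x) (- (n1 + n2))%:~R ^+ c.

(** By 1/0 = 0 an excluded configuration contributes zero, so the sums can run over all pairs of
    integers. *)
Lemma kern00 t : kern t 0 0 = 0.
Proof. by rewrite /kern mul0r expr0n addr0 mulr0 invr0 mulr0. Qed.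

Lemma kernN t (u v : R) : kern t (- u) (- v) = kern t u v.
Proof. by rewrite /kern mulNr !sqrrN. Qed.

Lemma kern_ge0 t (u v : R) : 0 < t -> 0 <= kern t u v.
Proof.
by move=> t0; rewrite /kern mulr_ge0 ?(ltW t0) ?invr_ge0 // mulr_ge0 ?pi_ge0 // addr_ge0 ?sqr_ge0.
Qed.

Lemma term_ge0 a b c t x n1 n2 m1 m2 : 0 < t -> 0 <= term a b c t x n1 n2 m1 m2.
Proof. by move=> t0; rewrite /term !mulr_ge0 ?exprn_ge0 ?kern_ge0. Qed.

Lemma continuous_expfun (f : R -> R) k : continuous f -> continuous (fun y => f y ^+ k).
Proof.
move=> cf; elim: k => [|k IH] y; first exact: cvg_cst.
rewrite (_ : (fun y => f y ^+ k.+1) = fun y => f y * f y ^+ k); first exact: (cvgM (cf y) (IH y)).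
by apply/funext => z; rewrite exprS.
Qed.

Lemma continuous_kern t (u k v : R) : 0 < t -> (v = 0 -> k = 0) ->
  continuous (fun y => kern t (u + k * y) v).
Proof.
move=> t0 vk; have [v0|v0] := eqVneq v 0.
  by rewrite (vk v0); rewrite (_ : (fun y => _) = fun=> kern t u v); [move=> y; exact: cvg_cst|apply/funext => y; rewrite mul0r addr0].
move=> y; apply: cvgM; first exact: cvg_cst.
apply: cvgV.
  by rewrite mulf_neq0 ?gt_eqF ?pi_gt0 // ltr_wpDl ?sqr_ge0 // exprn_even_gt0 //= mulf_neq0 // gt_eqF.
apply: cvgMl_tmp; apply: cvgD; last exact: cvg_cst.
have l : u + k * z @[z --> y] --> u + k * y.
  by apply: cvgD; [exact: cvg_cst|apply: cvgMl_tmp; exact: cvg_id].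
exact: (cvgM l l).
Qed.

Let o0 : 'I_3 := @Ordinal 3 0 isT.
Let o1 : 'I_3 := @Ordinal 3 1 isT.
Let o2 : 'I_3 := @Ordinal 3 2 isT.

Lemma forall_I3 (P : 'I_3 -> Prop) : P o0 -> P o1 -> P o2 -> forall r, P r.
Proof.
by move=> p0 p1 p2 [[|[|[|//]]] i]; [move: p0|move: p1|move: p2]; congr P; exact: val_inj.
Qed.

Lemma big_I3 (V : Type) (idx : V) (op : Monoid.law idx) (F : 'I_3 -> V) :
  \big[op/idx]_(r < 3) F r = op (F o0) (op (F o1) (F o2)).
Proof.
rewrite !big_ord_recl big_ord0 Monoid.mulm1.
by congr (op (F _) (op (F _) (F _))); exact: val_inj.
Qed.

Let config (q : (int * int) * (int * int)) : {ffun 'I_3 -> int * int} :=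
  [ffun r => tnth [tuple (q.2.1, q.1.1); (q.2.2, q.1.2);
                         (- (q.2.1 + q.2.2), - (q.1.1 + q.1.2))] r].

Let goodq (q : (int * int) * (int * int)) : bool :=
  [&& (q.2.1, q.1.1) != (0, 0), (q.2.2, q.1.2) != (0, 0) &
     (- (q.2.1 + q.2.2), - (q.1.1 + q.1.2)) != (0, 0)].

Lemma config_bij : set_bij [set q | goodq q] lattice_configs config.
Proof.
split => [q /and3P[/eqP g0 /eqP g1 /eqP g2]|q q' _ _ /ffunP e|p [p0 s1 s2]].
- split; first by apply: forall_I3; rewrite ffunE.
    by rewrite big_I3 !ffunE /=; lia.
  by rewrite big_I3 !ffunE /=; lia.
- have := e o0; have := e o1; rewrite !ffunE /=.
  by case: q e => [[? ?] [? ?]]; case: q' => [[? ?] [? ?]] /= _ [-> ->] [-> ->].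
rewrite big_I3 /= in s1; rewrite big_I3 /= in s2.
have e2 : p o2 = (- ((p o0).1 + (p o1).1), - ((p o0).2 + (p o1).2)).
  by rewrite [LHS]surjective_pairing; congr (_, _); lia.
exists (((p o0).2, (p o1).2), ((p o0).1, (p o1).1)).
  apply/and3P; split; apply/eqP => /= e; [apply: (p0 o0)|apply: (p0 o1)|apply: (p0 o2)] => //.
  - by rewrite -e -surjective_pairing.
  - by rewrite -e -surjective_pairing.
  - by rewrite e2.
by apply/ffunP; apply: forall_I3; rewrite ffunE //= -?surjective_pairing // e2.
Qed.

Lemma kernE t x (p : int * int) :
  complex.Im (Complex x t) / (pi * Normc.normc (p.1%:~R + p.2%:~R * Complex x t) ^+ 2)
  = kern t (p.1%:~R + p.2%:~R * x) p.2%:~R.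
Proof.
rewrite /kern; congr (_ / (_ * _)).
have ir (z : int) : (z%:~R : R[i]) = (z%:~R : R)%:C%C by rewrite rmorph_int.
rewrite !ir normc_sqr /=; congr (_ + _ ^+ 2); ring.
Qed.

Lemma modular_graph_functionE a b c t x : (0 < a)%N -> (0 < b)%N -> (0 < c)%N -> 0 < t ->
  modular_graph_function a b c (Complex x t) =
  (\esum_(q in [set: (int * int) * (int * int)]) (term a b c t x q.1.1 q.1.2 q.2.1 q.2.2)%:E)%E.
Proof.
move=> a0 b0 c0 t0; rewrite /modular_graph_function (@reindex_esum _ _ _ _ _ _ _ config_bij) esum_mkcond.
apply: eq_esum => q _.
have -> : \prod_(r < 3) (complex.Im (Complex x t) / (pi * Normc.normc
   ((config q r).1%:~R + (config q r).2%:~R * Complex x t) ^+ 2)) ^+ triple a b c r =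
   term a b c t x q.1.1 q.1.2 q.2.1 q.2.2.
  by rewrite big_I3 /= !kernE !ffunE /= /triple /= !(tnth_nth 0%N) /= mulrA.
have [gq|ng] := boolP (goodq q); first by rewrite mem_set.
rewrite memNset; last exact/negP.
have {ng} : [\/ (q.2.1, q.1.1) = (0, 0), (q.2.2, q.1.2) = (0, 0) |
     (- (q.2.1 + q.2.2), - (q.1.1 + q.1.2)) = (0, 0)].
  have [?|n0] := eqVneq (q.2.1, q.1.1) (0, 0); first exact: Or31.
  have [?|n1] := eqVneq (q.2.2, q.1.2) (0, 0); first exact: Or32.
  have [?|n2] := eqVneq (- (q.2.1 + q.2.2), - (q.1.1 + q.1.2)) (0, 0); first exact: Or33.
  by case/negP: ng; apply/and3P; split.
case=> -[e1 e2]; rewrite /term.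
- by rewrite e1 e2 mul0r addr0 kern00 expr0n (gtn_eqF a0) !mul0r.
- by rewrite e1 e2 mul0r addr0 kern00 [0 ^+ b]expr0n (gtn_eqF b0) mulr0 mul0r.
- by rewrite e1 e2 mul0r addr0 kern00 [0 ^+ c]expr0n (gtn_eqF c0) mulr0.
Qed.

Local Open Scope ereal_scope.

Definition term_int a b c t n1 n2 m1 m2 : \bar R :=
  \int[lebesgue_measure]_(x in `[0%R, 1%R]) (term a b c t x n1 n2 m1 m2)%:E.

Definition slice a b c t n1 n2 : \bar R :=
  \esum_(m in [set: int * int]) term_int a b c t n1 n2 m.1 m.2.

Lemma term_int_ge0 a b c t n1 n2 m1 m2 : (0 < t)%R -> 0 <= term_int a b c t n1 n2 m1 m2.
Proof. by move=> t0; apply: integral_ge0 => x _; rewrite lee_fin term_ge0. Qed.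

Lemma slice_ge0 a b c t n1 n2 : (0 < t)%R -> 0 <= slice a b c t n1 n2.
Proof. by move=> t0; apply: esum_ge0 => m _; exact: term_int_ge0. Qed.

Lemma continuous_term a b c t n1 n2 m1 m2 : (0 < t)%R ->
  continuous (fun x : R => term a b c t x n1 n2 m1 m2).
Proof.
move=> t0 x.
have ck (u k : R) e : continuous (fun y : R => kern t (u + k * y) k ^+ e)%R.
  by apply: continuous_expfun; exact: continuous_kern.
exact: (cvgM (cvgM (ck _ _ _ x) (ck _ _ _ x)) (ck _ _ _ x)).
Qed.

Lemma constant_mode_slices a b c t : (0 < a)%N -> (0 < b)%N -> (0 < c)%N -> (0 < t)%R ->
  constant_mode a b c t =
  \esum_(n1 in [set: int]) \esum_(n2 in [set: int]) slice a b c t n1 n2.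
Proof.
move=> a0 b0 c0 t0; rewrite /constant_mode.
under eq_integral do rewrite modular_graph_functionE //.
rewrite (@integral_esum R _ _ lebesgue_measure ((int * int) * (int * int))%type _
   (fun q x => (term a b c t x q.1.1 q.1.2 q.2.1 q.2.2)%:E)) //.
- rewrite (@esum_pair _ _ _ (fun n m : int * int => term_int a b c t n.1 n.2 m.1 m.2)) => [|n m]; last exact: term_int_ge0.
  by rewrite (@esum_pair _ _ _ (fun n1 n2 => slice a b c t n1 n2)) // => n m; exact: slice_ge0.
- move=> q; apply/measurable_EFinP; apply: measurable_funTS; apply: continuous_measurable_fun.
  exact: continuous_term.
- by move=> q x; rewrite lee_fin term_ge0.
Qed.

Lemma slice_swap12 a b c t n1 n2 : slice a b c t n1 n2 = slice b a c t n2 n1.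
Proof.
rewrite /slice (@reindex_esum _ _ _ [set: int * int] _ (fun p => (p.2, p.1))).
  apply: eq_esum => m _; apply: eq_integral => x _; congr (_%:E); rewrite /term /=.
  by rewrite [(m.2 + m.1)%R]addrC [(n2 + n1)%R]addrC; congr (_ * _)%R; rewrite mulrC.
by split => [p|[u v] [u' v'] _ _ [-> ->]|[u v] _] //; exists (v, u).
Qed.

Lemma slice_swap23 a b c t n1 n2 : slice a b c t n1 n2 = slice a c b t n1 (- (n1 + n2))%R.
Proof.
rewrite /slice (@reindex_esum _ _ _ [set: int * int] _ (fun p => (p.1, - (p.1 + p.2))%R)).
  apply: eq_esum => m _; apply: eq_integral => x _; congr (_%:E); rewrite /term /=.
  have -> : (- (n1 - (n1 + n2)) = n2)%R by ring.
  by rewrite mulrAC; congr (_ * _ * _)%R; congr (kern _ (_%:~R + _) _ ^+ _)%R; ring.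
split => [p|[u v] [u' v'] _ _ [-> /= /oppr_inj /addrI ->]|[u v] _] //.
by exists (u, - (u + v))%R => //=; congr (_, _); ring.
Qed.

Lemma slice_opp a b c t n1 n2 : slice a b c t (- n1)%R (- n2)%R = slice a b c t n1 n2.
Proof.
rewrite /slice (@reindex_esum _ _ _ [set: int * int] _ (fun p => (- p.1, - p.2)%R)).
  apply: eq_esum => m _; apply: eq_integral => x _; congr (_%:E); rewrite /term /=.
  by rewrite -!opprD !rmorphN !mulNr -!opprD !kernN.
split => [p|[u v] [u' v'] _ _ [/= /oppr_inj -> /oppr_inj ->]|[u v] _] //.
by exists (- u, - v)%R => //=; rewrite !opprK.
Qed.

(** The symmetries of the slices bring every ray to the form (k, -k) and every sector to the form
    (k, l) with positive entries, at the cost of permuting the exponents. *)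
Lemma constant_mode_split a b c t : (0 < a)%N -> (0 < b)%N -> (0 < c)%N -> (0 < t)%R ->
  let B a b c := \esum_(k in [set: nat]) slice a b c t k.+1%:Z (- k.+1%:Z)%R in
  let C a b c := \esum_(k in [set: nat]) \esum_(l in [set: nat]) slice a b c t k.+1%:Z l.+1%:Z in
  let half := (B a b c + B a c b + B b c a) + (C a b c + C a c b + C b c a) in
  constant_mode a b c t = slice a b c t 0%R 0%R + (half + half).
Proof.
move=> a0 b0 c0 t0 B C half; rewrite constant_mode_slices; [|assumption..].
apply: esum_int2_split => [n m|n m||||||].
- exact: slice_ge0.
- exact: slice_opp.
- by [].
- by apply: eq_esum => k _; rewrite slice_swap23 addr0.
- by apply: eq_esum => k _; rewrite slice_swap12 slice_swap23 addr0.
- by [].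
- apply: eq_esum => k _; apply: eq_esum => l _; rewrite slice_swap23; congr slice; lia.
- rewrite esum_swap; last by move=> k l; exact: slice_ge0.
  apply: eq_esum => l _; apply: eq_esum => k _.
  rewrite slice_swap12 slice_swap23 -slice_opp; congr slice; lia.
Qed.

End Lattice.

(** * Values of the individual slices *)

Section SliceValues.
Variable R : realType.
Local Notation C := R[i].
Implicit Types (t x y : R) (a b c g : nat) (k u m n : int).

(** The summand for (n_1, n_2) = g (k1, k2) in the coordinates m = M u + j k, where (u, k) is
    unimodular: [y] stands for j + g tau_1, so the sum over j unrolls the integral. *)
Definition line_term a b c t g k1 k2 u1 u2 (M : int) y : R :=
  kern t (M%:~R * u1%:~R + k1%:~R * y) (g%:R * k1%:~R) ^+ a
  * kern t (M%:~R * u2%:~R + k2%:~R * y) (g%:R * k2%:~R) ^+ b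
  * kern t (M%:~R * (u1 + u2)%:~R + (k1 + k2)%:~R * y) (g%:R * (k1 + k2)%:~R) ^+ c.

Lemma slice_unimodular a b c t g k1 k2 u1 u2 : 0 < t -> u1 * k2 - u2 * k1 = 1 ->
  (slice a b c t (g%:Z * k1) (g%:Z * k2) =
   \esum_(M in [set: int]) \esum_(j in [set: int])
     \int[lebesgue_measure]_(x in `[0%R, 1%R])
       (line_term a b c t g k1 k2 u1 u2 M (j%:~R + g%:R * x))%:E)%E.
Proof.
move=> t0 det; rewrite -esum_pair; last first.
  by move=> M j; apply: integral_ge0 => x _; rewrite lee_fin /line_term !mulr_ge0 ?exprn_ge0 ?kern_ge0.
rewrite /slice (@reindex_esum _ _ _ [set: int * int] _
  (fun p => (p.1 * u1 + p.2 * k1, p.1 * u2 + p.2 * k2))).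
  apply: eq_esum => p _; apply: eq_integral => x _; congr (_%:E); rewrite /term /line_term /=.
  rewrite -[kern t (p.1%:~R * (u1 + u2)%:~R + _) _]kernN.
  have gz : (g%:R : R) = (g%:Z)%:~R by [].
  congr (kern t _ _ ^+ _ * kern t _ _ ^+ _ * kern t _ _ ^+ _); rewrite ?gz !(rmorphD, rmorphN, rmorphM) /=; ring.
split => [//|[M j] [M' j'] _ _ /= [e1 e2]|[m1 m2] _].
  have EM (N i : int) : N = (N * u1 + i * k1) * k2 - (N * u2 + i * k2) * k1.
    by rewrite -[LHS]mulr1 -det; ring.
  have Ej (N i : int) : i = u1 * (N * u2 + i * k2) - u2 * (N * u1 + i * k1).
    by rewrite -[LHS]mulr1 -det; ring.
  by congr (_, _); [rewrite (EM M j) e1 e2 -EM|rewrite (Ej M j) e1 e2 -Ej].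
exists (m1 * k2 - m2 * k1, u1 * m2 - u2 * m1) => //=.
by congr (_, _); rewrite -[RHS]mulr1 -det; ring.
Qed.

Lemma slice_value a b c t g k1 k2 u1 u2 (W : int -> C) s : 0 < t -> (0 < g)%N ->
  u1 * k2 - u2 * k1 = 1 ->
  (forall M, has_pv (fun y => (line_term a b c t g k1 k2 u1 u2 M y)%:C%C) (W M)) ->
  csum W s -> slice a b c t (g%:Z * k1) (g%:Z * k2) = (complex.Re s)%:E.
Proof.
move=> t0 g0 det hW [cW _]; rewrite (slice_unimodular _ _ _ _ t0 det).
have l0 M y : 0 <= line_term a b c t g k1 k2 u1 u2 M y.
  by rewrite /line_term !mulr_ge0 ?exprn_ge0 ?kern_ge0.
have gn : g%:R != 0 :> R by rewrite pnatr_eq0 -lt0n.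
have cl M : continuous (line_term a b c t g k1 k2 u1 u2 M).
  have ck (u k : R) e : continuous (fun y : R => kern t (u + k * y) (g%:R * k) ^+ e).
    apply: continuous_expfun; apply: continuous_kern => // /eqP.
    by rewrite mulf_eq0 (negPf gn) /= => /eqP.
  by move=> x; exact: (cvgM (cvgM (ck _ _ _ x) (ck _ _ _ x)) (ck _ _ _ x)).
under eq_esum => M _ do rewrite (esum_unroll (l0 M) (cl M) (hW M).1 g0).
apply: esum_ssum => // M; exact: (rpv_ge0 (l0 M) (hW M).1).
Qed.

Lemma Re_realM (r : R) (s : C) : complex.Re (r%:C%C * s) = r * complex.Re s.
Proof. by case: s => u v /=; rewrite mul0r subr0. Qed.

Lemma resolvent_pair (v T y : R) : resolvent (Complex (- v) (- T)) y * resolvent (Complex (- v) T) y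
  = (((y + v) ^+ 2 + T ^+ 2)^-1)%:C%C.
Proof.
rewrite /resolvent -invfM fmorphV; congr (_^-1).
by apply/eqP; rewrite eq_complex /=; apply/andP; split; apply/eqP; ring.
Qed.

Lemma exp_poly_bound (c : R) E : 0 < c -> exists2 K, 0 <= K &
  forall x, 0 <= x -> x ^+ E * expR (- (c * x)) <= K.
Proof.
move=> c0; exists (E`!%:R / c ^+ E) => [|x x0]; first by rewrite divr_ge0 ?exprn_ge0 // ltW.
have cx0 : 0 <= c * x by rewrite mulr_ge0 // ltW.
have /andP[h _] := expR_taylor E.+1 cx0.
rewrite big_nat_recr //= subr_ge0 in h.
have h' : (c * x) ^+ E / E`!%:R <= expR (c * x).
  by apply: le_trans h; rewrite lerDr; apply: sumr_ge0 => j _; rewrite divr_ge0 ?exprn_ge0.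
rewrite expRN ler_pdivrMr ?expR_gt0 // mulrAC ler_pdivlMr ?exprn_gt0 //.
rewrite ler_pdivrMr ?ltr0n ?fact_gt0 // exprMn in h'.
by rewrite mulrC [E`!%:R * _]mulrC.
Qed.

(* The gain (T X)^-4 is traded for half of the exponential decay. *)
Lemma tail_bound (K c : R) E : 0 < c -> 0 <= K -> exists K', 0 <= K' /\
  forall t T X : R, 1 <= t -> t <= T -> 1 <= X ->
  K * X ^+ E * expR (- (c * (T * X))) <= K' * expR (- (c / 2 * t)) / (T * X) ^+ 4.
Proof.
move=> c0 K0; have c2 : 0 < c / 2 by rewrite divr_gt0.
have [B B0 hB] := @exp_poly_bound (c / 2) (E + 4) c2.
exists (K * B); split; first exact: mulr_ge0.
move=> t T X t1 tT X1; have TX : X <= T * X by nra.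
have TX0 : 0 < T * X by nra.
rewrite ler_pdivlMr ?exprn_gt0 //.
have := hB _ (ltW TX0); rewrite exprD => hB'.
have -> : expR (- (c * (T * X))) = expR (- (c / 2 * (T * X))) * expR (- (c / 2 * (T * X))).
  by rewrite -expRD; congr expR; field.
have e1 : expR (- (c / 2 * (T * X))) <= expR (- (c / 2 * t)).
  by rewrite ler_expR lerN2 ler_wpM2l ?(ltW c2) //; nra.
have XE : X ^+ E <= (T * X) ^+ E by apply: lerXn2r => //; rewrite nnegrE; lra.
set e := expR (- (c / 2 * (T * X))) in hB' e1 *; have e0 : 0 <= e by exact: expR_ge0.
have p0 : 0 <= X ^+ E by rewrite exprn_ge0 //; lra.
have q0 : 0 <= (T * X) ^+ 4 by rewrite exprn_ge0 // ltW.
have -> : K * X ^+ E * (e * e) * (T * X) ^+ 4 = K * ((X ^+ E * (T * X) ^+ 4 * e) * e) by ring.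
rewrite -[X in _ <= X]mulrA ler_wpM2l //; apply: ler_pM => //; first by apply: mulr_ge0 => //; exact: mulr_ge0.
apply: le_trans hB'; apply: ler_wpM2r => //; exact: ler_wpM2r.
Qed.

(** Homogeneity lets the greatest common divisor of n_1 and n_2 pass from the height g tau_2 to the
    arguments, which become n_1, n_2 and n_1 + n_2 again. *)
Lemma zcoef_scale a b w (z x x' : R) : (a + 1 < w)%N ->
  zcoef a b w (z * x) (z * x') = z^-1 ^+ (2 * w - 2) * zcoef a b w x x'.
Proof.
move=> aw; rewrite /zcoef mulr_sumr; apply: eq_big_nat => k /andP[_ ka].
rewrite mulr_sumr; apply: eq_big_nat => l /andP[_ la].
have -> : (2 * w - 2 = (k + l + 1) + (2 * w - k - l - 3))%N by lia.
rewrite (exprD z^-1 (k + l + 1)) (invfM z x) (invfM z x').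
rewrite (exprMn (k + l + 1)) (exprMn (2 * w - k - l - 3)).
by move: (z^-1 ^+ (k + l + 1)) (z^-1 ^+ (2 * w - k - l - 3)) => p q; ring.
Qed.

Lemma slice_same_sign a b c : (0 < a)%N -> (0 < b)%N -> (0 < c)%N ->
  exists K d, [/\ 0 < d, 0 <= K & forall t (n1 n2 : nat), 1 <= t -> (0 < n1)%N -> (0 < n2)%N ->
   exists2 r, slice a b c t n1%:Z n2%:Z = ((t / pi) ^+ (a + b + c) * r)%:E &
   `|r - 4 * pi ^+ 2 * (2 * t)^-1 ^+ (2 * (a + b + c) - 2) *
       (zcoef a b (a + b + c) n1%:R (n1 + n2)%:R + zcoef b a (a + b + c) n2%:R (n1 + n2)%:R)|
   <= K * expR (- (d * t)) / (n1%:R * n2%:R) ^+ 2].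
Proof.
move=> a0 b0 c0; set w := (a + b + c)%N.
have aw : (a + 1 < w)%N by rewrite /w; lia.
have bw : (b + 1 < w)%N by rewrite /w; lia.
have sc (G z : R) N : G != 0 -> z != 0 ->
    4 * pi ^+ 2 * (2 * z)^-1 ^+ N = 4 * pi ^+ 2 * (2 * (G * z))^-1 ^+ N * G ^+ N.
  move=> G0 z0; rewrite -[RHS]mulrA; congr (_ * _); rewrite -exprMn; congr (_ ^+ _).
  by field; rewrite G0 z0.
(* The index packs tau_2 together with (n_1, n_2), so that one application of the uniform estimate
   yields constants valid for all of them. The maximum with 1 and the successors make the hypotheses
   true at every index. *)
pose I := (R * (nat * nat))%type.
pose tt (i : I) : R := Num.max 1 i.1.
pose g (i : I) : nat := gcdn i.2.1.+1 i.2.2.+1.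
pose k1 (i : I) : nat := (i.2.1.+1 %/ g i)%N.
pose k2 (i : I) : nat := (i.2.2.+1 %/ g i)%N.
pose u1 (i : I) : nat := (egcdn i.2.2.+1 i.2.1.+1).1.
pose u2 (i : I) : nat := (egcdn i.2.2.+1 i.2.1.+1).2.
have g0 i : (0 < g i)%N by rewrite gcdn_gt0.
have gk1 i : (k1 i * g i = i.2.1.+1)%N by rewrite /k1 divnK ?dvdn_gcdl.
have gk2 i : (k2 i * g i = i.2.2.+1)%N by rewrite /k2 divnK ?dvdn_gcdr.
have k10 i : (0 < k1 i)%N by have := gk1 i; case: (k1 i).
have k20 i : (0 < k2 i)%N by have := gk2 i; case: (k2 i).
have bez i : (u1 i * k2 i = u2 i * k1 i + 1)%N.
  rewrite /u1 /u2; case: egcdnP => //= km kn e _.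
  apply/eqP; rewrite -(eqn_pmul2r (g0 i)) mulnDl mul1n -!mulnA gk1 gk2 e /g.
  by rewrite gcdnC.
have tt1 i : 1 <= tt i by rewrite /tt le_max lexx.
pose T i : R := (g i)%:R * tt i.
have gR i : 1 <= (g i)%:R :> R by rewrite ler1n.
have T1 i : 1 <= T i by rewrite /T; have := gR i; have := tt1 i; nra.
pose x1 i : R := (k1 i)%:R; pose x2 i : R := (k2 i)%:R.
have h1 i : 1 <= x1 i by rewrite /x1 ler1n.
have h2 i : 1 <= x2 i by rewrite /x2 ler1n.
pose v1 i : R := (u1 i)%:R; pose v2 i : R := (u2 i)%:R.
have hu i : v1 i * x2 i - v2 i * x1 i = 1.
  by rewrite /v1 /v2 /x1 /x2 -!natrM bez natrD addrAC subrr add0r.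
have [W hW [K [d [E [d0 K0 hK]]]]] := dbl_same_sign T1 h1 h2 hu a0 b0 c0.
have [K' [K0' tb]] := tail_bound E d0 K0.
exists K', (d / 2); split => //; first by rewrite divr_gt0.
move=> t n1 n2 t1 n10 n20; pose i : I := (t, (n1.-1, n2.-1)).
have [s hs bs] := hK i.
have tti : tt i = t by rewrite /tt /= max_r.
have en1 : (g i * k1 i = n1)%N by rewrite mulnC gk1 /= prednK.
have en2 : (g i * k2 i = n2)%N by rewrite mulnC gk2 /= prednK.
have t0 : 0 < t by lra.
pose q : C := ((t / pi) ^+ w)%:C%C.
have hline M : has_pv (fun y => (line_term a b c t (g i) (k1 i)%:Z (k2 i)%:Z (u1 i)%:Z (u2 i)%:Z M y)%:C%C) (q * W i M).
  apply: has_pv_ext (has_pvZ q (hW i M)) => y.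
  have pr (x u : R) : x != 0 -> x^-1%:C%C * resolvent (lo T (fun=> u / x) i M) y *
      (x^-1%:C%C * resolvent (up T (fun=> u / x) i M) y) =
      (((M%:~R * u + x * y) ^+ 2 + (x * T i) ^+ 2)^-1)%:C%C.
    move=> x0; rewrite mulrACA resolvent_pair -!(rmorphM (@real_complex R)) /=; congr (_%:C%C).
    rewrite -!invfM; congr (_^-1); field; exact: x0.
  have x10 : x1 i != 0 by have := h1 i => ?; apply/eqP; lra.
  have x20 : x2 i != 0 by have := h2 i => ?; apply/eqP; lra.
  have x30 : x1 i + x2 i != 0 by have := h1 i; have := h2 i => ? ?; apply/eqP; lra.
  have P1 := pr _ (v1 i) x10; have P2 := pr _ (v2 i) x20; have P3 := pr _ (v1 i + v2 i) x30.
  rewrite /Lo /Up.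
  have sh (A B D A' B' D' : C) : A ^+ a * B ^+ b * D ^+ c * (A' ^+ a * B' ^+ b * D' ^+ c) =
      (A * A') ^+ a * (B * B') ^+ b * (D * D') ^+ c by rewrite !exprMn; ring.
  rewrite sh P1 P2 P3 -!(rmorphXn (@real_complex R)) /q -!(rmorphM (@real_complex R)); congr (real_complex _ _).
  rewrite /line_term /kern -!PoszD -!pmulrn natrD /w 2!exprD.
  have kf (u v : R) : t / (pi * (u + ((g i)%:R * v * t) ^+ 2)) = t / pi * (u + (v * T i) ^+ 2)^-1.
    by rewrite /T tti invfM [LHS]mulrA; congr (_ / _); ring.
  rewrite !kf /x1 /x2 /v1 /v2 !natrD !exprMn; ring.
have det : (u1 i)%:Z * (k2 i)%:Z - (u2 i)%:Z * (k1 i)%:Z = 1 by have := bez i; lia.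
have sv := slice_value t0 (g0 i) det hline (csumZ q hs).
exists (complex.Re s).
  rewrite -en1 -en2 !PoszM sv; congr (_%:E).
  exact: Re_realM.
have X1 : 1 <= x1 i * x2 i by exact: mulr_ege1.
have XX : T i * (x1 i * x2 i) >= 1 by exact: mulr_ege1.
have t1' : t <= T i by rewrite /T tti ler_peMl // ltW.
set V := (X in s - X%:C%C) in bs.
apply: (@le_trans _ _ (Normc.normc (s - V%:C%C))).
  have -> : 4 * pi ^+ 2 * (2 * t)^-1 ^+ (2 * w - 2) *
     (zcoef a b w n1%:R (n1 + n2)%:R + zcoef b a w n2%:R (n1 + n2)%:R) = V; last first.
    by have := Re_le_normc (s - V%:C%C); case: (s).
  rewrite /V -/w.
  have zs' (z x x' : R) aa bb : (aa + 1 < w)%N -> z != 0 -> zcoef aa bb w x x' = z ^+ (2 * w - 2) * zcoef aa bb w (z * x) (z * x').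
    by move=> aaw z0; rewrite zcoef_scale // mulrA -exprMn divff // expr1n mul1r.
  have gn0 : (g i)%:R != 0 :> R by rewrite pnatr_eq0 -lt0n.
  have e3 : (g i)%:R * (x1 i + x2 i) = (n1 + n2)%:R by rewrite mulrDr /x1 /x2 -!natrM en1 en2 natrD.
  have e1 : (g i)%:R * x1 i = n1%:R by rewrite /x1 -natrM en1.
  have e2 : (g i)%:R * x2 i = n2%:R by rewrite /x2 -natrM en2.
  have z1 := zs' (g i)%:R (x1 i) (x1 i + x2 i) a b aw gn0.
  have z2 := zs' (g i)%:R (x2 i) (x1 i + x2 i) b a bw gn0.
  rewrite z1 z2 e1 e2 e3 -mulrDr [RHS]mulrA; congr (_ * _); rewrite /T tti.
  by apply: sc => //; exact: lt0r_neq0.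
apply: le_trans bs (le_trans (tb t (T i) (x1 i * x2 i) t1 t1' X1) _).
apply: ler_wpM2l; first by apply: mulr_ge0 => //; exact: expR_ge0.
have p1 : 0 < (n1%:R * n2%:R : R) ^+ 2 by rewrite exprn_gt0 // mulr_gt0 // ltr0n.
have p2 : 0 < (T i * (x1 i * x2 i)) ^+ 4 by rewrite exprn_gt0 //; lra.
rewrite lef_pV2 //.
have y0 : 0 <= n1%:R * n2%:R :> R by rewrite mulr_ge0.
(* Here n_1 n_2 = g^2 x1 x2, so the gain (T X)^-4 of [tail_bound] dominates the summable (n_1
   n_2)^-2. *)
have y2 : n1%:R * n2%:R <= (T i * (x1 i * x2 i)) ^+ 2.
  have -> : (T i * (x1 i * x2 i)) ^+ 2 = n1%:R * n2%:R * (t ^+ 2 * (x1 i * x2 i)).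
    by rewrite -en1 -en2 !natrM /T tti /x1 /x2; ring.
  by rewrite ler_peMr // mulr_ege1 // exprn_ege1.
rewrite (_ : 4 = 2 * 2)%N // exprM; apply: lerXn2r => //; rewrite nnegrE //.
by apply: exprn_ge0; lra.
Qed.

Lemma slice_zero_line a b c : (0 < a)%N -> (0 < b)%N -> (0 < c)%N ->
  exists K d, [/\ 0 < d, 0 <= K & forall t (n : nat), 1 <= t -> (0 < n)%N ->
   exists2 r, slice a b c t n%:Z (- n%:Z) = ((t / pi) ^+ (a + b + c) * r)%:E &
   `|r - (zero_line_value a b c (n%:R * t) + zero_line_value b a c (n%:R * t))|
   <= K * expR (- (d * t)) / n%:R ^+ 2].
Proof.
case: a b => [//|a] [//|b] _ _ c0; set w := (a.+1 + b.+1 + c)%N.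
pose I := (R * nat)%type.
pose T (i : I) : R := i.2.+1%:R * Num.max 1 i.1.
have T1 i : 1 <= T i by rewrite /T mulr_ege1 ?ler1n // le_max lexx.
have [W hW [K [d [E [d0 K0 hK]]]]] := dbl_zero_line T1 a b c0.
have [K' [K0' tb]] := tail_bound E d0 K0.
exists K', (d / 2); split => //; first by rewrite divr_gt0.
move=> t n t1 n0; pose i : I := (t, n.-1); have [s hs bs] := hK i.
have Ti : T i = n%:R * t by rewrite /T /= prednK // max_r.
have t0 : 0 < t by lra.
have nR : 1 <= n%:R :> R by rewrite ler1n.
pose q : C := ((t / pi) ^+ w)%:C%C.
(* The choice g = n, k = (1, -1), u = (0, -1) gives lines of slopes 0 and 1, and the third kernel
   becomes t / (pi M^2). *)
have hline M : has_pv (fun y => (line_term a.+1 b.+1 c t n 1 (-1) 0 (-1) M y)%:C%C) (q * W i M).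
  apply: has_pv_ext (has_pvZ q (hW i M)) => y.
  have pr (e : R) : resolvent (lo T (fun=> e) i M) y * resolvent (up T (fun=> e) i M) y =
      (((y + e * M%:~R) ^+ 2 + T i ^+ 2)^-1)%:C%C by rewrite resolvent_pair.
  have sh (A B A' B' : C) : A ^+ a.+1 * B ^+ b.+1 * (A' ^+ a.+1 * B' ^+ b.+1) =
      (A * A') ^+ a.+1 * (B * B') ^+ b.+1 by rewrite !exprMn; ring.
  rewrite sh !pr -!(rmorphXn (@real_complex R)) /q -!(rmorphM (@real_complex R)); congr (real_complex _ _).
  rewrite /line_term /kern Ti subrr /w 2!exprD exprM mulr0 add0r.
  rewrite !(mulr1, mul1r, mulr0, mul0r, add0r, addr0, expr0n, rmorphN, rmorph1, mulN1r, mulrN1) /= ?mul0r ?addr0.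
  have kf (u v : R) : t / (pi * (u + v)) = t / pi * (u + v)^-1 by rewrite invfM mulrA.
  rewrite !(mulrN1, mulNr, mulN1r, mulrN, sqrrN) -!opprD !sqrrN [(M%:~R + y)%R]addrC !kf.
  have kf0 (u : R) : t / (pi * u) = t / pi * u^-1 by rewrite invfM mulrA.
  rewrite kf0 [M%:~R^-1 ^+ 2]exprVn.
  move: (t / pi) (M%:~R ^- 2) (y ^+ 2 + _)^-1 ((y + _) ^+ 2 + _)^-1 => p1 p2 p3 p4.
  by rewrite !exprMn; ring.
have sv := slice_value t0 n0 (_ : 0 * -1 - -1 * 1 = 1 :> int) hline (csumZ q hs).
exists (complex.Re s).
  by rewrite -[n%:Z]mulr1 -mulrN sv //; congr (_%:E); exact: Re_realM.
have TN : n%:R <= T i by rewrite Ti ler_peMr //; lra.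
have t1' : t <= T i by rewrite Ti ler_peMl //; lra.
rewrite -Ti; set V := (X in s - X%:C%C) in bs.
apply: (@le_trans _ _ (Normc.normc (s - V%:C%C))).
  by have := Re_le_normc (s - V%:C%C); case: (s).
apply: le_trans bs (le_trans (tb t (T i) 1 t1 t1' (lexx _)) _).
have T0 : 0 < T i by have := T1 i; lra.
rewrite mulr1; apply: ler_wpM2l; first by apply: mulr_ge0 => //; exact: expR_ge0.
have p1 : 0 < (n%:R : R) ^+ 2 by rewrite exprn_gt0 // ltr0n.
have p2 : 0 < T i ^+ 4 by rewrite exprn_gt0.
rewrite lef_pV2 //.
apply: (@le_trans _ _ (T i ^+ 2)); first by apply: lerXn2r; rewrite ?nnegrE //; lra.
by apply: ler_weXn2l; first exact: T1.
Qed.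

End SliceValues.

(** * Translation and reflection of symmetric sums *)

Section ShiftedSums.
Variable R : realType.
Implicit Types g : int -> R.

(** A translation changes symmetric partial sums by boundary terms; vanishing at each end separately
    makes these harmless. *)
Definition decays g := (g N%:Z @[N --> \oo] --> 0) /\ (g (- N%:Z) @[N --> \oo] --> 0).

Lemma symsumS g N : symsum g N.+1 = symsum g N + (g N.+1%:Z + g (- N.+1%:Z)).
Proof. by rewrite /symsum big_nat_recr //= addrA. Qed.

Lemma ssum_shift1 g s : decays g -> ssum g s -> ssum (fun m => g (m + 1)) s.
Proof.
move=> [dp dn] gs.
have e N : symsum (fun m => g (m + 1)) N = symsum g N + g (N.+1%:Z) - g (- N%:Z).
  elim: N => [|N IH]; first by rewrite /symsum !big_nil add0r !addr0 oppr0; ring.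
  rewrite !symsumS IH.
  have -> : N.+1%:Z + 1 = N.+2%:Z by lia.
  have -> : - N.+1%:Z + 1 = - N%:Z by lia.
  ring.
have dS : g N.+1%:Z @[N --> \oo] --> 0 by rewrite (cvg_shiftS (fun N : nat => g N%:Z)).
have l := cvgB (cvgD gs dS) dn.
by apply: cvg_eqf; [exact: l|move=> N; rewrite e|rewrite addr0 subr0].
Qed.

Lemma decays_shift1 g : decays g -> decays (fun m => g (m + 1)).
Proof.
move=> [dp dn]; split.
  rewrite (_ : (fun N : nat => _) = fun N => g N.+1%:Z); first by rewrite (cvg_shiftS (fun N : nat => g N%:Z)).
  by apply/funext => N; congr g; lia.
rewrite -(cvg_shiftS (fun N : nat => g (- N%:Z + 1))).
by rewrite (_ : (fun N : nat => _) = fun N => g (- N%:Z)) //; apply/funext => N; congr g; lia.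
Qed.

Lemma decays_opp g : decays g -> decays (fun m => g (- m)).
Proof. by move=> [dp dn]; split => //; under eq_fun do rewrite opprK. Qed.

Lemma ssum_opp g s : ssum g s -> ssum (fun m => g (- m)) s.
Proof.
rewrite /ssum (_ : symsum (fun m => g (- m)) = symsum g) //.
by apply/funext => N; rewrite /symsum oppr0; congr (_ + _); apply: eq_bigr => m _; rewrite opprK addrC.
Qed.

Lemma ssum_reflect g s n : decays g -> ssum g s -> ssum (fun m => g (n - m)) s.
Proof.
have shift k h : decays h -> ssum h s -> ssum (fun m => h (m + k%:Z)) s.
  elim: k h => [|k IH] h dh hs; first by apply: ssum_ext hs => m; rewrite addr0.
  apply: ssum_ext (IH _ (decays_shift1 dh) (ssum_shift1 dh hs)) => m /=; congr h; lia.
move=> dg gs; case: n => k.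
  by apply: ssum_ext (ssum_opp (shift k _ dg gs)) => m; congr g; lia.
by apply: ssum_ext (shift k.+1 _ (decays_opp dg) (ssum_opp gs)) => m; congr g; lia.
Qed.

Lemma decays_inv_pow p : decays (fun m => (m%:~R : R)^-1 ^+ p.+1).
Proof.
have h1 : (N%:R : R)^-1 @[N --> \oo] --> 0.
  by rewrite -(cvg_shiftS (fun N : nat => (N%:R : R)^-1)); exact: cvg_harmonic.
have l : (N%:R : R)^-1 ^+ p.+1 @[N --> \oo] --> 0.
  elim: p => [|p IH]; first exact: h1.
  by apply: cvg_eqf; [exact: (cvgM h1 IH)|move=> N /=; rewrite -exprS|rewrite mulr0].
split => //=.
apply: cvg_eqf; [exact: (cvgMl_tmp (a := (-1) ^+ p.+1) l)|move=> N /=|by rewrite mulr0].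
by rewrite rmorphN /= invrN -[- _^-1]mulN1r exprMn.
Qed.

Lemma ssum_inv_pow k : (0 < k)%N -> ssum (fun m => (m%:~R : R)^-1 ^+ k) (zs R k).
Proof.
move=> k0; have [h _] := csum_inv_pow R k0; apply: ssum_ext h => m.
by rewrite -(rmorphXn (@real_complex R)).
Qed.

Lemma ssum_delta n (k : R) : ssum (fun m => if m == n then k else 0) k.
Proof.
have fin (n' : int) : n' != 0 ->
    (if (absz n')%:Z == n' then k else 0) + (if - (absz n')%:Z == n' then k else 0) = k.
  case: n' => [[|j]|j] // _; rewrite /absz.
    by rewrite eqxx (_ : (- j.+1%:Z == j.+1%:Z) = false) ?addr0.
  by rewrite (_ : (j.+1%:Z == Negz j) = false) ?add0r // NegzE eqxx.
rewrite /ssum; apply: cvg_near_cst; near=> N.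
have nN : (absz n <= N)%N by near: N; exact: nbhs_infty_ge.
rewrite /symsum; have [->|n0] := eqVneq n 0.
  rewrite big_nat big1 ?addr0 // => m /andP[m0 _].
  by rewrite oppr_eq0 eqz_nat (gtn_eqF m0) addr0.
rewrite add0r (bigD1_seq (absz n)) ?iota_uniq //=; last first.
  by rewrite mem_index_iota ltnS nN andbT absz_gt0.
rewrite big1_seq ?addr0 => [|m /andP[/eqP mn _]]; last first.
  have m1 : (m%:Z == n) = false by apply/eqP => e; apply: mn; rewrite -e.
  have m2 : (- m%:Z == n) = false by apply/eqP => e; apply: mn; rewrite -e abszN.
  by rewrite m1 m2 addr0.
exact: fin.
Unshelve. all: by end_near.
Qed.

Lemma ssum_sum (J : Type) (r : seq J) (F : J -> int -> R) (v : J -> R) :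
  (forall j, ssum (F j) (v j)) ->
  ssum (fun m => \sum_(j <- r) F j m) (\sum_(j <- r) v j).
Proof.
move=> h; elim: r => [|j r IH].
  by rewrite big_nil; apply: (ssum_ext _ (@ssum0 R)) => m; rewrite big_nil.
by rewrite big_cons; apply: ssum_ext (ssumD (h j) IH) => m; rewrite big_cons.
Qed.

End ShiftedSums.

(** * The Tornheim sum at n_1 = n_2 = 0 *)

Section TornheimSum.
Variable R : realType.
Variables a b c : nat.
Hypotheses (a0 : (0 < a)%N) (b0 : (0 < b)%N) (c0 : (0 < c)%N).
Let w := (a + b + c)%N.
Let v (m : int) : R := (m%:~R)^-1.

Lemma sum_pexp_coef p q : (0 < q)%N ->
  (\sum_(0 <= k < p.+1) 'C(p.+1 + q - k - 2, q - 1) = 'C(p + q, q))%N.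
Proof.
move=> q0; rewrite big_nat_rev /= add0n.
transitivity (\sum_(0 <= i < p.+1) 'C(q - 1 + i, i))%N.
  by apply: eq_big_nat => k kp; rewrite -bin_sub; [congr ('C(_, _)); lia|lia].
by rewrite hockey_stick -bin_sub; [congr ('C(_, _)); lia|lia].
Qed.

Let pexp_same p q n (x : R) : (0 < p)%N -> (0 < q)%N -> (p <= n)%N ->
  pexp p q n x x = 'C(p + q - 1, q)%:R * x ^+ n.
Proof.
case: p => [//|p] _ q0 pn; rewrite addSn subn1 /= -sum_pexp_coef // natr_sum mulr_suml.
by apply: eq_big_nat => k kp; rewrite -exprD; congr (_ * _ ^+ _); lia.
Qed.

Let pexp0 p q n (x : R) : pexp p q n 0 x = 0.
Proof. by rewrite /pexp big1 // => k _; rewrite expr0n /= mul0r mulr0. Qed.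

Let wE : (2 * w = 2 * b + 2 * c + 2 * a)%N. Proof. by rewrite /w; lia. Qed.

Let f (n m : int) : R := v n ^+ (2 * a) * v m ^+ (2 * b) * v (n - m) ^+ (2 * c).

(** Partial fractions in [m]. At m = 0 and m = n an inverse on the left is 1/0 = 0, while one of the
    two expansions is nonzero there; the subtracted terms restore equality. *)
Let f_split n m : n != 0 ->
  f n m = pexp (2 * b) (2 * c) (2 * w) (v m) (v n)
        + pexp (2 * c) (2 * b) (2 * w) (v (n - m)) (v n)
        - (if m == 0 then 'C(2 * b + 2 * c - 1, 2 * b)%:R * v n ^+ (2 * w) else 0)
        - (if m == n then 'C(2 * b + 2 * c - 1, 2 * c)%:R * v n ^+ (2 * w) else 0).
Proof.
have v0 : v 0 = 0 by rewrite /v invr0.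
move=> n0; have [-> | m0] := eqVneq m 0.
  rewrite /f subr0 v0 pexp0 expr0n muln_eq0 (gtn_eqF b0) /= mulr0 mul0r.
  rewrite [0 == n]eq_sym (negPf n0) subr0 add0r pexp_same ?muln_gt0 //; last by rewrite wE; lia.
  by rewrite [(2 * c + _)%N]addnC subrr.
have [-> | mn] := eqVneq m n.
  rewrite /f subrr v0 pexp0 expr0n muln_eq0 (gtn_eqF c0) /= mulr0 addr0 subr0.
  by rewrite pexp_same ?muln_gt0 ?subrr //; rewrite wE; lia.
rewrite !subr0 wE -pexpE ?muln_gt0 //.
  by rewrite /f -mulrA mulrC.
have nR : (n%:~R : R) != 0 by rewrite intr_eq0.
have mR : (m%:~R : R) != 0 by rewrite intr_eq0.
have nmR : (n%:~R - m%:~R : R) != 0 by rewrite -rmorphB intr_eq0 subr_eq0 eq_sym.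
by rewrite /v rmorphB /=; field; rewrite nR mR nmR.
Qed.

Definition top_half_value p q : R :=
  \sum_(0 <= k < p.+1) 'C(2 * p + 2 * q - 2 * k - 1, 2 * q - 1)%:R * (zs R (2 * k) * zs R (2 * w - 2 * k)).

Let row n : n != 0 -> ssum (f n)
  (\sum_(0 <= k < 2 * b) 'C(2 * b + 2 * c - k - 2, 2 * c - 1)%:R * (zs R k.+1 * v n ^+ (2 * w - k - 1))
  + \sum_(0 <= k < 2 * c) 'C(2 * c + 2 * b - k - 2, 2 * b - 1)%:R * (zs R k.+1 * v n ^+ (2 * w - k - 1))
  - 'C(2 * b + 2 * c - 1, 2 * b)%:R * v n ^+ (2 * w) - 'C(2 * b + 2 * c - 1, 2 * c)%:R * v n ^+ (2 * w)).
Proof.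
move=> n0.
have s1 p q : ssum (fun m => pexp p q (2 * w) (v m) (v n))
  (\sum_(0 <= k < p) 'C(p + q - k - 2, q - 1)%:R * (zs R k.+1 * v n ^+ (2 * w - k - 1))).
  apply: ssum_sum => k; apply: ssumZ; rewrite mulrC.
  have h := ssumZ (k := v n ^+ (2 * w - k - 1)) (@ssum_inv_pow R k.+1 isT).
  by apply: ssum_ext h => m; exact: mulrC.
have s2 p q : ssum (fun m => pexp p q (2 * w) (v (n - m)) (v n))
  (\sum_(0 <= k < p) 'C(p + q - k - 2, q - 1)%:R * (zs R k.+1 * v n ^+ (2 * w - k - 1))).
  apply: ssum_sum => k; apply: ssumZ; rewrite mulrC.
  have h := ssumZ (k := v n ^+ (2 * w - k - 1)) (ssum_reflect n (@decays_inv_pow R k) (@ssum_inv_pow R k.+1 isT)).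
  by apply: ssum_ext h => m; exact: mulrC.
have d1 := @ssum_delta R 0 (- ('C(2 * b + 2 * c - 1, 2 * b)%:R * v n ^+ (2 * w))).
have d2 := @ssum_delta R n (- ('C(2 * b + 2 * c - 1, 2 * c)%:R * v n ^+ (2 * w))).
have h := ssumD (ssumD (ssumD (s1 (2 * b) (2 * c)) (s2 (2 * c) (2 * b)))%N d1) d2.
apply: ssum_ext h => m.
by rewrite f_split //; congr (_ + _ + _); case: ifP; rewrite ?oppr0.
Qed.

Let row_value n : R :=
  \sum_(0 <= k < 2 * b) 'C(2 * b + 2 * c - k - 2, 2 * c - 1)%:R * (zs R k.+1 * v n ^+ (2 * w - k - 1))
  + \sum_(0 <= k < 2 * c) 'C(2 * c + 2 * b - k - 2, 2 * b - 1)%:R * (zs R k.+1 * v n ^+ (2 * w - k - 1))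
  - 'C(2 * b + 2 * c - 1, 2 * b)%:R * v n ^+ (2 * w) - 'C(2 * b + 2 * c - 1, 2 * c)%:R * v n ^+ (2 * w).

(** Odd arguments of [zs] vanish, and the term [k = 0], where [zs] is -1, is exactly the correction
    subtracted in [f_split]. *)
Let top_half_valueE p q : (0 < p)%N -> (0 < q)%N -> (p < w)%N ->
  top_half_value p q =
  \sum_(0 <= k < 2 * p) 'C(2 * p + 2 * q - k - 2, 2 * q - 1)%:R * (zs R k.+1 * zs R (2 * w - k - 1))
  - 'C(2 * p + 2 * q - 1, 2 * p)%:R * zs R (2 * w).
Proof.
move=> p0 q0 pw.
have h := @sum_nat_even R (fun j => 'C(2 * p + 2 * q - j - 1, 2 * q - 1)%:R * (zs R j * zs R (2 * w - j))) (2 * p) p.+1.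
have {}h := h ltac:(lia) ltac:(by move=> l ol; rewrite /zs ol mul0r mulr0).
rewrite /top_half_value.
transitivity (\sum_(0 <= l < (2 * p).+1) 'C(2 * p + 2 * q - l - 1, 2 * q - 1)%:R * (zs R l * zs R (2 * w - l))).
  by rewrite h; apply: eq_big_nat => k /andP[_ kp]; rewrite leq_pmul2l // -ltnS kp.
rewrite big_nat_recl // zs0 mulN1r subn0 mulrN subn0 addrC; congr (_ - _).
  by apply: eq_big_nat => k kp; congr ('C(_, _)%:R * (_ * zs R _)); lia.
by congr (_%:R * _); rewrite -bin_sub; [congr ('C(_, _)); lia|lia].
Qed.

Lemma esum_tornheim :
  (\esum_(n in [set: int]) \esum_(m in [set: int]) (f n m)%:E = (top_half_value b c + top_half_value c b)%:E)%E.
Proof.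
have vsq k (m : int) : 0 <= v m ^+ (2 * k) by rewrite exprM exprn_ge0 // sqr_ge0.
have f0 n m : 0 <= f n m by rewrite /f !mulr_ge0.
have fz m : f 0 m = 0 by rewrite /f {1}/v invr0 expr0n muln_eq0 (gtn_eqF a0) /= !mul0r.
have vz k : (0 < k)%N -> v 0 ^+ k = 0 by move=> k0; rewrite /v invr0 expr0n (gtn_eqF k0).
have rz : row_value 0 = 0.
  rewrite /row_value !vz; try by rewrite /w; lia.
  rewrite !mulr0 !subr0 !big1_seq ?addr0 // => k; rewrite mem_index_iota => /andP[_ kb];
    by rewrite vz ?mulr0 //; rewrite wE; lia.
have rows n : (\esum_(m in [set: int]) (f n m)%:E = (row_value n)%:E)%E.
  have [->|n0] := eqVneq n 0; last by apply: esum_ssum; [exact: f0|exact: row].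
  by rewrite rz; apply: esum1 => m _; rewrite fz.
under eq_esum => n _ do rewrite rows.
apply: esum_ssum => [n|].
  by rewrite -lee_fin -rows; apply: esum_ge0 => m _; rewrite lee_fin.
rewrite !top_half_valueE //; try by rewrite /w; lia.
have s1 p q : (p <= 2 * w - 2)%N -> ssum (fun n => \sum_(0 <= k < p) 'C(p + q - k - 2, q - 1)%:R * (zs R k.+1 * v n ^+ (2 * w - k - 1)))
   (\sum_(0 <= k < p) 'C(p + q - k - 2, q - 1)%:R * (zs R k.+1 * zs R (2 * w - k - 1))).
  move=> pw; rewrite big_mkord; under eq_fun do rewrite big_mkord.
  apply: ssum_sum => k; apply: ssumZ; apply: ssumZ; apply: ssum_inv_pow.
  by have := ltn_ord k; lia.
have s2 (k : R) : ssum (fun n => - (k * v n ^+ (2 * w))) (- (k * zs R (2 * w))).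
  have w0 : (0 < 2 * w)%N by rewrite /w; lia.
  have h := ssumZ (k := - k) (@ssum_inv_pow R _ w0).
  by rewrite -mulNr; apply: ssum_ext h => n; rewrite mulNr.
have h1 := s1 (2 * b)%N (2 * c)%N ltac:(rewrite wE; lia).
have h2 := s1 (2 * c)%N (2 * b)%N ltac:(rewrite wE; lia).
have h := ssumD (ssumD (ssumD h1 h2) (s2 'C(2 * b + 2 * c - 1, 2 * b)%:R)) (s2 'C(2 * b + 2 * c - 1, 2 * c)%:R).
have -> : (2 * c + 2 * b - 1 = 2 * b + 2 * c - 1)%N by lia.
set u := (X in ssum _ X); move: h; set u' := (X in ssum _ X).
have -> : u' = u by rewrite /u /u'; ring.
by [].
Qed.

Lemma slice00 (t : R) : 0 < t ->
  slice a b c t 0 0 = (ratr (coef_top a b c) * (- (4 * pi * t)) ^+ w)%:E.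
Proof.
move=> t0; pose K := (t / pi) ^+ w.
have K0 : 0 <= K by rewrite exprn_ge0 // divr_ge0 ?pi_ge0 // ltW.
have vsq k (m : int) : 0 <= v m ^+ (2 * k) by rewrite exprM exprn_ge0 // sqr_ge0.
have f0 n m : 0 <= f n m by rewrite /f !mulr_ge0.
have e n m : term_int a b c t 0 0 (- n) m = (K * f n m)%:E.
  rewrite /term_int (eq_integral (fun=> (K * f n m)%:E)) => [|x _].
    by rewrite integral_cst //= lebesgue_measure_itv /= lte_fin ltr01 oppr0 adde0 mule1.
  congr (_%:E); rewrite /term /kern !(addr0, oppr0, mul0r, expr0n) /= ?addr0 /K /w /f.
  have kf (u : int) : t / (pi * (u%:~R) ^+ 2) = t / pi * v u ^+ 2 by rewrite invfM mulrA exprVn.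
  have -> : (- (- n + m))%:~R = (n - m)%:~R :> R by congr (_%:~R); ring.
  have -> : (- n)%:~R ^+ 2 = n%:~R ^+ 2 :> R by rewrite rmorphN sqrrN.
  rewrite !kf !(exprM (v _)) !exprD.
  by move: (t / pi) (v n ^+ 2) (v m ^+ 2) (v (n - m) ^+ 2) => p1 p2 p3 p4; rewrite !exprMn; ring.
rewrite /slice (@reindex_esum _ _ _ [set: int * int] _ (fun p => (- p.1, p.2))); last first.
  split => [//|[x y] [x' y'] _ _ /= [/oppr_inj -> ->]|[x y] _] //.
  by exists (- x, y) => //=; rewrite opprK.
rewrite (@esum_pair _ _ _ (fun n m => term_int a b c t 0 0 (- n) m)); last by move=> n m; exact: term_int_ge0.
under eq_esum => n _ do under eq_esum => m _ do rewrite e EFinM.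
have -> : (\esum_(n in [set: int]) \esum_(m in [set: int]) (K%:E * (f n m)%:E) =
   K%:E * \esum_(n in [set: int]) \esum_(m in [set: int]) (f n m)%:E)%E.
  rewrite -esum_scale //; last by move=> n; apply: esum_ge0 => m _; rewrite lee_fin.
  by apply: eq_esum => n _; rewrite esum_scale // => m; rewrite lee_fin.
rewrite esum_tornheim -EFinM; congr (_%:E).
have half p q : (0 < p)%N -> (0 < q)%N -> (p < w)%N ->
   K * top_half_value p q = ratr (coef_top_half w p q) * (- (4 * pi * t)) ^+ w.
  move=> p0 q0 pw; rewrite /top_half_value /coef_top_half rmorph_sum /= mulr_sumr mulr_suml.
  apply: eq_big_nat => k /andP[_ kp].
  have odd2 n : odd (2 * n) = false by rewrite mul2n odd_double.
  have odd2' : odd (2 * w - 2 * k) = false by rewrite -mulnBr.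
  have h2 n : ((2 * n)./2 = n)%N by rewrite mul2n doubleK.
  rewrite /zs odd2 odd2' -mulnBr !h2 /Gamma.
  have -> : (2 * (w - k) = 2 * w - 2 * k)%N by rewrite mulnBr.
  have pn := lt0r_neq0 (pi_gt0 R).
  have -> : K = ((t * pi) ^+ w) * (pi ^+ (2 * w))^-1.
    rewrite /K (exprM pi 2 w) -(exprVn (pi ^+ 2) w) -(exprMn w); congr (_ ^+ _).
    by move: (@pi R) pn => z zn; field.
  rewrite !rmorphM /= !fmorphV /= !rmorphM /= !ratr_nat.
  have fn n : (n`!%:R : R) != 0 by rewrite pnatr_eq0 -lt0n fact_gt0.
  have -> : 'C(2 * p + 2 * q - 2 * k - 1, 2 * q - 1)%:R =
     ((2 * p + 2 * q - 2 * k).-1)`!%:R / (((2 * q).-1)`!%:R * ((2 * p - 2 * k + 1).-1)`!%:R) :> R.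
    have h : (2 * q - 1 <= 2 * p + 2 * q - 2 * k - 1)%N by lia.
    have /(congr1 (fun n => n%:R : R)) := bin_fact h; rewrite !natrM.
    have -> : (2 * p + 2 * q - 2 * k - 1 - (2 * q - 1) = (2 * p - 2 * k + 1).-1)%N by lia.
    rewrite !subn1 => <-; by field; rewrite !fn.
  have -> : (- (4 * pi * t)) ^+ w = (-1) ^+ w * (2 * pi) ^+ (2 * w) * (t * pi) ^+ w * (pi ^+ (2 * w))^-1.
    rewrite (exprM (2 * pi) 2 w) (exprM pi 2 w) -(exprVn (pi ^+ 2) w) -!(exprMn w); congr (_ ^+ _).
    by move: (@pi R) pn => z zn; field.
  have -> : (2 * pi) ^+ (2 * w) = (2 * pi) ^+ (2 * k) * (2 * pi) ^+ (2 * w - 2 * k) :> R.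
    by rewrite -exprD; congr (_ ^+ _); lia.
  have -> : (-1) ^+ w = (-1) ^+ k.+1 * (-1) ^+ (w - k).+1 :> R.
    by rewrite !exprS mulrACA mulN1r opprK mul1r -exprD; congr (_ ^+ _); lia.
  have := fn (2 * k)%N; have := fn (2 * w - 2 * k)%N; have := fn (2 * q).-1; have := fn (2 * p - 2 * k + 1).-1.
  move: ((2 * k)`!%:R) ((2 * w - 2 * k)`!%:R) ((2 * q).-1`!%:R) ((2 * p - 2 * k + 1).-1`!%:R) => x1 x2 x3 x4 n4 n3 n2 n1.
  move: (pi ^+ (2 * w))^-1 ((2 * pi) ^+ (2 * k)) ((2 * pi) ^+ (2 * w - 2 * k)) ((t * pi) ^+ w) => y1 y2 y3 y4.
  by field; rewrite n1 n2 n3 n4.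
by rewrite mulrDr !half // /coef_top -/w ?rmorphD ?mulrDl //; rewrite /w; lia.
Qed.

End TornheimSum.

(** * Comparison of sums with their main values *)

Section NearbySums.
Variable R : realType.

(** Convergence of the sum of [u] is part of the conclusion: the slices are known only to be
    nonnegative and close to explicit values. *)
Lemma near_sum_nat (u v e : nat -> R) (V B : R) :
  (forall k, 0 <= u k) -> \sum_(0 <= k < N) v k @[N --> \oo] --> V ->
  (forall k, `|u k - v k| <= e k) -> (forall N, \sum_(0 <= k < N) e k <= B) ->
  exists2 U, \sum_(0 <= k < N) u k @[N --> \oo] --> U & `|U - V| <= B.
Proof.
move=> u0 vV uve eB.
have diff N : `|\sum_(0 <= k < N) u k - \sum_(0 <= k < N) v k| <= B.
  rewrite -sumrB; apply: le_trans (ler_norm_sum _ _ _) (le_trans _ (eB N)).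
  by apply: ler_sum => k _; exact: uve.
have [M hM] : exists M, forall N, \sum_(0 <= k < N) u k <= M.
  have /cvg_seq_bounded[x [_ hx]] : cvg ((fun N => \sum_(0 <= k < N) v k) @ \oo) by apply/cvg_ex; exists V.
  exists (x + 1 + B) => N.
  have h1 : `|\sum_(0 <= k < N) v k| <= x + 1 by apply: hx => //; rewrite ltrDl.
  have := diff N; rewrite ler_norml => /andP[_ h2].
  by have := ler_norm (\sum_(0 <= k < N) v k); lra.
have nd : nondecreasing_seq (fun N => \sum_(0 <= k < N) u k).
  by apply/nondecreasing_seqP => N; rewrite big_nat_recr //= lerDl.
have /cvg_ex[U hU] : cvg ((fun N => \sum_(0 <= k < N) u k) @ \oo).
  by apply: nondecreasing_is_cvgn => //; exists M => _ [N _ <-]; exact: hM.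
exists U => //.
have l : `|\sum_(0 <= k < N) u k - \sum_(0 <= k < N) v k| @[N --> \oo] --> `|U - V|.
  by apply: cvg_norm; apply: cvgB.
by apply: (cvgr_to_le l); near=> N; exact: diff.
Unshelve. all: by end_near.
Qed.

Lemma near_sum_esum (I : choiceType) (u v e : I -> R) (V B : R) :
  (forall i, 0 <= u i) -> (forall i, 0 <= v i) -> (forall i, `|u i - v i| <= e i) ->
  (\esum_(i in [set: I]) (v i)%:E = V%:E)%E -> (\esum_(i in [set: I]) (e i)%:E <= B%:E)%E ->
  exists2 U, (\esum_(i in [set: I]) (u i)%:E = U%:E)%E & `|U - V| <= B.
Proof.
move=> u0 v0 uve hV hB.
have e0 i : 0 <= e i by apply: le_trans (uve i).
have U0 : (0 <= \esum_(i in [set: I]) (u i)%:E)%E by apply: esum_ge0 => i _; rewrite lee_fin.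
have le1 : (\esum_(i in [set: I]) (u i)%:E <= V%:E + B%:E)%E.
  rewrite -hV; apply: le_trans (leeD2l _ hB); rewrite -esumD => [|i _|i _]; rewrite ?lee_fin //.
  apply: le_esum => i _; rewrite lee_fin.
  by have := uve i; rewrite ler_norml => /andP[]; lra.
have fin : (\esum_(i in [set: I]) (u i)%:E)%E \is a fin_num.
  by rewrite ge0_fin_numE //; apply: le_lt_trans le1 _; rewrite -EFinD ltry.
exists (fine (\esum_(i in [set: I]) (u i)%:E)); first by rewrite fineK.
rewrite -(fineK fin) -EFinD lee_fin in le1.
have le2 : (V%:E <= \esum_(i in [set: I]) (u i)%:E + B%:E)%E.
  rewrite -hV; apply: le_trans (leeD2l _ hB); rewrite -esumD => [|i _|i _]; rewrite ?lee_fin //.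
  apply: le_esum => i _; rewrite lee_fin.
  by have := uve i; rewrite ler_norml => /andP[]; lra.
rewrite -(fineK fin) -EFinD lee_fin in le2.
by rewrite ler_norml; apply/andP; split; lra.
Qed.

Lemma esum_inv_sqr : exists2 s : R, s <= 2 & (\esum_(k in [set: nat]) ((k.+1%:R ^+ 2)^-1)%:E = s%:E)%E.
Proof.
have h := zeta_cvg (R := R) (s := 2) isT; rewrite -cvg_shiftS in h.
  have e : (fun N : nat => \sum_(1 <= m < N.+1) (m%:R ^+ 2 : R)^-1) = fun N => \sum_(0 <= k < N) (k.+1%:R ^+ 2)^-1.
    by apply/funext => N; rewrite big_add1.
  rewrite e in h; exists (zeta R 2); last by apply: esum_nat_cvg => // k; rewrite invr_ge0 exprn_ge0.
  apply: (cvgr_to_le h); near=> N.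
  by have := @sum_inv_sqr_le R N; rewrite big_add1.
Unshelve. all: by end_near.
Qed.

End NearbySums.

(** * Summation over the rays and sectors *)

Section ClassSums.
Variable R : realType.
Implicit Types (a b c : nat) (t : R).

Definition zero_line_total a b c t : R :=
  \sum_(1 <= k < a + b + c) mid_weight R k a b c *
     (2 * pi * (-1) ^+ k.+1 * (2 * t)^-1 ^+ (2 * k).+1 * zs R (2 * (a + b + c - 1 - k))) * zeta R (2 * k).+1
  + bot_weight R a b c * (2 * pi ^+ 2 * (-1) ^+ (a + b + c) * (2 * t)^-1 ^+ (2 * (a + b + c) - 2))
    * zeta R (2 * (a + b + c) - 2).

Lemma zeta_cvg_shift s : (1 < s)%N ->
  \sum_(0 <= k < N) (k.+1%:R ^+ s : R)^-1 @[N --> \oo] --> zeta R s.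
Proof.
move=> s1; have h := zeta_cvg (R := R) s1; rewrite -cvg_shiftS in h.
by move: h; under eq_fun do rewrite big_add1.
Qed.

Lemma cvg_sum_seq (J : eqType) (r : seq J) (F : J -> nat -> R) (v : J -> R) :
  (forall j, j \in r -> F j N @[N --> \oo] --> v j) ->
  \sum_(j <- r) F j N @[N --> \oo] --> \sum_(j <- r) v j.
Proof.
elim: r => [|j r IH] h.
  by rewrite big_nil; under eq_fun do rewrite big_nil; exact: cvg_cst.
rewrite big_cons; under eq_fun do rewrite big_cons.
by apply: cvgD; [apply: h; rewrite mem_head|apply: IH => i ir; apply: h; rewrite in_cons ir orbT].
Qed.

(** The height k t enters only through powers of its inverse, so each monomial sums to a zeta
    value. *)
Lemma zero_line_cvg a b c t : (2 < a + b + c)%N ->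
  \sum_(0 <= k < N) zero_line_value a b c (k.+1%:R * t) @[N --> \oo] --> zero_line_total a b c t.
Proof.
move=> w3; set w := (a + b + c)%N in w3 *.
have sc (k p : nat) : (2 * (k.+1%:R * t))^-1 ^+ p = (k.+1%:R ^+ p)^-1 * (2 * t)^-1 ^+ p.
  by rewrite -exprVn -exprMn -invfM mulrCA.
pose X k : R := mid_weight R k a b c *
     (2 * pi * (-1) ^+ k.+1 * (2 * t)^-1 ^+ (2 * k).+1 * zs R (2 * (w - 1 - k))).
pose Y : R := bot_weight R a b c * (2 * pi ^+ 2 * (-1) ^+ w * (2 * t)^-1 ^+ (2 * w - 2)).
have e N : \sum_(0 <= k < N) zero_line_value a b c (k.+1%:R * t) =
  \sum_(1 <= j < w) X j * \sum_(0 <= k < N) (k.+1%:R ^+ (2 * j).+1)^-1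
  + Y * \sum_(0 <= k < N) (k.+1%:R ^+ (2 * w - 2))^-1.
  rewrite /zero_line_value big_split /= -/w; congr (_ + _).
    rewrite exchange_big; apply: eq_bigr => j _; rewrite mulr_sumr; apply: eq_bigr => k _.
    by rewrite sc /X; ring.
  by rewrite mulr_sumr; apply: eq_bigr => k _; rewrite sc /Y; ring.
rewrite (funext e); apply: cvgD; last by apply: cvgMl_tmp; apply: zeta_cvg_shift; lia.
apply: (@cvg_sum_seq _ _ (fun j N => X j * \sum_(0 <= k < N) (k.+1%:R ^+ (2 * j).+1)^-1)) => j.
rewrite mem_index_iota => /andP[j1 _]; apply: cvgMl_tmp; apply: zeta_cvg_shift; lia.
Qed.

Lemma zero_line_class a b c : (0 < a)%N -> (0 < b)%N -> (0 < c)%N ->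
  exists K d : R, [/\ 0 < d, 0 <= K & forall t, 1 <= t -> exists2 U,
    (\esum_(k in [set: nat]) slice a b c t k.+1%:Z (- k.+1%:Z)%R = ((t / pi) ^+ (a + b + c) * U)%:E)%E &
    `|U - (zero_line_total a b c t + zero_line_total b a c t)| <= K * expR (- (d * t))].
Proof.
move=> a0 b0 c0; have [K [d [d0 K0 h]]] := slice_zero_line R a0 b0 c0.
exists (2 * K), d; split => //; first by rewrite mulr_ge0.
move=> t t1; have t0 : 0 < t by lra.
have q0 : 0 < (t / pi) ^+ (a + b + c) by rewrite exprn_gt0 // divr_gt0 // pi_gt0.
have /choice[r hr] k : exists r, slice a b c t k.+1%:Z (- k.+1%:Z) = ((t / pi) ^+ (a + b + c) * r)%:E /\
   `|r - (zero_line_value a b c (k.+1%:R * t) + zero_line_value b a c (k.+1%:R * t))|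
   <= K * expR (- (d * t)) / k.+1%:R ^+ 2.
  by have [r] := h t k.+1 t1 isT; exists r.
have r0 k : 0 <= r k.
  have := slice_ge0 a b c k.+1%:Z (- k.+1%:Z) t0; rewrite (hr k).1 lee_fin pmulr_rge0 //.
have hv : \sum_(0 <= k < N) (zero_line_value a b c (k.+1%:R * t) + zero_line_value b a c (k.+1%:R * t))
   @[N --> \oo] --> zero_line_total a b c t + zero_line_total b a c t.
  under eq_fun do rewrite big_split.
  by apply: cvgD; apply: zero_line_cvg; lia.
have he N : \sum_(0 <= k < N) K * expR (- (d * t)) / k.+1%:R ^+ 2 <= 2 * K * expR (- (d * t)).
  rewrite -mulr_sumr mulrC -mulrA ler_wpM2r ?mulr_ge0 ?expR_ge0 //.
  by have := @sum_inv_sqr_le R N; rewrite big_add1.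
have [U hU bU] := near_sum_nat r0 hv (fun k => (hr k).2) he.
exists U => //; under eq_esum => k _ do rewrite (hr k).1.
apply: esum_nat_cvg => [k|]; first by rewrite mulr_ge0 // ltW.
by under eq_fun do rewrite -mulr_sumr; exact: cvgMl_tmp.
Qed.

(** Since [fine] keeps the value only of a finite sum, finiteness comes first: k (k + l)^3 is at
    least k^2 l^2, and the sum of the inverses of the latter is a square. *)
Lemma zeta2_esum p q : (2 < p)%N -> (0 < q)%N ->
  (\esum_(k in [set: nat]) \esum_(l in [set: nat])
     (k.+1%:R^-1 ^+ q * (k.+1 + l.+1)%:R^-1 ^+ p)%:E = (zeta2 R p q)%:E)%E.
Proof.
move=> p2 q0; pose F (k l : nat) : R := k.+1%:R^-1 ^+ q * (k.+1 + l.+1)%:R^-1 ^+ p.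
have F0 k l : 0 <= F k l by rewrite mulr_ge0 ?exprn_ge0 ?invr_ge0.
have e : (\esum_(x in [set p0 : nat * nat | (0 < p0.1)%N /\ (0 < p0.2)%N])
   (((x.1 + x.2)%:R ^+ p * x.2%:R ^+ q)^-1)%:E = \esum_(k in [set: nat]) \esum_(l in [set: nat]) (F k l)%:E)%E.
  rewrite -esum_pair // (@reindex_esum _ _ _ [set: nat * nat] _ (fun x => (x.2.+1, x.1.+1))).
    by apply: eq_esum => -[k l] _ /=; rewrite /F invfM !exprVn mulrC addnC.
  split => [//|[k l] [k' l'] _ _ [-> ->] //|[k l] [/= k0 l0]].
  by exists (l.-1, k.-1) => //=; rewrite !prednK.
rewrite /zeta2 e fineK // ge0_fin_numE; last first.
  by apply: esum_ge0 => k _; apply: esum_ge0 => l _; rewrite lee_fin.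
have [s _ hs] := esum_inv_sqr R.
apply: (@le_lt_trans _ _ (s%:E * s%:E)%E); last by rewrite -EFinM ltry.
have i0 (k : nat) : 0 <= (k.+1%:R ^+ 2 : R)^-1 by rewrite invr_ge0 exprn_ge0.
have s0 : 0 <= s by rewrite -lee_fin -hs; apply: esum_ge0 => k _; rewrite lee_fin.
have -> : (s%:E * s%:E = \esum_(k in [set: nat]) \esum_(l in [set: nat]) ((k.+1%:R ^+ 2)^-1 * (l.+1%:R ^+ 2)^-1)%:E)%E.
  have -> : (s%:E * s%:E = s%:E * \esum_(k in [set: nat]) ((k.+1%:R ^+ 2)^-1)%:E)%E by rewrite hs.
  rewrite -esum_scale => [|//|k]; last by rewrite lee_fin.
  apply: eq_esum => k _.
  have -> : (s%:E * ((k.+1%:R ^+ 2)^-1)%:E =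
     ((k.+1%:R ^+ 2)^-1)%:E * \esum_(l in [set: nat]) ((l.+1%:R ^+ 2)^-1)%:E)%E by rewrite hs muleC.
  rewrite -esum_scale => [|//|l]; last by rewrite lee_fin.
  apply: eq_esum => l _.
  by rewrite EFinM.
apply: le_esum => k _; apply: le_esum => l _; rewrite lee_fin /F.
have k1 : 1 <= k.+1%:R :> R by rewrite ler1n.
have l1 : 1 <= l.+1%:R :> R by rewrite ler1n.
have kl : 0 < (k.+1 + l.+1)%:R :> R by rewrite ltr0n.
rewrite -!exprVn.
apply: (@le_trans _ _ (k.+1%:R^-1 ^+ 1 * (k.+1 + l.+1)%:R^-1 ^+ 3)).
  apply: ler_pM; rewrite ?exprn_ge0 ?invr_ge0 //.
    by apply: ler_wiXn2l; rewrite ?invr_ge0 // invf_le1 // ltr0n.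
  by apply: ler_wiXn2l; rewrite ?invr_ge0 // invf_le1 // ler1n.
rewrite !exprVn -!invfM expr1.
rewrite lef_pV2 ?posrE ?mulr_gt0 ?exprn_gt0 ?ltr0n //.
have kz : k.+1%:R <= (k.+1 + l.+1)%:R :> R by rewrite ler_nat leq_addr.
have lz : l.+1%:R <= (k.+1 + l.+1)%:R :> R by rewrite ler_nat leq_addl.
rewrite (exprS _ 2) mulrA ![_ ^+ 2]expr2.
move: (k.+1%:R) (l.+1%:R) ((k.+1 + l.+1)%:R) k1 l1 kz lz => x y z x1 y1 xz yz.
have -> : x * x * y * y = x * (x * (y * y)) by ring.
apply: ler_wpM2l; first by lra.
by apply: ler_pM => //; [lra|nra|apply: ler_pM => //; lra].
Qed.

Lemma zcoef_esum a b c : (0 < a)%N -> (0 < b)%N -> (0 < c)%N ->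
  (\esum_(k in [set: nat]) \esum_(l in [set: nat])
     (zcoef a b (a + b + c) k.+1%:R (k.+1 + l.+1)%:R : R)%:E = (Zcomb R a b c)%:E)%E.
Proof.
move=> a0 b0 c0; set w := (a + b + c)%N.
pose q (i j : nat) : R := 'C(a + b - i - 2, b - 1)%:R * 'C(a + b - j - 2, b - 1)%:R * 'C(i + j, i)%:R
    * 'C(2 * w - i - j - 4, w - i - 2)%:R.
pose F i j (x : nat * nat) : R := x.1.+1%:R^-1 ^+ (i + j + 1) * (x.1.+1 + x.2.+1)%:R^-1 ^+ (2 * w - i - j - 3).
have q0 i j : 0 <= q i j by rewrite !mulr_ge0.
have F0 i j x : 0 <= F i j x by rewrite mulr_ge0 ?exprn_ge0 ?invr_ge0.
rewrite -(@esum_pair _ _ _ (fun k l => (zcoef a b w k.+1%:R (k.+1 + l.+1)%:R)%:E)); last first.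
  move=> k l; rewrite lee_fin /zcoef; apply: sumr_ge0 => i _; apply: sumr_ge0 => j _.
  by rewrite !mulr_ge0 ?exprn_ge0 ?invr_ge0.
have E x : ((zcoef a b w x.1.+1%:R (x.1.+1 + x.2.+1)%:R : R)%:E =
   \sum_(i <- index_iota 0 a) \sum_(j <- index_iota 0 a) (q i j)%:E * (F i j x)%:E)%E.
  rewrite /zcoef -sumEFin; apply: eq_bigr => i _; rewrite -sumEFin; apply: eq_bigr => j _.
  by rewrite -EFinM /q /F !mulrA.
rewrite (eq_esum (fun x _ => E x)).
rewrite esum_sum; last by move=> x i _ _; apply: sume_ge0 => j _; rewrite mule_ge0 ?lee_fin.
rewrite /Zcomb -/w big_add1 /= -sumEFin; apply: eq_big_nat => i /andP[_ ia].
rewrite esum_sum; last by move=> x j _ _; rewrite mule_ge0 ?lee_fin.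
rewrite big_add1 /= -sumEFin; apply: eq_big_nat => j /andP[_ ja].
rewrite esum_scale; [|exact: q0|by move=> x; rewrite lee_fin].
rewrite (@esum_pair _ _ _ (fun k l => (F i j (k, l))%:E)); last by move=> k l; rewrite lee_fin.
rewrite zeta2_esum; [|rewrite /w; lia|lia].
rewrite -EFinM !natrM /q; congr (_ * _ * _ * _ * zeta2 _ _ _)%:E; try congr (_%:R); try congr ('C(_, _)); lia.
Qed.

Lemma same_sign_class a b c : (0 < a)%N -> (0 < b)%N -> (0 < c)%N ->
  exists K d : R, [/\ 0 < d, 0 <= K & forall t, 1 <= t -> exists2 U,
    (\esum_(k in [set: nat]) \esum_(l in [set: nat]) slice a b c t k.+1%:Z l.+1%:Z
      = ((t / pi) ^+ (a + b + c) * U)%:E)%E &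
    `|U - 4 * pi ^+ 2 * (2 * t)^-1 ^+ (2 * (a + b + c) - 2) * (Zcomb R a b c + Zcomb R b a c)|
      <= K * expR (- (d * t))].
Proof.
move=> a0 b0 c0; have [K [d [d0 K0 h]]] := slice_same_sign R a0 b0 c0.
exists (4 * K), d; split => //; first by rewrite mulr_ge0.
move=> t t1; have t0 : 0 < t by lra.
set w := (a + b + c)%N in h *.
have q0 : 0 < (t / pi) ^+ w by rewrite exprn_gt0 // divr_gt0 // pi_gt0.
pose A : R := 4 * pi ^+ 2 * (2 * t)^-1 ^+ (2 * w - 2).
have A0 : 0 <= A.
  by rewrite /A !mulr_ge0 ?exprn_ge0 ?pi_ge0 // invr_ge0 mulr_ge0 // ltW.
pose v (x : nat * nat) : R := A * (zcoef a b w x.1.+1%:R (x.1.+1 + x.2.+1)%:R + zcoef b a w x.2.+1%:R (x.1.+1 + x.2.+1)%:R).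
pose e (x : nat * nat) : R := K * expR (- (d * t)) / (x.1.+1%:R * x.2.+1%:R) ^+ 2.
have /choice[r hr] x : exists r, slice a b c t x.1.+1%:Z x.2.+1%:Z = ((t / pi) ^+ w * r)%:E /\ `|r - v x| <= e x.
  by have [r] := h t x.1.+1 x.2.+1 t1 isT isT; exists r.
have r0 x : 0 <= r x.
  have := slice_ge0 a b c x.1.+1%:Z x.2.+1%:Z t0; rewrite (hr x).1 lee_fin pmulr_rge0 //.
have z0 aa bb (x y : R) : 0 <= x -> 0 <= y -> 0 <= zcoef aa bb w x y.
  move=> x0 y0; rewrite /zcoef; apply: sumr_ge0 => i _; apply: sumr_ge0 => j _.
  by rewrite !mulr_ge0 ?exprn_ge0 ?invr_ge0.
have v0 x : 0 <= v x by rewrite mulr_ge0 // addr_ge0 // z0.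
have hv : (\esum_(x in [set: nat * nat]) (v x)%:E = (A * (Zcomb R a b c + Zcomb R b a c))%:E)%E.
  under eq_esum => x _ do rewrite EFinM EFinD.
  rewrite esum_scale => [|//|x]; last by rewrite -EFinD lee_fin addr_ge0 // z0.
  rewrite [RHS]EFinM [in RHS]EFinD; congr (_ * _)%E.
  rewrite esumD => [|x _|x _]; rewrite ?lee_fin ?z0 //; congr (_ + _)%E.
    rewrite (@esum_pair _ _ _ (fun k l => (zcoef a b w k.+1%:R (k.+1 + l.+1)%:R)%:E)) ?zcoef_esum //.
    by move=> k l; rewrite lee_fin z0.
  rewrite (@esum_pair _ _ _ (fun k l => (zcoef b a w l.+1%:R (k.+1 + l.+1)%:R)%:E)); last first.
    by move=> k l; rewrite lee_fin z0.
  rewrite esum_swap; last by move=> k l; rewrite lee_fin z0.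
  rewrite -zcoef_esum // (addnC b a); apply: eq_esum => k _; apply: eq_esum => l _.
  by rewrite [(l.+1 + k.+1)%N]addnC.
have he : (\esum_(x in [set: nat * nat]) (e x)%:E <= (4 * K * expR (- (d * t)))%:E)%E.
  have [s s2 hs] := esum_inv_sqr R.
  have s0 : 0 <= s by rewrite -lee_fin -hs; apply: esum_ge0 => k _; rewrite lee_fin invr_ge0 exprn_ge0.
  have k0 : 0 <= K * expR (- (d * t)) by rewrite mulr_ge0 ?expR_ge0.
  have i0 (k : nat) : 0 <= (k.+1%:R ^+ 2 : R)^-1 by rewrite invr_ge0 exprn_ge0.
  rewrite (@esum_pair _ _ _ (fun k l => (e (k, l))%:E)); last first.
    by move=> k l; rewrite lee_fin /e /= divr_ge0 // exprn_ge0 // mulr_ge0.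
  rewrite (_ : \esum_(k in _) _ = ((K * expR (- (d * t)) * s) * s)%:E)%E.
    have ss : s * s <= 4 by clear -s2 s0; nra.
    by rewrite lee_fin -mulrA -[4 * K * _]mulrA mulrC ler_wpM2r.
  rewrite EFinM -[in RHS]hs -esum_scale ?mulr_ge0 //; apply: eq_esum => k _.
  rewrite -EFinM mulrAC EFinM -[in RHS]hs -esum_scale ?mulr_ge0 //; apply: eq_esum => l _.
  by rewrite -EFinM /e /= exprMn invfM mulrA.
have [U hU bU] := near_sum_esum r0 v0 (fun x => (hr x).2) hv he.
exists U => //; rewrite -(@esum_pair _ _ _ (fun k l : nat => slice a b c t k.+1%:Z l.+1%:Z)); last first.
  by move=> k l; exact: slice_ge0.
rewrite EFinM -hU -esum_scale => [|//|x]; [|exact: ltW|by rewrite lee_fin].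
by apply: eq_esum => x _; rewrite (hr x).1 EFinM.
Qed.

End ClassSums.

(** * A Dixon-type sum in closed form *)

Section DixonSum.
Variable R : realType.
Local Notation F n := (n`!%:R : R).

Lemma factR_neq0 n : F n != 0. Proof. by rewrite pnatr_eq0 -lt0n fact_gt0. Qed.

Lemma factRS n : F n.+1 = n.+1%:R * F n. Proof. by rewrite factS natrM. Qed.

(** The value is the beta function B(x, n + 1); Pascal's rule reduces [n.+1] to [n] at [x] and at
    [x.+1]. *)
Lemma alternating_bin_inv n x : (0 < x)%N ->
  \sum_(0 <= i < n.+1) (-1) ^+ i * 'C(n, i)%:R / (x + i)%:R = F n * F x.-1 / F (x + n).
Proof.
elim: n x => [|n IH] x x0.
  rewrite big_nat1 bin0 !addn0 expr0 fact0 !mul1r.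
  have -> : F x = x%:R * F x.-1 by rewrite -{1}(prednK x0) factRS prednK.
  have := factR_neq0 x.-1; have : (x%:R : R) != 0 by rewrite pnatr_eq0 -lt0n.
  by move: (F x.-1) (x%:R) => u v v0 u0; field; rewrite u0 v0.
have -> : \sum_(0 <= i < n.+2) (-1) ^+ i * 'C(n.+1, i)%:R / (x + i)%:R =
   \sum_(0 <= i < n.+1) (-1) ^+ i * 'C(n, i)%:R / (x + i)%:R
   - \sum_(0 <= i < n.+1) (-1) ^+ i * 'C(n, i)%:R / (x.+1 + i)%:R :> R.
  rewrite big_nat_recl // [in RHS]big_nat_recl // bin0.
  have -> : \sum_(0 <= i < n) (-1) ^+ i.+1 * 'C(n, i.+1)%:R / (x + i.+1)%:R
     = \sum_(0 <= i < n.+1) (-1) ^+ i.+1 * 'C(n, i.+1)%:R / (x + i.+1)%:R :> R.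
    by rewrite [RHS]big_nat_recr //= bin_small // mulr0 mul0r addr0.
  rewrite bin0 -addrA; congr (_ + _); rewrite -sumrB; apply: eq_bigr => i _.
  by rewrite binS natrD addnS addSn exprS; ring.
rewrite !IH // addnS addSn !factRS.
have -> : F x.+1.-1 = x%:R * F x.-1 by rewrite /= -{1}(prednK x0) factRS prednK.
have := factR_neq0 (x + n); have xn : (x + n).+1%:R != 0 :> R by rewrite pnatr_eq0.
move: xn; rewrite -addnS natrD; move: (F (x + n)) (F x.-1) (F n) (x%:R) (n.+1%:R) => u v z x' n' xn un.
by field; rewrite xn un.
Qed.

(** Up to normalization, the summand of the well-poised hypergeometric 3F2 at argument 1 with upper
    parameters -2c, b and 1 - a - b - 2c. *)
Definition dixon_term a b c i : R :=
  (-1) ^+ i * F (b - 1 + i) * F (b - 1 + (2 * c - i)) /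
  (F i * F (2 * c - i) * (F (a + b - 1 + i) * F (a + b - 1 + (2 * c - i)))).

Definition dixon_sum a b c : R := \sum_(0 <= i < (2 * c).+1) dixon_term a b c i.

(** Creative telescoping in [a], with certificate [V]: the combination of the two summands at i is
    half of V(i + 1) - V(i), and [V] vanishes at both ends. [V'] is the shifted certificate written
    so that it makes sense at i = 2c. *)
Lemma dixon_step a b c : (0 < a)%N -> (0 < b)%N ->
  ((a + b + c) * a * (a + b + 2 * c))%:R * dixon_sum a.+1 b c = (a + c)%:R * dixon_sum a b c.
Proof.
case: a b => [//|a] [//|b] _ _.
pose t i := dixon_term a.+1 b.+1 c i.
pose V i : R := t i * i%:R * (b.+1 + (2 * c - i))%:R / (a.+1 + b.+1 + (2 * c - i))%:R.
pose V' i : R := - t i * (b.+1 + i)%:R * (2 * c - i)%:R / (a.+1 + b.+1 + i)%:R.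
have VS i : (i < 2 * c)%N -> V i.+1 = V' i.
  move=> ic; rewrite /V /V' /t /dixon_term.
  have [m mE] : exists m, (2 * c - i = m.+1)%N by exists (2 * c - i).-1; rewrite prednK // subn_gt0.
  have -> : (2 * c - i.+1 = m)%N by lia.
  rewrite mE.
  have -> : (b.+1 - 1 + i.+1 = (b + i).+1)%N by lia.
  have -> : (b.+1 - 1 + m.+1 = (b + m).+1)%N by lia.
  have -> : (b.+1 - 1 + m = b + m)%N by lia.
  have -> : (b.+1 - 1 + i = b + i)%N by lia.
  have -> : (a.+1 + b.+1 - 1 + i.+1 = (a + b + i).+2)%N by lia.
  have -> : (a.+1 + b.+1 - 1 + m.+1 = (a + b + m).+2)%N by lia.
  have -> : (a.+1 + b.+1 - 1 + m = (a + b + m).+1)%N by lia.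
  have -> : (a.+1 + b.+1 - 1 + i = (a + b + i).+1)%N by lia.
  have -> : (a.+1 + b.+1 + i = (a + b + i).+2)%N by lia.
  have -> : (a.+1 + b.+1 + m = (a + b + m).+2)%N by lia.
  have -> : (b.+1 + i = (b + i).+1)%N by lia.
  have -> : (b.+1 + m = (b + m).+1)%N by lia.
  rewrite !factRS exprS.
  have := factR_neq0 (b + i); have := factR_neq0 (b + m); have := factR_neq0 i; have := factR_neq0 m.
  have := factR_neq0 (a + b + i); have := factR_neq0 (a + b + m).
  have nS n : (n.+1%:R : R) != 0 by rewrite pnatr_eq0.
  have := nS (a + b + m).+1; have := nS (a + b + i).+1; have := nS (a + b + m)%N; have := nS (a + b + i)%N.
  have := nS i; have := nS m; have := nS (b + m)%N; have := nS (b + i)%N.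
  move: (F (b + i)) (F (b + m)) (F i) (F m) (F (a + b + i)) (F (a + b + m)) ((-1) ^+ i).
  move: ((b + i).+1%:R) ((b + m).+1%:R) (i.+1%:R) (m.+1%:R) ((a + b + i).+1%:R) ((a + b + i).+2%:R) ((a + b + m).+1%:R) ((a + b + m).+2%:R).
  move=> g1 g2 g3 g4 g5 g6 g7 g8 f1 f2 f3 f4 f5 f6 s q1 q2 q3 q4 q5 q6 q7 q8 n6 n5 n4 n3 n2 n1.
  by field; rewrite ?q1 ?q2 ?q3 ?q4 ?q5 ?q6 ?q7 ?q8 ?n3 ?n4 ?n5 ?n6.
have tS i : (i <= 2 * c)%N -> dixon_term a.+2 b.+1 c i = t i / ((a.+1 + b.+1 + i)%:R * (a.+1 + b.+1 + (2 * c - i))%:R).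
  move=> ic; rewrite /t /dixon_term.
  have -> : (a.+2 + b.+1 - 1 + i = (a.+1 + b.+1 - 1 + i).+1)%N by lia.
  have -> : (a.+2 + b.+1 - 1 + (2 * c - i) = (a.+1 + b.+1 - 1 + (2 * c - i)).+1)%N by lia.
  have -> : (a.+1 + b.+1 - 1 + i = (a + b + i).+1)%N by lia.
  have -> : (a.+1 + b.+1 - 1 + (2 * c - i) = (a + b + (2 * c - i)).+1)%N by lia.
  by rewrite -[RHS]mulrA -invfM; congr (_ * _^-1); rewrite !factRS; ring.
have key i : (i <= 2 * c)%N -> ((a.+1 + b.+1 + c) * a.+1 * (a.+1 + b.+1 + 2 * c))%:R * dixon_term a.+2 b.+1 c i
   - (a.+1 + c)%:R * t i = (V' i - V i) / 2.
  move=> ic; rewrite tS // /V /V'.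
  have p0 : (a.+1 + b.+1 + i)%:R != 0 :> R by rewrite pnatr_eq0.
  have p1 : (a.+1 + b.+1 + (2 * c - i))%:R != 0 :> R by rewrite pnatr_eq0.
  rewrite !natrM !natrD natrB // !natrM in p0 p1 *.
  move: (t i) (a.+1%:R) (b.+1%:R) (c%:R) (i%:R) p0 p1 => x a' b' c' i' p0 p1.
  by field; rewrite p0 p1.
apply/eqP; rewrite -subr_eq0 /dixon_sum !mulr_sumr -sumrB; apply/eqP.
rewrite (eq_big_nat _ _ (F2 := fun i => (V' i - V i) / 2)) => [|i /andP[_ ic]]; last by rewrite -key.
rewrite -mulr_suml sumrB big_nat_recr //= [X in _ - X]big_nat_recl //=.
have -> : V' (2 * c)%N = 0 by rewrite /V' subnn mulr0 mul0r.
have -> : V 0 = 0 by rewrite /V mulr0 !mul0r.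
rewrite (eq_big_nat _ _ (F2 := V')) => [|i /andP[_ ic]]; last exact: VS.
by rewrite addr0 add0r subrr mul0r.
Qed.

(** For a = 1 partial fractions in i split the summand into two terms exchanged by the reflection of
    i into 2c - i; each is an alternating binomial sum. *)
Lemma dixon_base b c : (0 < b)%N ->
  dixon_sum 1 b c = F b.-1 / ((b + c)%:R * F (b + 2 * c)).
Proof.
case: b => [//|b] _.
have e i : (i <= 2 * c)%N -> dixon_term 1 b.+1 c i =
   (2 * (b.+1 + c)%:R * F (2 * c))^-1 * ((-1) ^+ i * 'C(2 * c, i)%:R / (b.+1 + i)%:R
     + (-1) ^+ (2 * c - i) * 'C(2 * c, 2 * c - i)%:R / (b.+1 + (2 * c - i))%:R).
  move=> ic; rewrite /dixon_term bin_sub //.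
  have -> : (-1) ^+ (2 * c - i) = (-1) ^+ i :> R.
    by rewrite -signr_odd oddB // mul2n odd_double /= signr_odd.
  have -> : F (2 * c) = 'C(2 * c, i)%:R * (F i * F (2 * c - i)) by rewrite -!natrM bin_fact.
  have -> : (b.+1 - 1 + i = b + i)%N by lia.
  have -> : (b.+1 - 1 + (2 * c - i) = b + (2 * c - i))%N by lia.
  have -> : (1 + b.+1 - 1 + i = (b + i).+1)%N by lia.
  have -> : (1 + b.+1 - 1 + (2 * c - i) = (b + (2 * c - i)).+1)%N by lia.
  rewrite !(addSn b) !factRS.
  have nS n : (n.+1%:R : R) != 0 by rewrite pnatr_eq0.
  have := nS (b + c)%N; have := nS (b + i)%N; have := nS (b + (2 * c - i))%N.
  have := factR_neq0 (b + i); have := factR_neq0 (b + (2 * c - i)); have := factR_neq0 i; have := factR_neq0 (2 * c - i).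
  have bn : ('C(2 * c, i)%:R : R) != 0 by rewrite pnatr_eq0 -lt0n bin_gt0.
  rewrite -!natr1 !natrD natrB // natrM.
  move: ('C(_, _)%:R) bn (F (b + i)) (F (b + (2 * c - i))) (F i) (F (2 * c - i)) (b%:R) (c%:R) (i%:R) ((-1) ^+ i).
  by move=> B Bn f1 f2 f3 f4 b' c' i' s n4 n3 n2 n1 m3 m2 m1; field; rewrite ?n1 ?n2 ?n3 ?n4 ?m1 ?m2 ?m3 ?Bn.
rewrite /dixon_sum (eq_big_nat _ _ (fun i (hi : (0 <= i < (2 * c).+1)%N) => e i (proj2 (andP hi)))).
rewrite -mulr_sumr big_split /= [X in _ + X]big_nat_rev /= add0n.
rewrite [X in _ + X](eq_big_nat _ _ (F2 := fun i => (-1) ^+ i * 'C(2 * c, i)%:R / (b.+1 + i)%:R)); last first.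
  by move=> i /andP[_ ic]; rewrite subSS subKn.
rewrite alternating_bin_inv //.
have := factR_neq0 (2 * c); have := factR_neq0 (b.+1 + 2 * c); have : (b.+1 + c)%:R != 0 :> R by rewrite pnatr_eq0.
rewrite /=; move: ((b.+1 + c)%:R) (F (2 * c)) (F b) (F _) => x y z u x0 u0 y0.
by field; rewrite x0 y0 u0.
Qed.

Lemma dixon_sumE a b c : (0 < a)%N -> (0 < b)%N ->
  dixon_sum a b c = F (b - 1) * F (b + c - 1) * F (a + c - 1) /
    (F c * F (a - 1) * F (a + b + c - 1) * F (a + b + 2 * c - 1)).
Proof.
case: a b => [//|a] [//|b] _ _; rewrite !subn1 /=; elim: a => [|a IH].
  rewrite dixon_base // !add0n !addSn !factRS fact0 /=.
  have := factR_neq0 (b + c); have := factR_neq0 c; have := factR_neq0 (b + 2 * c).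
  have : (b + c).+1%:R != 0 :> R by rewrite pnatr_eq0.
  have : (b + 2 * c).+1%:R != 0 :> R by rewrite pnatr_eq0.
  move: (F (b + c)) (F c) (F (b + 2 * c)) (F b) ((b + c).+1%:R) ((b + 2 * c).+1%:R) => x y z u v s sn vn zn yn xn.
  by field; rewrite xn yn zn vn sn.
have h := dixon_step c (isT : (0 < a.+1)%N) (isT : (0 < b.+1)%N).
have n0 : ((a.+1 + b.+1 + c) * a.+1 * (a.+1 + b.+1 + 2 * c))%:R != 0 :> R.
  by rewrite pnatr_eq0 !addSn !muln_eq0.
apply: (mulfI n0); rewrite h IH !addSn /= !factRS !natrM.
have := factR_neq0 c; have := factR_neq0 a; have := factR_neq0 (a + b.+1 + c); have := factR_neq0 (a + b.+1 + 2 * c).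
have nS n : (n.+1%:R : R) != 0 by rewrite pnatr_eq0.
have := nS a; have := nS (a + b.+1 + c)%N; have := nS (a + b.+1 + 2 * c)%N.
move: (F c) (F a) (F (a + b.+1 + c)) (F (a + b.+1 + 2 * c)) (F b) (F (b + c)) (F (a + c)).
move: (a.+1%:R) ((a + b.+1 + c).+1%:R) ((a + b.+1 + 2 * c).+1%:R) ((a + c).+1%:R).
move=> x1 x2 x3 x4 f1 f2 f3 f4 f5 f6 f7 p1 p2 p3 p4 p5 p6 p7.
by field; rewrite ?p1 ?p2 ?p3 ?p4 ?p5 ?p6 ?p7.
Qed.

End DixonSum.

(** * Absence of cancellation in the lowest coefficient *)

Section StrictDominance.
Variables (R : realType) (w : nat).
Local Notation F n := (n`!%:R : R).

Definition hweight n : R := (F (w + n - 1) * F (w - n - 1))^-1.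

Lemma hweight_gt0 n : 0 < hweight n.
Proof. by rewrite invr_gt0 mulr_gt0 // ltr0n fact_gt0. Qed.

Lemma hweightS n : (n.+1 < w)%N -> (0 < n)%N -> (w + n)%:R * hweight n.+1 = (w - n - 1)%:R * hweight n.
Proof.
move=> nw n0; rewrite /hweight.
have -> : (w + n.+1 - 1 = (w + n - 1).+1)%N by lia.
have -> : (w - n - 1 = (w - n.+1 - 1).+1)%N by lia.
rewrite !factRS; have -> : (w + n - 1).+1 = (w + n)%N by lia.
have := factR_neq0 R (w + n - 1); have := factR_neq0 R (w - n.+1 - 1).
have : (w + n)%:R != 0 :> R by rewrite pnatr_eq0; lia.
have : (w - n.+1 - 1).+1%:R != 0 :> R by rewrite pnatr_eq0.
move: ((w + n)%:R) ((w - n.+1 - 1).+1%:R) (F (w + n - 1)) (F _) => x y u v yn xn vn un.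
by field; rewrite xn yn un vn.
Qed.

Lemma hweight_ler n m : (0 < n)%N -> (n <= m)%N -> (m < w)%N -> hweight m / m%:R <= hweight n / n%:R.
Proof.
move=> n0 nm; elim: m nm => [|m IH]; first by rewrite leqn0 => /eqP->.
rewrite leq_eqVlt => /predU1P[-> //|]; rewrite ltnS => nm mw.
apply: le_trans (IH nm _); last by lia.
have m0 : (0 < m)%N by lia.
have h := hweightS mw m0; have g := hweight_gt0 m; have g1 := hweight_gt0 m.+1.
apply: ler_pM; [exact: ltW|by rewrite invr_ge0| |by rewrite lef_pV2 ?posrE ?ltr0n // ler_nat].
have p : 0 < (w + m)%:R :> R by rewrite ltr0n; lia.
by rewrite -(ler_pM2l p) h; apply: ler_wpM2r; [exact: ltW|rewrite ler_nat; lia].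
Qed.

(* Bernoulli's inequality for the product of the ratios [(w-a-j) / (w+a-1+j)], each at most [s/(s+2a+1)]. *)
Lemma hweight_decay a d : (0 < a)%N -> (a + d < w)%N ->
  hweight (a + d) * ((w - a - 1) + d * (2 * a + 1))%:R <= (w - a - 1)%:R * hweight a.
Proof.
move=> a0; elim: d => [|d IH] dw; first by rewrite addn0 mul0n addn0 mulrC.
have {}IH : hweight (a + d) * ((w - a - 1) + d * (2 * a + 1))%:R <= (w - a - 1)%:R * hweight a by apply: IH; lia.
have h : (w + (a + d))%:R * hweight (a + d).+1 = (w - (a + d) - 1)%:R * hweight (a + d) by apply: hweightS; lia.
apply: le_trans IH; rewrite addnS.
have p : 0 < (w + (a + d))%:R :> R by rewrite ltr0n; lia.
rewrite -(ler_pM2l p) mulrA h [X in _ <= X]mulrCA [X in X * _ <= _]mulrC -mulrA.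
apply: ler_wpM2l; first exact/ltW/hweight_gt0.
rewrite -!natrM ler_nat.
have [s sE] : exists s, w = (s + a + d + 1)%N by exists (w - a - d - 1)%N; lia.
rewrite sE; have -> : (s + a + d + 1 - (a + d) - 1 = s)%N by lia.
have -> : (s + a + d + 1 - a - 1 = s + d)%N by lia.
nia.
Qed.

(** The weight at [b] is less than the share c / (b + c) of the weight at [a], and the weight at [c]
    less than the share b / (b + c); the shares add up to 1. *)
Lemma hweight_dominates a b c : (a + b + c = w)%N -> (0 < a)%N -> (a < b)%N -> (a < c)%N ->
  hweight b / b%:R + hweight c / c%:R < hweight a / a%:R.
Proof.
move=> wE a0 ab ac; have ha := hweight_gt0 a.
have half x y : (a + x + y = w)%N -> (a < x)%N -> (a < y)%N ->
   hweight x / x%:R < hweight a / a%:R * (y%:R / (x + y)%:R).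
  move=> xyw ax ay; pose d := (x - a)%N; have dE : x = (a + d)%N by rewrite /d; lia.
  have dw : (a + d < w)%N by lia.
  have := hweight_decay a0 dw; rewrite -dE.
  set s := (w - a - 1)%N; set q := (2 * a + 1)%N => hd.
  have sE : s = (x + y - 1)%N by rewrite /s; lia.
  have lt : (a * s * (x + y) < x * y * (s + d * q))%N.
    rewrite sE /q dE; have [e eE] : exists e, y = (a + e.+1)%N by exists (y - a).-1; lia.
    have [d' dE'] : exists d', d = d'.+1 by exists d.-1; lia.
    rewrite eE dE'; have -> : (a + d'.+1 + (a + e.+1) - 1 = 2 * a + d' + e + 1)%N by lia.
    rewrite -!(addn1 d') -!(addn1 e).
    (* The difference of the two sides is [k + 1], a polynomial in a, d' and e with positive
       coefficients. *)
    pose k := (6*a*a*d' + 4*a*a + a*a*e + 2*a*a*a*d' + 7*a*d'*e + 5*a*e + 2*a*a*d'*e + 9*a*d' + 6*a + 3*a*d'*d'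
      + 2*a*a*d'*d' + 2*d'*d'*e + 5*d'*e + d'*e*e + 2*a*d'*d'*e + 2*d'*d' + 4*d' + 3*e + e*e + 1)%N.
    apply: (@leq_trans (a * (2 * a + d' + e + 1) * (a + (d' + 1) + (a + (e + 1))) + (k + 1))).
      by rewrite -[X in (X < _)%N]addn0 ltn_add2l addn1.
    by apply: eq_leq; rewrite /k; ring.
  have pp : 0 < (s + d * q)%:R :> R by rewrite ltr0n sE; lia.
  have x0 : 0 < x%:R :> R by rewrite ltr0n; lia.
  have y0 : 0 < y%:R :> R by rewrite ltr0n; lia.
  have a0' : 0 < a%:R :> R by rewrite ltr0n.
  have xy0 : 0 < (x + y)%:R :> R by rewrite ltr0n; lia.
  have {}lt : a%:R * s%:R * (x + y)%:R < x%:R * y%:R * (s + d * q)%:R :> R by rewrite -!natrM ltr_nat.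
  have {}hd : hweight x <= s%:R * hweight a / (s + d * q)%:R by rewrite ler_pdivlMr.
  apply: (@le_lt_trans _ _ (s%:R * hweight a / (s + d * q)%:R / x%:R)).
    by rewrite ler_wpM2r // invr_ge0 ltW.
  move: (hweight a) ha (s%:R) ((s + d * q)%:R) (x%:R) (y%:R) (a%:R) ((x + y)%:R) pp x0 y0 a0' xy0 lt => H H0 S P X Y A Z P0 X0 Y0 A0 Z0 lt.
  rewrite ltr_pdivrMr // ltr_pdivrMr //.
  have -> : H / A * (Y / Z) * X * P = H * (X * Y * P) / (A * Z) by field; rewrite !gt_eqF.
  rewrite ltr_pdivlMr ?mulr_gt0 //; have -> : S * H * (A * Z) = H * (A * S * Z) by ring.
  by rewrite ltr_pM2l.
have hb := half b c wE ab ac; have hc : hweight c / c%:R < hweight a / a%:R * (b%:R / (c + b)%:R) by apply: half; lia.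
apply: lt_le_trans (ltrD hb hc) _; rewrite addnC -mulrDr -mulrDl -natrD addnC divff ?mulr1 // pnatr_eq0; lia.
Qed.

(** With mixed signs a zero would make one weight the sum of the two others. If its index is not
    strictly the smallest, one of the others is already at least as large, by monotonicity; if it
    is, [hweight_dominates] applies. *)
Lemma signed_hweight_neq0 a b c : (a + b + c = w)%N -> (0 < a)%N -> (0 < b)%N -> (0 < c)%N ->
  (-1) ^+ a * (hweight a / a%:R) + (-1) ^+ b * (hweight b / b%:R) + (-1) ^+ c * (hweight c / c%:R) != 0.
Proof.
move=> wE a0 b0 c0.
have pos n : (0 < n)%N -> 0 < hweight n / n%:R by move=> n0; rewrite divr_gt0 ?hweight_gt0 // ltr0n.
have ne x y z : (x + y + z = w)%N -> (0 < x)%N -> (0 < y)%N -> (0 < z)%N ->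
   hweight x / x%:R != hweight y / y%:R + hweight z / z%:R.
  move=> xw x0 y0 z0; have py := pos y y0; have pz := pos z z0.
  have [yx|xy] := leqP y x.
    have h : hweight x / x%:R <= hweight y / y%:R by apply: hweight_ler => //; lia.
    by apply/negP => /eqP e; move: h; rewrite e; lra.
  have [zx|xz] := leqP z x.
    have h : hweight x / x%:R <= hweight z / z%:R by apply: hweight_ler => //; lia.
    by apply/negP => /eqP e; move: h; rewrite e; lra.
  by rewrite gt_eqF // hweight_dominates.
have n1 := ne a b c wE a0 b0 c0.
have n2 : hweight b / b%:R != hweight a / a%:R + hweight c / c%:R by apply: ne; lia.
have n3 : hweight c / c%:R != hweight a / a%:R + hweight b / b%:R by apply: ne; lia.
have pa := pos a a0; have pb := pos b b0; have pc := pos c c0.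
move: (hweight a / _) (hweight b / _) (hweight c / _) n1 n2 n3 pa pb pc => x y z n1 n2 n3 pa pb pc.
rewrite -(signr_odd _ a) -(signr_odd _ b) -(signr_odd _ c).
by case: (odd a); case: (odd b); case: (odd c); rewrite ?expr1 ?expr0 ?mulN1r ?mul1r;
  apply/negP => /eqP e; move/eqP: n1; move/eqP: n2; move/eqP: n3; lra.
Qed.

End StrictDominance.

(** * Assembly of the coefficients *)

Lemma sum_S3E (V : nmodType) (F : nat -> nat -> nat -> V) a b c :
  sum_S3 F a b c = F a b c + F b a c + (F a c b + F c a b) + (F b c a + F c b a).
Proof.
pose o0 : 'I_3 := @Ordinal 3 0 isT; pose o1 : 'I_3 := @Ordinal 3 1 isT; pose o2 : 'I_3 := @Ordinal 3 2 isT.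
have [i0 i1 i2] : [/\ inord 0 = o0, inord 1 = o1 & inord 2 = o2] by split; apply/val_inj; rewrite /= inordK.
pose u := tperm o0 o1; pose v := tperm o0 o2.
(* The six value triples are distinct, so the list has no repetition; since the group has order 3!,
   it is complete. *)
pose ps : seq 'S_3 := [:: 1%g; u; tperm o1 o2; (v * u)%g; (u * v)%g; v].
pose val3 (s : 'S_3) : nat * nat * nat := (s o0 : nat, s o1 : nat, s o2 : nat).
have vals : map val3 ps = [:: (0, 1, 2); (1, 0, 2); (0, 2, 1); (2, 0, 1); (1, 2, 0); (2, 1, 0)]%N.
  by rewrite /ps /val3 /u /v /= !permM !perm1 !permE /=.
have ups : uniq ps by apply: (@map_uniq _ _ val3); rewrite vals.
have [_ mem] := @uniq_min_size _ ps (index_enum {perm 'I_3}) ups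
  (fun s _ => mem_index_enum s) ltac:(by rewrite -sum1_size -[X in (_ <= X)%N]/(3`!) -card_Sn -sum1_card leq_eqVlt; apply/orP; left; apply/eqP/eq_bigl => s; rewrite ?inE).
rewrite /sum_S3 (perm_big ps) /=; last by rewrite perm_sym; apply: uniq_perm => //; exact: index_enum_uniq.
pose H (x : nat * nat * nat) := F (nth 0 [:: a; b; c] x.1.1) (nth 0 [:: a; b; c] x.1.2) (nth 0 [:: a; b; c] x.2).
rewrite (eq_bigr (fun s => H (val3 s))) => [|s _]; last first.
  by rewrite i0 i1 i2 /H /triple !(tnth_nth 0).
by rewrite -(big_map val3 xpredT H) vals !big_cons big_nil /H /= addr0 !addrA.
Qed.

Section Coefficients.
Variable R : realType.
Implicit Types (a b c k : nat) (t : R).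

Lemma inv_expz_sub (x : R) m n : x != 0 -> (x ^ (m%:Z - n%:Z))^-1 = x ^+ n / x ^+ m.
Proof.
move=> x0; have h : x ^ (m%:Z - n%:Z) * x ^+ n = x ^+ m.
  by rewrite -[x ^+ n]/(x ^ n%:Z) -expfzDr // subrK.
have yn : x ^ (m%:Z - n%:Z) != 0 by exact: expfz_neq0.
have zn := expf_neq0 n x0.
by rewrite -h; move: (x ^ _) (x ^+ n) yn zn => y z yn zn; field; rewrite yn zn.
Qed.

Lemma mid_summandE k a b c : (k < a + b + c)%N ->
  ratr (coef_mid_summand k a b c) =
  - 2 * (-1) ^+ (a + b + c) * (ratr (bernoulli (2 * (a + b + c - 1 - k))) / (2 * (a + b + c - 1 - k))`!%:R)
    * mid_weight R k a b c.
Proof.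
move=> kw; rewrite /coef_mid_summand.
have -> : (2 * (a + b + c) - 2 * k - 2 = 2 * (a + b + c - 1 - k))%N by lia.
rewrite !rmorphM /= fmorphV /= !ratr_nat ratr_int.
rewrite /mid_weight [X in _ * X = _](_ : _ = - (-1) ^+ (a + b + c) * mid_weight R k a b c).
  by rewrite /mid_weight; move: (ratr _) (_`!%:R^-1) => x y; ring.
rewrite /mid_weight rmorph_sum mulr_sumr; apply: eq_big_nat => al /andP[_ ala].
rewrite rmorph_sum mulr_sumr; apply: eq_big_nat => be /andP[_ bea].
have -> : theta (c%:Z + ((b + be) %/ 2)%N%:Z - (a + b + c)%N%:Z + k%:Z + 1)
   = (2 * (a + b + c - 1 - k) <= 2 * c + b + be)%N%:R.
  rewrite /theta; have -> : (0 <= c%:Z + ((b + be) %/ 2)%N%:Z - (a + b + c)%N%:Z + k%:Z + 1)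
    = (2 * (a + b + c - 1 - k) <= 2 * c + b + be)%N by lia.
  by case: ifP.
case: ifP => _; last by rewrite mulr0 !mul0r rmorph0 !mulr0.
rewrite mulr1 /g /triangle_coef !rmorphM /= !rmorphXn /= !rmorphN1 !rmorph_nat.
have -> : (-1) ^+ (a + c + be + 1) = - ((-1) ^+ a * ((-1) ^+ c * (-1) ^+ be)) :> R.
  by rewrite !exprD expr1; ring.
rewrite !(exprD (-1 : R)).
have sq n : (-1) ^+ n * (-1) ^+ n = 1 :> R by rewrite -exprMn mulN1r opprK expr1n.
move: ((-1) ^+ a) ((-1) ^+ b) ((-1) ^+ c) ((-1) ^+ be) (sq a) (sq b) => x y z u hx hy.
move: (_%:R) (_%:R) (_%:R) (_%:R) => p q r s.
transitivity (- (x * x) * (y * y) * (z * u * p * q * r * s)); last by ring.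
by rewrite hy mulr1; ring.
Qed.

Lemma bot_weightE a b c :
  bot_weight R a b c = (\sum_(0 <= alpha < a) \sum_(0 <= beta < a - alpha)
      (-1) ^+ (b + beta) * g a b alpha beta
      * ('C(2 * b + 2 * c + alpha + beta - 2, b + alpha - 1))%:R)%:~R.
Proof.
rewrite rmorph_sum; apply: eq_big_nat => al _; rewrite rmorph_sum; apply: eq_big_nat => be _.
rewrite /g /triangle_coef /= !rmorphM /= !rmorphXn /= !rmorphN1 !rmorph_nat !(exprD (-1 : R)).
by move: ((-1) ^+ a) ((-1) ^+ b) ((-1) ^+ be) => x y z; ring.
Qed.

Lemma pow_mid w k t : (k < w)%N -> 0 < t ->
  (t / pi) ^+ w * (2 * pi) * (2 * t)^-1 ^+ (2 * k).+1 * (2 * pi) ^+ (2 * (w - 1 - k))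
  = (4 * pi * t) ^+ w / (4 * pi * t) ^+ (2 * k).+1.
Proof.
move=> kw t0; have pn := lt0r_neq0 (pi_gt0 R); have tn := lt0r_neq0 t0.
have e1 : (4 * pi * t) ^+ w = (t / pi) ^+ w * ((2 * pi) * (2 * pi) ^+ (2 * (w - 1 - k)) * (2 * pi) ^+ (2 * k).+1).
  rewrite -exprS -exprD (_ : (_ + _)%N = 2 * w)%N; last by lia.
  rewrite exprM -exprMn; congr (_ ^+ _).
  by move: (@pi R) pn => z zn; field.
have e2 : ((4 * pi * t) ^+ (2 * k).+1)^-1 = (2 * t)^-1 ^+ (2 * k).+1 * ((2 * pi) ^+ (2 * k).+1)^-1.
  rewrite -!exprVn -exprMn; congr (_ ^+ _).
  by move: (@pi R) pn => z zn; field; rewrite zn tn.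
have un : (2 * pi : R) ^+ (2 * k).+1 != 0 by rewrite expf_neq0 // mulf_neq0.
rewrite e1 e2; move: ((2 * pi) ^+ (2 * k).+1) un => u un.
move: ((t / pi) ^+ w) ((2 * pi) ^+ (2 * (w - 1 - k))) ((2 * t)^-1 ^+ (2 * k).+1) => x y z.
by field.
Qed.

Lemma pow_bot w t : (1 < w)%N -> 0 < t ->
  4 * pi ^+ 2 * (t / pi) ^+ w * (2 * t)^-1 ^+ (2 * w - 2) = ((4 * pi * t) ^+ (w - 2))^-1.
Proof.
move=> w1 t0; have pn := lt0r_neq0 (pi_gt0 R); have tn := lt0r_neq0 t0.
have -> : w = (w - 2).+2 by lia.
move: (w - 2)%N => n; have -> : (2 * n.+2 - 2 = (2 * n).+2)%N by lia.
have -> : (n.+2 - 2 = n)%N by lia.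
rewrite !(exprS _ n.+1) !(exprS _ n) !(exprS _ (2 * n).+1) !(exprS _ (2 * n)) exprM.
rewrite (_ : ((4 * pi * t) ^+ n)^-1 = (t / pi) ^+ n * ((2 * t)^-1 ^+ 2) ^+ n).
  by move: ((t / pi) ^+ n) (((2 * t)^-1 ^+ 2) ^+ n) (@pi R) pn => x y z zn; field; rewrite zn tn.
rewrite -exprVn -exprMn; congr (_ ^+ _).
by move: (@pi R) pn => z zn; field; rewrite zn tn.
Qed.

Definition class_total a b c t : R :=
  zero_line_total a b c t + zero_line_total b a c t
  + 4 * pi ^+ 2 * (2 * t)^-1 ^+ (2 * (a + b + c) - 2) * (Zcomb R a b c + Zcomb R b a c).

Definition laurent_part a b c t : R :=
  ratr (coef_top a b c) * (- (4 * pi * t)) ^+ (a + b + c)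
  + \sum_(1 <= k < a + b + c) ratr (coef_mid k a b c) * zeta R (2 * k + 1)
      / (4 * pi * t) ^ ((2 * k + 1)%:Z - (a + b + c)%:Z)
  + coef_bot R a b c / (4 * pi * t) ^+ (a + b + c - 2).

Lemma zero_line_totalE a b c w t : (a + b + c = w)%N -> (1 < w)%N -> 0 < t ->
  2 * (t / pi) ^+ w * zero_line_total a b c t =
  \sum_(1 <= k < w) ratr (coef_mid_summand k a b c) * zeta R (2 * k + 1)
     * ((4 * pi * t) ^+ w / (4 * pi * t) ^+ (2 * k).+1)
  + bot_weight R a b c * (-1) ^+ w * zeta R (2 * w - 2) / (4 * pi * t) ^+ (w - 2).
Proof.
move=> wE w1 t0; rewrite /zero_line_total wE mulrDr mulr_sumr; congr (_ + _); last first.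
  rewrite -pow_bot //; move: ((t / pi) ^+ w) (zeta _ _) (_ ^+ (2 * w - 2)) ((-1) ^+ w) (bot_weight _ _ _ _) => x y z u v.
  by ring.
apply: eq_big_nat => k /andP[k1 kw]; rewrite mid_summandE wE // -pow_mid // addn1.
have od : odd (2 * (w - 1 - k)) = false by rewrite mul2n odd_double.
have hf : (2 * (w - 1 - k))./2 = (w - 1 - k)%N by rewrite mul2n doubleK.
rewrite /zs od hf.
have -> : (-1) ^+ w = - ((-1) ^+ k.+1 * (-1) ^+ (w - 1 - k).+1) :> R.
  rewrite -exprD (_ : (_ + _)%N = w.+1); last by lia.
  by rewrite exprS mulN1r opprK.
move: (_ / (_)`!%:R) (zeta _ _) (_ ^+ (2 * (w - 1 - k))) ((t / pi) ^+ w) ((2 * t)^-1 ^+ _) ((-1) ^+ _) ((-1) ^+ _) (mid_weight _ _ _ _ _) => x y z u v p q r.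
by ring.
Qed.

(** The three pairs of exponents, each taken in both orders inside [class_total], give the six
    permutations; the factor 2 is the central symmetry of the lattice. *)
Lemma laurent_partE a b c t : (0 < a)%N -> (0 < b)%N -> (0 < c)%N -> 0 < t ->
  laurent_part a b c t = ratr (coef_top a b c) * (- (4 * pi * t)) ^+ (a + b + c)
   + 2 * (t / pi) ^+ (a + b + c) * (class_total a b c t + class_total a c b t + class_total b c a t).
Proof.
move=> a0 b0 c0 t0; rewrite /laurent_part -[LHS]addrA; congr (_ + _).
have [w1 e1 e2] : [/\ (1 < a + b + c)%N, (a + c + b = a + b + c)%N & (b + c + a = a + b + c)%N] by split; lia.
rewrite /class_total e1 e2; move: e1 e2 w1; set w := (a + b + c)%N => e1 e2 w1.
pose S x y z := \sum_(1 <= k < w) ratr (coef_mid_summand k x y z) * zeta R (2 * k + 1)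
     * ((4 * pi * t) ^+ w / (4 * pi * t) ^+ (2 * k).+1).
pose q := ((4 * pi * t) ^+ (w - 2))^-1.
have pn := lt0r_neq0 (pi_gt0 R); have tn := lt0r_neq0 t0.
have xn : 4 * pi * t != 0 by rewrite !mulf_neq0.
have zl x y z : (x + y + z = w)%N -> 2 * (t / pi) ^+ w * zero_line_total x y z t =
   S x y z + bot_weight R x y z * (-1) ^+ w * zeta R (2 * w - 2) * q.
  by move=> e; exact: zero_line_totalE.
have zc x : 2 * (t / pi) ^+ w * (4 * pi ^+ 2 * (2 * t)^-1 ^+ (2 * w - 2) * x) = 2 * x * q.
  rewrite /q -pow_bot //; by ring.
have D3 x y z : 2 * (t / pi) ^+ w * (x + y + z) = 2 * (t / pi) ^+ w * x + 2 * (t / pi) ^+ w * y + 2 * (t / pi) ^+ w * z.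
  by rewrite !mulrDr.
rewrite [in RHS]D3 !D3 !zc (zl a b c) // (zl b a c) ?(zl a c b) // ?(zl c a b) ?(zl b c a) // ?(zl c b a) //; try (rewrite /w; lia).
have -> : \sum_(1 <= k < w) ratr (coef_mid k a b c) * zeta R (2 * k + 1)
      / (4 * pi * t) ^ ((2 * k + 1)%:Z - w%:Z) =
   S a b c + S b a c + (S a c b + S c a b) + (S b c a + S c b a).
  rewrite /S -!big_split /=; apply: eq_bigr => k _.
  rewrite /coef_mid sum_S3E !rmorphD /= inv_expz_sub // !addn1.
  by move: (_ / _) (zeta _ _) => x y; ring.
rewrite /coef_bot -/w /coef_bot0 !sum_S3E !rmorphD /= -!bot_weightE -/q.
move: (S _ _ _) (S _ _ _) (S _ _ _) (S _ _ _) (S _ _ _) (S _ _ _) => s1 s2 s3 s4 s5 s6.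
move: ((-1) ^+ w) (zeta _ _) => x y.
by ring.
Qed.

Lemma norm_six (u1 u2 u3 u4 u5 u6 z1 z2 z3 z4 z5 z6 k1 k2 k3 k4 k5 k6 x : R) :
  `|u1 - z1| <= k1 * x -> `|u2 - z2| <= k2 * x -> `|u3 - z3| <= k3 * x ->
  `|u4 - z4| <= k4 * x -> `|u5 - z5| <= k5 * x -> `|u6 - z6| <= k6 * x ->
  `|u1 + u2 + u3 + (u4 + u5 + u6) - (z1 + z2 + z3 + (z4 + z5 + z6))| <= (k1 + k2 + k3 + k4 + k5 + k6) * x.
Proof.
rewrite !ler_norml => /andP[p1 r1] /andP[p2 r2] /andP[p3 r3] /andP[p4 r4] /andP[p5 r5] /andP[p6 r6].
rewrite !mulrDl; apply/andP; split; lra.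
Qed.

Lemma constant_mode_asymptotics a b c : (0 < a)%N -> (0 < b)%N -> (0 < c)%N ->
  exists K d : R, [/\ 0 < d, 0 <= K & forall t, 1 <= t -> exists2 v : R,
    constant_mode a b c t = v%:E &
    `|v - laurent_part a b c t| <= K * (t ^+ (a + b + c) * expR (- (d * t)))].
Proof.
move=> a0 b0 c0; set w := (a + b + c)%N.
have w2 : (a + c + b = w)%N by rewrite /w; lia.
have w3 : (b + c + a = w)%N by rewrite /w; lia.
have [K1 [d1 [d10 K10 h1]]] := zero_line_class R a0 b0 c0.
have [K2 [d2 [d20 K20 h2]]] := zero_line_class R a0 c0 b0.
have [K3 [d3 [d30 K30 h3]]] := zero_line_class R b0 c0 a0.
have [K4 [d4 [d40 K40 h4]]] := same_sign_class R a0 b0 c0.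
have [K5 [d5 [d50 K50 h5]]] := same_sign_class R a0 c0 b0.
have [K6 [d6 [d60 K60 h6]]] := same_sign_class R b0 c0 a0.
pose d := Num.min d1 (Num.min d2 (Num.min d3 (Num.min d4 (Num.min d5 d6)))).
pose K := K1 + K2 + K3 + K4 + K5 + K6.
exists (2 * K / pi ^+ w), d; split.
- by rewrite /d !lt_min d10 d20 d30 d40 d50 d60.
- by rewrite divr_ge0 ?exprn_ge0 ?pi_ge0 // mulr_ge0 // /K !addr_ge0.
move=> t t1; have t0 : 0 < t by lra.
have [U1 e1 b1] := h1 t t1; have [U2 e2 b2] := h2 t t1; have [U3 e3 b3] := h3 t t1.
have [U4 e4 b4] := h4 t t1; have [U5 e5 b5] := h5 t t1; have [U6 e6 b6] := h6 t t1.
rewrite ?w2 ?w3 -/w in e1 e2 e3 e4 e5 e6 b1 b2 b3 b4 b5 b6.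
pose q := (t / pi) ^+ w; pose U := U1 + U2 + U3 + (U4 + U5 + U6).
exists (ratr (coef_top a b c) * (- (4 * pi * t)) ^+ w + 2 * q * U).
  rewrite constant_mode_split // slice00 // -/w e1 e2 e3 e4 e5 e6 -/q -!EFinD; congr (_%:E).
  by rewrite /U; ring.
rewrite laurent_partE // -/w -/q /class_total ?w2 ?w3 -/w.
have em (c' k : R) : 0 <= k -> d <= c' -> k * expR (- (c' * t)) <= k * expR (- (d * t)).
  by move=> k0 dc; apply: ler_wpM2l => //; rewrite ler_expR lerN2 ler_wpM2r // ltW.
have [l1 l2 l3] : [/\ d <= d1, d <= d2 & d <= d3] by split; rewrite /d !ge_min lexx ?orbT.
have [l4 l5 l6] : [/\ d <= d4, d <= d5 & d <= d6] by split; rewrite /d !ge_min lexx ?orbT.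
have {}b1 := le_trans b1 (em _ _ K10 l1); have {}b2 := le_trans b2 (em _ _ K20 l2).
have {}b3 := le_trans b3 (em _ _ K30 l3); have {}b4 := le_trans b4 (em _ _ K40 l4).
have {}b5 := le_trans b5 (em _ _ K50 l5); have {}b6 := le_trans b6 (em _ _ K60 l6).
have -> : 2 * K / pi ^+ w * (t ^+ w * expR (- (d * t))) = 2 * q * (K * expR (- (d * t))).
  rewrite /q exprMn exprVn; by move: (_ ^+ w) (_ ^+ w)^-1 (expR _) => x y z; ring.
have q0 : 0 <= 2 * q by rewrite mulr_ge0 // exprn_ge0 // divr_ge0 ?pi_ge0 // ltW.
rewrite [X in `|X|](_ : _ = 2 * q * (U - (zero_line_total a b c t + zero_line_total b a c t
   + (zero_line_total a c b t + zero_line_total c a b t)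
   + (zero_line_total b c a t + zero_line_total c b a t)
   + (4 * pi ^+ 2 * (2 * t)^-1 ^+ (2 * w - 2) * (Zcomb R a b c + Zcomb R b a c)
   + 4 * pi ^+ 2 * (2 * t)^-1 ^+ (2 * w - 2) * (Zcomb R a c b + Zcomb R c a b)
   + 4 * pi ^+ 2 * (2 * t)^-1 ^+ (2 * w - 2) * (Zcomb R b c a + Zcomb R c b a))))); last first.
  by move: (4 * pi ^+ 2 * _) => x; ring.
rewrite normrM (ger0_norm q0) ler_wpM2l //.
rewrite /U /K; exact: norm_six.
Qed.

End Coefficients.

(** * Finiteness for all tau_2 and the leading coefficient *)

Section Finiteness.
Variable R : realType.
Implicit Types (a b c : nat) (t : R).

(** This carries finiteness from tau_2 = 1, where the asymptotic estimate holds, to smaller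
    tau_2. *)
Lemma kern_le1 t (u v : R) : 0 < t -> t <= 1 -> kern t u v <= t^-1 * kern 1 u v.
Proof.
move=> t0 t1; rewrite /kern.
have u0 := sqr_ge0 u; have v0 := sqr_ge0 v; have p0 := pi_gt0 R.
have [z|nz] := eqVneq (u ^+ 2 + v ^+ 2) 0.
  have /andP[/eqP uz /eqP vz] : (u ^+ 2 == 0) && (v ^+ 2 == 0) by rewrite -paddr_eq0 // z.
  by rewrite !exprMn uz vz !mul0r !addr0 !mulr0 !invr0 !mulr0.
have s0 : 0 < u ^+ 2 + v ^+ 2 by rewrite lt_neqAle eq_sym nz addr_ge0.
have le : t ^+ 2 * (u ^+ 2 + v ^+ 2) <= u ^+ 2 + (v * t) ^+ 2.
  have t21 : t ^+ 2 <= 1 by rewrite expr_le1 // ltW.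
  by rewrite mulrDr exprMn [v ^+ 2 * _]mulrC lerD2r -[leRHS]mul1r ler_wpM2r.
have r0 : 0 < t ^+ 2 * (u ^+ 2 + v ^+ 2) by rewrite mulr_gt0 // exprn_gt0.
have -> : t^-1 * (1 / (pi * (u ^+ 2 + (v * 1) ^+ 2))) = t / (pi * (t ^+ 2 * (u ^+ 2 + v ^+ 2))).
  have tn := lt0r_neq0 t0; have pn := lt0r_neq0 p0; rewrite mulr1.
  by move: (u ^+ 2 + v ^+ 2) nz (@pi R) pn => x xn y yn; field; rewrite xn yn tn.
apply: ler_wpM2l; first exact: ltW.
have r1 := lt_le_trans r0 le.
by rewrite lef_pV2 ?posrE ?mulr_gt0 // ler_wpM2l // ltW.
Qed.

Lemma constant_mode_fin a b c t : (0 < a)%N -> (0 < b)%N -> (0 < c)%N -> 0 < t ->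
  constant_mode a b c t \is a fin_num.
Proof.
move=> a0 b0 c0 t0.
have [K [d [_ _ h]]] := constant_mode_asymptotics R a0 b0 c0.
have [t1|t1] := leP 1 t; first by have [v -> _] := h t t1.
have [v hv _] := h 1 (lexx _); have {}t1 := ltW t1.
have l01 := @ltr01 R.
pose k : R := t^-1 ^+ a * t^-1 ^+ b * t^-1 ^+ c.
have k0 : 0 <= k by rewrite !mulr_ge0 ?exprn_ge0 // invr_ge0 ltW.
have le n1 n2 m1 m2 : (term_int a b c t n1 n2 m1 m2 <= k%:E * term_int a b c 1 n1 n2 m1 m2)%E.
  have mt s : 0 < s -> measurable_fun [set: R] (fun x => (term a b c s x n1 n2 m1 m2)%:E).
    by move=> s0; apply/measurable_EFinP; apply: continuous_measurable_fun; exact: continuous_term.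
  rewrite /term_int -ge0_integralZl_EFin //; first last.
  - by apply: measurable_funTS; exact: mt.
  - by move=> x _; rewrite lee_fin term_ge0.
  apply: ge0_le_integral => //.
  - by move=> x _; rewrite lee_fin term_ge0.
  - by apply: measurable_funTS; exact: mt.
  - by apply: measurable_funTS; apply: measurable_funeM; exact: mt.
  move=> x _; rewrite -EFinM lee_fin /term /k.
  have kl (u v' : R) e : kern t u v' ^+ e <= t^-1 ^+ e * kern 1 u v' ^+ e.
    rewrite -exprMn; apply: lerXn2r; rewrite ?nnegrE; [exact: kern_ge0| |exact: kern_le1].
    by apply: mulr_ge0; [rewrite invr_ge0 ltW|exact: kern_ge0].
  have kg (u v' : R) e : 0 <= kern t u v' ^+ e by rewrite exprn_ge0 // kern_ge0.
  set p1 := (X in X ^+ a * _); set p2 := (X in X ^+ b); set p3 := (X in X ^+ c).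
  apply: (@le_trans _ _ ((t^-1 ^+ a * kern 1 (m1%:~R + n1%:~R * x) n1%:~R ^+ a) * (t^-1 ^+ b * kern 1 (m2%:~R + n2%:~R * x) n2%:~R ^+ b)
      * (t^-1 ^+ c * kern 1 ((- (m1 + m2))%:~R + (- (n1 + n2))%:~R * x) (- (n1 + n2))%:~R ^+ c))).
    by apply: ler_pM; rewrite ?mulr_ge0 ?kg //; [apply: ler_pM; rewrite ?kg ?kl|exact: kl].
  by rewrite le_eqVlt; apply/orP; left; apply/eqP; ring.
rewrite constant_mode_slices // ge0_fin_numE; last first.
  by apply: esum_ge0 => n1 _; apply: esum_ge0 => n2 _; exact: slice_ge0.
have sl n1 n2 : (slice a b c t n1 n2 <= k%:E * slice a b c 1 n1 n2)%E.
  rewrite /slice -esum_scale // => [|m]; last exact: term_int_ge0.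
  by apply: le_esum => m _; exact: le.
apply: (@le_lt_trans _ _ (k%:E * constant_mode a b c 1%R)%E); last by rewrite hv -EFinM ltry.
rewrite (constant_mode_slices a0 b0 c0 l01) -esum_scale // => [|n]; last first.
  by apply: esum_ge0 => n2 _; exact: slice_ge0.
apply: le_esum => n1 _; rewrite -esum_scale // => [|n2]; last exact: slice_ge0.
by apply: le_esum => n2 _; exact: sl.
Qed.

(** The slice at n_1 = n_2 = 0 is a nonzero multiple of the coefficient. It has nonnegative terms,
    and the one at m_1 = m_2 = 1, m_3 = -2 is positive. *)
Lemma coef_top_neq0 a b c : (0 < a)%N -> (0 < b)%N -> (0 < c)%N ->
  (ratr (coef_top a b c) : R) != 0.
Proof.
move=> a0 b0 c0; apply/negP => /eqP z.
have l01 := @ltr01 R.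
have := slice00 a0 b0 c0 l01; rewrite z mul0r => s0.
have : (term_int a b c (1 : R) 0 0 1 1 <= slice a b c 1%R 0%R 0%R)%E.
  apply: esum_ge; exists [set (1, 1)]; last by rewrite fsbig_set1.
  by split => //; exact: finite_set1.
rewrite s0 /term_int (eq_integral (fun=> (term a b c (1 : R) 0 0 0 1 1)%:E)) => [|x _]; last first.
  by rewrite /term !(rmorph0, addr0, oppr0, mul0r).
rewrite integral_cst //= lebesgue_measure_itv /= lte_fin ltr01 oppr0 adde0 mule1 lee_fin.
have pk (u : R) e : u != 0 -> 0 < kern 1 u 0 ^+ e.
  move=> u0; rewrite exprn_gt0 // /kern divr_gt0 // mulr_gt0 ?pi_gt0 //.
  by rewrite mul0r expr0n addr0 exprn_even_gt0.
apply/negP; rewrite -ltNge /term !(addr0, oppr0, mul0r) !mulr_gt0 //; apply: pk.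
- by rewrite rmorph1 oner_eq0.
- by rewrite rmorph1 oner_eq0.
- by rewrite intr_eq0.
Qed.

End Finiteness.

(** * Degrees of the Laurent polynomial *)

Section LaurentDegree.
Variable R : realType.

(** Once t^(1-w) is factored out, [A] sits in degree 2w - 1, [m k] in degree 2 (w - 1 - k) and [B]
    in degree 1. The constant coefficient is therefore [m (w - 1)]. *)
Lemma laurent_degree w (A B : R) (m : nat -> R) (L : R -> R) : (2 < w)%N -> A != 0 -> m (w - 1)%N != 0 ->
  (forall t, 0 < t -> L t = A * t ^+ w + \sum_(1 <= k < w) m k * (t ^+ w / t ^+ (2 * k).+1) + B / t ^+ (w - 2)) ->
  laurent_polynomial_of_degree w%:Z (1 - w%:Z) L.
Proof.
move=> w3 A0 m0 LE.
pose q : {poly R} := \sum_(1 <= k < w) m k *: 'X^(2 * (w - 1 - k)) + B *: 'X.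
exists (A *: 'X^(2 * w - 1) + q); split.
- have sA : size (A *: 'X^(2 * w - 1) : {poly R}) = (2 * w)%N.
    by rewrite size_scale // size_polyXn; lia.
  rewrite size_polyDl sA; first by lia.
  apply: (leq_ltn_trans (size_polyD _ _)); rewrite gtn_max; apply/andP; split.
    apply: (leq_ltn_trans (size_sum _ _ _)).
    rewrite big_seq_cond; apply: (big_ind (fun x => (x < 2 * w)%N)) => [|x y hx hy|k]; first by lia.
      by rewrite gtn_max hx hy.
    rewrite mem_index_iota => /andP[/andP[k1 kw] _].
    by apply: (leq_ltn_trans (size_scale_leq _ _)); rewrite size_polyXn; lia.
  by apply: (leq_ltn_trans (size_scale_leq _ _)); rewrite size_polyX; lia.
- rewrite /q !coefD !coefZ coefXn coefX /= mulr0 addr0.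
  have -> : (0 == 2 * w - 1)%N = false by lia.
  have wp : w.-1.+1 = w by lia.
  rewrite mulr0 add0r coef_sum -[in index_iota 1 w]wp big_nat_recr /=; last by lia.
  rewrite big1_seq => [|k]; last first.
    rewrite mem_index_iota => /andP[_ /andP[k1 kw]]; rewrite coefZ coefXn.
    have -> : (0 == 2 * (w - 1 - k))%N = false by lia.
    by rewrite mulr0.
  rewrite add0r coefZ coefXn -subn1 subnn muln0 eqxx mulr1 //.
move=> t t0; have tn := lt0r_neq0 t0; rewrite LE // expfzDr // expr1z -exprnN.
rewrite /q !hornerD !hornerZ hornerXn hornerX horner_sum !mulrDr.
have wn : t ^+ w != 0 by rewrite expf_neq0.
rewrite addrA mulr_sumr; congr (_ + _ + _).
- have -> : t / t ^+ w * (A * t ^+ (2 * w - 1)) = A * (t * t ^+ (2 * w - 1)) / t ^+ w by ring.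
  rewrite -exprS (_ : (2 * w - 1).+1 = w + w)%N; last by lia.
  by rewrite exprD; move: (t ^+ w) wn => x xn; field.
- apply: eq_big_nat => k /andP[k1 kw]; rewrite hornerZ hornerXn.
  have kn : t ^+ (2 * k).+1 != 0 by rewrite expf_neq0.
  have h : t ^+ w * t ^+ w = t * t ^+ (2 * (w - 1 - k)) * t ^+ (2 * k).+1.
    by rewrite -exprS -!exprD; congr (_ ^+ _); lia.
  move: (t ^+ w) (t ^+ (2 * (w - 1 - k))) (t ^+ (2 * k).+1) wn kn h => x y z xn zn h.
  by apply: (mulIf xn); rewrite -[LHS]mulrA [_ / z * x]mulrAC h; field; rewrite xn zn.
have kn : t ^+ (w - 2) != 0 by rewrite expf_neq0.
have h : t ^+ w = t * t * t ^+ (w - 2) by rewrite -mulrA -!exprS; congr (_ ^+ _); lia.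
by rewrite h; move: (t ^+ _) kn => x xn; field; rewrite xn tn.
Qed.

Lemma laurent_part_degree a b c : (0 < a)%N -> (0 < b)%N -> (0 < c)%N ->
  coef_mid (a + b + c - 1) a b c != 0 ->
  laurent_polynomial_of_degree (a + b + c)%:Z (1 - (a + b + c)%:Z) (@laurent_part R a b c).
Proof.
move=> a0 b0 c0 mz; set w := (a + b + c)%N in mz *.
have pn := lt0r_neq0 (pi_gt0 R).
have fn : 4 * pi != 0 :> R by rewrite mulf_neq0.
apply: (@laurent_degree w (ratr (coef_top a b c) * (- (4 * pi)) ^+ w) (coef_bot R a b c / (4 * pi) ^+ (w - 2))
  (fun k => ratr (coef_mid k a b c) * zeta R (2 * k + 1) * ((4 * pi) ^+ w / (4 * pi) ^+ (2 * k).+1))).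
- by rewrite /w; lia.
- by rewrite mulf_neq0 ?coef_top_neq0 // expf_neq0 // oppr_eq0.
- apply: mulf_neq0; last by rewrite mulf_neq0 ?invr_eq0 ?expf_neq0.
  apply: mulf_neq0; first by rewrite fmorph_eq0.
  by rewrite gt_eqF // (lt_le_trans ltr01) // zeta_ge1 // /w; lia.
move=> t t0; have tn := lt0r_neq0 t0; rewrite /laurent_part -/w; congr (_ + _ + _).
- by rewrite -mulNr exprMn mulrA.
- apply: eq_bigr => k _; rewrite inv_expz_sub ?mulf_neq0 // addn1 !exprMn.
  move: (expf_neq0 (2 * k).+1 tn) (expf_neq0 (2 * k).+1 fn); rewrite !exprMn.
  move: (4 ^+ w) (4 ^+ (2 * k).+1) (pi ^+ w) (pi ^+ (2 * k).+1) (t ^+ w) (t ^+ (2 * k).+1) => x1 x2 x3 x4 x5 x6 n6.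
  by rewrite mulf_eq0 negb_or => /andP[n2 n4]; field; rewrite n2 n4 n6.
by rewrite exprMn invfM mulrA.
Qed.

End LaurentDegree.

(** * Taylor coefficients from one-sided estimates *)

Lemma sum_delta_nat (V : nmodType) (F : nat -> V) n k : (k < n)%N ->
  \sum_(0 <= j < n) (if j == k then F j else 0) = F k.
Proof.
move=> kn; rewrite (bigD1_seq k) ?iota_uniq //=; last by rewrite mem_index_iota.
by rewrite eqxx big1 ?addr0 // => j /negPf ->.
Qed.

Section CoefficientsAtZero.
Variable R : realType.
Local Notation C := R[i].
Implicit Types (f g : R -> C) (n : nat).

(** A Taylor coefficient read off on (0, 1) only, from a polynomial approximation of order n + 1. It
    involves no derivative and suits a function whose formula is singular at 0, and it still
    determines [v]. *)
Definition has_coef n f (v : C) := exists (p : {poly C}) (K : R), p`_n = v /\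
  forall M : R, 0 < M -> M < 1 -> `|f M - p.[M%:C%C]| <= (K * M ^+ n.+1)%:C%C.

Lemma real_norm (z : C) : exists2 r : R, 0 <= r & `|z| = r%:C%C.
Proof.
have := normr_ge0 z; case: (`|z|) => x y; rewrite lecE /= => /andP[/eqP y0 x0].
by exists x => //; rewrite y0.
Qed.

Lemma norm_realC (x : R) : 0 <= x -> `|x%:C%C : C| = x%:C%C.
Proof. by move=> x0; rewrite ger0_norm // lecR. Qed.

Lemma norm_RtoC (x : R) : `|x%:C%C : C| = (`|x|)%:C%C.
Proof.
by rewrite normc_def /= expr0n /= addr0 sqrtr_sqr.
Qed.

Lemma norm_ge_Re (z : C) : `|(complex.Re z)%:C%C : C| <= `|z|.
Proof. by rewrite norm_RtoC; exact: normc_ge_Re. Qed.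

Lemma norm_ge_Im (z : C) : `|(complex.Im z)%:C%C : C| <= `|z|.
Proof.
case: z => x y; rewrite norm_RtoC normc_def lecR /= -sqrtr_sqr ler_wsqrtr //.
by rewrite lerDr sqr_ge0.
Qed.

Lemma has_coef_ext n f g v : (forall M, 0 < M -> M < 1 -> f M = g M) -> has_coef n f v -> has_coef n g v.
Proof. by move=> fg [p [K [pn h]]]; exists p, K; split=> // M M0 M1; rewrite -fg //; exact: h. Qed.

Lemma has_coef0 n : has_coef n (fun=> 0) 0.
Proof. by exists 0, 0; rewrite coef0; split=> // M _ _; rewrite horner0 subrr normr0 mul0r. Qed.

Lemma has_coefD n f g u v : has_coef n f u -> has_coef n g v -> has_coef n (fun M => f M + g M) (u + v).
Proof.
move=> [p [K [pn hp]]] [q [L [qn hq]]]; exists (p + q), (K + L); rewrite coefD pn qn; split=> // M M0 M1.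
rewrite hornerD opprD addrACA mulrDl rmorphD; apply: le_trans (ler_normD _ _) _.
by apply: lerD; [exact: hp|exact: hq].
Qed.

Lemma has_coefZ n k f v : has_coef n f v -> has_coef n (fun M => k * f M) (k * v).
Proof.
move=> [p [K [pn hp]]]; have [r r0 rE] := real_norm k.
exists (k *: p), (r * K); rewrite coefZ pn; split=> // M M0 M1.
by rewrite hornerZ -mulrBr normrM rE -mulrA rmorphM; apply: ler_wpM2l; [rewrite lecR|exact: hp].
Qed.

Lemma has_coef_sum (J : Type) (r : seq J) n (f : J -> R -> C) (v : J -> C) :
  (forall j, has_coef n (f j) (v j)) -> has_coef n (fun M => \sum_(j <- r) f j M) (\sum_(j <- r) v j).
Proof.
move=> h; elim: r => [|j r IH].
  by rewrite big_nil; apply: has_coef_ext (has_coef0 n) => M _ _; rewrite big_nil.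
by rewrite big_cons; apply: has_coef_ext (has_coefD (h j) IH) => M _ _; rewrite big_cons.
Qed.

Lemma has_coef_sum_nat n a b (f : nat -> R -> C) (v : nat -> C) :
  (forall j, (a <= j < b)%N -> has_coef n (f j) (v j)) ->
  has_coef n (fun M => \sum_(a <= j < b) f j M) (\sum_(a <= j < b) v j).
Proof.
move=> h; pose f' j := if (a <= j < b)%N then f j else fun=> 0; pose v' j := if (a <= j < b)%N then v j else 0.
have h' j : has_coef n (f' j) (v' j) by rewrite /f' /v'; case: ifP => [/h //|_]; exact: has_coef0.
have -> : \sum_(a <= j < b) v j = \sum_(a <= j < b) v' j.
  by apply: eq_big_nat => j jab; rewrite /v' jab.
apply: has_coef_ext (has_coef_sum _ h') => M _ _.
by apply: eq_big_nat => j jab; rewrite /f' jab.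
Qed.

Lemma has_coef_shift n k f v : has_coef n f v -> has_coef (n + k) (fun M => M%:C%C ^+ k * f M) v.
Proof.
move=> [p [K [pn hp]]]; exists (p * 'X^k), K; rewrite coefMXn ltnNge leq_addl addnK pn; split=> // M M0 M1.
rewrite hornerM hornerXn [p.[_] * _]mulrC -mulrBr normrM -rmorphXn norm_realC ?exprn_ge0 ?(ltW M0) //.
have -> : (K * M ^+ (n + k).+1)%:C%C = (M ^+ k)%:C%C * (K * M ^+ n.+1)%:C%C :> C.
  by rewrite -rmorphM -addSn exprD; congr (_%:C%C); ring.
by apply: ler_wpM2l; [rewrite lecR exprn_ge0 // ltW|exact: hp].
Qed.

Lemma Re_sum (J : Type) (r : seq J) (F : J -> C) : complex.Re (\sum_(j <- r) F j) = \sum_(j <- r) complex.Re (F j).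
Proof. by elim: r => [|j r IH]; rewrite ?big_nil // !big_cons ReD IH. Qed.

Lemma Im_sum (J : Type) (r : seq J) (F : J -> C) : complex.Im (\sum_(j <- r) F j) = \sum_(j <- r) complex.Im (F j).
Proof. by elim: r => [|j r IH]; rewrite ?big_nil // !big_cons ImD IH. Qed.

Lemma has_coef_unique n f u v : has_coef n f u -> has_coef n f v -> u = v.
Proof.
move=> [p [K [pn hp]]] [q [L [qn hq]]].
pose r := p - q; suff rn : r`_n = 0 by move/eqP: rn; rewrite coefB pn qn subr_eq0 => /eqP.
have hr M : 0 < M -> M < 1 -> `|r.[M%:C%C]| <= ((K + L) * M ^+ n.+1)%:C%C.
  move=> M0 M1; have -> : r.[M%:C%C] = (f M - q.[M%:C%C]) - (f M - p.[M%:C%C]) by rewrite /r hornerD hornerN; ring.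
  apply: le_trans (ler_normB _ _) _; rewrite mulrDl rmorphD [X in _ <= X]addrC.
  by apply: lerD; [exact: hq|exact: hp].
(* On a real argument the real and imaginary parts are real polynomials, to which [poly_small_coef]
   applies. *)
have part (pr : C -> R) : (forall z, `|(pr z)%:C%C : C| <= `|z|) ->
    (forall M, pr r.[M%:C%C] = \sum_(i < size r) pr r`_i * M ^+ i) -> pr 0 = 0 -> pr r`_n = 0.
  move=> ple prE pr0; pose rr := \poly_(i < size r) pr r`_i.
  have -> : pr r`_n = rr`_n by rewrite coef_poly; case: ltnP => // h; rewrite nth_default.
  apply: (@poly_small_coef R rr n.+1 (K + L) 1) => // M M0 M1.
  rewrite /rr horner_poly -prE -lecR; apply: le_trans (hr M M0 M1).
  by rewrite -norm_RtoC; exact: ple.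
have re0 : complex.Re r`_n = 0.
  apply: (part (@complex.Re R)) => [z|M|//]; first exact: norm_ge_Re.
  rewrite horner_coef Re_sum; apply: eq_bigr => i _.
  by rewrite -rmorphXn ReM /= mulr0 addr0.
have im0 : complex.Im r`_n = 0.
  apply: (part (@complex.Im R)) => [z|M|//]; first exact: norm_ge_Im.
  rewrite horner_coef Im_sum; apply: eq_bigr => i _.
  by rewrite -rmorphXn ImM /= mulr0 add0r.
by apply/eqP; rewrite eq_complex re0 im0 !eqxx.
Qed.

(** This is [partial_fractions] for 1 / m and [Y]: the powers of 1 / m give the truncated binomial
    series in [m], and the powers of [Y] its exact remainder. *)
Lemma pow_expansion (D Y m : C) q n : Y = D * (1 - m * Y) -> m != 0 -> (0 < n + q)%N ->
  Y ^+ q = \sum_(0 <= i < n) (-1) ^+ i * 'C(q + i - 1, i)%:R * D ^+ (q + i) * m ^+ i + m ^+ n * pf Y (- D) q n.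
Proof.
move=> YE m0 nq.
have h : m^-1 * Y = D * (m^-1 - Y).
  by apply: (mulfI m0); rewrite mulVKf // mulrCA mulrBr divff.
have := partial_fractions h nq; rewrite /(pf m^-1) => e.
have mn : m ^+ n != 0 by rewrite expf_neq0.
have -> : Y ^+ q = m ^+ n * (m^-1 ^+ n * Y ^+ q) by rewrite exprVn mulVKf.
rewrite e mulrDr mulr_sumr; congr (_ + _); apply: eq_big_nat => i /andP[_ ii].
have -> : m ^+ n = m ^+ i * m ^+ (n - i) by rewrite -exprD subnKC // ltnW.
have mi : m ^+ (n - i) != 0 by rewrite expf_neq0.
by rewrite exprVn; move: (m ^+ (n - i)) mi => u un; field.
Qed.

Lemma norm_pf_le (Y D : C) q n : `|Y| <= 1 -> `|D| <= 1 ->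
  `|pf Y D q n| <= \sum_(0 <= i < q) 'C(n + i - 1, i)%:R.
Proof.
move=> Y1 D1; apply: le_trans (ler_norm_sum _ _ _) _; apply: ler_sum => i _.
rewrite !normrM normrX normrN1 expr1n mul1r normr_nat !normrX -mulrA -[leRHS]mulr1.
by apply: ler_wpM2l => //; apply: mulr_ile1; rewrite ?exprn_ge0 ?exprn_ile1.
Qed.

Lemma has_coef_pow q n (d s : C) (Y : R -> C) : `|d| <= 1 -> `|s| = 1 ->
  (forall M, 0 < M -> M < 1 -> `|Y M| <= 1) ->
  (forall M, 0 < M -> M < 1 -> Y M = d * (1 - (s * M%:C%C) * Y M)) ->
  has_coef n (fun M => Y M ^+ q) ((-1) ^+ n * 'C(q + n - 1, n)%:R * d ^+ (q + n) * s ^+ n).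
Proof.
move=> d1 s1 Y1 YE; pose cf i : C := (-1) ^+ i * 'C(q + i - 1, i)%:R * d ^+ (q + i) * s ^+ i.
exists (\poly_(i < n.+1) cf i), (\sum_(0 <= i < q) 'C(n.+1 + i - 1, i)%:R).
split=> [|M M0 M1]; first by rewrite coef_poly ltnSn.
have Mn : M%:C%C != 0 :> C by rewrite fmorph_eq0 gt_eqF.
have sn : s != 0 by rewrite -normr_eq0 s1 oner_eq0.
rewrite (@pow_expansion d (Y M) (s * M%:C%C) q n.+1 (YE _ M0 M1)) ?mulf_neq0 //.
rewrite horner_poly big_mkord.
have -> : \sum_(i < n.+1) (-1) ^+ i * 'C(q + i - 1, i)%:R * d ^+ (q + i) * (s * M%:C%C) ^+ i =
   \sum_(i < n.+1) cf i * M%:C%C ^+ i by apply: eq_bigr => i _; rewrite exprMn mulrA.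
rewrite addrAC subrr add0r normrM exprMn normrM normrX s1 expr1n mul1r -rmorphXn norm_realC ?exprn_ge0 ?(ltW M0) //.
rewrite mulrC rmorphM; apply: ler_pM => //; first by rewrite lecR exprn_ge0 // ltW.
rewrite rmorph_sum; under eq_bigr do rewrite rmorph_nat.
by apply: norm_pf_le; rewrite ?normrN ?Y1.
Qed.

Lemma norm_resolvent_le1 (z : C) y : `|complex.Im z| = 1 -> `|resolvent z y| <= 1.
Proof.
move=> z1; have h : 1 <= `|y%:C%C - z|.
  apply: le_trans (norm_ge_Im (y%:C%C - z)); rewrite norm_RtoC -[1]/(1%:C%C) lecR.
  by case: z z1 => u v /= vE; rewrite sub0r normrN vE.
by rewrite /resolvent normfV invf_le1 // (lt_le_trans ltr01).
Qed.

End CoefficientsAtZero.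

(** * The overlap integral of two lines at height 1 *)

Section Overlap.
Variables (R : realType) (a b : nat).
Local Notation C := R[i].
Local Notation A := a.+1.
Local Notation B := b.+1.
Let z0 : C := Complex 0 (-1).
Let z0' : C := Complex 0 1.
Let z1 (M : R) : C := Complex (- M) (-1).
Let z1' (M : R) : C := Complex (- M) 1.
Let d : C := (Complex 0 (-2))^-1.
Let P : C := Complex 0 (- (2 * pi)).

Let overlap M y := (resolvent z0 y * resolvent z0' y) ^+ A * (resolvent (z1 M) y * resolvent (z1' M) y) ^+ B.

(** The integral by residues at the two lower poles. Each half is singular at M = 0, although the
    integral is not. *)
Definition overlap_value (M : R) : C :=
  residue_half (M%:C%C)^-1 d (Complex M (-2))^-1 a b + residue_half (- (M%:C%C)^-1) d (Complex (- M) (-2))^-1 b a.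

Lemma has_pv_overlap M : 0 < M -> has_pv (overlap M) (overlap_value M).
Proof.
move=> M0; have sgm u : (complex.Im (Complex u (-1) : C) * complex.Im (Complex u 1 : C) < 0) by rewrite /= mulr1 ltrN10.
have pvz u : pv2 (Complex u (-1) : C) = P by rewrite /pv2 /= sgrN sgr1 mulrN1.
have M1 : z0 - z1 M = M%:C%C by apply/eqP; rewrite eq_complex /= opprK add0r subrr !eqxx.
have h1 := @has_pv_half R z0 z0' (z1' M) (M%:C%C)^-1 a b.
have h2 := @has_pv_half R (z1 M) (z1' M) z0' (- (M%:C%C)^-1) b a.
have n1 : (-1 : R) * 1 < 0 by rewrite mulr1 ltrN10.
have {}h1 := h1 n1 n1 (pvz 0); have {}h2 := h2 n1 n1 (pvz (- M)).
have e (u v : R) (x y : R) : (Complex u v : C) - Complex x y = Complex (u - x) (v - y) by [].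
rewrite /overlap_value.
have d1 : (z0 - z0')^-1 = d by rewrite e subrr; congr ((Complex _ _)^-1); ring.
have d2 : (z1 M - z1' M)^-1 = d by rewrite e subrr; congr ((Complex _ _)^-1); ring.
have d3 : (z0 - z1' M)^-1 = (Complex M (-2))^-1 by rewrite e; congr ((Complex _ _)^-1); ring.
have d4 : (z1 M - z0')^-1 = (Complex (- M) (-2))^-1 by rewrite e; congr ((Complex _ _)^-1); ring.
rewrite d1 d3 in h1; rewrite d2 d4 in h2.
apply: has_pv_ext (has_pvD h1 h2) => y.
have ne : z0 != z1 M by rewrite -subr_eq0 M1 fmorph_eq0 gt_eqF.
have im (u v : R) : v != 0 -> complex.Im (Complex u v : C) != 0 by [].
have n10 : (-1 : R) != 0 by rewrite oppr_eq0 oner_eq0.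
have h := @resolventM R z0 (z1 M) y (im 0 _ n10) (im (- M) _ n10) ne; rewrite M1 in h.
have := @partial_fractions C _ _ _ A B h isT.
rewrite /overlap !exprMn; move: (resolvent z0 y ^+ A) (resolvent (z1 M) y ^+ B) => u v uv.
transitivity ((u * v) * (resolvent z0' y ^+ A * resolvent (z1' M) y ^+ B)); last by ring.
by rewrite uv; ring.
Qed.

Definition overlap_coef N : C := \sum_(0 <= i < N.+1)
  ((-1) ^+ N * 'C(B + i - 1, i)%:R * 'C(B + (N - i) - 1, N - i)%:R)
  * ((-1) ^+ (A + B + i - 1) * 'C(2 * A + 2 * B + N - 2, A + B + i - 1)%:R * d ^+ (2 * A + 2 * B + N - 1) * P).

(** The resolvents of the second line are expanded in M at the poles of the first, so that every
    coefficient is an integral with two opposite poles. The remainder is M^(N+1) times a multiple of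
    1 / (y^2 + 1), so the expansion may be integrated. *)
Lemma has_coef_overlap N : has_coef N overlap_value (overlap_coef N).
Proof.
pose cf i : C := (-1) ^+ i * 'C(B + i - 1, i)%:R.
pose pv i j : C := (-1) ^+ (A + B + i - 1) * 'C(2 * A + 2 * B + i + j - 2, A + B + i - 1)%:R
  * d ^+ (2 * A + 2 * B + i + j - 1) * P.
pose p : {poly C} := \sum_(0 <= i < N.+1) \sum_(0 <= j < N.+1) (cf i * cf j * pv i j) *: 'X^(i + j).
pose k1 : R := \sum_(0 <= i < B) 'C(N.+1 + i - 1, i)%:R.
pose k2 : R := \sum_(0 <= i < N.+1) 'C(B + i - 1, i)%:R.
have k10 : 0 <= k1 by apply: sumr_ge0.
have k20 : 0 <= k2 by apply: sumr_ge0.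
exists p, (2 * ((k1 * k2 + k1) * pi)); split.
  rewrite /p coef_sum; apply: eq_big_nat => i /andP[_ iN]; rewrite coef_sum.
  rewrite (eq_big_nat _ _ (F2 := fun j => if j == (N - i)%N then cf i * cf j * pv i j else 0)) => [|j _]; last first.
    rewrite coefZ coefXn; have -> : (N == i + j)%N = (j == (N - i)%N) by lia.
    by case: eqP => _; rewrite ?mulr1 ?mulr0.
  rewrite sum_delta_nat ?ltnS ?leq_subr // /pv /cf -!addnA !subnKC // !addnA.
  have -> : (-1) ^+ N = (-1) ^+ i * (-1) ^+ (N - i) :> C by rewrite -exprD subnKC.
  by congr (_ * _); ring.
move=> M M0 M1; set v := overlap_value M - p.[M%:C%C].
pose L y := resolvent z0 y; pose U y := resolvent z0' y.
pose SL y := \sum_(0 <= i < N.+1) (-1) ^+ i * 'C(B + i - 1, i)%:R * L y ^+ (B + i) * M%:C%C ^+ i.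
pose SU y := \sum_(0 <= i < N.+1) (-1) ^+ i * 'C(B + i - 1, i)%:R * U y ^+ (B + i) * M%:C%C ^+ i.
have pvp : has_pv (fun y => (L y * U y) ^+ A * (SL y * SU y)) p.[M%:C%C].
  rewrite /p horner_sum.
  have hij i j : has_pv (fun y => (cf i * cf j * M%:C%C ^+ (i + j)) * (L y ^+ (A + B + i - 1).+1 * U y ^+ (A + B + j - 1).+1))
     ((cf i * cf j * M%:C%C ^+ (i + j)) * pv i j).
    apply: has_pvZ; have n1 : complex.Im z0 * complex.Im z0' < 0 by rewrite /= mulr1 ltrN10.
    have := @has_pv2_opp R z0 z0' (A + B + i - 1) (A + B + j - 1) n1.
    have -> : (z0 - z0')^-1 = d.
      by rewrite /d; congr (_^-1); apply/eqP; rewrite eq_complex /= subrr eqxx /=; apply/eqP; ring.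
    have -> : pv2 z0 = P by rewrite /pv2 /= sgrN sgr1 mulrN1.
    have -> : (A + B + i - 1 + (A + B + j - 1) = 2 * A + 2 * B + i + j - 2)%N by lia.
    by have -> : (2 * A + 2 * B + i + j - 2).+1 = (2 * A + 2 * B + i + j - 1)%N by lia.
  have h := @has_pv_sum R _ (index_iota 0 N.+1) xpredT _ _
    (fun i _ => @has_pv_sum R _ (index_iota 0 N.+1) xpredT _ _ (fun j _ => hij i j)).
  rewrite [X in has_pv _ X](_ : _ = \sum_(i <- index_iota 0 N.+1) \sum_(j <- index_iota 0 N.+1) (cf i * cf j * M%:C%C ^+ (i + j)) * pv i j); last first.
    apply: eq_bigr => i _; rewrite horner_sum; apply: eq_bigr => j _; rewrite hornerZ hornerXn; ring.
  apply: has_pv_ext h => y; rewrite /SL /SU mulr_suml mulr_sumr; apply: eq_bigr => i _.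
  rewrite !mulr_sumr; apply: eq_bigr => j _.
  have -> : (A + B + i - 1).+1 = (A + (B + i))%N by lia.
  have -> : (A + B + j - 1).+1 = (A + (B + j))%N by lia.
  by rewrite exprMn !(exprD (L y)) !(exprD (U y)) exprD /cf; ring.
have pvv : has_pv (fun y => overlap M y - (L y * U y) ^+ A * (SL y * SU y)) v.
  have := has_pvD (has_pv_overlap M0) (has_pvZ (-1) pvp); rewrite mulN1r.
  by apply: has_pv_ext => y; rewrite mulN1r.
have Mn : M%:C%C != 0 :> C by rewrite fmorph_eq0 gt_eqF.
have rel (e : R) y : e != 0 -> resolvent (Complex (- M) e) y = resolvent (Complex 0 e) y * (1 - M%:C%C * resolvent (Complex (- M) e) y).
  move=> e0; rewrite /resolvent.
  have nz (u : R) : y%:C%C - (Complex u e : C) != 0.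
    by rewrite eq_complex /= negb_and sub0r oppr_eq0 e0 orbT.
  have := nz 0; have := nz (- M).
  have -> : y%:C%C - (Complex (- M) e : C) = (y%:C%C - Complex 0 e) + M%:C%C.
    by apply/eqP; rewrite eq_complex /=; apply/andP; split; apply/eqP; ring.
  by move: (y%:C%C - Complex 0 e) (M%:C%C) => x m xm x0; field; rewrite x0 xm.
have n10 : (-1 : R) != 0 by rewrite oppr_eq0 oner_eq0.
have im1 (u : R) : `|complex.Im (Complex u (-1) : C)| = 1 by rewrite /= normrN1.
have im1' (u : R) : `|complex.Im (Complex u 1 : C)| = 1 by rewrite /= normr1.
have nL (u y : R) : `|resolvent (Complex u (-1)) y| <= 1 by apply: norm_resolvent_le1; exact: im1.
have nU (u y : R) : `|resolvent (Complex u 1) y| <= 1 by apply: norm_resolvent_le1; exact: im1'.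
have Mle : `|M%:C%C ^+ N.+1 : C| = (M ^+ N.+1)%:C%C by rewrite -rmorphXn norm_realC // exprn_ge0 // ltW.
(* One factor L U = 1 / (y^2 + 1) is kept for integrability; all other resolvents have modulus at
   most 1, the poles being at distance 1 from the real axis. *)
have bound y : `|overlap M y - (L y * U y) ^+ A * (SL y * SU y)| <= (((k1 * k2 + k1) * M ^+ N.+1) * (1 / ((y - 0) ^+ 2 + 1 ^+ 2)))%:C%C.
  have eL := @pow_expansion R _ _ _ B N.+1 (@rel (-1) y n10) Mn isT.
  have eU := @pow_expansion R _ _ _ B N.+1 (@rel 1 y (oner_neq0 R)) Mn isT.
  rewrite -/z0 -/(L y) -/(SL y) in eL; rewrite -/z0' -/(U y) -/(SU y) in eU.
  rewrite /overlap !(exprMn B) -/(L y) -/(U y).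
  set rL := pf _ _ _ _ in eL; set rU := pf _ _ _ _ in eU.
  have bL : `|rL| <= k1%:C%C.
    by rewrite /k1 rmorph_sum; under eq_bigr do rewrite rmorph_nat; apply: norm_pf_le; [exact: nL|rewrite normrN; exact: nL].
  have bU : `|rU| <= k1%:C%C.
    by rewrite /k1 rmorph_sum; under eq_bigr do rewrite rmorph_nat; apply: norm_pf_le; [exact: nU|rewrite normrN; exact: nU].
  have bS : `|SU y| <= k2%:C%C.
    rewrite /k2 rmorph_sum; apply: le_trans (ler_norm_sum _ _ _) _; apply: ler_sum => i _.
    rewrite rmorph_nat !normrM !normrX normrN1 expr1n mul1r normr_nat -mulrA -[leRHS]mulr1; apply: ler_wpM2l => //.
    apply: mulr_ile1; rewrite ?exprn_ge0 //; first by apply: exprn_ile1 => //; exact: nU.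
    by apply: exprn_ile1 => //; rewrite norm_realC ?(ltW M0) // -[1]/(1%:C%C) lecR ltW.
  have b1 : `|resolvent (z1 M) y ^+ B| <= 1 by rewrite normrX; apply: exprn_ile1 => //; exact: nL.
  have -> : (L y * U y) ^+ A * (resolvent (z1 M) y ^+ B * resolvent (z1' M) y ^+ B) - (L y * U y) ^+ A * (SL y * SU y)
     = (L y * U y) * ((L y * U y) ^+ a * (M%:C%C ^+ N.+1 * (resolvent (z1 M) y ^+ B * rU + rL * SU y))).
    have eU' : resolvent (z1' M) y ^+ B = SU y + M%:C%C ^+ N.+1 * rU := eU.
    have eSL : SL y = resolvent (z1 M) y ^+ B - M%:C%C ^+ N.+1 * rL.
      by apply/eqP; rewrite eq_sym subr_eq; apply/eqP; exact: eL.
    rewrite eU' eSL [in LHS]exprS; move: (SU y) (resolvent (z1 M) y ^+ B) (M%:C%C ^+ N.+1) => x1 x2 x3.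
    by ring.
  have lu : L y * U y = (1 / ((y - 0) ^+ 2 + 1 ^+ 2))%:C%C.
    rewrite /L /U /z0 /z0' !resolventE !subr0 sqrrN !expr1n; apply/eqP; rewrite eq_complex /=.
    have nz : y ^+ 2 + 1 != 0 :> R by rewrite gt_eqF // ltr_wpDl ?sqr_ge0.
    by apply/andP; split; apply/eqP; field; rewrite ?nz.
  have lu0 : 0 <= 1 / ((y - 0) ^+ 2 + 1 ^+ 2) :> R by rewrite divr_ge0 // addr_ge0 // sqr_ge0.
  have lu1 : `|L y * U y| <= 1 by rewrite normrM; apply: mulr_ile1 => //; [exact: nL|exact: nU].
  rewrite normrM {1}lu norm_realC // [X in _ <= X]rmorphM [X in _ <= X]mulrC; apply: ler_wpM2l; first by rewrite lecR.
  rewrite normrM -[leRHS]mul1r; apply: ler_pM => //; first by rewrite normrX exprn_ile1.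
  rewrite normrM Mle rmorphM [X in _ <= X]mulrC; apply: ler_wpM2l; first by rewrite lecR exprn_ge0 // ltW.
  apply: le_trans (ler_normD _ _) _; rewrite rmorphD addrC; apply: lerD; rewrite normrM.
    by rewrite rmorphM; apply: ler_pM; [exact: normr_ge0|exact: normr_ge0|exact: bL|exact: bS].
  by rewrite -[leRHS]mul1r; apply: ler_pM; [exact: normr_ge0|exact: normr_ge0|exact: b1|exact: bU].
have po : rpv (fun x : R => 1 / ((x - 0) ^+ 2 + 1 ^+ 2)) (pi * Num.sg 1) by apply: rpv_poisson; exact: oner_neq0.
rewrite sgr1 mulr1 in po.
set k := (k1 * k2 + k1) * M ^+ N.+1 in bound.
have rbound (f : R -> R) u : (forall y, `|f y| <= k * (1 / ((y - 0) ^+ 2 + 1 ^+ 2))) -> rpv f u -> `|u| <= k * pi.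
  move=> fb fu; rewrite ler_norml; apply/andP; split.
    rewrite lerNl -mulN1r; apply: (@rpv_le R (fun x => -1 * f x) _ _ _ _ (rpvZ (-1) fu) (rpvZ k po)) => x.
    by rewrite mulN1r; have := fb x; rewrite ler_norml => /andP[]; rewrite lerNl.
  apply: (@rpv_le R f _ _ _ _ fu (rpvZ k po)) => x; exact: le_trans (ler_norm _) (fb x).
have [reb imb] : `|complex.Re v| <= k * pi /\ `|complex.Im v| <= k * pi.
  case: pvv => rv iv; split; [apply: rbound rv|apply: rbound iv] => y; rewrite -lecR -norm_RtoC; apply: le_trans (bound y).
    exact: norm_ge_Re.
  exact: norm_ge_Im.
apply: (@le_trans _ _ (`|complex.Re v| + `|complex.Im v|)%:C%C).
  have vE : v = (complex.Re v)%:C%C + Complex 0 1 * (complex.Im v)%:C%C.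
    by case: (v) => x y; apply/eqP; rewrite eq_complex /= !(mul0r, mulr0, mul1r, addr0, add0r, subr0) !eqxx.
  have i1 : `|Complex 0 1 : C| = 1 by rewrite normc_def /= expr0n expr1n add0r sqrtr1.
  by rewrite {1}vE; apply: le_trans (ler_normD _ _) _; rewrite normrM i1 mul1r !norm_RtoC rmorphD.
rewrite lecR; apply: le_trans (lerD reb imb) _; rewrite le_eqVlt; apply/orP; left; apply/eqP; rewrite /k; ring.
Qed.

End Overlap.

(** * Residue side of the overlap coefficient *)

Section HalfCoefficient.
Variables (R : realType) (a b c : nat) (s : R).
Local Notation C := R[i].
Local Notation A := a.+1.
Local Notation B := b.+1.
Hypothesis s1 : s * s = 1.
Let d : C := (Complex 0 (-2))^-1.
Let P : C := Complex 0 (- (2 * pi)).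
Let D (M : R) : C := (Complex (s * M) (-2))^-1.

Let nz2 (u : R) : (Complex u (-2) : C) != 0.
Proof. by rewrite eq_complex /= negb_and oppr_eq0 pnatr_eq0 orbT. Qed.

Let norm_inv_le1 (u : R) : `|(Complex u (-2) : C)^-1| <= 1.
Proof.
have h : 1 <= `|Complex u (-2) : C|.
  apply: le_trans (norm_ge_Im _); rewrite norm_RtoC /= -[1]/(1%:C%C) lecR normrN normr_nat ler1n //.
by rewrite normfV invf_le1 // (lt_le_trans ltr01).
Qed.

(** The factor M^(A+B) clears the singularity of a single half and shifts the index accordingly; the
    sign [s] covers both halves. In [residue_halfE] only powers of [D M] are not monomials in M, and
    [has_coef_pow] yields the binomials of [mid_weight]. *)
Lemma has_coef_half : has_coef (A + B + 2 * c)
  (fun M => M%:C%C ^+ (A + B) * residue_half (s%:C%C * (M%:C%C)^-1) d (D M) a b)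
  (P * d ^+ (2 * (A + B + c) - 1) * (- mid_weight R (A + B + c - 1) A B c)%:C%C).
Proof.
have sn : s%:C%C != 0 :> C.
  by rewrite fmorph_eq0; apply/eqP => z; move: s1; rewrite z mul0r => /eqP; rewrite eq_sym oner_eq0.
have ss : s%:C%C * s%:C%C = 1 :> C by rewrite -rmorphM s1.
have sq n : s%:C%C ^+ n * s%:C%C ^+ n = 1 :> C by rewrite -exprMn ss expr1n.
have sabs : `|s%:C%C : C| = 1.
  rewrite norm_RtoC; have : `|s| ^+ 2 = 1 by rewrite -normrX expr2 s1 normr1.
  by move/eqP; rewrite sqrf_eq1 => /orP[/eqP -> //|/eqP e]; have := normr_ge0 s; rewrite e oppr_ge0 ler10.
pose kap al be : C := ((-1) ^+ a * triangle_coef R A B al be)%:C%C * (P * d ^+ (2 * A - 1 - al - be)) * s%:C%C ^+ (B + be).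
have hp al be : (be < A - al)%N -> has_coef (A + B + 2 * c) (fun M => kap al be * (M%:C%C ^+ (A - be) * D M ^+ (B + al)))
   (kap al be * ((-1) ^+ (B + be + 2 * c) * 'C(B + al + (B + be + 2 * c) - 1, B + be + 2 * c)%:R
      * d ^+ (B + al + (B + be + 2 * c)) * s%:C%C ^+ (B + be + 2 * c))).
  move=> ba; apply: has_coefZ.
  have -> : (A + B + 2 * c = B + be + 2 * c + (A - be))%N by lia.
  apply: has_coef_shift; apply: has_coef_pow => //.
  - exact: norm_inv_le1.
  - by move=> M _ _; exact: norm_inv_le1.
  - move=> M _ _; have := nz2 (s * M); have := nz2 0; rewrite /D /d.
    have -> : (Complex (s * M) (-2) : C) = Complex 0 (-2) + s%:C%C * M%:C%C.
      by apply/eqP; rewrite eq_complex /= !(mul0r, mulr0, addr0, subr0, add0r) !eqxx.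
    by move: (Complex 0 (-2) : C) (s%:C%C * M%:C%C) => x m x0 xm; field; rewrite x0 xm.
have h : has_coef (A + B + 2 * c)
   (fun M => \sum_(0 <= al < A) \sum_(0 <= be < A - al) kap al be * (M%:C%C ^+ (A - be) * D M ^+ (B + al)))
   (\sum_(0 <= al < A) \sum_(0 <= be < A - al) kap al be * ((-1) ^+ (B + be + 2 * c) * 'C(B + al + (B + be + 2 * c) - 1, B + be + 2 * c)%:R
      * d ^+ (B + al + (B + be + 2 * c)) * s%:C%C ^+ (B + be + 2 * c))).
  by apply: has_coef_sum_nat => al _; apply: has_coef_sum_nat => be /andP[_ ba]; exact: hp.
have -> : P * d ^+ (2 * (A + B + c) - 1) * (- mid_weight R (A + B + c - 1) A B c)%:C%C =
   \sum_(0 <= al < A) \sum_(0 <= be < A - al) kap al be * ((-1) ^+ (B + be + 2 * c) * 'C(B + al + (B + be + 2 * c) - 1, B + be + 2 * c)%:R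
      * d ^+ (B + al + (B + be + 2 * c)) * s%:C%C ^+ (B + be + 2 * c)).
  rewrite /mid_weight -sumrN rmorph_sum mulr_sumr /=; apply: eq_big_nat => al /andP[_ ala].
  rewrite -sumrN rmorph_sum mulr_sumr /=; apply: eq_big_nat => be /andP[_ ba].
  rewrite subnn muln0 leq0n.
  have -> : (2 * (A + B + c - 1) + al + be + 1 - 2 * A = B + al + (B + be + 2 * c) - 1)%N by lia.
  have -> : 'C(B + al + (B + be + 2 * c) - 1, B + al - 1) = 'C(B + al + (B + be + 2 * c) - 1, B + be + 2 * c).
    by rewrite -bin_sub; [congr ('C(_, _)); lia|lia].
  rewrite /kap; have -> : (2 * (A + B + c) - 1 = (2 * A - 1 - al - be) + (B + al + (B + be + 2 * c)))%N by lia.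
  rewrite (exprD d (2 * A - 1 - al - be)) !(exprD _ (B + be)) exprM sqrrN expr1n exprM expr2 ss expr1n !mulr1.
  have sg : (-1) ^+ (A + B + be) = - ((-1) ^+ a * (-1) ^+ (B + be)) :> R by rewrite -addnA exprD exprS mulN1r mulNr.
  rewrite sg !mulNr mulrN opprK !(rmorphM (@real_complex R)) /= !rmorphXn /= !rmorphN1 !rmorph_nat.
  have := sq (B + be)%N; move: (s%:C%C ^+ _) (d ^+ (2 * A - 1 - al - be)) (d ^+ (B + al + (B + be + 2 * c))) => x y z hx.
  rewrite -[LHS]mulr1 -hx; move: ((-1 : C) ^+ a) ((-1 : C) ^+ (B + be)) => p q.
  by ring.
apply: has_coef_ext h => M M0 M1.
have Mn : M%:C%C != 0 :> C by rewrite fmorph_eq0 gt_eqF.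
have x2 : (s%:C%C * (M%:C%C)^-1) ^+ (2 * c) * M%:C%C ^+ (2 * c) = 1 :> C.
  by rewrite -exprMn divfK // exprM expr2 ss expr1n.
have -> : M%:C%C ^+ (A + B) * residue_half (s%:C%C * (M%:C%C)^-1) d (D M) a b =
   M%:C%C ^+ (A + B + 2 * c) * ((s%:C%C * (M%:C%C)^-1) ^+ (2 * c) * residue_half (s%:C%C * (M%:C%C)^-1) d (D M) a b).
  rewrite (exprD _ (A + B)); move: x2.
  move: ((s%:C%C * (M%:C%C)^-1) ^+ (2 * c)) (M%:C%C ^+ (2 * c)) (M%:C%C ^+ (A + B)) (residue_half _ _ _ _ _) => u v q r uv.
  by rewrite -[LHS]mul1r -uv; ring.
rewrite residue_halfE mulr_sumr; apply: eq_big_nat => al /andP[_ ala].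
rewrite mulr_sumr; apply: eq_big_nat => be /andP[_ ba].
have e1 : M%:C%C ^+ (A + B + 2 * c) * (s%:C%C * (M%:C%C)^-1) ^+ (2 * c + B + be) = s%:C%C ^+ (B + be) * M%:C%C ^+ (A - be) :> C.
  have -> : (A + B + 2 * c = A - be + (2 * c + B + be))%N by lia.
  rewrite exprD -mulrA -exprMn mulrCA divff // mulr1 -addnA (exprD _ (2 * c)) exprM expr2 ss expr1n mul1r mulrC //.
rewrite /kap -/P; transitivity (((-1) ^+ a * triangle_coef R A B al be)%:C%C * (P * d ^+ (2 * A - 1 - al - be)) *
   (s%:C%C ^+ (B + be) * M%:C%C ^+ (A - be)) * D M ^+ (B + al)); first by ring.
by rewrite -e1; ring.
Qed.

End HalfCoefficient.

(** * Nonvanishing of the lowest coefficient *)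

Section LastCoefficient.
Variable R : realType.
Local Notation C := R[i].
Local Notation F n := (n`!%:R : R).

Lemma binR n m : (m <= n)%N -> 'C(n, m)%:R = F n / (F m * F (n - m)).
Proof.
move=> mn; rewrite -(bin_fact mn) !natrM.
have := factR_neq0 R m; have := factR_neq0 R (n - m).
by move: (F m) (F (n - m)) ('C(n, m)%:R) => x y z y0 x0; field; rewrite x0 y0.
Qed.

(* Both sides are, up to a common factor, the coefficient of [M ^+ (2 * c)] in the integral over y of
   [(y^2 + 1)^-a ((y + M)^2 + 1)^-b]: by residues on the left, by expanding the integrand on the right. *)
Lemma mid_weight_dixon a b c :
  mid_weight R (a.+1 + b.+1 + c - 1) a.+1 b.+1 c + mid_weight R (b.+1 + a.+1 + c - 1) b.+1 a.+1 c =
  (-1) ^+ (a.+1 + b.+1) * (F (2 * (a.+1 + b.+1 + c) - 2) / (F b * F b)) * dixon_sum R a.+1 b.+1 c.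
Proof.
set A := a.+1; set B := b.+1.
have h1 := has_coef_shift (A + B) (has_coef_overlap R a b (2 * c)).
have hp := @has_coef_half R a b c 1 (mulr1 1).
have hm := @has_coef_half R b a c (-1) ltac:(by rewrite mulrNN mulr1).
rewrite -/A -/B in hp hm.
have {}h1 : has_coef (A + B + 2 * c) (fun M => M%:C%C ^+ (A + B) * overlap_value a b M) (overlap_coef R a b (2 * c)).
  by rewrite [(A + B + 2 * c)%N]addnC.
have eBA : (B + A = A + B)%N by rewrite addnC.
rewrite eBA in hm *.
have h2 := has_coefD hp hm.
have {}h2 := has_coef_ext (_ : forall M : R, 0 < M -> M < 1 -> _ = M%:C%C ^+ (A + B) * overlap_value a b M) h2.
have {}h2 := h2 ltac:(by move=> M _ _; rewrite /overlap_value rmorph1 rmorphN1 !mul1r !mulN1r -mulrDr).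
have := has_coef_unique h1 h2; clear h1 h2 hp hm.
set d : C := (Complex 0 (-2))^-1; set P : C := Complex 0 (- (2 * pi)).
have -> : overlap_coef R a b (2 * c) = P * d ^+ (2 * (A + B + c) - 1) *
   (- ((-1) ^+ (A + B) * (F (2 * (A + B + c) - 2) / (F b * F b)) * dixon_sum R A B c))%:C%C.
  rewrite /overlap_coef /dixon_sum mulr_sumr -sumrN rmorph_sum mulr_sumr; apply: eq_big_nat => i /andP[_ ic].
  rewrite -/A -/B -/d -/P.
  have -> : (2 * A + 2 * B + 2 * c - 1 = 2 * (A + B + c) - 1)%N by lia.
  have -> : (2 * A + 2 * B + 2 * c - 2 = 2 * (A + B + c) - 2)%N by lia.
  have e : (- ((-1) ^+ (A + B) * (F (2 * (A + B + c) - 2) / (F b * F b)) * dixon_term R A B c i)) =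
    'C(B + i - 1, i)%:R * 'C(B + (2 * c - i) - 1, 2 * c - i)%:R * ((-1) ^+ (A + B + i - 1) * 'C(2 * (A + B + c) - 2, A + B + i - 1)%:R) :> R.
    rewrite !binR; try (rewrite /A /B; lia).
    have -> : (B + i - 1 - i = b)%N by rewrite /B; lia.
    have -> : (B + (2 * c - i) - 1 - (2 * c - i) = b)%N by rewrite /B; lia.
    have -> : (2 * (A + B + c) - 2 - (A + B + i - 1) = A + B - 1 + (2 * c - i))%N by rewrite /A /B; lia.
    have -> : (A + B + i - 1 = A + B - 1 + i)%N by rewrite /A /B; lia.
    have -> : (B + i - 1 = B - 1 + i)%N by rewrite /B; lia.
    have -> : (B + (2 * c - i) - 1 = B - 1 + (2 * c - i))%N by rewrite /B; lia.
    have -> : (-1) ^+ (A + B - 1 + i) = - ((-1) ^+ (A + B) * (-1) ^+ i) :> R.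
      have -> : (A + B = (A + B - 1).+1)%N by rewrite /A; lia.
      by rewrite subn1 /= exprS exprD; ring.
    rewrite /dixon_term.
    have := factR_neq0 R b; have := factR_neq0 R i; have := factR_neq0 R (2 * c - i).
    have := factR_neq0 R (A + B - 1 + i); have := factR_neq0 R (A + B - 1 + (2 * c - i)).
    move: (F b) (F i) (F (2 * c - i)) (F (A + B - 1 + i)) (F (A + B - 1 + (2 * c - i))) => x1 x2 x3 x4 x5 n5 n4 n3 n2 n1.
    move: (F (B - 1 + i)) (F (B - 1 + (2 * c - i))) (F (2 * (A + B + c) - 2)) => y1 y2 y3.
    by field; rewrite n1 n2 n3 n4 n5.
  rewrite e !rmorphM /= !rmorph_nat rmorphXn /= rmorphN1 exprM sqrrN !expr1n mul1r.
  by ring.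
have u0 : P * d ^+ (2 * (A + B + c) - 1) != 0.
  rewrite mulf_neq0 ?expf_neq0 ?invr_eq0 // eq_complex /= negb_and ?oppr_eq0 ?pnatr_eq0 ?orbT //.
  by rewrite mulf_neq0 ?orbT // gt_eqF // pi_gt0.
rewrite -mulrDr => /(mulfI u0); rewrite -rmorphD => /(fmorph_inj _) e.
by apply: oppr_inj; rewrite e opprD.
Qed.

(** The closed form of the Dixon sum is arranged as a factor symmetric in x, y, z times a term that
    depends on [z] and [w] only, so that the three choices of [z] can be added. *)
Lemma mid_weight_last w x y z : (x + y + z = w)%N -> (0 < x)%N -> (0 < y)%N -> (0 < z)%N ->
  mid_weight R (w - 1) x y z + mid_weight R (w - 1) y x z =
  (-1) ^+ w * ((F (2 * w - 2) / F (w - 1)) *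
   (F (w - x - 1) * F (w - y - 1) * F (w - z - 1) / (F (x - 1) * F (y - 1) * F (z - 1))))
  * ((-1) ^+ z * (hweight R w z / z%:R)).
Proof.
move=> <-; case: x y z => [//|x] [//|y] [//|z] _ _ _.
have h := mid_weight_dixon x y z.+1.
have e : (y.+1 + x.+1 + z.+1 = x.+1 + y.+1 + z.+1)%N by lia.
rewrite e in h; rewrite h dixon_sumE // /hweight.
have -> : (-1) ^+ (x.+1 + y.+1 + z.+1) = (-1) ^+ (x.+1 + y.+1) * (-1) ^+ z.+1 :> R by rewrite exprD.
have sq : (-1) ^+ z.+1 * (-1) ^+ z.+1 = 1 :> R by rewrite -exprMn mulN1r opprK expr1n.
rewrite !subn1 /=.
have -> : (x.+1 + y.+1 + z.+1 - x.+1).-1 = (y + z.+1)%N by lia.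
have -> : (x.+1 + y.+1 + z.+1 - y.+1).-1 = (x + z.+1)%N by lia.
have -> : (x.+1 + y.+1 + z.+1 - z.+1).-1 = (x + y.+1)%N by lia.
have -> : (x + y.+1 + z.+1 + z.+1 = x + y.+1 + 2 * z.+1)%N by lia.
have -> : F z.+1 = z.+1%:R * F z by exact: factRS.
have zn : (z.+1%:R : R) != 0 by rewrite pnatr_eq0.
have := factR_neq0 R x; have := factR_neq0 R y; have := factR_neq0 R z.
have := factR_neq0 R (x + y.+1); have := factR_neq0 R (x + y.+1 + z.+1).
have := factR_neq0 R (x + y.+1 + 2 * z.+1).
move: (F x) (F y) (F z) (F (x + y.+1)) (F (x + y.+1 + z.+1)) (F (x + y.+1 + 2 * z.+1)).
move: (F (y + z.+1)) (F (x + z.+1)) (F (2 * _ - 2)) (z.+1%:R) zn ((-1) ^+ z.+1) sq ((-1) ^+ (x.+1 + y.+1)).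
move=> y1 y2 y3 Z Zn s ss t x1 x2 x3 x4 x5 x6 n6 n5 n4 n3 n2 n1.
rewrite -[LHS]mul1r -ss; by field; rewrite n1 n2 n3 n4 n5 n6 Zn.
Qed.

(** For k = w - 1 the Bernoulli factor is B_0 = 1. The six permutations form three pairs to which
    [mid_weight_last] applies, and the common factor leaves the sum treated in
    [signed_hweight_neq0]. *)
Lemma coef_mid_last_neq0 a b c : (0 < a)%N -> (0 < b)%N -> (0 < c)%N ->
  coef_mid (a + b + c - 1) a b c != 0.
Proof.
move=> a0 b0 c0; apply/eqP => /(congr1 (ratr : rat -> R)); rewrite rmorph0 /coef_mid sum_S3E !rmorphD /=.
set w := (a + b + c)%N.
have me x y z : (x + y + z = w)%N -> ratr (coef_mid_summand (w - 1) x y z) = - 2 * (-1) ^+ w * mid_weight R (w - 1) x y z.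
  move=> e; rewrite mid_summandE e; last by rewrite /w; lia.
  by rewrite subnn muln0 rmorph1 fact0 divr1 mulr1.
rewrite !me; try (rewrite /w; lia).
rewrite -!mulrDr.
have pa : (a + b + c = w)%N by [].
have pb : (a + c + b = w)%N by rewrite /w; lia.
have pc : (b + c + a = w)%N by rewrite /w; lia.
rewrite (mid_weight_last pa) // (mid_weight_last pb) // (mid_weight_last pc) //.
have sq : (-1) ^+ w * (-1) ^+ w = 1 :> R by rewrite -exprMn mulN1r opprK expr1n.
have := signed_hweight_neq0 R pa a0 b0 c0.
have := factR_neq0 R (2 * w - 2); have := factR_neq0 R (w - 1).
have := factR_neq0 R (a - 1); have := factR_neq0 R (b - 1); have := factR_neq0 R (c - 1).
have := factR_neq0 R (w - a - 1); have := factR_neq0 R (w - b - 1); have := factR_neq0 R (w - c - 1).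
move: (F (2 * w - 2)) (F (w - 1)) (F (a - 1)) (F (b - 1)) (F (c - 1)) (F (w - a - 1)) (F (w - b - 1)) (F (w - c - 1)).
move: ((-1) ^+ a * _) ((-1) ^+ b * _) ((-1) ^+ c * _) ((-1) ^+ w) sq.
move=> ta tb tc s ss f1 f2 f3 f4 f5 f6 f7 f8 n8 n7 n6 n5 n4 n3 n2 n1 nt e.
have : - 2 * (s * s) * (f1 / f2 * (f6 * f7 * f8 / (f3 * f4 * f5))) * (ta + tb + tc) = 0.
  by rewrite -[RHS]e; field; rewrite n2 n3 n4 n5.
rewrite ss mulr1 => /eqP; apply/negP; apply: mulf_neq0 => //; apply: mulf_neq0; first by rewrite oppr_eq0 pnatr_eq0.
by rewrite !mulf_neq0 ?invr_eq0 ?mulf_neq0.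
Qed.

End LastCoefficient.

Theorem theorem1p1 (R : realType) (a1 a2 a3 : nat)
    (ha1 : (0 < a1)%N) (ha2 : (0 < a2)%N) (ha3 : (0 < a3)%N) :
  let w := (a1 + a2 + a3)%N in
  exists L E : R -> R,
    [/\ forall t : R, 0 < t -> constant_mode a1 a2 a3 t = (L t + E t)%:E,
        laurent_polynomial_of_degree w%:Z (1 - w%:Z) L,
        exponentially_decaying E
      & forall t : R, 0 < t ->
          L t = ratr (coef_top a1 a2 a3) * (- (4 * pi * t)) ^+ w
                + \sum_(1 <= k < w)
                    ratr (coef_mid k a1 a2 a3) * zeta R (2 * k + 1)
                      / (4 * pi * t) ^ ((2 * k + 1)%:Z - w%:Z)
                + coef_bot R a1 a2 a3 / (4 * pi * t) ^+ (w - 2)].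
Proof.
move=> w; pose L := @laurent_part R a1 a2 a3.
(* With the remainder defined by subtraction through [fine], the decomposition amounts to finiteness
   of the constant mode at every t > 0, beyond the range t >= 1 of the estimate. *)
exists L, (fun t => fine (constant_mode a1 a2 a3 t) - L t); split => //.
- by move=> t t0; rewrite addrC subrK fineK // constant_mode_fin.
- by apply: laurent_part_degree => //; exact: (coef_mid_last_neq0 R).
have [K [d [d0 K0 h]]] := constant_mode_asymptotics R ha1 ha2 ha3.
have d2 : 0 < d / 2 by rewrite divr_gt0.
(* Half of the exponential rate absorbs the factor t^w. *)
have [Q Q0 hQ] := exp_poly_bound w d2.
exists (d / 2), (K * Q); split => //.
near=> t.
have t1 : 1 <= t by near: t; apply: nbhs_pinfty_ge; exact: num_real.
have [v -> hv] := h t t1; apply: le_trans hv _.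
rewrite -mulrA ler_wpM2l // -/w (_ : - (d * t) = - (d / 2 * t) + - (d / 2 * t)); last by field.
by rewrite expRD mulrA ler_wpM2r ?expR_ge0 // hQ // (le_trans ler01).
Unshelve. all: by end_near.
Qed.
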